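(* Let $\beta>0$ be a real number and let $f\in C^{1}([0,1])$. Let $\{u_{\varepsilon}\}_{\varepsilon\in(0,1)}\subseteq H^{2}((0,1))$ be a family of functions such that, for every $\varepsilon\in(0,1)$, $u_{\varepsilon}$ is a minimizer of $u\mapsto\mathrm{PMF}_{\varepsilon}(\beta,f,(0,1),u)$ over $H^{2}((0,1))$. Then $u_{\varepsilon}$ converges to $f$ as $\varepsilon\to 0^{+}$ in the following senses. (1) $u_{\varepsilon}\to f$ strictly in $BV((0,1))$, and therefore also uniformly in $[0,1]$. (2) Let $V_{0}^{+}:=\{x\in[0,1]:f'(x)>0\}$ and $V_{0}^{-}:=\{x\in[0,1]:f'(x)<0\}$. Then for every continuous function $\phi:[0,1]\times\mathbb{R}\times\left[-\frac{\pi}{2},\frac{\pi}{2}\right]\to\mathbb{R}$ it turns out that $$\lim_{\varepsilon\to 0^{+}}\int_{0}^{1}\phi\left(x,u_{\varepsilon}(x),\arctan(u_{\varepsilon}'(x))\right)\sqrt{1+u_{\varepsilon}'(x)^{2}}\,dx=\int_{0}^{1}\phi(x,f(x),0)\,dx+\int_{V_{0}^{-}}\phi\left(x,f(x),-\frac{\pi}{2}\right)|f'(x)|\,dx+\int_{V_{0}^{+}}\phi\left(x,f(x),\frac{\pi}{2}\right)|f'(x)|\,dx.$$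
   Context: For every $\varepsilon\in(0,1)$ set $\omega(\varepsilon):=\varepsilon|\log\varepsilon|^{1/2}$. For $\beta>0$, an open set $\Omega\subseteq\mathbb{R}$, $f\in L^{2}(\Omega)$ and $u\in H^{2}(\Omega)$ set $$\mathrm{PMF}_{\varepsilon}(\beta,f,\Omega,u):=\int_{\Omega}\left\{\varepsilon^{6}\omega(\varepsilon)^{4}u''(x)^{2}+\log\left(1+u'(x)^{2}\right)+\beta(u(x)-f(x))^{2}\right\}dx.$$ Strict convergence: $u_{n}\to u_{\infty}$ strictly in $BV((a,b))$ means $u_{n}\to u_{\infty}$ in $L^{1}((a,b))$ and $|Du_{n}|((a,b))\to|Du_{\infty}|((a,b))$ (total variations). For families indexed by $\varepsilon$, convergence as $\varepsilon\to 0^{+}$ means convergence along every sequence $\varepsilon_{n}\to 0^{+}$. *)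

(* Defs.v *)
From HB Require Import structures.
From mathcomp Require Import all_boot all_order all_algebra.
From mathcomp Require Import all_classical all_reals all_analysis.
Set Implicit Arguments.
Unset Strict Implicit.
Unset Printing Implicit Defensive.
Import Order.TTheory GRing.Theory Num.Theory.
Import numFieldNormedType.Exports.
Local Open Scope classical_set_scope.
Local Open Scope ring_scope.

(* Elements of Lebesgue, Sobolev and BV spaces on an open set are represented
   by total functions R -> R; only their values in that set matter, and only
   up to null sets. *)

Section function_spaces.
Context {R : realType}.
Implicit Types (Om : set R) (u v phi : R -> R).
Let mu := @lebesgue_measure R.

Definition C1c Om : set (R -> R) :=
  [set phi : R -> R |
    [/\ forall x : R, derivable phi x 1, continuous (derive1 phi) &
     exists K : set R,
       [/\ compact K, K `<=` Om & forall x, ~ K x -> phi x = 0]]].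

Definition L2 Om : set (R -> R) :=
  [set u : R -> R | measurable_fun Om u /\
                    mu.-integrable Om (EFin \o (fun x => u x ^+ 2))].

(* [locally_integrable] contains measurability on, and openness of, [Om]. *)
Definition is_weak_derive Om u v : Prop :=
  [/\ locally_integrable Om u, locally_integrable Om v &
     forall phi, C1c Om phi ->
       \int[mu]_(x in Om) (u x * derive1 phi x) =
       - \int[mu]_(x in Om) (v x * phi x)].

(* Some representative of the weak derivative of [u], which is unique up to
   a null subset of [Om]; the null function if there is no weak derivative. *)
Definition weak_derive Om u : R -> R :=
  xget (fun=> 0) [set v : R -> R | is_weak_derive Om u v].

Definition H1 Om : set (R -> R) :=
  [set u : R -> R | L2 Om u /\ exists2 v, L2 Om v & is_weak_derive Om u v].

Definition H2 Om : set (R -> R) :=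
  [set u : R -> R | H1 Om u /\ H1 Om (weak_derive Om u)].

(* |Du|(Om), in its dual formulation *)
Definition BV_variation Om u : \bar R :=
  ereal_sup [set (\int[mu]_(x in Om) (u x * derive1 phi x))%:E | phi in
    [set phi : R -> R | C1c Om phi /\ forall x, `|phi x| <= 1]].

Definition BV Om : set (R -> R) :=
  [set u : R -> R | mu.-integrable Om (EFin \o u) /\
                    (BV_variation Om u < +oo)%E].

Definition strict_BV_cvg Om (u_ : nat -> R -> R) u : Prop :=
  [/\ forall n, BV Om (u_ n), BV Om u,
      (\int[mu]_(x in Om) `|u_ n x - u x|%:E)%E @[n --> \oo] --> 0%E &
      BV_variation Om (u_ n) @[n --> \oo] --> BV_variation Om u].

(* [v] is the representative of [u], defined a.e. in (a, b), that is
   continuous up to the boundary; it is unique on [a, b] when a < b. *)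
Definition continuous_repr (a b : R) u v : Prop :=
  {within `[a, b], continuous v} /\
  {ae mu, forall x, x \in `]a, b[ -> v x = u x}.

Definition repr_uniform_cvg (a b : R) (u_ : nat -> R -> R)
    (g : R -> R) : Prop :=
  exists v : nat -> R -> R,
    (forall n, continuous_repr a b (u_ n) (v n)) /\
    {uniform `[a, b], v @ \oo --> g}.

(* Derivative relative to a set: one-sided at the end points of an interval *)
Definition derive_in (A : set R) (f : R -> R) (x : R) : R :=
  lim ((f y - f x) / (y - x) @[y --> within A x^']).

Definition C1_on (A : set R) (f : R -> R) : Prop :=
  (forall x, A x -> cvg ((f y - f x) / (y - x) @[y --> within A x^'])) /\
  {within A, continuous (derive_in A f)}.

End function_spaces.

Section perona_malik.
Context {R : realType}.
Let mu := @lebesgue_measure R.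

Definition omega (e : R) : R := e * Num.sqrt `|ln e|.

Definition PMF (e beta : R) (f : R -> R) (Om : set R) (u : R -> R) : \bar R :=
  let u' := weak_derive Om u in
  let u'' := weak_derive Om u' in
  (\int[mu]_(x in Om)
     (e ^+ 6 * omega e ^+ 4 * u'' x ^+ 2 + ln (1 + u' x ^+ 2)
      + beta * (u x - f x) ^+ 2)%:E)%E.

Definition minimizer (T : Type) (A : set T) (F : T -> \bar R) (u : T) : Prop :=
  A u /\ forall w, A w -> (F u <= F w)%E.

End perona_malik.

(* Main.v *)
Require Import Defs.
From HB Require Import structures.
From mathcomp Require Import all_boot all_order all_algebra.
From mathcomp Require Import all_classical all_reals all_analysis.
From mathcomp Require Import measurable_realfun ring lra.
Set Implicit Arguments.
Unset Strict Implicit.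
Unset Printing Implicit Defensive.
Import Order.TTheory GRing.Theory Num.Theory.
Import numFieldNormedType.Exports.
Local Open Scope classical_set_scope.
Local Open Scope ring_scope.

(** Why the theorem holds.

Let om = eps |log eps|^(1/2) and h = eps^6 om^4, and write G t = ln (1 + t^2) for the
logarithmic density. A function of class H2 is an arc, that is, a triple (w, v, z) with w' = v
continuous and v' = z square integrable (H2_arc, arc_H2), and its energy is
E = int (h z^2 + G v + beta (w - f)^2). The datum f is extended by constants to a Lipschitz
function on the line, and all estimates concern minimal arcs at a fixed small eps.

Scaling. A jump of height of order om that is spread over the length bb = eps^2 om costs energy of
order om^3: there the terms h z^2 and G v balance. A staircase that follows f with steps of
length om therefore has energy of order om^2 (total_energy), and comparison with such a step
between two good points shows that a minimizer has energy of order om^3 on every window of length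
om (window_energy). Conversely, slopes above 1 that amount to a total variation J >= om^3 cost
energy of order at least J^(1/2) om^(5/2) (excess_cost). Hence in a window of length om the
variation of a minimizer is of order om and so is its distance from f (minimizers_tame). This
gives the uniform convergence, and the integral of G v tends to zero.

Total variation. The main point is that the variation of a minimizer does not exceed that of f
in the limit (variation_limit); it has to be excluded that a minimizer goes up and down
at the scale om. Three competitors do this.
- In a window that is short compared with om, large positive and negative slopes cannot coexist,
  because removing the same amount of both hardly changes the values (cancel_window).
- If the minimizer drops near some point, then the short block that contains the drop can be
  exchanged with the blocks to the right and to the left of it. The exchange changes the fidelity
  term only. That neither exchange pays forces the minimizer to lie below f by half of the
  drop right after it, and f cannot increase fast there (drop_position).
- If a drop is followed by a rise, at a distance of order om, then by the previous point the
  minimizer lies below f in between, and undoing a part of the drop and of the rise brings it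
  closer to f while it saves slope energy (cancel_pair), a contradiction (no_rise_after_drop).
So on a window of length K om, on which f is nearly affine, the minimizer is monotone up to
an error of order om, which does not depend on K (cell_variation). Its variation there is at most
that of f plus O(om), and the sum over all windows is at most the variation of f plus O(1/K).

Conclusion. With the lower semicontinuity of the variation (BV_variation_lower) this is strict
convergence. For the last statement, phi (x, u, arctan u') sqrt (1 + u'^2) is compared
with phi (x, u, 0) + phi (x, u, pi/2) max (0, u') + phi (x, u, - pi/2) max (0, - u'); the difference is at
most eta (1 + |u'|) + C G u' (direction), and the integral of G u' is small. Strict convergence
implies that the positive and the negative parts of u' converge separately, as measures
(positive_part_limit). *)

(** * Integrals over compact intervals *)

Section interval_integrals.
Context {R : realType}.
Implicit Types (a b c : R) (g k : R -> R).
Local Notation mu := (@lebesgue_measure R).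

Definition ig a b g := mu.-integrable `[a, b] (EFin \o g).
Definition I a b g : R := \int[mu]_(x in `[a, b]) g x.

Lemma ig_sub a b c d g : ig a b g -> a <= c -> d <= b -> ig c d g.
Proof.
move=> ig1 ac db; apply: integrableS ig1 => //.
by apply: subset_itv; rewrite bnd_simp.
Qed.

Lemma ig_continuous a b g : continuous g -> ig a b g.
Proof.
move=> cg; apply: continuous_compact_integrable; first exact: segment_compact.
exact: continuous_subspaceT.
Qed.

Lemma ig_eq a b g k : (forall x, a <= x <= b -> g x = k x) -> ig a b g -> ig a b k.
Proof.
move=> gk; apply: eq_integrable => // x; rewrite inE/= in_itv/= => xab.
by rewrite /= gk.
Qed.

Lemma ig_dom a b g k : measurable_fun [set: R] g -> ig a b k ->
  (forall x, a <= x <= b -> `|g x| <= `|k x|) -> ig a b g.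
Proof.
move=> mg ik gk; apply: le_integrable ik => //.
by apply/measurable_EFinP; exact: measurable_funTS.
Qed.

Lemma ig_add a b g k : ig a b g -> ig a b k -> ig a b (fun x => g x + k x).
Proof. by move=> h1 h2; apply: integrableD h1 h2. Qed.

Lemma ig_sub2 a b g k : ig a b g -> ig a b k -> ig a b (fun x => g x - k x).
Proof. by move=> h1 h2; apply: integrableB h1 h2. Qed.

Lemma ig_scale a b (r : R) g : ig a b g -> ig a b (fun x => r * g x).
Proof. by move=> h1; apply: integrableZl h1. Qed.

Lemma ig_norm a b g : ig a b g -> ig a b (fun x => `|g x|).
Proof. by move=> h1; apply: integrable_norm h1. Qed.

Lemma continuous_itv_bounded a b g : continuous g ->
  exists2 M, 0 <= M & forall x, a <= x <= b -> `|g x| <= M.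
Proof.
move=> cg; have [ab|ba] := leP a b; last first.
  by exists 0 => // x; lra.
have cng : {within `[a, b], continuous (fun x => `|g x|)}.
  by apply: continuous_subspaceT => x; apply: cvg_norm; exact: cg.
have [c _ cP] := EVT_max ab cng.
exists `|g c| => // x xab; apply: cP; by rewrite in_itv.
Qed.

Lemma measurable_continuous g : continuous g -> measurable_fun [set: R] g.
Proof. exact: continuous_measurable_fun. Qed.

Lemma ig_mul_continuous a b g k : continuous g -> ig a b k ->
  ig a b (fun x => g x * k x).
Proof.
move=> cg ik; have [M M0 gM] := continuous_itv_bounded a b cg.
apply: (@integrableMr _ _ _ mu `[a,b] _ g (EFin \o k)) => //.
  by apply: measurable_funTS; exact: measurable_continuous.
exists M; split; first exact: num_real.
move=> N MN x /=; rewrite in_itv/= => /gM h; exact: (le_trans h (ltW MN)).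
Qed.

Lemma I_add a b g k : ig a b g -> ig a b k ->
  I a b (fun x => g x + k x) = I a b g + I a b k.
Proof. by move=> h1 h2; exact: RintegralD. Qed.

Lemma I_sub a b g k : ig a b g -> ig a b k ->
  I a b (fun x => g x - k x) = I a b g - I a b k.
Proof. by move=> h1 h2; exact: RintegralB. Qed.

Lemma I_scale a b (r : R) g : ig a b g -> I a b (fun x => r * g x) = r * I a b g.
Proof. by move=> h1; exact: RintegralZl. Qed.

Lemma I_opp a b g : ig a b g -> I a b (fun x => - g x) = - I a b g.
Proof.
move=> h1; rewrite -mulN1r -I_scale//; congr I.
by apply/funext => x; rewrite mulN1r.
Qed.

Lemma I_le a b g k : ig a b g -> ig a b k ->
  (forall x, a <= x <= b -> g x <= k x) -> I a b g <= I a b k.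
Proof. by move=> h1 h2 gk; apply: le_Rintegral => //= x; rewrite in_itv/=; exact: gk. Qed.

Lemma I_eq a b g k : (forall x, a <= x <= b -> g x = k x) -> I a b g = I a b k.
Proof. by move=> gk; apply: eq_Rintegral => x; rewrite inE/= in_itv/=; exact: gk. Qed.

Lemma I_cst a b (r : R) : a <= b -> I a b (fun=> r) = r * (b - a).
Proof.
move=> ab; rewrite /I Rintegral_cst//; congr (_ * _).
rewrite /= lebesgue_measure_itv/= lte_fin; case: ltP => // ba.
by rewrite (_ : b = a) ?subrr//; apply/eqP; rewrite eq_le ba ab.
Qed.

Lemma ig_cst a b (r : R) : ig a b (fun=> r).
Proof. by apply: ig_continuous => x; exact: cvg_cst. Qed.

Lemma I_ge0 a b g : (forall x, a <= x <= b -> 0 <= g x) -> 0 <= I a b g.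
Proof. by move=> g0; apply: Rintegral_ge0 => x /=; rewrite in_itv/=; exact: g0. Qed.

Lemma I_norm a b g : ig a b g -> `|I a b g| <= I a b (fun x => `|g x|).
Proof. by move=> h1; exact: le_normr_Rintegral. Qed.

Lemma I_empty a b g : b <= a -> I a b g = 0.
Proof.
move=> ba; rewrite /I; move: ba; rewrite le_eqVlt => /orP[/eqP ->|ba].
  by rewrite set_itv1 Rintegral_set1.
by rewrite set_itv_ge ?Rintegral_set0// bnd_simp -ltNge.
Qed.

Lemma I_split a b c g : ig a c g -> a <= b -> b <= c ->
  I a c g = I a b g + I b c g.
Proof.
move=> h1 ab bc; have := @Rintegral_itvB R g (BLeft a) (BRight c) b h1.
rewrite !bnd_simp => /(_ ab bc) h2.
rewrite /I -[X in _ + X]Rintegral_itv_obnd_cbnd; last first.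
  by apply: integrableS h1 => //; apply: subset_itv; rewrite bnd_simp.
by rewrite -h2; ring.
Qed.

Lemma I_sub_le a b c d g : ig a b g -> (forall x, a <= x <= b -> 0 <= g x) ->
  a <= c -> c <= d -> d <= b -> I c d g <= I a b g.
Proof.
move=> h1 g0 ac cd db; rewrite (I_split h1 ac); last by lra.
rewrite (@I_split c d b)//; last by apply: (ig_sub h1); lra.
have h2 : 0 <= I a c g by apply: I_ge0 => x xx; apply: g0; lra.
have h3 : 0 <= I d b g by apply: I_ge0 => x xx; apply: g0; lra.
lra.
Qed.

Lemma I_bound a b g (M : R) : ig a b g -> a <= b ->
  (forall x, a <= x <= b -> g x <= M) -> I a b g <= M * (b - a).
Proof. by move=> h1 ab gM; rewrite -I_cst//; apply: I_le => //; exact: ig_cst. Qed.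

Lemma I_norm_bound a b g (M : R) : ig a b g -> a <= b ->
  (forall x, a <= x <= b -> `|g x| <= M) -> `|I a b g| <= M * (b - a).
Proof.
move=> h1 ab gM; apply: le_trans (I_norm h1) _.
by apply: I_bound => //; exact: ig_norm.
Qed.

Lemma I_lower a b g (M : R) : ig a b g -> a <= b ->
  (forall x, a <= x <= b -> M <= g x) -> M * (b - a) <= I a b g.
Proof. by move=> h1 ab gM; rewrite -I_cst//; apply: I_le => //; exact: ig_cst. Qed.

Lemma ig_sqr a b g : measurable_fun [set: R] g ->
  ig a b (fun x => g x ^+ 2) -> ig a b g.
Proof.
move=> mg h; apply: (@ig_dom a b g (fun x => 1 + g x ^+ 2)) => //.
  by apply: ig_add => //; exact: ig_cst.
move=> x _; rewrite [X in _ <= X]ger0_norm; last by have := sqr_ge0 (g x); lra.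
have := sqr_ge0 (`|g x| - 2^-1); rewrite -[g x ^+ 2]real_normK ?num_real//; nra.
Qed.

(** Integrate (|g| - t)^2 >= 0 with t the mean of |g|. *)
Lemma I_CS a b g : a <= b -> measurable_fun [set: R] g ->
  ig a b (fun x => g x ^+ 2) ->
  (I a b (fun x => `|g x|)) ^+ 2 <= (b - a) * I a b (fun x => g x ^+ 2).
Proof.
move=> ab mg h; have ign := ig_norm (ig_sqr mg h).
move: ab; rewrite le_eqVlt => /orP[/eqP ->|ab].
  by rewrite !I_empty// subrr mul0r expr0n.
pose t := I a b (fun x => `|g x|) / (b - a).
have : 0 <= I a b (fun x => (g x ^+ 2 - (2 * t) * `|g x|) + t ^+ 2).
  apply: I_ge0 => x _; have := sqr_ge0 (`|g x| - t).
  by rewrite -[g x ^+ 2]real_normK ?num_real//; nra.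
have h1 : ig a b (fun x => (2 * t) * `|g x|) by exact: ig_scale.
rewrite (I_add (ig_sub2 h h1) (ig_cst _ _ _)) I_sub// I_scale// I_cst; last exact: ltW.
rewrite -/t; set A := I a b _; set B := I a b _ => h0.
have ba : 0 < b - a by lra.
have bn : b - a != 0 by rewrite gt_eqF.
have tE : B = t * (b - a) by rewrite /t divfK.
have : 0 <= (b - a) * (A - 2 * t * B + t ^+ 2 * (b - a)).
  by apply: mulr_ge0 => //; lra.
by rewrite tE; nra.
Qed.

End interval_integrals.

(** * Calculus in integrated form *)

Section calculus_for_primitives.
Context {R : realType}.
Implicit Types (a b c d : R) (g v z : R -> R).
Local Notation mu := (@lebesgue_measure R).

(** The push-forward of the Lebesgue measure by a translation agrees with it on half-open
    intervals. *)
Lemma shift_integral d a b g : measurable_fun [set: R] g -> ig a b g ->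
  ig (a + d) (b + d) (fun x => g (x - d)) /\
  I (a + d) (b + d) (fun x => g (x - d)) = I a b g.
Proof.
move=> mg igg.
pose phi : measurableTypeR R -> measurableTypeR R := fun x => x + d.
have mphi : measurable_fun [set: measurableTypeR R] phi.
  apply: measurable_continuous => x; apply: cvgD; first exact: cvg_id.
  exact: cvg_cst.
pose phim := @isMeasurableFun.Build _ _ _ _ _ mphi.
pose phiM : {mfun measurableTypeR R >-> measurableTypeR R} := HB.pack phi phim.
have E : forall A, measurable A -> mu A = pushforward mu phiM A.
  apply: lebesgue_measure_unique => X [[x y] _ <-] /=.
  rewrite /pushforward.
  have -> : phiM @^-1` `]x, y]%classic = `]x - d, y - d]%classic.
    apply/seteqP; split => t /=; rewrite /phi !in_itv/=; lra.
  rewrite /= !lebesgue_measure_itv/= !lte_fin -!EFinB.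
  have -> : (x - d < y - d) = (x < y) by apply/idP/idP; lra.
  by case: ifP => // _; congr EFin; ring.
have pD : phiM @^-1` `[a + d, b + d]%classic = `[a, b]%classic.
  by apply/seteqP; split => t /=; rewrite /phi !in_itv/=; lra.
have mf : measurable_fun [set: measurableTypeR R] (EFin \o (fun x => g (x - d))).
  apply/measurable_EFinP.
  apply: (@measurableT_comp _ _ _ _ _ _ g) => //.
  by apply: measurable_continuous => x; apply: cvgD; [exact: cvg_id|exact: cvg_cst].
have fphi : (EFin \o (fun x => g (x - d))) \o phi = EFin \o g.
  by apply/funext => x /=; rewrite /phi addrK.
have i1 : mu.-integrable (phi @^-1` `[a + d, b + d]%classic)
   ((EFin \o (fun x => g (x - d))) \o phi) by rewrite fphi pD.
have i2 := integrable_pushforward mphi mf i1 (measurable_itv _).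
have i3 := integral_pushforward mphi mf i1 (measurable_itv _).
have eqI (f : R -> \bar R) (D : set R) : measurable D -> (\int[mu]_(x in D) f x = \int[pushforward mu phi]_(x in D) f x)%E.
  by move=> mD; apply: eq_measure_integral => A mA _; exact: E.
split.
  apply/integrableP; split; first by case/integrableP : i2.
  by rewrite eqI//; case/integrableP : i2.
rewrite /I /Rintegral eqI//; congr fine; apply: etrans i3 _.
by rewrite pD; apply: eq_integral => x _; rewrite -[RHS]/((EFin \o g) x) -fphi.
Qed.

(** Subdividing into n equal pieces gives |g b - g a| <= C (b - a) (F b - F a) / n for every n.
    This replaces differentiation a.e. in the chain rule and in the integration by parts. *)
Lemma const_of_superadditive_bound a b g (F : R -> R) (C : R) : a <= b ->
  (forall x y, a <= x -> x <= y -> y <= b ->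
     `|g y - g x| <= C * (y - x) * (F y - F x)) ->
  g b = g a.
Proof.
move=> ab H; apply/eqP; rewrite -subr_eq0 -normr_le0.
have Hn (n : nat) : `|g b - g a| * n.+1%:R <= C * (b - a) * (F b - F a).
  pose x (i : nat) := a + (b - a) * i%:R / n.+1%:R.
  have n0 : (0 : R) < n.+1%:R by rewrite ltr0n.
  have step i : x i.+1 - x i = (b - a) / n.+1%:R.
    by rewrite /x -natr1; field; rewrite gt_eqF.
  have d0 : 0 <= (b - a) / n.+1%:R by apply: divr_ge0; lra.
  have ba : 0 <= b - a by lra.
  have xa i : a <= x i.
    by rewrite /x lerDl; apply: divr_ge0; [exact: mulr_ge0|exact: ltW].
  have xb i : (i <= n.+1)%N -> x i <= b.
    move=> ile; have h : i%:R / n.+1%:R <= 1 :> R by rewrite ler_pdivrMr// mul1r ler_nat.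
    rewrite /x -mulrA; move: h; set q := _ / _ => h; have := ler_wpM2l ba h; rewrite mulr1; lra.
  have x0 : x 0%N = a by rewrite /x mulr0 mul0r addr0.
  have xn : x n.+1 = b by rewrite /x; field; rewrite gt_eqF.
  have qE : C * (b - a) * (F b - F a) = C * ((b - a) / n.+1%:R) * (F b - F a) * n.+1%:R.
    by field; rewrite gt_eqF.
  rewrite qE ler_pM2r//; move: step d0; set q := (b - a) / n.+1%:R => step d0.
  clearbody x q.
  have K i : (i <= n.+1)%N ->
     `|g (x i) - g a| <= C * q * (F (x i) - F a).
    elim: i => [|i IH] ile; first by rewrite x0 !subrr normr0 mulr0.
    have h1 := IH (ltnW ile).
    have h2 : `|g (x i.+1) - g (x i)| <= C * q * (F (x i.+1) - F (x i)).
      by rewrite -(step i); apply: H => //; [have := step i; lra|exact: xb].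
    have := ler_normD (g (x i.+1) - g (x i)) (g (x i) - g a).
    have -> : g (x i.+1) - g (x i) + (g (x i) - g a) = g (x i.+1) - g a by ring.
    lra.
  by have := K n.+1 (leqnn _); rewrite xn.
rewrite leNgt; apply/negP => p0.
set A := `|_| in Hn p0; set B := _ * _ in Hn.
have [n Hb] : exists n : nat, B / A < n.+1%:R.
  exists (Num.trunc (B / A)); exact: truncnS_gt.
by have := Hn n; rewrite leNgt -ltr_pdivrMl// mulrC Hb.
Qed.

Lemma lipschitz_continuous_fun g (M : R) :
  (forall x y, `|g y - g x| <= M * `|y - x|) -> continuous g.
Proof.
move=> H x; apply/cvgrPdist_le => e e0; near=> y.
apply: le_trans (H y x) _.
have M1 : 0 < `|M| + 1 by have := normr_ge0 M; lra.
have : `|x - y| <= e / (`|M| + 1).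
  near: y; apply: (@cvgr_dist_le _ _ _ _ _ id x) => //.
  exact: divr_gt0.
rewrite ler_pdivlMr// => h; have := ler_norm M; have := normr_ge0 (x - y).
by have := normr_ge0 M; nra.
Unshelve. all: by end_near. Qed.

(** The relations v' = z and w' = v hold in integrated form. Continuity of w and v is
    required on the whole line so that compositions are integrable on every interval. *)
Definition h2arc a b (w v z : R -> R) : Prop :=
  [/\ continuous w, continuous v, measurable_fun [set: R] z,
      ig a b (fun x => z x ^+ 2) &
      forall x y, a <= x -> x <= y -> y <= b ->
        v y - v x = I x y z /\ w y - w x = I x y v].

Lemma arc_sub a b c d w v z : h2arc a b w v z -> a <= c -> d <= b -> h2arc c d w v z.
Proof.
move=> [cw cv mz iz P] ac db; split => //; first exact: ig_sub iz _ _.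
by move=> x y cx xy yd; apply: P => //; lra.
Qed.

Lemma arc_igz a b w v z : h2arc a b w v z -> ig a b z.
Proof. by move=> [_ _ mz iz _]; exact: ig_sqr. Qed.

Lemma comp_continuous g v : continuous g -> continuous v -> continuous (g \o v).
Proof. by move=> cg cv x; apply: continuous_comp; [exact: cv|exact: cg]. Qed.

(** On [x, y] the remainder of the Taylor expansion is bounded by
    (int |z|)^2 <= (y - x) int z^2, so const_of_superadditive_bound applies to the difference of
    the two sides. *)
Lemma chain_rule a b v z (Th Th' : R -> R) (C : R) : a <= b -> 0 <= C ->
  continuous v -> measurable_fun [set: R] z -> ig a b (fun x => z x ^+ 2) ->
  (forall x y, a <= x -> x <= y -> y <= b -> v y - v x = I x y z) ->
  continuous Th -> continuous Th' ->
  (forall s t, `|Th t - Th s - Th' s * (t - s)| <= C * (t - s) ^+ 2) ->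
  (forall s t, `|Th' t - Th' s| <= C * `|t - s|) ->
  Th (v b) - Th (v a) = I a b (fun x => Th' (v x) * z x).
Proof.
move=> ab C0 cv mz iz vz cT cT' T1 T2.
have igz : ig a b z by exact: ig_sqr.
have igt : ig a b (fun x => Th' (v x) * z x).
  by apply: ig_mul_continuous => //; exact: (comp_continuous cT' cv).
pose g x := Th (v x) - I a x (fun x => Th' (v x) * z x).
suff : g b = g a by rewrite /g (@I_empty _ a a)// ; lra.
apply: (@const_of_superadditive_bound a b g (fun x => I a x (fun x => z x ^+ 2)) (C + C)) => //.
move=> x y ax xy yb.
have sub k : ig a b k -> ig x y k by move=> h; exact: (ig_sub h).
have isp k : ig a b k -> I a y k = I a x k + I x y k.
  by move=> h; rewrite (@I_split _ a x y)//; apply: (ig_sub h).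
rewrite /g !isp//.
have -> : Th (v y) - (I a x (fun x => Th' (v x) * z x) + I x y (fun x => Th' (v x) * z x))
  - (Th (v x) - I a x (fun x => Th' (v x) * z x)) =
  Th (v y) - Th (v x) - I x y (fun x => Th' (v x) * z x) by ring.
have -> : I a x (fun x => z x ^+ 2) + I x y (fun x => z x ^+ 2) - I a x (fun x => z x ^+ 2)
  = I x y (fun x => z x ^+ 2) by ring.
set Z := I x y (fun x => `|z x|).
have Zge k : x <= k -> k <= y -> `|v k - v x| <= Z.
  move=> xk ky; rewrite vz//; last by lra.
  apply: le_trans (I_norm _) _; first by apply: (ig_sub igz); lra.
  by apply: I_sub_le => //; apply: ig_norm; apply: sub.
have h1 : `|Th (v y) - Th (v x) - Th' (v x) * (v y - v x)| <= C * Z ^+ 2.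
  apply: le_trans (T1 _ _) _; apply: ler_wpM2l => //.
  rewrite -real_normK ?num_real// ler_sqr ?nnegrE//; last by apply: I_ge0.
  exact: Zge.
have h2 : `|I x y (fun t => Th' (v t) * z t) - Th' (v x) * (v y - v x)| <= C * Z * Z.
  rewrite vz// -I_scale; last exact: sub.
  rewrite -I_sub; [|exact: sub|by apply: ig_scale; exact: sub].
  have i3 : ig x y (fun t => Th' (v t) * z t - Th' (v x) * z t).
    by apply: ig_sub2; [exact: sub|apply: ig_scale; exact: sub].
  apply: le_trans (I_norm i3) _.
  rewrite /Z -I_scale; last by apply: ig_norm; exact: sub.
  apply: I_le; [exact: ig_norm|by apply: ig_scale; apply: ig_norm; exact: sub|].
  move=> t /andP[xt ty]; rewrite -mulrBl normrM ler_wpM2r//.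
  by apply: le_trans (T2 _ _) _; apply: ler_wpM2l => //; apply: Zge.
have h3 : Z ^+ 2 <= (y - x) * I x y (fun t => z t ^+ 2).
  by apply: I_CS => //; exact: sub.
have := ler_normB (Th (v y) - Th (v x) - Th' (v x) * (v y - v x))
  (I x y (fun t => Th' (v t) * z t) - Th' (v x) * (v y - v x)).
have -> : Th (v y) - Th (v x) - Th' (v x) * (v y - v x) -
  (I x y (fun t => Th' (v t) * z t) - Th' (v x) * (v y - v x)) =
  Th (v y) - Th (v x) - I x y (fun x => Th' (v x) * z x) by ring.
by nra.
Qed.

(** The mechanism is that of chain_rule, with a remainder of order (y - x) int |z|. *)
Lemma by_parts a b v z (p q : R -> R) (M : R) : a <= b ->
  continuous v -> continuous p -> continuous q -> ig a b z ->
  (forall x y, a <= x -> x <= y -> y <= b -> v y - v x = I x y z) ->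
  (forall x y, a <= x -> x <= y -> y <= b -> p y - p x = I x y q) ->
  (forall x, a <= x <= b -> `|q x| <= M) ->
  p b * v b - p a * v a = I a b (fun x => p x * z x) + I a b (fun x => q x * v x).
Proof.
move=> ab cv cp cq igz vz pq qM.
have i1 : ig a b (fun x => p x * z x) by exact: ig_mul_continuous.
have i2 : ig a b (fun x => q x * v x).
  by apply: ig_mul_continuous => //; exact: ig_continuous.
pose g x := p x * v x - I a x (fun x => p x * z x) - I a x (fun x => q x * v x).
suff : g b = g a by rewrite /g !(@I_empty _ a a)//; lra.
apply: (@const_of_superadditive_bound a b g (fun x => I a x (fun x => `|z x|)) (M + M)) => //.
move=> x y ax xy yb.
have sub k : ig a b k -> ig x y k by move=> h; exact: (ig_sub h).
have isp k : ig a b k -> I a y k = I a x k + I x y k.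
  by move=> h; rewrite (@I_split _ a x y)//; apply: (ig_sub h).
have iz' := ig_norm igz.
rewrite /g !isp//.
have -> : I a x (fun x => `|z x|) + I x y (fun x => `|z x|) - I a x (fun x => `|z x|)
  = I x y (fun x => `|z x|) by ring.
set Z := I x y (fun x => `|z x|).
have Z0 : 0 <= Z by apply: I_ge0.
have M0 : 0 <= M by apply: le_trans (qM a _) => //; lra.
have Zge k : x <= k -> k <= y -> `|v k - v x| <= Z.
  move=> xk ky; rewrite vz//; last by lra.
  apply: le_trans (I_norm _) _; first by apply: (ig_sub igz); lra.
  by apply: I_sub_le => //; apply: ig_norm; apply: sub.
have pge k : x <= k -> k <= y -> `|p y - p k| <= M * (y - x).
  move=> xk ky; rewrite pq//; last by lra.
  apply: le_trans (I_norm_bound (ig_continuous _ _ cq) ky _) _.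
    by move=> t tt; apply: qM; lra.
  by apply: ler_wpM2l => //; lra.
have i3 : ig x y (fun t => (p y - p t) * z t).
  apply: ig_mul_continuous; last exact: sub.
  by move=> t; apply: cvgB; [exact: cvg_cst|exact: cp].
have i4 : ig x y (fun t => (v x - v t) * q t).
  apply: ig_mul_continuous; last exact: ig_continuous.
  by move=> t; apply: cvgB; [exact: cvg_cst|exact: cv].
have -> : p y * v y - (I a x (fun x0 => p x0 * z x0) + I x y (fun x0 => p x0 * z x0)) -
   (I a x (fun x0 => q x0 * v x0) + I x y (fun x0 => q x0 * v x0)) -
   (p x * v x - I a x (fun x0 => p x0 * z x0) - I a x (fun x0 => q x0 * v x0))
  = I x y (fun t => (p y - p t) * z t) + I x y (fun t => (v x - v t) * q t).
  have -> : I x y (fun t => (p y - p t) * z t) = p y * (v y - v x) - I x y (fun t => p t * z t).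
    rewrite vz// -I_scale; last exact: sub.
    rewrite -I_sub; [|by apply: ig_scale; exact: sub|exact: sub].
    by apply: I_eq => t _; ring.
  have -> : I x y (fun t => (v x - v t) * q t) = v x * (p y - p x) - I x y (fun t => q t * v t).
    rewrite pq// -I_scale; last exact: ig_continuous.
    rewrite -I_sub; [|by apply: ig_scale; exact: ig_continuous|exact: sub].
    by apply: I_eq => t _; ring.
  by ring.
have h1 : `|I x y (fun t => (p y - p t) * z t)| <= M * (y - x) * Z.
  apply: le_trans (I_norm i3) _; rewrite /Z -I_scale; last exact: sub.
  apply: I_le; [exact: ig_norm|by apply: ig_scale; exact: sub|].
  by move=> t /andP[xt ty]; rewrite normrM ler_wpM2r//; apply: pge.
have h2 : `|I x y (fun t => (v x - v t) * q t)| <= (M * Z) * (y - x).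
  apply: I_norm_bound => // t /andP[xt ty]; rewrite normrM mulrC.
  by apply: ler_pM => //; [apply: qM; lra|rewrite distrC; apply: Zge].
by apply: le_trans (ler_normD _ _) _; lra.
Qed.

End calculus_for_primitives.

(** * The logarithm of the slope *)

Section logarithm.
Context {R : realType}.
Implicit Types (s t x : R).

Definition G t : R := ln (1 + t ^+ 2).

Lemma G_ge0 t : 0 <= G t.
Proof. by apply: ln_ge0; have := sqr_ge0 t; lra. Qed.

Lemma G_le_sqr t : G t <= t ^+ 2.
Proof. by apply: le_ln1Dx; have := sqr_ge0 t; lra. Qed.

Lemma G_continuous : continuous G.
Proof.
move=> t; apply: continuous_comp.
  by apply: cvgD; [exact: cvg_cst|apply: exprn_continuous].
by apply: continuous_ln; have := sqr_ge0 t; lra.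
Qed.

Lemma G_le s t : `|s| <= `|t| -> G s <= G t.
Proof.
move=> st; rewrite /G ler_ln ?posrE; [|by have := sqr_ge0 s; lra|by have := sqr_ge0 t; lra].
by rewrite lerD2l -(real_normK (num_real s)) -(real_normK (num_real t)) ler_sqr ?nnegrE.
Qed.

Lemma ln_lower x : 0 < x -> 1 - x^-1 <= ln x.
Proof.
move=> x0; have x1 : 0 < x^-1 by rewrite invr_gt0.
have := @le_ln1Dx R (x^-1 - 1); have -> : 1 + (x^-1 - 1) = x^-1 by ring.
rewrite lnV ?posrE// => h.
have : - ln x <= x^-1 - 1 by apply: h; lra.
lra.
Qed.

Lemma G_diff s t : `|s| <= `|t| -> (t ^+ 2 - s ^+ 2) / (1 + t ^+ 2) <= G t - G s.
Proof.
move=> st; have s0 : 0 < 1 + s ^+ 2 by have := sqr_ge0 s; lra.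
have t0 : 0 < 1 + t ^+ 2 by have := sqr_ge0 t; lra.
rewrite /G -ln_div ?posrE//; apply: le_trans (ln_lower _); last exact: divr_gt0.
rewrite invf_div le_eqVlt; apply/orP; left; apply/eqP.
by field; rewrite gt_eqF.
Qed.

Lemma G0 : G 0 = 0.
Proof. by rewrite /G expr0n addr0 ln1. Qed.

Lemma G_lower t : t ^+ 2 / (1 + t ^+ 2) <= G t.
Proof.
have := @G_diff 0 t; rewrite G0 expr0n/= !subr0; apply.
by rewrite normr0.
Qed.

Lemma G_large t : 1 <= `|t| -> 2^-1 <= G t.
Proof.
move=> t1; apply: le_trans (G_lower t).
have t2 : 1 <= t ^+ 2.
  by rewrite -(real_normK (num_real t)) -(expr1n _ 2) ler_sqr ?nnegrE.
rewrite ler_pdivlMr; lra.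
Qed.

End logarithm.

(** * Primitives and pasting *)

Section arcs.
Context {R : realType}.
Implicit Types (a b c d x y : R) (g w v z : R -> R).

Definition clamp a b x : R := Num.max a (Num.min b x).

Lemma clampE a b x : a <= x <= b -> clamp a b x = x.
Proof. by move=> /andP[ax xb]; rewrite /clamp (min_idPr xb) (max_idPr ax). Qed.

Lemma clamp_itv a b x : a <= b -> a <= clamp a b x <= b.
Proof.
move=> ab; rewrite /clamp le_max lexx/= ge_max ab ge_min lexx//.
Qed.

Lemma clamp_le a b x y : x <= y -> clamp a b x <= clamp a b y.
Proof. by move=> xy; rewrite /clamp; apply: Order.TotalTheory.le_max2 => //; apply: Order.TotalTheory.le_min2. Qed.

Lemma clamp_dist a b x y : `|clamp a b y - clamp a b x| <= `|y - x|.
Proof.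
wlog xy : x y / x <= y.
  move=> H; have [|/ltW yx] := leP x y; first exact: H.
  by rewrite distrC [leRHS]distrC; exact: H.
have := clamp_le a b xy; rewrite -subr_ge0 => h; rewrite ger0_norm//.
rewrite ger0_norm ?subr_ge0//; move: h; rewrite /clamp /Num.max /Num.min.
by do ! case: ifP; move=> *; lra.
Qed.

Lemma clamp_continuous a b : continuous (clamp a b).
Proof.
by apply: (@lipschitz_continuous_fun _ _ 1) => x y; rewrite mul1r clamp_dist.
Qed.

(** Clamping makes the primitive a function on the whole line, as arcs require. *)
Definition prim a b g x : R := I a (clamp a b x) g.

Lemma primB a b g x y : ig a b g -> a <= x -> x <= y -> y <= b ->
  prim a b g y - prim a b g x = I x y g.
Proof.
move=> ig1 ax xy yb; rewrite /prim !clampE; [|lra|lra].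
rewrite (@I_split _ a x y)//; first by ring.
by apply: (ig_sub ig1).
Qed.

Lemma prim0 a b g : a <= b -> prim a b g a = 0.
Proof. by move=> ab; rewrite /prim clampE ?lexx// I_empty. Qed.

(** By the Cauchy-Schwarz inequality the primitive is Hoelder continuous of exponent 1/2. *)
Lemma prim_continuous a b g : a <= b -> measurable_fun [set: R] g ->
  ig a b (fun x => g x ^+ 2) -> continuous (prim a b g).
Proof.
move=> ab mg ig2; pose A := I a b (fun x => g x ^+ 2).
have A0 : 0 <= A by apply: I_ge0 => x _; exact: sqr_ge0.
have ig1 := ig_sqr mg ig2.
have H x y : `|prim a b g y - prim a b g x| ^+ 2 <= `|y - x| * A.
  wlog xy : x y / x <= y.
    move=> H; have [|/ltW yx] := leP x y; first exact: H.
    by rewrite distrC [X in _ <= X * _]distrC; exact: H.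
  have /andP[h1 h2] := clamp_itv x ab; have /andP[h3 h4] := clamp_itv y ab.
  have h5 := clamp_le a b xy.
  have -> : prim a b g y - prim a b g x = I (clamp a b x) (clamp a b y) g.
    by rewrite -(@primB a b)// /prim !(@clampE a b (clamp a b _)) ?h1 ?h3.
  have ig1' := ig_sub ig1 h1 h4; have ig2' := ig_sub ig2 h1 h4.
  apply: le_trans (_ : I (clamp a b x) (clamp a b y) (fun x => `|g x|) ^+ 2 <= _).
    by rewrite ler_sqr ?nnegrE//; [exact: I_norm|apply: I_ge0].
  apply: le_trans (I_CS h5 mg ig2') _; apply: ler_pM => //.
  - lra.
  - by apply: I_ge0 => *; exact: sqr_ge0.
  - by apply: le_trans (clamp_dist a b x y); exact: ler_norm.
  - by apply: I_sub_le => // *; exact: sqr_ge0.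
move=> x; apply/cvgrPdist_le => e e0; near=> y.
rewrite -ler_sqr ?nnegrE//; last exact: ltW.
apply: le_trans (H y x) _.
have : `|x - y| <= e ^+ 2 / (A + 1).
  near: y; apply: (@cvgr_dist_le _ _ _ _ _ id x) => //.
  by apply: divr_gt0; [exact: exprn_gt0|lra].
rewrite ler_pdivlMr; last by lra.
by move=> h; have := normr_ge0 (x - y); nra.
Unshelve. all: by end_near. Qed.

Lemma sqr_continuous g : continuous g -> continuous (fun x => g x ^+ 2).
Proof. by move=> cg; apply: (comp_continuous (@exprn_continuous _ 2) cg). Qed.

Lemma ig_sqr_continuous a b g : continuous g -> ig a b (fun x => g x ^+ 2).
Proof. by move=> cg; apply: ig_continuous; exact: sqr_continuous. Qed.

Definition paste b g1 g2 x : R := if x <= b then g1 x else g2 x.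

Lemma paste_continuous b g1 g2 : continuous g1 -> continuous g2 -> g1 b = g2 b ->
  continuous (paste b g1 g2).
Proof.
move=> c1 c2 e12.
have cmin : continuous (fun x => Num.min x b : R).
  apply: (@lipschitz_continuous_fun _ _ 1) => x y; rewrite mul1r.
  rewrite ler_norml; have := ler_norm (y - x); have := ler_norm (x - y).
  by rewrite (distrC x y) => h1 h2; rewrite /Num.min; do ! case: ifP; lra.
have cmax : continuous (fun x => Num.max x b : R).
  apply: (@lipschitz_continuous_fun _ _ 1) => x y; rewrite mul1r.
  rewrite ler_norml; have := ler_norm (y - x); have := ler_norm (x - y).
  by rewrite (distrC x y) => h1 h2; rewrite /Num.max; do ! case: ifP; lra.
have -> : paste b g1 g2 = (fun x => g1 (Num.min x b) + g2 (Num.max x b) - g1 b).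
  apply/funext => x; rewrite /paste; case: leP => xb.
    by rewrite e12 addrK.
  by ring.
move=> x; apply: cvgB; last exact: cvg_cst.
by apply: cvgD; [apply: (comp_continuous c1 cmin)|apply: (comp_continuous c2 cmax)].
Qed.

Lemma paste_measurable b g1 g2 : measurable_fun [set: R] g1 ->
  measurable_fun [set: R] g2 -> measurable_fun [set: R] (paste b g1 g2).
Proof.
move=> m1 m2; apply: measurable_fun_ifT => //.
by apply: measurable_fun_ler => //; exact: measurable_cst.
Qed.

Lemma pasteL b g1 g2 x : x <= b -> paste b g1 g2 x = g1 x.
Proof. by rewrite /paste => ->. Qed.

Lemma pasteR b g1 g2 x : b < x -> paste b g1 g2 x = g2 x.
Proof. by rewrite /paste leNgt => ->. Qed.

Lemma pasteR' b g1 g2 x : g1 b = g2 b -> b <= x -> paste b g1 g2 x = g2 x.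
Proof.
move=> e; rewrite le_eqVlt => /orP[/eqP <-|]; last exact: pasteR.
by rewrite /paste lexx.
Qed.

Local Notation mu := (@lebesgue_measure R).

(** The end point is a null set. *)
Lemma I_eq_right a b g k : ig a b g -> (forall x, a < x -> x <= b -> g x = k x) ->
  ig a b k /\ I a b g = I a b k.
Proof.
move=> igg gk.
have ocP (l : R -> R) : mu.-integrable `]a, b] (EFin \o l) <-> ig a b l.
  split=> [/integrableP[ml fl]|igl]; last first.
    by apply: integrableS igl => //; apply: subset_itv; rewrite bnd_simp.
  apply/integrableP; split; first exact/emeasurable_fun_itv_obnd_cbndP.
  rewrite -integral_itv_obnd_cbnd//.
  by apply: measurableT_comp.
have i1 : mu.-integrable `]a, b] (EFin \o g) by apply/ocP.
have i2 : mu.-integrable `]a, b] (EFin \o k).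
  apply: eq_integrable i1 => // x; rewrite inE/= in_itv/= => /andP[h1 h2].
  by rewrite /= gk.
have i3 : ig a b k by apply/ocP.
split=> //; rewrite /I -!Rintegral_itv_obnd_cbnd//.
apply: eq_Rintegral => x; rewrite inE/= in_itv/= => /andP[h1 h2]; exact: gk.
Qed.

End arcs.

(** * The energy of an arc *)

Section energy.
Context {R : realType}.
Variables (h beta : R) (f : R -> R).
Hypotheses (h0 : 0 <= h) (beta0 : 0 <= beta) (cf : continuous f).
Implicit Types (a b c d x y r : R) (g w v z : R -> R).
Local Notation mu := (@lebesgue_measure R).

Lemma ftc a b (F g : R -> R) : a <= b -> continuous g ->
  (forall x, is_derive x (1 : R) F (g x)) -> F b - F a = I a b g.
Proof.
rewrite le_eqVlt => /orP[/eqP ->|ab] cg dF; first by rewrite subrr I_empty.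
have cF : continuous F.
  by move=> x; apply: differentiable_continuous; apply/derivable1_diffP; case: (dF x).
rewrite /I /Rintegral (@continuous_FTC2 _ g F)//.
- exact: continuous_subspaceT.
- split=> [x _||]; first by case: (dF x).
  + by apply: cvg_at_right_filter; exact: cF.
  + by apply: cvg_at_left_filter; exact: cF.
- by move=> x _; rewrite derive1E; case: (dF x).
Qed.

Lemma ig_join a b c g : a <= b -> b <= c -> ig a b g -> ig b c g -> ig a c g.
Proof.
move=> ab bc i1 i2.
have j2 : mu.-integrable `]b, c] (EFin \o g).
  by apply: integrableS i2 => //; apply: subset_itv; rewrite bnd_simp.
apply/(@integrable_mkcond _ _ _ _ _ _ _).2 => //.
have -> : (EFin \o g) \_ `[a, c] = ((EFin \o g) \_ `[a, b] \+ (EFin \o g) \_ `]b, c])%E.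
  apply/funext => x; rewrite /= !patchE.
  have [xb|bx] := leP x b.
    rewrite (memNset (_ : ~ `]b, c]%classic x)); last by rewrite /= in_itv/=; lra.
    rewrite adde0; have [ax|xa] := leP a x.
      by rewrite !mem_set//= in_itv/=; lra.
    by rewrite !memNset//= in_itv/=; lra.
  rewrite [in RHS](memNset (_ : ~ `[a, b]%classic x)); last by rewrite /= in_itv/=; lra.
  rewrite add0e; have [xc|cx] := leP x c.
    by rewrite !mem_set//= in_itv/=; lra.
  by rewrite !memNset//= in_itv/=; lra.
apply: integrableD => //.
  by apply/(@integrable_mkcond _ _ _ _ _ _ _).1.
by apply/(@integrable_mkcond _ _ _ _ _ _ _).1.
Qed.

Lemma I_paste a b c g1 g2 : a <= b -> b <= c -> ig a b g1 -> ig b c g2 ->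
  ig a c (paste b g1 g2) /\ I a c (paste b g1 g2) = I a b g1 + I b c g2.
Proof.
move=> ab bc i1 i2.
have j1 : ig a b (paste b g1 g2).
  by apply: ig_eq i1 => x /andP[_ xb]; rewrite pasteL.
have [j2 e2] : ig b c (paste b g1 g2) /\ I b c g2 = I b c (paste b g1 g2).
  by apply: I_eq_right => // x bx _; rewrite pasteR.
have j : ig a c (paste b g1 g2) by exact: ig_join j2.
split=> //; rewrite (@I_split _ a b c)// -e2; congr (_ + _).
by apply: I_eq => x /andP[_ xb]; rewrite pasteL.
Qed.

Definition dens w v z x := h * z x ^+ 2 + G (v x) + beta * (w x - f x) ^+ 2.

Definition E a b w v z := I a b (dens w v z).

Lemma ig_dens a b w v z : h2arc a b w v z -> ig a b (dens w v z).
Proof.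
move=> [cw cv mz iz _]; apply: ig_add.
  by apply: ig_add; [exact: ig_scale|apply: ig_continuous; exact: (comp_continuous (@G_continuous R) cv)].
apply: ig_scale; apply: ig_sqr_continuous => x.
by apply: cvgB; [exact: cw|exact: cf].
Qed.

Lemma dens_ge0 w v z x : 0 <= dens w v z x.
Proof.
by rewrite /dens !addr_ge0// ?G_ge0// mulr_ge0// sqr_ge0.
Qed.

Lemma E_ge0 a b w v z : 0 <= E a b w v z.
Proof. by apply: I_ge0 => x _; exact: dens_ge0. Qed.

Lemma E_split a b c w v z : h2arc a c w v z -> a <= b -> b <= c ->
  E a c w v z = E a b w v z + E b c w v z.
Proof. by move=> A ab bc; apply: I_split => //; exact: ig_dens. Qed.

Lemma E_mono a b c d w v z : h2arc a b w v z -> a <= c -> c <= d -> d <= b ->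
  E c d w v z <= E a b w v z.
Proof.
move=> A ac cd db; apply: I_sub_le => //; first exact: ig_dens.
by move=> x _; exact: dens_ge0.
Qed.

Lemma E_parts a b w v z : h2arc a b w v z ->
  E a b w v z = h * I a b (fun x => z x ^+ 2) + I a b (fun x => G (v x))
     + beta * I a b (fun x => (w x - f x) ^+ 2).
Proof.
move=> [cw cv mz iz _].
have i2 : ig a b (fun x => G (v x)).
  by apply: ig_continuous; exact: (comp_continuous (@G_continuous R) cv).
have i3 : ig a b (fun x => (w x - f x) ^+ 2).
  by apply: ig_sqr_continuous => x; apply: cvgB; [exact: cw|exact: cf].
rewrite /E /dens I_add; [|by apply: ig_add => //; exact: ig_scale|exact: ig_scale].
by rewrite I_add//; [rewrite !I_scale|exact: ig_scale].
Qed.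

Lemma I_G_le_E a b w v z : h2arc a b w v z -> I a b (fun x => G (v x)) <= E a b w v z.
Proof.
move=> A; rewrite (E_parts A).
have q1 : 0 <= h * I a b (fun x => z x ^+ 2).
  by apply: mulr_ge0 => //; apply: I_ge0 => x _; exact: sqr_ge0.
have q2 : 0 <= beta * I a b (fun x => (w x - f x) ^+ 2).
  by apply: mulr_ge0 => //; apply: I_ge0 => x _; exact: sqr_ge0.
lra.
Qed.

Lemma I_fid_le_E a b w v z : h2arc a b w v z ->
  beta * I a b (fun x => (w x - f x) ^+ 2) <= E a b w v z.
Proof.
move=> A; rewrite (E_parts A).
have q1 : 0 <= I a b (fun x => G (v x)) by apply: I_ge0 => x _; exact: G_ge0.
have q2 : 0 <= h * I a b (fun x => z x ^+ 2).
  by apply: mulr_ge0 => //; apply: I_ge0 => x _; exact: sqr_ge0.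
lra.
Qed.

Lemma arc_paste a b c w1 v1 z1 w2 v2 z2 : a <= b -> b <= c ->
  h2arc a b w1 v1 z1 -> h2arc b c w2 v2 z2 -> w1 b = w2 b -> v1 b = v2 b ->
  h2arc a c (paste b w1 w2) (paste b v1 v2) (paste b z1 z2) /\
  E a c (paste b w1 w2) (paste b v1 v2) (paste b z1 z2) = E a b w1 v1 z1 + E b c w2 v2 z2.
Proof.
move=> ab bc A1 A2 ew ev; have [cw1 cv1 mz1 iz1 P1] := A1; have [cw2 cv2 mz2 iz2 P2] := A2.
have gsq : (fun x => paste b z1 z2 x ^+ 2) = paste b (fun x => z1 x ^+ 2) (fun x => z2 x ^+ 2).
  by apply/funext => x; rewrite /paste; case: ifP.
have gd : dens (paste b w1 w2) (paste b v1 v2) (paste b z1 z2) = paste b (dens w1 v1 z1) (dens w2 v2 z2).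
  by apply/funext => x; rewrite /dens /paste; case: ifP.
split; last first.
  by rewrite /E gd; apply: (I_paste ab bc _ _).2; exact: ig_dens.
split; [exact: paste_continuous|exact: paste_continuous|exact: paste_measurable| |].
  by rewrite gsq; apply: (I_paste ab bc _ _).1.
have aux (F1 F2 g1 g2 : R -> R) : F1 b = F2 b -> ig a b g1 -> ig b c g2 ->
   (forall x y, a <= x -> x <= y -> y <= b -> F1 y - F1 x = I x y g1) ->
   (forall x y, b <= x -> x <= y -> y <= c -> F2 y - F2 x = I x y g2) ->
   forall x y, a <= x -> x <= y -> y <= c -> paste b F1 F2 y - paste b F1 F2 x = I x y (paste b g1 g2).
  move=> eF i1 i2 Q1 Q2 x y ax xy yc.
  have [yb|/ltW yb] := leP y b.
    rewrite !pasteL//; last by lra.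
    rewrite Q1//; apply: I_eq => t tt; rewrite pasteL//; lra.
  have [bx|/ltW bx] := leP b x.
    rewrite !pasteR'// Q2//.
    by apply: (@I_eq_right _ x y _ _ _ _).2 => [|t xt ty]; [apply: (ig_sub i2)|rewrite pasteR//; lra].
  rewrite (pasteR' eF yb) (pasteL _ _ bx).
  rewrite (_ : F2 y - F1 x = (F1 b - F1 x) + (F2 y - F2 b)); last by rewrite eF; ring.
  rewrite Q1// Q2//; apply/esym.
  apply: (I_paste _ _ _ _).2 => //; [apply: (ig_sub i1)|apply: (ig_sub i2)] => //.
move=> x y ax xy yc; split; apply: aux => //.
- exact: arc_igz A1.
- exact: arc_igz A2.
- by move=> *; apply: (P1 _ _ _ _ _).1.
- by move=> *; apply: (P2 _ _ _ _ _).1.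
- exact: ig_continuous.
- exact: ig_continuous.
- by move=> *; apply: (P1 _ _ _ _ _).2.
- by move=> *; apply: (P2 _ _ _ _ _).2.
Qed.

(** Cubic interpolation of the values and slopes at both ends. *)
Lemma connector (p r y0 v0 y1 v1 V : R) : 0 < r ->
  2 * (`|v0| + `|v1| + `|y1 - y0| / r) <= V ->
  exists w v z, [/\ h2arc p (p + r) w v z, w p = y0 /\ v p = v0,
    w (p + r) = y1 /\ v (p + r) = v1 &
    forall x, p <= x <= p + r ->
      [/\ `|v x| <= V, `|z x| <= 4 * V / r & `|w x - y0| <= V * r]].
Proof.
move=> r0 HV.
have rn : r != 0 by rewrite gt_eqF.
pose D := (y1 - y0) / r; pose a := D - (v0 + v1) / 2.
pose A := ((v1 - v0) + 6 * a) / r; pose B := - 6 * a / r ^+ 2.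
pose z x := A + 2 * B * (x - p).
pose v x := v0 + A * (x - p) + B * (x - p) ^+ 2.
pose w x := y0 + v0 * (x - p) + A / 2 * (x - p) ^+ 2 + B / 3 * (x - p) ^+ 3.
have dv x : is_derive x (1 : R) v (z x).
  by rewrite /v; apply: is_derive_eq; rewrite /GRing.scale/= /z; ring.
have dw x : is_derive x (1 : R) w (v x).
  by rewrite /w; apply: is_derive_eq; rewrite /GRing.scale/= /v; field.
have cont F g : (forall x, is_derive x (1 : R) F (g x)) -> continuous F.
  by move=> dF x; apply: differentiable_continuous; apply/derivable1_diffP; case: (dF x).
have dz x : is_derive x (1 : R) z (2 * B).
  by rewrite /z; apply: is_derive_eq; rewrite /GRing.scale/=; ring.
have cv := cont _ _ dv; have cw := cont _ _ dw; have cz := cont z (fun=> 2 * B) dz.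
have aarc : h2arc p (p + r) w v z.
  split => //; [exact: measurable_continuous|exact: ig_sqr_continuous|].
  by move=> x y _ xy _; split; apply: ftc.
have aD : `|a| <= `|D| + (`|v0| + `|v1|) / 2.
  rewrite /a; apply: le_trans (ler_normB _ _) _; rewrite lerD2l normrM (ger0_norm (_ : 0 <= 2^-1)) ?invr_ge0//.
  by have := ler_normD v0 v1; lra.
have DE : `|D| = `|y1 - y0| / r by rewrite /D normrM normfV (gtr0_norm r0).
rewrite -DE in HV.
have vb x : p <= x <= p + r -> `|v x| <= V /\ `|z x| <= 4 * V / r.
  move=> px; pose t := (x - p) / r.
  have tE : x - p = t * r by rewrite /t divfK.
  have t01 : 0 <= t <= 1.
    apply/andP; split; first by apply: divr_ge0; lra.
    by rewrite /t ler_pdivrMr//; lra.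
  have -> : v x = (1 - t) * v0 + t * v1 + 6 * (t * (1 - t)) * a.
    by rewrite /v tE /A /B; field.
  have -> : z x = ((v1 - v0) + 6 * (1 - 2 * t) * a) / r.
    by rewrite /z tE /A /B; field.
  have q0 : 0 <= t * (1 - t) by apply: mulr_ge0; lra.
  have q1 : t * (1 - t) <= 1 / 4 by have := sqr_ge0 (t - 1 / 2); lra.
  split.
    apply: le_trans (ler_normD _ _) _; apply: le_trans (lerD (ler_normD _ _) (lexx _)) _.
    rewrite (normrM (1 - t)) (normrM t) (normrM (6 * _)) (ger0_norm (_ : 0 <= 1 - t)); last lra.
    rewrite (ger0_norm (_ : 0 <= t)); last lra.
    rewrite (ger0_norm (_ : 0 <= 6 * (t * (1 - t)))); last lra.
    have e1 : (1 - t) * `|v0| <= `|v0| by rewrite ler_piMl//; lra.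
    have e2 : t * `|v1| <= `|v1| by rewrite ler_piMl//; lra.
    have e3 : 6 * (t * (1 - t)) * `|a| <= 3 / 2 * `|a| by rewrite ler_wpM2r//; lra.
    have := normr_ge0 D; have := normr_ge0 v0; have := normr_ge0 v1; lra.
  rewrite normrM normfV (gtr0_norm r0) ler_pM2r ?invr_gt0//.
  apply: le_trans (ler_normD _ _) _; apply: le_trans (lerD (ler_normB _ _) (lexx _)) _.
  rewrite !normrM (ger0_norm (_ : 0 <= 6)) //.
  have t1 : `|1 - 2 * t| <= 1 by rewrite ler_norml; lra.
  have e1 : 6 * `|1 - 2 * t| * `|a| <= 6 * `|a| by rewrite ler_wpM2r//; lra.
  have := normr_ge0 D; have := normr_ge0 v0; have := normr_ge0 v1; lra.
exists w, v, z; split => //.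
- by rewrite /w /v subrr !expr0n/= !mulr0 !addr0.
- by split; rewrite /w /v /A /B /a /D; field.
- move=> x px; have [h1 h2] := vb x px; split => //.
  have wp : w p = y0 by rewrite /w subrr !expr0n/= !mulr0 !addr0.
  rewrite -wp; have [_ _ _ _ P] := aarc; have px1 : p <= x by lra.
  have px2 : x <= p + r by lra.
  rewrite (P p x _ px1 px2).2//.
  apply: le_trans (@I_norm_bound _ p x v V (ig_continuous _ _ cv) px1 _) _.
    by move=> t pt; apply: (vb t _).1; lra.
  by have := normr_ge0 (v x); nra.
Qed.

Lemma E_bound a b w v z (Z V D : R) : a <= b -> h2arc a b w v z ->
  (forall x, a <= x <= b -> [/\ `|z x| <= Z, `|v x| <= V & `|w x - f x| <= D]) ->
  E a b w v z <= (h * Z ^+ 2 + G V + beta * D ^+ 2) * (b - a).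
Proof.
move=> ab A B; apply: I_bound => //; first exact: ig_dens.
move=> x xab; have [h1 h2 h3] := B x xab.
have sq (s t : R) : `|s| <= t -> s ^+ 2 <= t ^+ 2.
  by move=> st; rewrite -(real_normK (num_real s)) ler_sqr ?nnegrE//; apply: le_trans st.
rewrite /dens; apply: lerD; [apply: lerD|].
- by apply: ler_wpM2l => //; exact: sq.
- by apply: G_le; rewrite [leRHS]ger0_norm//; apply: le_trans h2.
- by apply: ler_wpM2l => //; exact: sq.
Qed.

Lemma arc_const a b (c : R) : h2arc a b (fun=> c) (fun=> 0) (fun=> 0).
Proof.
split; try exact: cst_continuous; first exact: measurable_cst.
  exact: (@ig_sqr_continuous _ _ _ (fun=> 0) (@cst_continuous _ _ _)).
by move=> x y _ xy _; rewrite !I_cst// mul0r !subrr.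
Qed.

Lemma arc_shift a b d w v z (k : R) : h2arc a b w v z ->
  h2arc (a + d) (b + d) (fun x => w (x - d) + k) (fun x => v (x - d)) (fun x => z (x - d)).
Proof.
move=> [cw cv mz iz P].
have cs : continuous (fun x : R => x - d).
  by move=> x; apply: cvgB; [exact: cvg_id|exact: cvg_cst].
have iz1 : ig a b z by exact: ig_sqr.
split.
- move=> x; apply: cvgD; last exact: cvg_cst.
  exact: (comp_continuous cw cs).
- exact: (comp_continuous cv cs).
- by apply: (@measurableT_comp _ _ _ _ _ _ z) => //; exact: measurable_continuous.
- apply: (@shift_integral R d a b (fun x => z x ^+ 2) _ _).1 => //.
  by apply: measurable_funX.
move=> x y ax xy yb.
have [h1 h2] := P (x - d) (y - d) (ltac:(lra)) (ltac:(lra)) (ltac:(lra)).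
have q g : measurable_fun [set: R] g -> ig a b g -> I (x - d) (y - d) g = I x y (fun x => g (x - d)).
  move=> mg igg; rewrite -(@shift_integral R d _ _ g mg _).2; first by rewrite !subrK.
  by apply: (ig_sub igg); lra.
split; first by rewrite h1 q.
rewrite (_ : _ - _ = w (y - d) - w (x - d)); last by ring.
by rewrite h2 q//; [exact: measurable_continuous|exact: ig_continuous].
Qed.

End energy.

(** * Scales *)

Section scales.
Context {R : realType}.
Variable e : R.
Hypotheses (e0 : 0 < e) (e1 : 625 * e <= 1).

Definition Lam := - ln e.
Definition om := omega e.
Definition hh := e ^+ 6 * om ^+ 4.
(** The width over which a jump of height of order om is spread: there the costs
    h om^2 / bb^3 and bb * Lam of the two gradient terms are both equal to om^3. *)
Definition bb := e ^+ 2 * om.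

Lemma Lam_ge1 : 1 <= Lam.
Proof.
have h5 : 1 - 5^-1 <= ln (5 : R) by exact: ln_lower.
have h6 : ln (5 ^+ 4 : R) <= ln e^-1.
  rewrite ler_ln ?posrE ?invr_gt0 ?exprn_gt0//.
  have -> : 5 ^+ 4 = 625 :> R by ring.
  by rewrite -[e^-1]mul1r ler_pdivlMr.
move: h6; rewrite lnV ?posrE// lnXn ?posrE// -[ln 5 *+ 4]mulr_natl /Lam => h6.
have h7 : 4 / 5 <= ln (5 : R) by apply: le_trans h5; lra.
lra.
Qed.

Lemma Lam_le : e * Lam <= 1.
Proof.
have h := @ln_lower R e e0; rewrite /Lam.
have h2 : e * (1 - e^-1) <= e * ln e by apply: ler_wpM2l => //; exact: ltW.
have h3 : e * (1 - e^-1) = e - 1 by rewrite mulrBr mulr1 divff ?gt_eqF.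
rewrite h3 in h2; rewrite mulrN; clear h h3.
have := e0; have := e1; lra.
Qed.

Lemma om_sqr : om ^+ 2 = e ^+ 2 * Lam.
Proof.
have L1 := Lam_ge1; rewrite /om /omega exprMn sqr_sqrtr ?normr_ge0//; congr (_ * _).
by rewrite ler0_norm//; move: L1; rewrite /Lam; lra.
Qed.

Lemma om_ge0 : 0 <= om.
Proof. by rewrite /om /omega mulr_ge0// ?sqrtr_ge0// ltW. Qed.

Lemma e_le_om : e <= om.
Proof.
rewrite -(@ler_pXn2r _ 2)// ?nnegrE ?om_ge0// ?(ltW e0)// om_sqr.
by rewrite ler_peMr ?sqr_ge0// Lam_ge1.
Qed.

Lemma om_gt0 : 0 < om. Proof. exact: lt_le_trans e_le_om. Qed.

Lemma om_sqr_le : om ^+ 2 <= e.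
Proof.
rewrite om_sqr expr2 -mulrA; have := Lam_le; have := e0 => h1 h2.
by rewrite ger_pMr.
Qed.

Lemma om_le : 25 * om <= 1.
Proof.
rewrite -(@ler_pXn2r _ 2)// ?nnegrE// ?mulr_ge0 ?om_ge0// ?(ltW e0)//.
by rewrite exprMn expr1n; have := om_sqr_le; have := e1; lra.
Qed.

Lemma bb_gt0 : 0 < bb. Proof. by rewrite /bb mulr_gt0// ?exprn_gt0// om_gt0. Qed.

Lemma hhE : hh = om * bb ^+ 3.
Proof. by rewrite /hh /bb; ring. Qed.

Lemma bbLam : bb * Lam = om ^+ 3.
Proof. have -> : om ^+ 3 = om ^+ 2 * om by ring.
by rewrite om_sqr /bb; ring. Qed.

Lemma hh_gt0 : 0 < hh. Proof. by rewrite hhE mulr_gt0// ?exprn_gt0// ?bb_gt0// om_gt0. Qed.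

Lemma bb_le : 25 * bb <= om.
Proof.
rewrite /bb mulrA ger_pMl ?om_gt0//.
have := e0; have := e1; nra.
Qed.

Lemma bb_ge : e ^+ 3 <= bb.
Proof. by rewrite /bb exprSr ler_wpM2l ?sqr_ge0// e_le_om. Qed.

Lemma hh_Lam : hh * Lam ^+ 3 = om ^+ 10.
Proof.
have -> : om ^+ 10 = (om ^+ 2) ^+ 3 * om ^+ 4 by ring.
by rewrite om_sqr /hh; ring.
Qed.

(** The logarithm of a fixed power of 1/e is a multiple of Lam, so the steep part of a
    connector costs no more than Lam per unit of length. *)
Lemma G_Lam V : 0 <= V -> V * e ^+ 5 <= 1 -> G V <= 11 * Lam.
Proof.
move=> V0 Ve; have e5 : 0 < e ^+ 11 by rewrite exprn_gt0.
have -> : 11 * Lam = ln (e ^- 11).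
  by rewrite lnV ?posrE// lnXn ?posrE// /Lam -[ln e *+ 11]mulr_natl; ring.
rewrite /G ler_ln ?posrE ?invr_gt0//; last by have := sqr_ge0 V; lra.
rewrite -[leRHS]mul1r ler_pdivlMr//.
have -> : (1 + V ^+ 2) * e ^+ 11 = e * (e ^+ 5) ^+ 2 + e * (V * e ^+ 5) ^+ 2 by ring.
have h1 : (V * e ^+ 5) ^+ 2 <= 1.
  by rewrite -(expr1n _ 2) ler_sqr ?nnegrE// mulr_ge0// exprn_ge0// ltW.
have h2 : (e ^+ 5) ^+ 2 <= 1.
  by rewrite -exprM exprn_ile1// ?(ltW e0)//; have := e1; lra.
have := ler_wpM2l (ltW e0) h1; have := ler_wpM2l (ltW e0) h2.
by have := e1; lra.
Qed.

End scales.

(** * The excess of a slope above 1 *)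

Section soft_excess.
Context {R : realType}.
Implicit Types (s t : R).

(** A C^1 substitute for max (0, t - 1), to which the chain rule applies; for t >= 1 it
    differs from t by less than 2. *)
Definition T t : R := if 1 <= t then (t - 1) ^+ 2 / t else 0.
Definition T' t : R := if 1 <= t then 1 - t ^- 2 else 0.

Lemma T_le1 t : t <= 1 -> T t = 0.
Proof.
rewrite /T; case: ifP => // h1 h2; have -> : t = 1 by apply/eqP; rewrite eq_le h1 h2.
by rewrite subrr expr0n mul0r.
Qed.

Lemma T'_le1 t : t <= 1 -> T' t = 0.
Proof.
rewrite /T'; case: ifP => // h1 h2; have -> : t = 1 by apply/eqP; rewrite eq_le h1 h2.
by rewrite expr1n invr1 subrr.
Qed.

Lemma T_ge1 t : 1 <= t -> T t = t - 2 + t^-1.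
Proof.
move=> t1; rewrite /T t1; field; rewrite gt_eqF//; lra.
Qed.

Lemma T'_ge1 t : 1 <= t -> T' t = 1 - t^-1 ^+ 2.
Proof. by move=> t1; rewrite /T' t1 exprVn. Qed.

Lemma inv_le1 t : 1 <= t -> 0 < t^-1 <= 1.
Proof. by move=> t1; rewrite invr_gt0 invf_le1 ?t1 ?andbT//; lra. Qed.

Lemma T'_bounds t : 0 <= T' t <= 1.
Proof.
have [t1|t1] := leP 1 t; last by rewrite T'_le1 ?lexx ?ler01// ltW.
rewrite T'_ge1//; have /andP[h1 h2] := inv_le1 t1; nra.
Qed.

Lemma T_bounds t : 0 <= T t <= `|t|.
Proof.
have [t1|t1] := leP 1 t; last by rewrite T_le1 ?lexx ?normr_ge0// ltW.
rewrite T_ge1//; have /andP[h1 h2] := inv_le1 t1.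
have t0 : 0 < t by lra.
have e1 : t * t^-1 = 1 by rewrite divff// gt_eqF.
rewrite gtr0_norm//; have := sqr_ge0 (t - 1) => h3.
have h4 : 0 <= (t - 1) ^+ 2 * t^-1 by apply: mulr_ge0 => //; lra.
have h5 : (t - 1) ^+ 2 * t^-1 = t * (t * t^-1) - 2 * (t * t^-1) + t^-1 by ring.
rewrite e1 in h5; lra.
Qed.

Lemma T_taylor s t : `|T t - T s - T' s * (t - s)| <= 2 * (t - s) ^+ 2.
Proof.
have key (x y : R) : 1 <= x -> 1 <= y ->
   T y - T x - T' x * (y - x) = (y - x) ^+ 2 * (x^-1 ^+ 2 * y^-1).
  move=> x1 y1; rewrite !T_ge1// T'_ge1//; field; rewrite !gt_eqF//; lra.
have [s1|s1] := leP 1 s; have [t1|t1] := leP 1 t.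
- rewrite key//; have /andP[h1 h2] := inv_le1 s1; have /andP[h3 h4] := inv_le1 t1.
  have h5 : 0 <= s^-1 ^+ 2 * t^-1 <= 1.
    rewrite mulr_ge0 ?sqr_ge0//=; last lra.
    by rewrite mulr_ile1 ?sqr_ge0 ?exprn_ile1//; lra.
  rewrite ger0_norm; last by apply: mulr_ge0; [exact: sqr_ge0|lra].
  by have := sqr_ge0 (t - s); nra.
- rewrite (T_le1 (ltW t1)).
  have k := @key s 1 s1 (lexx _); rewrite (@T_le1 1)// in k.
  have /andP[h1 h2] := inv_le1 s1; have := T'_bounds s => /andP[d0 d1].
  have q0 : 0 <= (1 - s) ^+ 2 * (s^-1 ^+ 2 * 1^-1).
    by rewrite invr1 mulr1 mulr_ge0// sqr_ge0.
  have q1 : (1 - s) ^+ 2 * (s^-1 ^+ 2 * 1^-1) <= (1 - s) ^+ 2.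
    by rewrite invr1 mulr1 ler_piMr ?sqr_ge0// exprn_ile1//; lra.
  have d2 : T' s <= 2 * (s - 1).
    have e1 : s * s^-1 = 1 by rewrite divff// gt_eqF//; lra.
    by rewrite T'_ge1//; nra.
  have d3 : T' s * (1 - t) <= 2 * (s - 1) * (1 - t) by apply: ler_wpM2r => //; lra.
  have d4 : 0 <= T' s * (1 - t) by apply: mulr_ge0 => //; lra.
  have sqq := sqr_ge0 (1 - s - (1 - t)); have sq2 := sqr_ge0 (1 - t).
  rewrite ler_norml; nra.
- rewrite (T_le1 (ltW s1)) (T'_le1 (ltW s1)) mul0r !subr0.
  have k := @key 1 t (lexx _) t1; rewrite (@T_le1 1)// (@T'_le1 1)// in k.
  have /andP[h1 h2] := inv_le1 t1.
  have q0 : 0 <= (t - 1) ^+ 2 * (1^-1 ^+ 2 * t^-1).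
    by rewrite invr1 expr1n mul1r mulr_ge0// ?sqr_ge0//; lra.
  have q1 : (t - 1) ^+ 2 * (1^-1 ^+ 2 * t^-1) <= (t - 1) ^+ 2.
    by rewrite invr1 expr1n mul1r ler_piMr ?sqr_ge0.
  rewrite ger0_norm; last lra.
  nra.
- rewrite (T_le1 (ltW t1)) (T_le1 (ltW s1)) (T'_le1 (ltW s1)) mul0r !subrr normr0.
  by have := sqr_ge0 (t - s); lra.
Qed.

Lemma T'_lipschitz s t : `|T' t - T' s| <= 2 * `|t - s|.
Proof.
wlog st : s t / s <= t.
  move=> H; have [|/ltW ts] := leP s t; first exact: H.
  by rewrite distrC [X in _ <= _ * X]distrC; exact: H.
have key (x y : R) : 1 <= x -> x <= y -> 0 <= T' y - T' x <= 2 * (y - x).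
  move=> x1 xy; have y1 : 1 <= y by lra.
  rewrite !T'_ge1//; have /andP[h1 h2] := inv_le1 x1; have /andP[h3 h4] := inv_le1 y1.
  have e1 : x^-1 - y^-1 = (y - x) * (x^-1 * y^-1) by field; rewrite !gt_eqF//; lra.
  have -> : 1 - y^-1 ^+ 2 - (1 - x^-1 ^+ 2) = (x^-1 - y^-1) * (x^-1 + y^-1) by ring.
  have q0 : 0 <= x^-1 * y^-1 <= 1 by rewrite mulr_ge0 ?mulr_ile1//; lra.
  have q1 : 0 <= (y - x) * (x^-1 * y^-1) <= y - x by nra.
  by rewrite e1; nra.
have -> : `|t - s| = t - s by rewrite ger0_norm//; lra.
have [s1|s1] := leP 1 s.
  have /andP[h1 h2] := key s t s1 st; rewrite ger0_norm//; lra.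
rewrite (T'_le1 (ltW s1)) subr0; have [t1|t1] := leP 1 t.
  have /andP[h1 h2] := key 1 t (lexx _) t1; rewrite (@T'_le1 1) ?subr0// in h1 h2.
  by rewrite ger0_norm//; lra.
by rewrite (T'_le1 (ltW t1)) normr0; lra.
Qed.

Lemma T'_continuous : continuous (T' : R -> R).
Proof. by apply: (@lipschitz_continuous_fun _ _ 2) => x y; exact: T'_lipschitz. Qed.

Lemma T_lipschitz s t : `|T t - T s| <= 1 * `|t - s|.
Proof.
rewrite mul1r; wlog st : s t / s <= t.
  move=> H; have [|/ltW ts] := leP s t; first exact: H.
  by rewrite distrC [leRHS]distrC; exact: H.
have key (x y : R) : 1 <= x -> x <= y -> 0 <= T y - T x <= y - x.
  move=> x1 xy; have y1 : 1 <= y by lra.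
  rewrite !T_ge1//; have /andP[h1 h2] := inv_le1 x1; have /andP[h3 h4] := inv_le1 y1.
  have e1 : x^-1 - y^-1 = (y - x) * (x^-1 * y^-1) by field; rewrite !gt_eqF//; lra.
  have q0 : 0 <= x^-1 * y^-1 <= 1 by rewrite mulr_ge0 ?mulr_ile1//; lra.
  have q1 : 0 <= (y - x) * (x^-1 * y^-1) <= y - x by nra.
  lra.
have -> : `|t - s| = t - s by rewrite ger0_norm//; lra.
have [s1|s1] := leP 1 s.
  have /andP[h1 h2] := key s t s1 st; rewrite ger0_norm//; lra.
rewrite (T_le1 (ltW s1)) subr0; have [t1|t1] := leP 1 t.
  have /andP[h1 h2] := key 1 t (lexx _) t1; rewrite (@T_le1 1) ?subr0// in h1 h2.
  by rewrite ger0_norm//; lra.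
by rewrite (T_le1 (ltW t1)) normr0; lra.
Qed.

Lemma T_continuous : continuous (T : R -> R).
Proof. by apply: (@lipschitz_continuous_fun _ _ 1) => x y; exact: T_lipschitz. Qed.

(** What the excess leaves over is some m with m^2 <= 5 G t; Young's inequality with weight k
    does the rest. *)
Lemma flat_part (k t : R) : 0 < k ->
  `|t| <= T t + T (- t) + (k + 5 * G t / k) / 2.
Proof.
move=> k0; wlog t0 : t / 0 <= t.
  move=> H; have [|/ltW t0] := leP 0 t; first exact: H.
  have := H (- t); rewrite oppr_ge0 normrN opprK => /(_ t0).
  rewrite /G sqrrN; lra.
have T2 : 0 <= T (- t) by have /andP[] := T_bounds (- t).
rewrite ger0_norm//; suff : exists2 m, t <= T t + m & m ^+ 2 <= 5 * G t.
  move=> [m tm mG]; apply: le_trans tm _; rewrite -addrA lerD2l.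
  have h1 : m ^+ 2 / k <= 5 * G t / k by rewrite ler_pM2r ?invr_gt0.
  have h2 : 0 <= (m - k) ^+ 2 / k by rewrite divr_ge0 ?sqr_ge0// ltW.
  have h3 : (m - k) ^+ 2 / k = m ^+ 2 / k - 2 * m + k by field; rewrite gt_eqF.
  lra.
have Gl := G_lower t; have s0 : 0 < 1 + t ^+ 2 by have := sqr_ge0 t; lra.
have [t2|t2] := leP t 2.
  exists t; first by have /andP[] := T_bounds t; lra.
  rewrite -ler_pdivrMl//; apply: le_trans Gl.
  rewrite mulrC; apply: ler_wpM2l; first exact: sqr_ge0.
  by rewrite lef_pV2 ?posrE//; nra.
exists 2.
  rewrite T_ge1; last lra.
  have t1 : 1 <= t by lra.
  by have /andP[h1 h2] := inv_le1 t1; lra.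
suff : 4 / 5 <= G t by lra.
by apply: le_trans Gl; rewrite ler_pdivlMr//; nra.
Qed.

(** The derivative 2 s / (1 + s^2) of G is at least 1 / t for s between t - T t >= 1 and t. *)
Lemma G_excess t : 1 <= t -> T t / t <= G t - G (t - T t).
Proof.
move=> t1; have t0 : 0 < t by lra.
have /andP[T0 Tt] := T_bounds t; rewrite gtr0_norm// in Tt.
apply: le_trans (G_diff _); last by rewrite !ger0_norm//; lra.
have s0 : 0 < 1 + t ^+ 2 by have := sqr_ge0 t; lra.
rewrite ler_pdivlMr// mulrAC ler_pdivrMr//.
have /andP[h1 h2] := inv_le1 t1; have e1 : t^-1 * t = 1 by rewrite mulVf ?gt_eqF.
have h3 : 0 <= T t * ((t - T t) * t - 1).
  apply: mulr_ge0 => //; rewrite T_ge1//.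
  have -> : (t - (t - 2 + t^-1)) * t - 1 = 2 * t - t^-1 * t - 1 by ring.
  by rewrite e1; lra.
nra.
Qed.

Lemma G_excess_ge0 t : 0 <= G t - G (t - T t).
Proof.
have /andP[T0 Tt] := T_bounds t.
have [t1|t1] := leP 1 t; last by rewrite T_le1 ?subr0 ?subrr// ltW.
apply: le_trans (G_excess t1); apply: divr_ge0 => //; lra.
Qed.

Lemma ln_le_half_sqrt (x : R) : 0 < x -> ln x <= 2 * (Num.sqrt x - 1).
Proof.
move=> x0; have s0 : 0 < Num.sqrt x by rewrite sqrtr_gt0.
have {1}-> : x = Num.sqrt x * Num.sqrt x by rewrite -expr2 sqr_sqrtr ?ltW.
have := @le_ln1Dx R (Num.sqrt x - 1); rewrite lnM ?posrE//.
have -> : 1 + (Num.sqrt x - 1) = Num.sqrt x by ring.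
have -> : - 1 < Num.sqrt x - 1 by lra.
by move=> /(_ isT); lra.
Qed.

Lemma ln_le_quarter (M : R) : 25 <= M -> 2 * ln 5 <= ln M.
Proof.
move=> M25; have -> : 2 * ln 5 = ln 25 :> R.
  have -> : 25 = 5 * 5 :> R by ring.
  by rewrite lnM ?posrE//; ring.
by rewrite ler_ln ?posrE//; lra.
Qed.

Lemma G_excess_large t : 2 <= t -> G t - ln 5 <= G t - G (t - T t).
Proof.
move=> t2; rewrite lerD2l lerN2; have -> : ln 5 = G 2 :> R by rewrite /G; congr ln; ring.
have /andP[h1 h2] := @inv_le1 t (ltac:(lra)).
by apply: G_le; rewrite T_ge1; [rewrite !ger0_norm//; lra|lra].
Qed.

(** For t up to the square root of M this is weaker than G_excess; beyond it the energy freed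
    is itself of order ln M. *)
Lemma G_excess_log (M t : R) : 25 <= M -> 1 <= t -> t <= M ->
  T t * ln M / (8 * M) <= G t - G (t - T t).
Proof.
move=> M25 t1 tM; have M0 : 0 < M by lra.
have t0 : 0 < t by lra.
have /andP[T0 Tt] := T_bounds t; rewrite gtr0_norm// in Tt.
have s0 : 0 < Num.sqrt M by rewrite sqrtr_gt0.
have sE : Num.sqrt M * Num.sqrt M = M by rewrite -expr2 sqr_sqrtr ?ltW.
have lnM0 : 0 <= ln M by rewrite ln_ge0; lra.
have [ts|ts] := leP t (Num.sqrt M).
  apply: le_trans (G_excess t1); rewrite -mulrA; apply: ler_wpM2l => //.
  rewrite ler_pdivrMr; last lra.
  rewrite mulrC ler_pdivlMr//.
  have h1 := ln_le_half_sqrt M0.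
  have h2 : ln M * t <= ln M * Num.sqrt M by apply: ler_wpM2l.
  have h3 : ln M * Num.sqrt M <= 2 * (Num.sqrt M - 1) * Num.sqrt M by apply: ler_wpM2r => //; exact: ltW.
  nra.
have s5 : 5 <= Num.sqrt M.
  by rewrite -(@ler_pXn2r _ 2)// ?nnegrE ?(ltW s0)// sqr_sqrtr ?(ltW M0)//; lra.
apply: le_trans (G_excess_large _); last lra.
have h1 : ln M <= G t.
  rewrite /G ler_ln ?posrE//; [|by have := sqr_ge0 t; lra].
  have : M <= t * t by rewrite -sE; apply: ler_pM => //; exact: ltW.
  by rewrite -expr2; lra.
have h2 := ln_le_quarter M25.
have h3 : T t * ln M / (8 * M) <= ln M / 8.
  rewrite ler_pdivrMr; last lra.
  have -> : ln M / 8 * (8 * M) = M * ln M by field.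
  by apply: ler_wpM2r => //; lra.
lra.
Qed.

End soft_excess.

(** * Upper bounds for the energy of minimizers *)

Section minimizers.
Context {R : realType}.
Variables (h beta : R) (f : R -> R).
Hypotheses (h0 : 0 <= h) (beta0 : 0 <= beta) (cf : continuous f).
Implicit Types (a b c d x y p q r : R) (g w v z : R -> R).
Local Notation EE := (E h beta f).

Definition minimal u v z := h2arc 0 1 u v z /\
  forall w v' z', h2arc 0 1 w v' z' -> EE 0 1 u v z <= EE 0 1 w v' z'.

(** Pasting the competitor into the minimizer needs equal values and slopes at interior end
    points only. *)
Lemma local_min u v z p q w v' z' : minimal u v z ->
  0 <= p -> p <= q -> q <= 1 -> h2arc p q w v' z' ->
  p = 0 \/ (w p = u p /\ v' p = v p) ->
  q = 1 \/ (w q = u q /\ v' q = v q) ->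
  EE p q u v z <= EE p q w v' z'.
Proof.
move=> [A M] p0 pq q1 B mp mq.
have [w1 [v1 [z1 [B1 e1 w1q v1q]]]] : exists w1 v1 z1, [/\ h2arc 0 q w1 v1 z1,
    EE 0 q w1 v1 z1 = EE 0 p u v z + EE p q w v' z', w1 q = w q & v1 q = v' q].
  case: mp => [p00|[wp vp]].
    exists w, v', z'; rewrite p00 in B *; split => //.
    by rewrite [EE 0 0 _ _ _]I_empty// add0r.
  have [|C1 C2] := arc_paste h beta cf p0 pq (arc_sub A (lexx 0) _) B (esym wp) (esym vp).
    by lra.
  exists (paste p u w), (paste p v v'), (paste p z z'); split => //.
    by rewrite pasteR'.
  by rewrite pasteR'.
have [w2 [v2 [z2 [B2 e2]]]] : exists w2 v2 z2, h2arc 0 1 w2 v2 z2 /\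
    EE 0 1 w2 v2 z2 = EE 0 p u v z + EE p q w v' z' + EE q 1 u v z.
  case: mq => [q11|[wq vq]].
    exists w1, v1, z1; rewrite q11 in B1 e1 *; split => //.
    by rewrite [EE 1 1 _ _ _]I_empty// addr0.
  have [||C1 C2] := @arc_paste _ h beta f cf 0 q 1 w1 v1 z1 u v z (le_trans p0 pq) q1 B1 (arc_sub A (le_trans p0 pq) (lexx 1)).
  - by rewrite w1q.
  - by rewrite v1q.
  by exists (paste q w1 u), (paste q v1 v), (paste q z1 z); split => //; rewrite C2 e1.
have := M _ _ _ B2; rewrite e2.
rewrite (E_split h beta cf A (le_trans p0 pq) q1).
rewrite (E_split h beta cf (arc_sub A (lexx 0) q1) p0 pq); lra.
Qed.

End minimizers.

Section energy_bounds.
Context {R : realType}.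
Variables (beta L : R) (f : R -> R) (e : R).
Hypotheses (beta0 : 0 < beta) (L0 : 0 <= L) (fL : forall x y, `|f y - f x| <= L * `|y - x|).
Hypotheses (e0 : 0 < e) (e1 : 625 * e <= 1) (eL : (6 + 2 * L) * e <= 1).
Implicit Types (a b c d x y p q r : R) (g w v z : R -> R).
Local Notation o := (om e).
Local Notation b := (bb e).
Local Notation h := (hh e).
Local Notation EE := (E h beta f).

Definition C1 := 700 + 12 * beta + 3 * beta * (4 + L) ^+ 2.
Definition C2 := 2 * C1 + 3 * C1 * L ^+ 2 + beta * L ^+ 2.

Let cf : continuous f. Proof. exact: lipschitz_continuous_fun fL. Qed.
Let o0 : 0 < o := om_gt0 e0 e1.
Let b0 : 0 < b := bb_gt0 e0 e1.
Let h0 : 0 <= h := ltW (hh_gt0 e0 e1).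
Let be0 : 0 <= beta := ltW beta0.

Ltac arith := clear - R beta L f e beta0 L0 fL e0 e1 eL cf o0 b0 h0 be0; lra.

Lemma C1_ge : 700 <= C1.
Proof.
have : 0 <= 3 * beta * (4 + L) ^+ 2 by rewrite mulr_ge0 ?sqr_ge0// mulr_ge0//.
by rewrite /C1; have := beta0; lra.
Qed.

Lemma C2_ge : 1400 <= C2.
Proof.
have h1 := C1_ge; have : 0 <= 3 * C1 * L ^+ 2 by rewrite mulr_ge0 ?sqr_ge0//; lra.
have : 0 <= beta * L ^+ 2 by rewrite mulr_ge0 ?sqr_ge0.
by rewrite /C2; lra.
Qed.

(** The choice of the transition length b balances the two gradient terms. *)
Lemma connector_energy (p y0 v0 y1 v1 j j0 : R) : `|v0| <= 1 -> `|v1| <= 1 ->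
  `|y1 - y0| <= j -> j <= 1 + L -> `|y0 - f p| <= j0 ->
  exists w v z, [/\ h2arc p (p + b) w v z, w p = y0 /\ v p = v0,
    w (p + b) = y1 /\ v (p + b) = v1 &
    EE p (p + b) w v z <= C1 * (o ^+ 3 + o * j ^+ 2 + o * j0 ^+ 2)].
Proof.
move=> hv0 hv1 hj jL hj0.
have j00 : 0 <= j by apply: le_trans hj.
have jj0 : 0 <= j0 by apply: le_trans hj0.
pose V := 4 + 2 * (j / b).
have jb0 : 0 <= j / b by rewrite divr_ge0// ltW.
have HV : 2 * (`|v0| + `|v1| + `|y1 - y0| / b) <= V.
  have : `|y1 - y0| / b <= j / b by rewrite ler_pM2r ?invr_gt0.
  by rewrite /V; lra.
have [w [v [z [A wp wq B]]]] := connector p b0 HV.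
exists w, v, z; split => //.
have bo : b <= o by have := bb_le e0 e1; have := b0; lra.
have Vb : V * b = 4 * b + 2 * j by rewrite /V mulrDl -!mulrA [_^-1 * b]mulVf ?gt_eqF// mulr1.
have GV : G V <= 11 * Lam e.
  apply: G_Lam => //; first by rewrite /V; lra.
  have : j / b * e ^+ 5 <= (1 + L) * e ^+ 2.
    rewrite mulrAC ler_pdivrMr//.
    have -> : (1 + L) * e ^+ 2 * b = (1 + L) * (e ^+ 2 * b) by ring.
    apply: ler_pM => //; first by rewrite exprn_ge0// ltW.
    have -> : e ^+ 5 = e ^+ 2 * e ^+ 3 by ring.
    by apply: ler_wpM2l; [exact: sqr_ge0|exact: bb_ge].
  have e2 : e ^+ 5 <= e by rewrite -[leRHS]expr1 ler_wiXn2l// ?(ltW e0)//; have := e1; lra.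
  have e3 : (1 + L) * e ^+ 2 <= (1 + L) * e.
    by apply: ler_wpM2l; [have := L0; lra|rewrite -[leRHS]expr1 ler_wiXn2l// ?(ltW e0)//; have := e1; lra].
  by rewrite /V; have := eL; lra.
pose D := (4 + L) * o + 2 * j + j0.
have := @E_bound R h beta f h0 be0 cf p (p + b) w v z (4 * V / b) V D.
have -> : p + b - p = b by ring.
have pb : p <= p + b by have := b0; lra.
move=> /(_ pb A) H; apply: le_trans (H _) _.
  move=> x px; have [h1 h2 h3] := B x px; split => //.
  have h4 : `|y0 - f x| <= j0 + L * o.
    have -> : y0 - f x = (y0 - f p) - (f x - f p) by ring.
    apply: le_trans (ler_normB _ _) _; apply: lerD => //.
    apply: le_trans (fL _ _) _; apply: ler_wpM2l => //.
    by rewrite ger0_norm; move: px bo; arith.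
  have -> : w x - f x = (w x - y0) + (y0 - f x) by ring.
  by apply: le_trans (ler_normD _ _) _; rewrite /D; lra.
have t1 : h * (4 * V / b) ^+ 2 * b = 16 * o * (V * b) ^+ 2.
  by rewrite hhE; field; rewrite gt_eqF.
have t2 : (V * b) ^+ 2 <= 32 * o ^+ 2 + 8 * j ^+ 2.
  have bsq : b ^+ 2 <= o ^+ 2 by rewrite ler_sqr ?nnegrE ?(ltW b0) ?(ltW o0).
  by rewrite Vb; have := sqr_ge0 (4 * b - 2 * j); lra.
have t3 : G V * b <= 11 * o ^+ 3.
  by rewrite -(bbLam e0 e1); have := ler_wpM2r (ltW b0) GV; lra.
have t4 : D ^+ 2 <= 3 * ((4 + L) ^+ 2 * o ^+ 2 + 4 * j ^+ 2 + j0 ^+ 2).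
  have := sqr_ge0 ((4 + L) * o - 2 * j); have := sqr_ge0 ((4 + L) * o - j0); have := sqr_ge0 (2 * j - j0).
  by rewrite /D; lra.
have t5 : beta * D ^+ 2 * b <= beta * (3 * ((4 + L) ^+ 2 * o ^+ 2 + 4 * j ^+ 2 + j0 ^+ 2)) * o.
  apply: ler_pM => //; [by rewrite mulr_ge0 ?sqr_ge0|exact: ltW|exact: ler_wpM2l].
rewrite 2!mulrDl t1.
have t6 := ler_wpM2l (_ : 0 <= 16 * o) t2.
have {}t6 := t6 (mulr_ge0 (ler0n R 16) (ltW o0)).
have j2 := sqr_ge0 j; have jj2 := sqr_ge0 j0.
have q1 : 0 <= beta * o * j ^+ 2 by rewrite !mulr_ge0// ltW.
have q2 : 0 <= beta * o * j0 ^+ 2 by rewrite !mulr_ge0// ltW.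
have q3 : 0 <= o * j ^+ 2 by rewrite !mulr_ge0// ltW.
have q4 : 0 <= o * j0 ^+ 2 by rewrite !mulr_ge0// ltW.
have q5 : 0 <= o ^+ 3 by rewrite exprn_ge0// ltW.
have q6 : 0 <= beta * (4 + L) ^+ 2 * (o * j ^+ 2) by rewrite mulr_ge0// mulr_ge0 ?sqr_ge0.
have q7 : 0 <= beta * (4 + L) ^+ 2 * (o * j0 ^+ 2) by rewrite mulr_ge0// mulr_ge0 ?sqr_ge0.
have q8 : 0 <= beta * o ^+ 3 by rewrite mulr_ge0.
by move: t3 t5 t6 q1 q2 q3 q4 q5 q6 q7 q8; rewrite /C1; arith.
Qed.

(** Jump to the constant value f p, stay there, and jump to the final data. *)
Lemma bridge (p q yp vp yq vq jp jq : R) : o <= q - p -> q - p <= 1 ->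
  `|vp| <= 1 -> `|vq| <= 1 -> `|yp - f p| <= jp -> `|yq - f q| <= jq ->
  jp <= 1 -> jq <= 1 ->
  exists w v z, [/\ h2arc p q w v z, w p = yp /\ v p = vp, w q = yq /\ v q = vq &
    EE p q w v z <= C2 * (o ^+ 3 + o * (jp ^+ 2 + jq ^+ 2) + (q - p) ^+ 3)].
Proof.
move=> lo l1 hvp hvq hjp hjq jp1 jq1; pose l := q - p.
have l0 : 0 <= l by rewrite /l; have := o0; lra.
have bo : 25 * b <= o by have := bb_le e0 e1.
have v00 : `|0 : R| <= 1 by rewrite normr0.
have jL : jp <= 1 + L by have := L0; lra.
have hj : `|f p - yp| <= jp by rewrite distrC.
have [w1 [v1 [z1 [A1 [w1p v1p] [w1q v1q] E1]]]] := connector_energy hvp v00 hj jL hjp.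
have fpx x : p <= x <= q -> `|f p - f x| <= L * l.
  move=> px; rewrite distrC; apply: le_trans (fL _ _) _; apply: ler_wpM2l => //.
  by rewrite ger0_norm /l; lra.
have hj2 : `|yq - f p| <= jq + L * l.
  have -> : yq - f p = (yq - f q) - (f p - f q) by ring.
  by apply: le_trans (ler_normB _ _) _; apply: lerD => //; apply: fpx; rewrite /l in l0; lra.
have jL2 : jq + L * l <= 1 + L.
  have : L * l <= L * 1 by apply: ler_wpM2l.
  lra.
have hj02 : `|f p - f (q - b)| <= L * l.
  by apply: fpx; rewrite /l in l0; have := b0; lra.
have [w3 [v3 [z3 [A3 [w3p v3p] [w3q v3q] E3]]]] := connector_energy v00 hvq hj2 jL2 hj02.
rewrite subrK in A3 w3q v3q E3.
have A2 := arc_const (p + b) (q - b) (f p).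
have E2 : EE (p + b) (q - b) (fun=> f p) (fun=> 0) (fun=> 0) <= beta * L ^+ 2 * l ^+ 3.
  have ab : p + b <= q - b by have := b0; lra.
  have := @E_bound R h beta f h0 be0 cf _ _ _ _ _ 0 0 (L * l) ab A2.
  rewrite expr0n/= mulr0 G0 !add0r => H; apply: le_trans (H _) _.
    move=> x xx; rewrite normr0; split => //; apply: fpx; move: xx b0; arith.
  have -> : beta * (L * l) ^+ 2 * (q - b - (p + b)) = beta * L ^+ 2 * l ^+ 2 * (l - 2 * b).
    by rewrite /l; ring.
  have -> : beta * L ^+ 2 * l ^+ 3 = beta * L ^+ 2 * l ^+ 2 * l by ring.
  apply: ler_wpM2l; last by have := b0; lra.
  by rewrite !mulr_ge0// ?sqr_ge0.
have ab1 : p <= p + b by have := b0; lra.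
have ab2 : p + b <= q - b by have := b0; lra.
have ab3 : q - b <= q by have := b0; lra.
have [B1 F1] := arc_paste h beta cf ab1 ab2 A1 A2 w1q v1q.
have mw : paste (p + b) w1 (fun=> f p) (q - b) = w3 (q - b) by rewrite pasteR'// w1q w3p.
have mv : paste (p + b) v1 (fun=> 0) (q - b) = v3 (q - b) by rewrite pasteR'// v1q v3p.
have [B2 F2] := arc_paste h beta cf (le_trans ab1 ab2) ab3 B1 A3 mw mv.
eexists; eexists; eexists; split; first exact: B2.
- have pq1 : p <= q - b by exact: le_trans ab1 ab2.
  by rewrite !pasteL.
- by rewrite !pasteR'.
rewrite F2 F1; apply: le_trans (lerD (lerD E1 E2) E3) _; rewrite -/l.
have q1 : (jq + L * l) ^+ 2 <= 2 * jq ^+ 2 + 2 * (L * l) ^+ 2.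
  by have := sqr_ge0 (jq - L * l); arith.
have q2 : o * (L * l) ^+ 2 <= L ^+ 2 * l ^+ 3.
  have -> : L ^+ 2 * l ^+ 3 = l * (L * l) ^+ 2 by ring.
  by apply: ler_wpM2r; [exact: sqr_ge0|].
have C11 : 0 <= C1 by have := C1_ge; arith.
have q3 : o * (jq + L * l) ^+ 2 <= o * (2 * jq ^+ 2 + 2 * (L * l) ^+ 2) by apply: ler_wpM2l => //; exact: ltW.
have r1 : o ^+ 3 + o * (jq + L * l) ^+ 2 + o * (L * l) ^+ 2 <= o ^+ 3 + 2 * o * jq ^+ 2 + 3 * (L ^+ 2 * l ^+ 3) by move: q2 q3; arith.
have r2 : C1 * (o ^+ 3 + o * (jq + L * l) ^+ 2 + o * (L * l) ^+ 2) <= C1 * (o ^+ 3 + 2 * o * jq ^+ 2 + 3 * (L ^+ 2 * l ^+ 3)).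
  by apply: ler_wpM2l.
have s1 : 0 <= o ^+ 3 by rewrite exprn_ge0// ltW.
have s2 : 0 <= o * jp ^+ 2 by rewrite mulr_ge0 ?sqr_ge0// ltW.
have s3 : 0 <= o * jq ^+ 2 by rewrite mulr_ge0 ?sqr_ge0// ltW.
have s4 : 0 <= l ^+ 3 by rewrite exprn_ge0.
have s5 : 0 <= C1 * L ^+ 2 by exact: mulr_ge0 C11 (sqr_ge0 L).
have s6 : 0 <= beta * L ^+ 2 by rewrite mulr_ge0 ?sqr_ge0.
have s7 := mulr_ge0 s5 s1; have s8 := mulr_ge0 s5 s2; have s9 := mulr_ge0 s5 s3.
have s10 := mulr_ge0 s6 s1; have s11 := mulr_ge0 s6 s2; have s12 := mulr_ge0 s6 s3.
have s13 : 0 <= C1 * l ^+ 3 by exact: mulr_ge0.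
by move: r2 s7 s8 s9 s10 s11 s12 s13; rewrite /C2; arith.
Qed.

(** Concatenate bridges between consecutive values of f; each costs a multiple of om^3. *)
Lemma staircase (n : nat) : (0 < n)%N -> o <= n%:R^-1 -> n%:R^-1 <= 2 * o ->
  forall k : nat, (k <= n)%N -> exists w v z,
    [/\ h2arc 0 (k%:R / n%:R) w v z, w (k%:R / n%:R) = f (k%:R / n%:R) /\ v (k%:R / n%:R) = 0 &
    EE 0 (k%:R / n%:R) w v z <= k%:R * (9 * C2 * o ^+ 3)].
Proof.
move=> n0 on no; have nR : (0 : R) < n%:R by rewrite ltr0n.
elim=> [_|k IH kn].
  exists (fun=> f 0), (fun=> 0), (fun=> 0); rewrite mul0r; split => //; first exact: arc_const.
  by rewrite [EE _ _ _ _ _]I_empty// mul0r.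
have [w [v [z [A [wk vk] Ek]]]] := IH (ltnW kn).
set p := k%:R / n%:R in A wk vk Ek *; set q := k.+1%:R / n%:R.
have qp : q - p = n%:R^-1 by rewrite /q /p -natr1; field; rewrite gt_eqF.
have v00 : `|0 : R| <= 1 by rewrite normr0.
have z0 y : `|f y - f y| <= 0 by rewrite subrr normr0.
have n1 : n%:R^-1 <= 1 :> R by rewrite invf_le1// ler1n.
have [||w1 [v1 [z1 [A1 [w1p v1p] [w1q v1q] E1]]]] := @bridge p q (f p) 0 (f q) 0 0 0 _ _ v00 v00 (z0 p) (z0 q) ler01 ler01.
- by rewrite qp.
- by rewrite qp.
have p0 : 0 <= p by rewrite /p divr_ge0.
have pq : p <= q by have := o0; lra.
have [B1 F1] := arc_paste h beta cf p0 pq A A1 (etrans wk (esym w1p)) (etrans vk (esym v1p)).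
eexists; eexists; eexists; split; first exact: B1.
  by rewrite !pasteR'// ?wk ?w1p ?vk ?v1p.
rewrite F1 -natr1 mulrDl mul1r; apply: lerD => //; apply: le_trans E1 _.
rewrite expr0n/= addr0 mulr0 addr0 qp.
have : n%:R^-1 ^+ 3 <= (2 * o) ^+ 3 by rewrite lerXn2r// ?nnegrE ?invr_ge0// mulr_ge0// ltW.
by have := C2_ge; have := o0; nra.
Qed.

Variables (u v z : R -> R).
Hypothesis minu : minimal h beta f u v z.

(** A staircase with about 1 / om steps. *)
Lemma total_energy : EE 0 1 u v z <= 9 * C2 * o ^+ 2.
Proof.
pose n := Num.trunc o^-1.
have o1 : 25 * o <= 1 := om_le e0 e1.
have i0 : 0 < o^-1 by rewrite invr_gt0.
have oi : o^-1 * o = 1 by rewrite mulVf// gt_eqF.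
have i25 : 25 <= o^-1 by rewrite -(ler_pM2r o0) oi.
have /andP[n1 n2] := truncn_itv (ltW i0); rewrite -/n in n1 n2.
have n0 : (0 < n)%N.
  by rewrite lt0n; apply/eqP => n00; move: n2; rewrite n00; lra.
have nR : (0 : R) < n%:R by rewrite ltr0n.
have n3 : o <= n%:R^-1 by rewrite -(invrK o) lef_pV2 ?posrE.
have n4 : n%:R^-1 <= 2 * o.
  rewrite -[n%:R^-1]mul1r ler_pdivrMr//.
  have : (o^-1 - 1) * o <= n%:R * o by apply: ler_wpM2r; [exact: ltW|rewrite -natr1 in n2; lra].
  by rewrite mulrBl oi; lra.
have [w [v' [z' [A _ Ew]]]] := staircase n0 n3 n4 (leqnn n).
rewrite divff ?gt_eqF// in A Ew.
apply: le_trans (minu.2 _ _ _ A) _; apply: le_trans Ew _.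
have -> : n%:R * (9 * C2 * o ^+ 3) = 9 * C2 * o ^+ 2 * (n%:R * o) by ring.
have n5 : n%:R * o <= 1 by rewrite -[leRHS]oi ler_wpM2r// ltW.
rewrite ler_piMr// mulr_ge0 ?sqr_ge0// mulr_ge0//.
by have := C2_ge; lra.
Qed.

(** Otherwise 2 G (v x) + (u x - f x)^2 / A0 >= 1 on the whole interval. *)
Lemma good_point a c (A0 : R) : 0 <= a -> a < c -> c <= 1 -> 0 < A0 ->
  2 * I a c (fun x => G (v x)) + I a c (fun x => (u x - f x) ^+ 2) / A0 < c - a ->
  exists x, [/\ a <= x <= c, `|v x| <= 1 & (u x - f x) ^+ 2 <= A0].
Proof.
move=> a0 ac c1 A00 H; apply: contrapT => H2.
have [[cu cv mz iz P] _] := minu.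
have i1 : ig a c (fun x => G (v x)).
  by apply: ig_continuous; exact: (comp_continuous (@G_continuous R) cv).
have i2 : ig a c (fun x => (u x - f x) ^+ 2).
  by apply: ig_sqr_continuous => x; apply: cvgB; [exact: cu|exact: cf].
have : 1 * (c - a) <= I a c (fun x => 2 * G (v x) + A0^-1 * (u x - f x) ^+ 2).
  apply: I_lower; [by apply: ig_add; exact: ig_scale|exact: ltW|].
  move=> x xac; have [v1|v1] := leP `|v x| 1.
    have [fx|fx] := leP ((u x - f x) ^+ 2) A0; first by exfalso; apply: H2; exists x.
    have : 1 <= A0^-1 * (u x - f x) ^+ 2 by rewrite mulrC ler_pdivlMr// mul1r ltW.
    by have := G_ge0 (v x); lra.
  have := G_large (ltW v1).
  have : 0 <= A0^-1 * (u x - f x) ^+ 2 by rewrite mulr_ge0 ?sqr_ge0// invr_ge0 ltW.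
  lra.
rewrite I_add ?I_scale//; try exact: ig_scale.
by rewrite mulrC in H; lra.
Qed.

(** In units of om, the length of the windows in the hole-filling argument; it makes the fidelity
    term strong enough for the factor 1/2 there. *)
Definition KW := 1 + 16 * C2 / beta.
Definition CW := 2 * C2 * (3 + 27 * KW ^+ 3).

Lemma KW_ge1 : 1 <= KW.
Proof. by rewrite /KW lerDl divr_ge0//; have := C2_ge; lra. Qed.

Lemma CW_gt0 : 0 < CW.
Proof. have k1 := KW_ge1; have c2 := C2_ge.
have k3 : 0 <= KW ^+ 3 by rewrite exprn_ge0//; lra.
by rewrite /CW mulr_gt0//; lra. Qed.

Definition CE := 9 * C2.

Hypothesis oK : KW * o <= 1.
Hypothesis oE : 8 * CE * o <= 1.
Hypothesis oE2 : 16 * CE * o <= beta.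

Ltac arith' := clear - R beta L f e beta0 L0 fL e0 e1 eL cf o0 b0 h0 be0 u v z minu oK oE oE2; lra.

(** Hole filling: a window of length KW om is compared with a bridge between good points
    of the two neighbouring windows, whose quality depends on the energy of these windows. The
    supremum of all window energies thereby bounds itself with a factor 1/2. *)
Lemma window_energy p q : 0 <= p -> p <= q -> q <= 1 -> q - p <= KW * o ->
  EE p q u v z <= CW * o ^+ 3.
Proof.
have o0' := o0; have K1 := KW_ge1; have c2 := C2_ge.
pose l := KW * o; have l0 : 0 < l by rewrite /l mulr_gt0//; lra.
have lo : o <= l by rewrite /l; nra.
have [A M] := minu.
have Etot := total_energy; rewrite -/CE in Etot.
have Emono a c : 0 <= a -> a <= c -> c <= 1 -> EE a c u v z <= CE * o ^+ 2.
  by move=> a0 ac c1; apply: le_trans Etot; apply: E_mono.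
pose S := [set EE p (p + l) u v z | p in [set p | 0 <= p <= 1 - l]].
have l1 : l <= 1 by exact: oK.
have S0 : S !=set0 by exists (EE 0 (0 + l) u v z); exists 0 => //=; lra.
have Sub : has_ubound S.
  by exists (CE * o ^+ 2) => _ [x /= xx <-]; apply: Emono; lra.
have supS : forall x, 0 <= x -> x <= 1 - l -> EE x (x + l) u v z <= sup S.
  by move=> x x0 xl; apply: sup_upper_bound => //; exists x => //=; lra.
set B := sup S in supS.
have B0 : 0 <= B by apply: le_trans (supS 0 (lexx 0) _); [exact: E_ge0|lra].
have Bt : B <= CE * o ^+ 2.
  by apply: sup_le_ub => // _ [x /= xx <-]; apply: Emono; move: xx l0; arith'.
pose A0 := 4 * B / (l * beta) + o ^+ 2.
have lb : 0 < l * beta by rewrite mulr_gt0.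
have A00 : 0 < A0 by rewrite /A0 ltr_wpDl ?exprn_gt0// divr_ge0 ?(ltW lb)// mulr_ge0.
have A01 : A0 <= 1.
  have : 4 * B / (l * beta) <= 1 / 4.
    rewrite ler_pdivrMr//.
    have t1 : o * (16 * CE * o) <= o * beta by rewrite ler_pM2l.
    have t2 : o * beta <= l * beta by rewrite ler_pM2r.
    lra.
  have : 25 * o <= 1 := om_le e0 e1; rewrite /A0; nra.
have good a : 0 <= a -> a <= 1 - l -> exists x, [/\ a <= x <= a + l, `|v x| <= 1 & (u x - f x) ^+ 2 <= A0].
  move=> a0 al; apply: good_point => //; [lra|lra|].
  have Aa : h2arc a (a + l) u v z by apply: (arc_sub A) => //; lra.
  have g1 := le_trans (I_G_le_E h0 be0 cf Aa) (Emono a (a + l) a0 (ltac:(lra)) (ltac:(lra))).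
  have g2 := le_trans (I_fid_le_E beta h0 cf Aa) (supS a a0 al).
  have g3 : I a (a + l) (fun x => (u x - f x) ^+ 2) / A0 <= l / 4.
    rewrite ler_pdivrMr//.
    have g4 : I a (a + l) (fun x => (u x - f x) ^+ 2) <= B / beta by rewrite ler_pdivlMr// mulrC.
    apply: le_trans g4 _; have -> : B / beta = l / 4 * (4 * B / (l * beta)) by field; rewrite !gt_eqF.
    apply: ler_wpM2l; first lra.
    by rewrite /A0 lerDl sqr_ge0.
  have g5 : CE * o ^+ 2 <= o / 8 by have := oE; nra.
  lra.
have step x : 0 <= x -> x <= 1 - l -> EE x (x + l) u v z <= C2 * (3 + 27 * KW ^+ 3) * o ^+ 3 + B / 2.
  move=> x0 xl.
  have [p' [yp [vp [[px pl] pl' hv hj mp]]]] : exists p' yp vp, [/\ p' <= x /\ 0 <= p', x - l <= p', `|vp| <= 1,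
       `|yp - f p'| <= Num.sqrt A0 & p' = 0 \/ (yp = u p' /\ vp = v p')].
    have [xl'|xl'] := ltP x l.
      exists 0, (f 0), 0; split; [by split|by move: xl'; arith'|by rewrite normr0|by rewrite subrr normr0 sqrtr_ge0|by left].
    have [||y [yy vy fy]] := good (x - l); [by move: xl'; arith'|by move: xl l0; arith'|].
    exists y, (u y), (v y); split; [by split; move: yy xl'; arith'|by move: yy; arith'|by []| |by right].
    by rewrite -sqrtr_sqr ler_wsqrtr.
  have [q' [yq [vq [[qx ql] ql' hvq hjq mq]]]] : exists q' yq vq, [/\ x + l <= q' /\ q' <= 1, q' <= x + l + l, `|vq| <= 1,
       `|yq - f q'| <= Num.sqrt A0 & q' = 1 \/ (yq = u q' /\ vq = v q')].
    have [xl'|xl'] := ltP (1 - l) (x + l).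
      exists 1, (f 1), 0; split; [by split => //; move: xl; arith'|by move: xl'; arith'|by rewrite normr0|by rewrite subrr normr0 sqrtr_ge0|by left].
    have [||y [yy vy fy]] := good (x + l); [by move: x0 l0; arith'|by move: xl'; arith'|].
    exists y, (u y), (v y); split; [by split; move: yy xl'; arith'|by move: yy; arith'|by []| |by right].
    by rewrite -sqrtr_sqr ler_wsqrtr.
  have s1 : Num.sqrt A0 <= 1 by rewrite -[leRHS]sqrtr1 ler_wsqrtr.
  have [||w [v1 [z1 [W [wp wvp] [wq wvq] Ew]]]] := @bridge p' q' yp vp yq vq _ _ _ _ hv hvq hj hjq s1 s1; [move: lo l0 px qx; arith'|move: pl ql; arith'|].
  have Em : EE p' q' u v z <= EE p' q' w v1 z1.
    have pq' : p' <= q' by move: px qx l0; arith'.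
    apply: (local_min cf minu pl pq' ql W).
      by case: mp => [->|[<- <-]]; [left|right].
    by case: mq => [->|[<- <-]]; [left|right].
  apply: le_trans (le_trans (E_mono h0 be0 cf (arc_sub A pl ql) px _ qx) (le_trans Em Ew)) _; first by move: l0; arith'.
  rewrite sqr_sqrtr ?(ltW A00)//.
  have t1 : (q' - p') ^+ 3 <= 27 * KW ^+ 3 * o ^+ 3.
    have -> : 27 * KW ^+ 3 * o ^+ 3 = (3 * l) ^+ 3 by rewrite /l; ring.
    by rewrite lerXn2r ?nnegrE//; move: px pl' qx ql' l0; arith'.
  have t2 : C2 * (o * (2 * (4 * B / (l * beta)))) <= B / 2.
    have -> : C2 * (o * (2 * (4 * B / (l * beta)))) = B * (8 * C2 * o / (l * beta)).
      by field; rewrite !gt_eqF.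
    rewrite ler_wpM2l// ler_pdivrMr//.
    have -> : 2^-1 * (l * beta) = o * (KW * beta / 2) by rewrite /l; field.
    rewrite [leLHS]mulrC ler_pM2l//.
    have -> : KW * beta = beta + 16 * C2 by rewrite /KW; field; rewrite gt_eqF.
    by have := beta0; arith'.
  have t3 : C2 * (o ^+ 3 + o * (A0 + A0) + (q' - p') ^+ 3) <= C2 * (o ^+ 3 + o * (A0 + A0) + 27 * KW ^+ 3 * o ^+ 3).
    by apply: ler_wpM2l; [move: c2; arith'|move: t1; arith'].
  apply: le_trans t3 _; rewrite /A0; move: t2; set Q := 4 * B / _ => t2.
  by move: t2; arith'.
have Bfin : B <= CW * o ^+ 3.
  have : B <= C2 * (3 + 27 * KW ^+ 3) * o ^+ 3 + B / 2.
    by apply: sup_le_ub => // _ [x /= xx <-]; apply: step; move: xx; arith'.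
  by rewrite /CW; lra.
move=> p0 pq q1 qp.
apply: le_trans _ Bfin; pose x := Num.min p (1 - l).
have x1 : 0 <= x by rewrite /x le_min p0; lra.
have x2 : x <= 1 - l by rewrite /x ge_min lexx orbT.
have x3 : x <= p by rewrite /x ge_min lexx.
have x4 : q <= x + l by rewrite /x; case: (leP p (1 - l)) => _; [move: qp; rewrite -/l; arith'|move: q1; arith'].
apply: le_trans (supS x x1 x2).
by apply: (E_mono h0 be0 cf) => //; apply: (arc_sub A) => //; move: x2; arith'.
Qed.

End energy_bounds.

(** * The cost of steep slopes *)

Section cost_of_excess.
Context {R : realType}.
Variable e : R.
Hypotheses (e0 : 0 < e) (e1 : 625 * e <= 1).
Implicit Types (a b c x y : R) (u v z : R -> R).
Local Notation o := (om e).
Local Notation h := (hh e).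

(** Energy density that is freed when the positive excess is removed. *)
Definition sav v z x : R :=
  h * z x ^+ 2 * (1 - (1 - T' (v x)) ^+ 2) + (G (v x) - G (v x - T (v x))).

Let h0 : 0 < h := hh_gt0 e0 e1.

Ltac arith := clear - R e e0 e1 h0; lra.

Lemma T'_sqr_bounds (t : R) : 0 <= 1 - (1 - T' t) ^+ 2 <= 1.
Proof. by have /andP[h1 h2] := T'_bounds t; apply/andP; split; nra. Qed.

Let slope_part_ge0 v z x : 0 <= h * z x ^+ 2 * (1 - (1 - T' (v x)) ^+ 2).
Proof.
have /andP[h1 h2] := T'_sqr_bounds (v x).
by apply: mulr_ge0 => //; apply: mulr_ge0; [exact: ltW|exact: sqr_ge0].
Qed.

Lemma sav_ge0 v z x : 0 <= sav v z x.
Proof. by apply: addr_ge0; [exact: slope_part_ge0|exact: G_excess_ge0]. Qed.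

Lemma ig_sav a b u v z : h2arc a b u v z -> ig a b (sav v z).
Proof.
move=> [cu cv mz iz _].
have cT := comp_continuous (@T_continuous R) cv; have cT' := comp_continuous (@T'_continuous R) cv.
apply: ig_add.
  apply: (@ig_eq _ _ _ (fun x => (1 - (1 - T' (v x)) ^+ 2) * (h * z x ^+ 2))).
    by move=> x _; rewrite mulrC.
  apply: ig_mul_continuous; last exact: ig_scale.
  move=> x; apply: cvgB; first exact: cvg_cst.
  apply: (@sqr_continuous _ (fun x => 1 - T' (v x))) => y.
  by apply: cvgB; [exact: cvg_cst|exact: cT'].
apply: ig_continuous => x; apply: cvgB; first exact: (comp_continuous (@G_continuous R) cv).
have cD : continuous (fun y => v y - T (v y)).
  by move=> y; apply: cvgB; [exact: cv|exact: cT].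
exact: (comp_continuous (@G_continuous R) cD).
Qed.

Lemma sav_ge v z x (M : R) : v x <= M -> 1 <= M -> T (v x) / M <= sav v z x.
Proof.
move=> vM M1; have [v1|v1] := leP 1 (v x); last first.
  by rewrite (T_le1 (ltW v1)) mul0r; exact: sav_ge0.
have /andP[h1 h2] := T'_sqr_bounds (v x); have /andP[T0 _] := T_bounds (v x).
apply: (@le_trans _ _ (T (v x) / v x)).
  by rewrite ler_wpM2l// lef_pV2 ?posrE//; lra.
by apply: le_trans (G_excess v1) _; rewrite /sav lerDr.
Qed.

Lemma sav_ge_log v z x (M : R) : 25 <= M -> v x <= M ->
  ln M / (8 * M) * T (v x) <= sav v z x.
Proof.
move=> M25 vM; have [v1|v1] := leP 1 (v x); last first.
  by rewrite (T_le1 (ltW v1)) mulr0; exact: sav_ge0.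
have /andP[h1 h2] := T'_sqr_bounds (v x).
apply: (@le_trans _ _ (G (v x) - G (v x - T (v x)))).
  by apply: le_trans (G_excess_log M25 v1 vM); rewrite mulrC mulrA.
by rewrite /sav lerDr.
Qed.

(** By Young's inequality: where v is at least M / 2, a unit of length frees a multiple of
    ln M and the second derivative frees h z^2. *)
Lemma sav_ge_slope v z x (M m : R) : 25 <= M -> 0 < m -> m ^+ 2 * h * ln M = 2 ->
  M / 2 <= v x -> `|z x| <= m * sav v z x.
Proof.
move=> M25 m0 mE Mv.
have v2 : 2 <= v x by lra.
have t1 : 15 / 16 * (h * z x ^+ 2) <= h * z x ^+ 2 * (1 - (1 - T' (v x)) ^+ 2).
  rewrite mulrC ler_wpM2l//; first by rewrite mulr_ge0 ?sqr_ge0// ltW.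
  rewrite T'_ge1; last lra.
  have v1 : 1 <= v x by lra.
  have /andP[q1 q2] := inv_le1 v1.
  have q3 : (v x)^-1 <= 2^-1 by rewrite lef_pV2 ?posrE//; lra.
  have q4 : (v x)^-1 ^+ 2 <= 4^-1 by nra.
  have -> : 1 - (1 - (v x)^-1 ^+ 2) = (v x)^-1 ^+ 2 by ring.
  by have := sqr_ge0 (v x)^-1; nra.
have l0 := ln_le_quarter M25.
have t2 : ln M / 4 <= G (v x) - G (v x - T (v x)).
  apply: le_trans (G_excess_large v2).
  have : ln M <= G (v x).
    rewrite /G ler_ln ?posrE; [nra|lra|by have := sqr_ge0 (v x); lra].
  have : 0 <= ln (5 : R) by apply: ln_ge0; lra.
  lra.
have t3 : m * (15 / 16 * (h * z x ^+ 2) + ln M / 4) <= m * sav v z x.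
  by apply: ler_wpM2l; [exact: ltW|rewrite /sav lerD].
apply: le_trans t3; rewrite -subr_ge0.
have mh : 0 < m * h by rewrite mulr_gt0.
rewrite -(pmulr_rge0 _ mh) -[z x ^+ 2]real_normK ?num_real//.
set y := `|z x|.
have -> : m * h * (m * (15 / 16 * (h * y ^+ 2) + ln M / 4) - y) =
  15 / 16 * (m * h * y) ^+ 2 - (m * h * y) + (m ^+ 2 * h * ln M) / 4 by field.
by rewrite mE; have := sqr_ge0 (m * h * y - 8 / 15); lra.
Qed.

(** Let M be the maximum of v. If M^2 e <= 1, removing the excess frees at least J / M,
    which suffices. Otherwise it frees at least a multiple of J ln M / M by length; and since v has to
    climb beyond M / 2, also a multiple of (h ln M)^(1/2) M. The product of these two bounds
    is at least of order J om^5, because Lam <= 2 ln M and h Lam^3 = om^10. *)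
Lemma excess_cost a b u v z : h2arc a b u v z -> a <= b ->
  (exists2 c, a <= c <= b & v c <= 1) -> o ^+ 3 <= I a b (T \o v) ->
  o ^+ 5 * I a b (T \o v) <= 128 * I a b (sav v z) ^+ 2.
Proof.
move=> A ab [c cab vc]; have [cu cv mz iz P] := A.
have cT := comp_continuous (@T_continuous R) cv.
have igT : ig a b (T \o v) by exact: ig_continuous.
have igS := ig_sav A.
set J := I a b (T \o v); set S := I a b (sav v z) => Jo.
have o0 := om_gt0 e0 e1.
have J0 : 0 < J by apply: lt_le_trans Jo; rewrite exprn_gt0.
have S0 : 0 <= S by apply: I_ge0 => x _; exact: sav_ge0.
have [x1 x1ab x1P] := EVT_max ab (continuous_subspaceT cv).
rewrite in_itv/= in x1ab; set M := v x1 in x1P.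
have vM x : a <= x <= b -> v x <= M by move=> xab; apply: x1P; rewrite in_itv.
have M1 : 1 < M.
  rewrite ltNge; apply/negP => M1; move: J0; rewrite /J.
  rewrite (@I_eq _ a b _ (fun=> 0)) ?I_cst ?mul0r ?ltxx//.
  by move=> x /vM vx; rewrite /= T_le1//; exact: le_trans M1.
have M0 : 0 < M by move: M1; arith.
have M4 : 0 <= M / 4 by move: M0; arith.
have /andP[ac cb] := cab; have /andP[ax xb] := x1ab.
have [Me|Me] := leP (M ^+ 2 * e) 1.
  have SJ : J <= M * S.
    rewrite -ler_pdivrMl// -I_scale//; apply: I_le => //; first exact: ig_scale.
    by move=> x /vM vx; rewrite mulrC; apply: sav_ge => //; lra.
  have SJ2 : J ^+ 2 <= M ^+ 2 * S ^+ 2.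
    by rewrite -exprMn ler_sqr ?nnegrE ?mulr_ge0// ltW.
  have t1 : e * J ^+ 2 <= S ^+ 2.
    apply: (@le_trans _ _ (M ^+ 2 * e * S ^+ 2)).
      have -> : M ^+ 2 * e * S ^+ 2 = e * (M ^+ 2 * S ^+ 2) by ring.
      by apply: ler_wpM2l => //; exact: ltW.
    by rewrite ler_piMl ?sqr_ge0.
  have t2 : o ^+ 5 * J <= e * J ^+ 2.
    have -> : o ^+ 5 * J = o ^+ 2 * (o ^+ 3 * J) by ring.
    rewrite expr2; apply: ler_pM => //; [exact: sqr_ge0|by rewrite mulr_ge0 ?exprn_ge0// ltW|exact: om_sqr_le|].
    by apply: ler_wpM2r => //; exact: ltW.
  by have := sqr_ge0 S; lra.
have M25 : 25 <= M.
  rewrite -(@ler_pXn2r _ 2) ?nnegrE ?(ltW M0)//.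
  have -> : 25 ^+ 2 = 625 :> R by ring.
  by rewrite -(ler_pM2r e0); apply: le_trans e1 _; exact: ltW.
have lnM : Lam e <= 2 * ln M.
  have : 0 <= ln (M ^+ 2 * e) by rewrite ln_ge0// ltW.
  rewrite lnM ?posrE ?exprn_gt0// lnXn ?posrE// /Lam mulr2n; lra.
have L1 := Lam_ge1 e0 e1; clear Me Jo.
have l0 : 0 < ln M by lra.
have SJ : J * ln M <= 8 * M * S.
  have : ln M / (8 * M) * J <= S.
    rewrite -I_scale//; apply: I_le => //; first exact: ig_scale.
    by move=> x /vM vx; exact: sav_ge_log.
  rewrite mulrAC ler_pdivrMr; last lra.
  by rewrite mulrC [S * _]mulrC.
pose m := Num.sqrt (2 / (h * ln M)).
have hl : 0 < h * ln M by rewrite mulr_gt0.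
have m0 : 0 < m by rewrite sqrtr_gt0 divr_gt0.
have mE : m ^+ 2 * h * ln M = 2.
  by rewrite sqr_sqrtr ?divr_ge0 ?(ltW hl)// -mulrA divfK// gt_eqF.
(* the rescaled excess above M/2 climbs from 0 to M/4 *)
have MS : M / 4 <= m * S.
  pose Ph t : R := M / 2 * T (2 / M * t); pose Ph' t : R := T' (2 / M * t).
  have cl : continuous (fun t : R => 2 / M * t).
    by move=> t; apply: cvgM; [exact: cvg_cst|exact: cvg_id].
  have cPh : continuous Ph.
    move=> t; apply: cvgM; first exact: cvg_cst.
    exact: (comp_continuous (@T_continuous R) cl).
  have cPh' : continuous Ph' by exact: (comp_continuous (@T'_continuous R) cl).
  have C0 : 0 <= 4 / M by rewrite divr_ge0// ltW.
  have D1 s t : `|Ph t - Ph s - Ph' s * (t - s)| <= 4 / M * (t - s) ^+ 2.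
    have -> : Ph t - Ph s - Ph' s * (t - s) = M / 2 * (T (2 / M * t) - T (2 / M * s) - T' (2 / M * s) * (2 / M * t - 2 / M * s)).
      by rewrite /Ph /Ph'; field; rewrite gt_eqF.
    rewrite normrM (ger0_norm (_ : 0 <= M / 2)); last lra.
    have := ler_wpM2l (_ : 0 <= M / 2) (T_taylor (2 / M * s) (2 / M * t)).
    move=> /(_ (ltac:(lra))) H; apply: le_trans H _.
    by rewrite le_eqVlt; apply/orP; left; apply/eqP; field; rewrite gt_eqF.
  have D2 s t : `|Ph' t - Ph' s| <= 4 / M * `|t - s|.
    apply: le_trans (T'_lipschitz _ _) _.
    rewrite -mulrBr normrM (ger0_norm (_ : 0 <= 2 / M)) ?divr_ge0 ?(ltW M0)//.
    by rewrite le_eqVlt; apply/orP; left; apply/eqP; field; rewrite gt_eqF.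
  have PhM : Ph (v x1) = M / 4.
    rewrite /Ph -/M divfK ?gt_eqF// T_ge1; last lra.
    by field.
  have Phc : Ph (v c) = 0.
    rewrite /Ph T_le1 ?mulr0// mulrAC ler_pdivrMr//; lra.
  have igP : ig a b (fun x => Ph' (v x) * z x).
    apply: ig_mul_continuous; first exact: (comp_continuous cPh' cv).
    exact: arc_igz A.
  have bound p q : a <= p -> p <= q -> q <= b -> `|Ph (v q) - Ph (v p)| <= m * S.
    move=> ap pq qb.
    have -> : Ph (v q) - Ph (v p) = I p q (fun x => Ph' (v x) * z x).
      apply: (chain_rule pq C0 cv mz _ _ cPh cPh' D1 D2).
        by apply: (ig_sub iz).
      by move=> x y px xy yq; apply: (P x y _ xy _).1; [exact: le_trans px|exact: le_trans qb].
    apply: le_trans (I_norm (ig_sub igP ap qb)) _.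
    apply: (@le_trans _ _ (I a b (fun x => `|Ph' (v x) * z x|))).
      by apply: I_sub_le => //; exact: ig_norm.
    rewrite -I_scale//; apply: I_le; [exact: ig_norm|exact: ig_scale|].
    move=> x xab; have [vx|vx] := leP (v x) (M / 2).
      rewrite /Ph' T'_le1 ?mul0r ?normr0 ?mulr_ge0 ?sav_ge0 ?(ltW m0)//.
      by rewrite mulrAC ler_pdivrMr//; move: vx; arith.
    rewrite normrM; apply: (@le_trans _ _ `|z x|).
      rewrite ler_piMl//; have /andP[T0 T1] := T'_bounds (2 / M * v x).
      by rewrite /Ph' ger0_norm.
    by apply: (@sav_ge_slope _ _ _ M) => //; exact: ltW.
  have [cx|xc] := leP c x1.
    have := bound c x1; rewrite PhM Phc subr0 ger0_norm//.
    by apply.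
  have := bound x1 c; rewrite PhM Phc sub0r normrN ger0_norm//.
  by apply => //; exact: ltW.
have MS2 : M ^+ 2 * (h * ln M) <= 32 * S ^+ 2.
  have : (M / 4) ^+ 2 <= (m * S) ^+ 2 by rewrite ler_sqr ?nnegrE ?mulr_ge0// ltW.
  move=> H.
  have : (M / 4) ^+ 2 * (h * ln M) <= (m * S) ^+ 2 * (h * ln M) by rewrite ler_pM2r.
  have -> : (m * S) ^+ 2 * (h * ln M) = (m ^+ 2 * h * ln M) * S ^+ 2 by ring.
  by rewrite mE; arith.
have SJ2 : J ^+ 2 * ln M ^+ 2 <= 64 * M ^+ 2 * S ^+ 2.
  have : (J * ln M) ^+ 2 <= (8 * M * S) ^+ 2 by rewrite ler_sqr ?nnegrE ?mulr_ge0 ?(ltW l0) ?(ltW J0)//; lra.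
  by rewrite !exprMn; arith.
have key : J ^+ 2 * (h * ln M ^+ 3) <= 2048 * S ^+ 4.
  rewrite -(ler_pM2l (_ : 0 < M ^+ 2)) ?exprn_gt0//.
  have -> : M ^+ 2 * (J ^+ 2 * (h * ln M ^+ 3)) = (J ^+ 2 * ln M ^+ 2) * (M ^+ 2 * (h * ln M)) by ring.
  have -> : M ^+ 2 * (2048 * S ^+ 4) = (64 * M ^+ 2 * S ^+ 2) * (32 * S ^+ 2) by ring.
  by apply: ler_pM => //; rewrite mulr_ge0 ?sqr_ge0// ltW.
have L3 : o ^+ 10 <= 8 * (h * ln M ^+ 3).
  rewrite -(hh_Lam e0 e1).
  have : Lam e ^+ 3 <= (2 * ln M) ^+ 3.
    by rewrite lerXn2r// ?nnegrE; [move: L1; arith|move: l0; arith].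
  have -> : (2 * ln M) ^+ 3 = 8 * ln M ^+ 3 by ring.
  by move=> H; have := ler_wpM2l (ltW h0) H; arith.
have q1 : 0 <= o ^+ 5 * J by apply: mulr_ge0; [apply: exprn_ge0|]; exact: ltW.
have q2 : 0 <= 128 * S ^+ 2 by exact: mulr_ge0 (ler0n R 128) (sqr_ge0 S).
rewrite -(@ler_pXn2r _ 2)//.
have -> : (o ^+ 5 * J) ^+ 2 = J ^+ 2 * o ^+ 10 by ring.
have -> : (128 * S ^+ 2) ^+ 2 = 8 * (2048 * S ^+ 4) by ring.
have := ler_wpM2l (sqr_ge0 J) L3; move: key; arith.
Qed.

Lemma arc_opp a b u v z : h2arc a b u v z ->
  h2arc a b (fun x => - u x) (fun x => - v x) (fun x => - z x).
Proof.
move=> [cu cv mz iz P]; split.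
- by move=> x; apply: cvgN; exact: cu.
- by move=> x; apply: cvgN; exact: cv.
- exact: measurableT_comp.
- by apply: ig_eq iz => x _; rewrite sqrrN.
move=> x y ax xy yb; have [h1 h2] := P x y ax xy yb.
rewrite !I_opp -?h1 -?h2; first by split; ring.
  exact: ig_continuous.
by apply: (@ig_sub _ a b) => //; exact: ig_sqr.
Qed.

Variables (beta : R) (f : R -> R).
Hypotheses (be0 : 0 <= beta) (cf : continuous f).
Local Notation EE := (E h beta f).

Lemma sav_le_E a b u v z : h2arc a b u v z -> I a b (sav v z) <= EE a b u v z.
Proof.
move=> A; apply: I_le; [exact: ig_sav A|exact: ig_dens A|].
move=> x _; rewrite /sav /dens.
have /andP[h1 h2] := T'_sqr_bounds (v x).
have q1 : h * z x ^+ 2 * (1 - (1 - T' (v x)) ^+ 2) <= h * z x ^+ 2.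
  by rewrite ler_piMr// mulr_ge0 ?sqr_ge0// ltW.
have q2 := G_ge0 (v x - T (v x)).
have q3 : 0 <= beta * (u x - f x) ^+ 2 by rewrite mulr_ge0 ?sqr_ge0.
lra.
Qed.

Lemma excess_bound a b u v z (C : R) : h2arc a b u v z -> a <= b ->
  (exists2 c, a <= c <= b & v c <= 1) -> 0 <= C -> EE a b u v z <= C * o ^+ 3 ->
  I a b (T \o v) <= (128 * C ^+ 2 + 1) * o.
Proof.
move=> A ab ce C0 EC; have o0 := om_gt0 e0 e1; have o1 := om_le e0 e1.
have C20 : 0 <= 128 * C ^+ 2 * o by rewrite !mulr_ge0 ?sqr_ge0// ltW.
have [Jo|Jo] := leP (o ^+ 3) (I a b (T \o v)); last first.
  have : o ^+ 3 <= o by rewrite -[leRHS]expr1 ler_wiXn2l// ?(ltW o0)//; lra.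
  lra.
have := excess_cost A ab ce Jo; have S1 := sav_le_E A.
have S0 : 0 <= I a b (sav v z) by apply: I_ge0 => x _; exact: sav_ge0.
have SC := le_trans S1 EC.
have S2 : I a b (sav v z) ^+ 2 <= (C * o ^+ 3) ^+ 2.
  by rewrite ler_sqr ?nnegrE//; apply: le_trans SC.
move=> H; have H2 : o ^+ 5 * I a b (T \o v) <= o ^+ 5 * (128 * C ^+ 2 * o).
  apply: le_trans H _; have -> : o ^+ 5 * (128 * C ^+ 2 * o) = 128 * (C * o ^+ 3) ^+ 2 by ring.
  by rewrite ler_pM2l.
rewrite ler_pM2l ?exprn_gt0// in H2; lra.
Qed.

Lemma variation_bound a b u v z : h2arc a b u v z -> a <= b ->
  I a b (fun x => `|v x|) <= I a b (T \o v) + I a b (fun x => T (- v x))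
    + (o * (b - a) + 5 * (EE a b u v z / o)) / 2.
Proof.
move=> A ab; have [cu cv mz iz P] := A; have o0 := om_gt0 e0 e1.
have cT := comp_continuous (@T_continuous R) cv.
have cN : continuous (fun x => - v x) by move=> x; apply: cvgN; exact: cv.
have cT2 := comp_continuous (@T_continuous R) cN.
have cG := comp_continuous (@G_continuous R) cv.
have i1 : ig a b (T \o v) by exact: ig_continuous.
have i2 : ig a b (fun x => T (- v x)) by exact: ig_continuous.
have i3 : ig a b (fun x => G (v x)) by exact: ig_continuous.
have i4 : ig a b (fun x => o / 2 + 5 / (2 * o) * G (v x)).
  by apply: ig_add; [exact: ig_cst|exact: ig_scale].
have i5 : ig a b (fun x => T (v x) + T (- v x)) by exact: ig_add.
apply: (@le_trans _ _ (I a b (fun x => T (v x) + T (- v x) + (o / 2 + 5 / (2 * o) * G (v x))))).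
  apply: I_le; [exact/ig_norm/ig_continuous|exact: ig_add|].
  move=> x _; have := flat_part (v x) o0.
  have -> : (o + 5 * G (v x) / o) / 2 = o / 2 + 5 / (2 * o) * G (v x) by field; rewrite gt_eqF.
  by [].
rewrite I_add// I_add// I_add//; [|exact: ig_cst|exact: ig_scale].
rewrite I_cst// I_scale//; have g := I_G_le_E (ltW h0) be0 cf A.
have : 5 / (2 * o) * I a b (fun x => G (v x)) <= 5 / (2 * o) * EE a b u v z.
  by apply: ler_wpM2l => //; rewrite divr_ge0// mulr_ge0// ltW.
have -> : 5 / (2 * o) * EE a b u v z = 5 * (EE a b u v z / o) / 2 by field; rewrite gt_eqF.
lra.
Qed.

End cost_of_excess.

(** * Minimizers at the scale om *)

Lemma le_of_sqr {R : realType} (x y : R) : 0 <= y -> x ^+ 2 <= y ^+ 2 -> x <= y.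
Proof.
move=> y0; rewrite -(real_normK (num_real x)) ler_sqr ?nnegrE// => h.
by apply: le_trans h; exact: ler_norm.
Qed.

(* From here on the scales are used only through the lemmas above. *)
Opaque om hh bb Lam.
(** The bounds on which the rest of the argument relies, all at the scale om. *)
Definition tame {R : realType} (beta : R) (f : R -> R) (e C : R) (u v z : R -> R) :=
  (forall p q, 0 <= p -> p <= q -> q <= 1 -> q - p <= om e ->
    [/\ E (hh e) beta f p q u v z <= C * om e ^+ 3,
        I p q (T \o v) <= C * om e,
        I p q (fun x => T (- v x)) <= C * om e &
        I p q (fun x => `|v x|) <= C * om e]) /\
  (forall x, 0 <= x <= 1 -> `|u x - f x| <= C * om e).

Section tameness.
Context {R : realType}.
Variables (beta L : R) (f : R -> R) (e : R).
Hypotheses (beta0 : 0 < beta) (L0 : 0 <= L) (fL : forall x y, `|f y - f x| <= L * `|y - x|).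
Hypotheses (e0 : 0 < e) (e1 : 625 * e <= 1) (eL : (6 + 2 * L) * e <= 1).
Variables (u v z : R -> R).
Hypothesis minu : minimal (hh e) beta f u v z.
Hypothesis oK : KW beta L * om e <= 1.
Hypothesis oE : 8 * CE beta L * om e <= 1.
Hypothesis oE2 : 16 * CE beta L * om e <= beta.
Hypothesis oW : 16 * CW beta L * om e <= 1.
Implicit Types (p q x y : R).
Local Notation o := (om e).
Local Notation EE := (E (hh e) beta f).
Local Notation K := (KW beta L).
Local Notation W := (CW beta L).

Let cf : continuous f. Proof. exact: lipschitz_continuous_fun fL. Qed.
Let be0 : 0 <= beta := ltW beta0.

Definition CA := 4 * CW beta L / beta + 1.
Definition CJ := 128 * CW beta L ^+ 2 + 1.
Definition CV := 2 * CJ + (KW beta L + 5 * CW beta L) / 2.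
Definition CD := CA + CV + L * KW beta L.

Lemma window_good p : 0 <= p -> p + K * o <= 1 ->
  exists x, [/\ p <= x <= p + K * o, `|v x| <= 1 & `|u x - f x| <= CA * o].
Proof.
move=> p0 p1; have o0 := om_gt0 e0 e1; have o1 := om_le e0 e1.
have K1 : 1 <= K by exact: KW_ge1.
have W0 : 0 < W by exact: CW_gt0.
have ol : o <= K * o by rewrite ler_peMl// ltW.
have A1 : 1 <= CA by rewrite /CA lerDr divr_ge0// mulr_ge0// ltW.
have [|||x [h1 h2 h3]] := @good_point R beta L f e fL u v z minu p (p + K * o) (CA * o ^+ 2) p0 _ p1.
- by rewrite ltrDl; apply: lt_le_trans ol.
- by rewrite mulr_gt0 ?exprn_gt0//; apply: lt_le_trans A1.
- have A : h2arc p (p + K * o) u v z by apply: (arc_sub minu.1).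
  have Ew : EE p (p + K * o) u v z <= W * o ^+ 3.
    apply: (window_energy beta0 L0 fL e0 e1 eL minu oK oE oE2) => //.
      by rewrite lerDl; apply: le_trans ol; exact: ltW.
    by rewrite addrAC subrr add0r.
  have g1 := le_trans (I_G_le_E (ltW (hh_gt0 e0 e1)) be0 cf A) Ew.
  have g2 := le_trans (I_fid_le_E beta (ltW (hh_gt0 e0 e1)) cf A) Ew.
  have g3 : I p (p + K * o) (fun x => (u x - f x) ^+ 2) / (CA * o ^+ 2) <= o / 4.
    rewrite ler_pdivrMr; last by rewrite mulr_gt0 ?exprn_gt0//; apply: lt_le_trans A1.
    have : I p (p + K * o) (fun x => (u x - f x) ^+ 2) <= W * o ^+ 3 / beta by rewrite ler_pdivlMr// mulrC.
    move=> H; apply: le_trans H _.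
    have -> : o / 4 * (CA * o ^+ 2) = W * o ^+ 3 / beta + o ^+ 3 / 4 by rewrite /CA; field; rewrite gt_eqF.
    by rewrite lerDl divr_ge0// exprn_ge0// ltW.
  have g4 : W * o ^+ 3 <= o / 400.
    have -> : W * o ^+ 3 = (16 * W * o) * (o * o) / 16 by field.
    have : (16 * W * o) * (o * o) <= 1 * (1 / 25 * o).
      have q1 : 0 <= 16 * W * o by apply: mulr_ge0; [apply: mulr_ge0 => //|]; exact: ltW.
      have q2 : 0 <= o * o by apply: mulr_ge0; exact: ltW.
      apply: ler_pM => //.
      by apply: ler_wpM2r; [exact: ltW|lra].
    lra.
  have -> : p + K * o - p = K * o by ring.
  by lra.
exists x; split => //.
have Ao : 0 <= CA * o by apply: mulr_ge0; [exact: le_trans A1|exact: ltW].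
apply: (le_of_sqr Ao); rewrite real_normK ?num_real//; apply: le_trans h3 _.
have -> : (CA * o) ^+ 2 = CA * (CA * o ^+ 2) by ring.
by rewrite ler_peMl// mulr_ge0 ?sqr_ge0//; exact: le_trans A1.
Qed.

Lemma CJ_ge1 : 1 <= CJ.
Proof. by rewrite /CJ lerDr mulr_ge0// sqr_ge0. Qed.

Lemma full_window p : 0 <= p -> p + K * o <= 1 ->
  [/\ EE p (p + K * o) u v z <= W * o ^+ 3, I p (p + K * o) (T \o v) <= CJ * o,
      I p (p + K * o) (fun x => T (- v x)) <= CJ * o &
      I p (p + K * o) (fun x => `|v x|) <= CV * o].
Proof.
move=> p0 p1; have o0 := om_gt0 e0 e1; have K1 : 1 <= K by exact: KW_ge1.
have W0 : 0 < W by exact: CW_gt0.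
have K0 : 0 <= K * o by rewrite mulr_ge0 ?(ltW o0)//; apply: le_trans K1.
have pq : p <= p + K * o by rewrite lerDl.
have A : h2arc p (p + K * o) u v z by apply: (arc_sub minu.1).
have Ew : EE p (p + K * o) u v z <= W * o ^+ 3.
  apply: (window_energy beta0 L0 fL e0 e1 eL minu oK oE oE2) => //.
  by rewrite addrAC subrr add0r.
have [c [cp vc _]] := window_good p0 p1.
have vc1 : v c <= 1 by apply: le_trans vc; exact: ler_norm.
have vc2 : - v c <= 1 by apply: le_trans vc; rewrite -normrN; exact: ler_norm.
have J1 : I p (p + K * o) (T \o v) <= CJ * o.
  by apply: (excess_bound e0 e1 be0 cf A pq _ (ltW W0) Ew); exists c.
have J2 : I p (p + K * o) (fun x => T (- v x)) <= CJ * o.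
  have cg : continuous (fun x => - f x) by move=> x; apply: cvgN; exact: cf.
  apply: (@excess_bound R e e0 e1 beta (fun x => - f x) be0 cg _ _ (fun x => - u x) (fun x => - v x) (fun x => - z x) W (arc_opp A) pq _ (ltW W0)).
    by exists c.
  apply: le_trans Ew; rewrite le_eqVlt; apply/orP; left; apply/eqP.
  by apply: I_eq => x _; rewrite /dens /G !sqrrN -opprD sqrrN.
split=> //.
apply: le_trans (variation_bound e0 e1 be0 cf A pq) _.
have -> : p + K * o - p = K * o by ring.
have h1 : EE p (p + K * o) u v z / o <= W * o ^+ 2.
  by rewrite ler_pdivrMr// -mulrA -exprSr.
have h2 : W * o ^+ 2 <= W * o.
  have o1 := om_le e0 e1.
  by rewrite ler_wpM2l ?(ltW W0)// expr2 ler_piMl ?(ltW o0)//; lra.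
have h3 : o * (K * o) <= K * o.
  have o1 := om_le e0 e1.
  by rewrite ler_piMl//; lra.
rewrite /CV; lra.
Qed.

Lemma contained_window p q : 0 <= p -> p <= q -> q <= 1 -> q - p <= K * o ->
  exists2 x, 0 <= x /\ x + K * o <= 1 & x <= p /\ q <= x + K * o.
Proof.
move=> p0 pq q1 qp; exists (Num.min p (1 - K * o)).
  split; first by rewrite le_min p0 subr_ge0 oK.
  by rewrite -lerBrDr ge_min lexx orbT.
split; first by rewrite ge_min lexx.
by case: (leP p (1 - K * o)); lra.
Qed.

Lemma minimizer_tame : tame beta f e (W + CJ + CD) u v z.
Proof.
have o0 := om_gt0 e0 e1; have K1 : 1 <= K by exact: KW_ge1.
have W0 : 0 < W by exact: CW_gt0.
have J0 : 1 <= CJ := CJ_ge1.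
have K0 : 0 <= K by exact: le_trans K1.
have A0 : 0 <= CA by rewrite /CA addr_ge0// divr_ge0// mulr_ge0// ltW.
have V0 : 0 <= CV by rewrite /CV; lra.
have LK : 0 <= L * K by exact: mulr_ge0.
have [cu cv mz iz P] := minu.1.
have mono (g : R -> R) a b c d : continuous g -> (forall x, 0 <= g x) -> a <= c -> c <= d -> d <= b ->
    I c d g <= I a b g.
  by move=> cg g0 ac cd db; apply: I_sub_le => //; exact: ig_continuous.
have cT := comp_continuous (@T_continuous R) cv.
have cN : continuous (fun x => - v x) by move=> x; apply: cvgN; exact: cv.
have cT2 := comp_continuous (@T_continuous R) cN.
have cA : continuous (fun x => `|v x|) by move=> x; apply: cvg_norm; exact: cv.
have T0 t : 0 <= T t :> R by have /andP[] := T_bounds t.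
have oKo : o <= K * o by rewrite ler_peMl// ltW.
split=> [p q p0 pq q1 qp|x /andP[x0 x1]].
  have [x [x0 x1] [xp qx]] := contained_window p0 pq q1 (le_trans qp oKo).
  have [h1 h2 h3 h4] := full_window x0 x1.
  have s1 : W * o ^+ 3 <= (W + CJ + CD) * o ^+ 3.
    by apply: ler_wpM2r; [rewrite exprn_ge0// ltW|rewrite /CD; lra].
  have s2 : CJ * o <= (W + CJ + CD) * o.
    by apply: ler_wpM2r; [exact: ltW|rewrite /CD; lra].
  have s3 : CV * o <= (W + CJ + CD) * o.
    by apply: ler_wpM2r; [exact: ltW|rewrite /CD; lra].
  have Ax : h2arc x (x + K * o) u v z by apply: (arc_sub minu.1).
  split.
  - apply: le_trans s1; apply: le_trans h1.
    exact: (E_mono (ltW (hh_gt0 e0 e1)) be0 cf Ax).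
  - by apply: le_trans s2; apply: le_trans h2; apply: (mono (T \o v) _ _ _ _ cT (fun t => T0 (v t))).
  - by apply: le_trans s2; apply: le_trans h3; apply: (mono _ _ _ _ _ cT2 (fun t => T0 (- v t))).
  - by apply: le_trans s3; apply: le_trans h4; apply: (mono _ _ _ _ _ cA (fun t => normr_ge0 (v t))).
have [|p [p0 p1] [px xp]] := contained_window x0 (lexx x) x1.
  by rewrite subrr mulr_ge0// ltW.
have [c [cp vc fc]] := window_good p0 p1.
have [_ _ _ h4] := full_window p0 p1.
have uc : `|u x - u c| <= CV * o.
  apply: le_trans h4; move: cp => /andP[pc cp].
  have [cx|/ltW xc] := leP c x.
    have [||_ ->] := P c x _ cx _; [exact: le_trans pc|by []|].
    by apply: le_trans (I_norm (ig_continuous _ _ cv)) _; apply: (mono _ _ _ _ _ cA (fun t => normr_ge0 (v t))).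
  rewrite distrC; have [||_ ->] := P x c _ xc _; [by []|exact: le_trans p1|].
  by apply: le_trans (I_norm (ig_continuous _ _ cv)) _; apply: (mono _ _ _ _ _ cA (fun t => normr_ge0 (v t))).
have fxc : `|f x - f c| <= L * (K * o).
  apply: le_trans (fL _ _) _; apply: ler_wpM2l => //.
  by rewrite ler_norml; lra.
have -> : u x - f x = (u x - u c) + (u c - f c) - (f x - f c) by ring.
apply: le_trans (ler_normB _ _) _; apply: le_trans (lerD (ler_normD _ _) (lexx _)) _.
have o0' := ltW o0; have w1 := mulr_ge0 (ltW W0) o0'.
have j1 : 0 <= CJ * o by apply: mulr_ge0 => //; apply: le_trans J0.
apply: (@le_trans _ _ (CV * o + CA * o + L * (K * o))); first by rewrite !lerD.
have -> : (W + CJ + CD) * o = CV * o + CA * o + L * (K * o) + (W * o + CJ * o) by rewrite /CD; ring.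
by rewrite lerDl addr_ge0.
Qed.

End tameness.

(** All constants depend on beta and the Lipschitz constant of f only. *)
Lemma minimizers_tame {R : realType} (beta L : R) : 0 < beta -> 0 <= L ->
  exists C r, [/\ 1 <= C, 0 < r & forall f e u v z,
    (forall x y, `|f y - f x| <= L * `|y - x|) -> 0 < e -> e <= r ->
    minimal (hh e) beta f u v z ->
    625 * e <= 1 /\ tame beta f e C u v z].
Proof.
move=> beta0 L0.
have W0 : 0 < CW beta L by exact: CW_gt0.
have K1 : 1 <= KW beta L by exact: KW_ge1.
have c2 : 1400 <= C2 beta L by exact: C2_ge.
have E0 : 0 <= CE beta L by rewrite /CE; clear - c2; lra.
pose N := 625 + 2 * L + KW beta L + 8 * CE beta L + 16 * CE beta L / beta + 16 * CW beta L.
have E1 : 0 <= 16 * CE beta L / beta by apply: divr_ge0; [exact: mulr_ge0|exact: ltW].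
have N1 : 1 <= N by rewrite /N; clear - E1 E0 L0 W0 K1; lra.
have N0 : 0 < N by apply: lt_le_trans N1.
exists (CW beta L + CJ beta L + CD beta L), (N ^- 2); split.
- have J1 : 1 <= CJ beta L by exact: CJ_ge1.
  have A0 : 0 <= CA beta L by rewrite /CA addr_ge0// divr_ge0 ?(ltW beta0)// mulr_ge0// ltW.
  have LK : 0 <= L * KW beta L by rewrite mulr_ge0//; apply: le_trans K1.
  rewrite /CD /CV; clear - W0 J1 A0 LK K1; lra.
- by rewrite invr_gt0 exprn_gt0.
move=> f e u v z fL e0 er minu.
have eN : N ^+ 2 * e <= 1 by rewrite -ler_pdivlMl ?exprn_gt0// mulr1.
have Ne : N * e <= 1.
  by apply: le_trans eN; rewrite ler_pM2r// expr2 ler_peMl// ltW.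
have le1 (x : R) : x <= N -> x * e <= 1.
  by move=> xN; apply: le_trans Ne; rewrite ler_pM2r.
have e1 : 625 * e <= 1 by apply: le1; rewrite /N; clear - E1 E0 L0 W0 K1; lra.
have o0 := om_gt0 e0 e1.
have No : N * om e <= 1.
  have No0 : 0 <= N * om e by apply: mulr_ge0; exact: ltW.
  apply: le_of_sqr => //; rewrite exprMn [leRHS]expr1n.
  by apply: le_trans eN; rewrite ler_pM2l ?exprn_gt0//; exact: om_sqr_le.
have lo (x : R) : x <= N -> x * om e <= 1.
  by move=> xN; apply: le_trans No; rewrite ler_pM2r.
split => //; apply: (minimizer_tame beta0 L0 fL e0 e1 _ minu).
- by apply: le1; rewrite /N; clear - E1 E0 L0 W0 K1; lra.
- by apply: lo; rewrite /N; clear - E1 E0 L0 W0 K1; lra.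
- by apply: lo; rewrite /N; clear - E1 E0 L0 W0 K1; lra.
- have : 16 * CE beta L / beta * om e <= 1 by apply: lo; rewrite /N; clear - E1 E0 L0 W0 K1; lra.
  by rewrite mulrAC ler_pdivrMr// mul1r.
- by apply: lo; rewrite /N; clear - E1 E0 L0 W0 K1; lra.
Qed.

(** * Cancelling excesses of opposite sign *)

Local Notation EE e beta f := (E (hh e) beta f).

Lemma T_disjoint {R : realType} (t : R) : T t = 0 /\ T' t = 0 \/ T (- t) = 0 /\ T' (- t) = 0.
Proof.
have [t1|t1] := leP t 1; [left|right].
  by rewrite T_le1// T'_le1.
by rewrite T_le1 ?T'_le1//; lra.
Qed.

(** The factor s damps the positive and t the negative excess; by T_disjoint only one of the
    two is present. *)
Lemma damped_density {R : realType} (h s t y d : R) : 0 <= h -> 0 <= s <= 1 -> 0 <= t <= 1 ->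
  h * (d * (1 - t * T' (- y) - s * T' y)) ^+ 2 + G (y + t * T (- y) - s * T y) <=
  h * d ^+ 2 + G y.
Proof.
move=> h0 s01 t01.
have key (k x : R) : 0 <= k <= 1 -> h * (d * (1 - k * T' x)) ^+ 2 + G (x - k * T x) <= h * d ^+ 2 + G x.
  move=> /andP[k0 k1]; have /andP[T0 T1] := T'_bounds x; have /andP[U0 U1] := T_bounds x.
  have kT : 0 <= k * T' x <= 1 by rewrite mulr_ge0//= mulr_ile1.
  apply: lerD.
    apply: ler_wpM2l => //; rewrite exprMn ler_piMr ?sqr_ge0// exprn_ile1//.
      by clear - kT; lra.
    by clear - kT; lra.
  have [x1|x1] := leP x 1; first by rewrite (T_le1 x1) mulr0 subr0.
  have kU : 0 <= k * T x <= T x by rewrite mulr_ge0//= ler_piMl.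
  rewrite gtr0_norm in U1; last by clear - x1; lra.
  by apply: G_le; rewrite !ger0_norm; clear - x1 kU U1; lra.
have [[h1 h2]|[h1 h2]] := T_disjoint y.
  rewrite h1 h2 !mulr0 !subr0.
  have := key t (- y) t01; rewrite /G sqrrN.
  have -> : - y - t * T (- y) = - (y + t * T (- y)) by ring.
  by rewrite sqrrN.
by rewrite h1 h2 !mulr0 !subr0 addr0; exact: key.
Qed.

Lemma damped_density_pos {R : realType} (e t : R) (v z : R -> R) x :
  0 < e -> 625 * e <= 1 -> 0 <= t <= 1 ->
  hh e * (z x * (1 - t * T' (- v x) - 1 * T' (v x))) ^+ 2 + G (v x + t * T (- v x) - 1 * T (v x)) <=
  hh e * z x ^+ 2 + G (v x) - sav e v z x.
Proof.
move=> e0 e1 t01; have h0 := ltW (hh_gt0 e0 e1).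
have [[h1 h2]|[h1 h2]] := T_disjoint (v x).
  have -> : sav e v z x = 0 by rewrite /sav h1 h2 !subr0 expr1n !subrr mulr0 addr0.
  rewrite h1 h2 subr0.
  have := @damped_density R (hh e) 1 t (v x) (z x) h0; rewrite h1 h2 !mulr0 !subr0 ler01 lexx.
  by apply.
by rewrite h1 h2 /sav !mulr0 !mul1r !subr0 addr0 le_eqVlt; apply/orP; left; apply/eqP; ring.
Qed.

Lemma damped_density_neg {R : realType} (e s : R) (v z : R -> R) x :
  0 < e -> 625 * e <= 1 -> 0 <= s <= 1 ->
  hh e * (z x * (1 - 1 * T' (- v x) - s * T' (v x))) ^+ 2 + G (v x + 1 * T (- v x) - s * T (v x)) <=
  hh e * z x ^+ 2 + G (v x) - sav e (fun x => - v x) (fun x => - z x) x.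
Proof.
move=> e0 e1 s01.
have := @damped_density_pos R e s (fun x => - v x) (fun x => - z x) x e0 e1 s01.
rewrite opprK /G !sqrrN => H; apply: le_trans _ H; rewrite le_eqVlt; apply/orP; left; apply/eqP.
by congr (_ * _ + ln (1 + _)); ring.
Qed.

Lemma prim_bounds {R : realType} (a b x : R) (g : R -> R) : continuous g -> (forall x, 0 <= g x) ->
  a <= x -> x <= b -> 0 <= prim a b g x <= I a b g.
Proof.
move=> cg g0 ax xb; rewrite /prim clampE ?ax//.
by rewrite I_ge0//=; apply: I_sub_le => //; exact: ig_continuous.
Qed.

(** The change of the value of u that goes with damping the excesses by s and t, starting from k
    at the left end. *)
Definition drift {R : realType} (k s t a b : R) (v : R -> R) (x : R) : R :=
  k + t * prim a b (fun x => T (- v x)) x - s * prim a b (T \o v) x.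

(** Up to the fidelity term, damping an excess never costs energy, and removing one sign of
    excess completely frees all of sav. *)
Lemma damped_arc {R : realType} (e beta : R) (f : R -> R) (a b s t k : R) (u v z : R -> R) :
  0 < e -> 625 * e <= 1 -> 0 <= beta -> continuous f -> a <= b ->
  0 <= s <= 1 -> 0 <= t <= 1 -> h2arc a b u v z ->
  let D := drift k s t a b v in
  exists z', let w x := u x + D x in let v' x := v x + t * T (- v x) - s * T (v x) in
  [/\ h2arc a b w v' z',
    EE e beta f a b w v' z' <= EE e beta f a b u v z + beta * I a b (fun x => D x * (2 * (u x - f x) + D x)),
    s = 1 -> EE e beta f a b w v' z' <= EE e beta f a b u v z - I a b (sav e v z)
               + beta * I a b (fun x => D x * (2 * (u x - f x) + D x)) &
    t = 1 -> EE e beta f a b w v' z' <= EE e beta f a b u v z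
               - I a b (sav e (fun x => - v x) (fun x => - z x))
               + beta * I a b (fun x => D x * (2 * (u x - f x) + D x))].
Proof.
move=> e0 e1 be0 cf ab s01 t01 A D; have [cu cv mz iz P] := A.
have h0 := ltW (hh_gt0 e0 e1).
pose z' x := z x * (1 - t * T' (- v x) - s * T' (v x)).
exists z' => w v'.
have cN : continuous (fun x => - v x) by move=> x; apply: cvgN; exact: cv.
have c1 := comp_continuous (@T_continuous R) cv; have c2 := comp_continuous (@T_continuous R) cN.
have c3 := comp_continuous (@T'_continuous R) cv; have c4 := comp_continuous (@T'_continuous R) cN.
have pc (g : R -> R) : continuous g -> continuous (prim a b g).
  by move=> cg; apply: prim_continuous => //; [exact: measurable_continuous|exact: ig_sqr_continuous].
have cD : continuous D.
  move=> x; apply: cvgB.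
    apply: cvgD; first exact: cvg_cst.
    by apply: cvgM; [exact: cvg_cst|exact: pc].
  by apply: cvgM; [exact: cvg_cst|exact: pc].
have cw : continuous w by move=> x; apply: cvgD; [exact: cu|exact: cD].
have cv' : continuous v'.
  move=> x; apply: cvgB.
    by apply: cvgD; [exact: cv|apply: cvgM; [exact: cvg_cst|exact: c2]].
  by apply: cvgM; [exact: cvg_cst|exact: c1].
have cf' : continuous (fun x => 1 - t * T' (- v x) - s * T' (v x)).
  move=> x; apply: cvgB.
    by apply: cvgB; [exact: cvg_cst|apply: cvgM; [exact: cvg_cst|exact: c4]].
  by apply: cvgM; [exact: cvg_cst|exact: c3].
have mz' : measurable_fun [set: R] z'.
  by apply: measurable_funM => //; exact: measurable_continuous.
have igD : ig a b (fun x => D x * (2 * (u x - f x) + D x)).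
  apply: ig_continuous => x; apply: cvgM; first exact: cD.
  apply: cvgD; last exact: cD.
  by apply: cvgM; [exact: cvg_cst|apply: cvgB; [exact: cu|exact: cf]].
have A' : h2arc a b w v' z'.
  split => //.
    apply: (@ig_dom _ a b _ (fun x => z x ^+ 2)) => //; first exact: measurable_funX.
    move=> x _; rewrite !ger0_norm ?sqr_ge0// /z' exprMn ler_piMr ?sqr_ge0// exprn_ile1//.
      have := T_disjoint (v x); have /andP[p1 p2] := T'_bounds (v x).
      have /andP[p3 p4] := T'_bounds (- v x).
      case=> [[_ ->]|[_ ->]]; rewrite mulr0 subr0 subr_ge0.
        by rewrite mulr_ile1//; clear - t01; lra.
      by rewrite mulr_ile1//; clear - s01; lra.
    have /andP[p1 p2] := T'_bounds (v x); have /andP[p3 p4] := T'_bounds (- v x).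
    have : 0 <= t * T' (- v x) by apply: mulr_ge0 => //; clear - t01; lra.
    have : 0 <= s * T' (v x) by apply: mulr_ge0 => //; clear - s01; lra.
    by clear; lra.
  move=> x y ax xy yb; have [vP uP] := P x y ax xy yb.
  have i0 : ig x y z by apply: (@ig_sub _ a b) => //; exact: arc_igz A.
  have i1 : ig x y (fun x => T' (v x) * z x) by exact: ig_mul_continuous.
  have i2 : ig x y (fun x => T' (- v x) * - z x).
    apply: ig_mul_continuous => //; apply: (@ig_eq _ _ _ (fun x => (- 1) * z x)); last exact: ig_scale.
    by move=> r _; rewrite mulN1r.
  have vN : forall r1 r2, x <= r1 -> r1 <= r2 -> r2 <= y -> - v r2 - - v r1 = I r1 r2 (fun x => - z x).
    move=> r1 r2 xr r12 ry; rewrite I_opp; last by apply: (ig_sub i0).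
    rewrite -(P r1 r2 _ r12 _).1; [ring|clear - ax xr; lra|clear - yb ry; lra].
  have vP' : forall r1 r2, x <= r1 -> r1 <= r2 -> r2 <= y -> v r2 - v r1 = I r1 r2 z.
    move=> r1 r2 xr r12 ry; apply: (P r1 r2 _ r12 _).1; [clear - ax xr; lra|clear - yb ry; lra].
  have izs : ig x y (fun x => z x ^+ 2) by apply: (ig_sub iz).
  have E1 := chain_rule xy (ler0n R 2) cv mz izs vP' (@T_continuous R) (@T'_continuous R) (@T_taylor R) (@T'_lipschitz R).
  have izs2 : ig x y (fun x => (- z x) ^+ 2) by apply: ig_eq izs => r _; rewrite sqrrN.
  have mzN : measurable_fun [set: R] (fun x => - z x) by exact: measurableT_comp.
  have E2 := chain_rule xy (ler0n R 2) cN mzN izs2 vN (@T_continuous R) (@T'_continuous R) (@T_taylor R) (@T'_lipschitz R).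
  split.
    have -> : v' y - v' x = (v y - v x) + t * (T (- v y) - T (- v x)) - s * (T (v y) - T (v x)) by rewrite /v'; ring.
    rewrite vP E1 E2 -!I_scale// -I_add//; last exact: ig_scale.
    rewrite -I_sub; [|by apply: ig_add => //; exact: ig_scale|exact: ig_scale].
    by apply: I_eq => r _; rewrite /z'; ring.
  have q1 := primB (ig_continuous a b c1) ax xy yb; have q2 := primB (ig_continuous a b c2) ax xy yb.
  have -> : w y - w x = (u y - u x) + t * (prim a b (T \o (fun x => - v x)) y - prim a b (T \o (fun x => - v x)) x)
      - s * (prim a b (T \o v) y - prim a b (T \o v) x) by rewrite /w /D /drift /=; ring.
  rewrite q1 q2 uP -!I_scale; [|exact: ig_continuous|exact: ig_continuous].
  rewrite -I_add; [|exact: ig_continuous|by apply: ig_scale; exact: ig_continuous].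
  rewrite -I_sub; [by apply: I_eq => r _; rewrite /v'| |by apply: ig_scale; exact: ig_continuous].
  by apply: ig_add; [exact: ig_continuous|apply: ig_scale; exact: ig_continuous].
have iA := ig_dens (hh e) beta cf A; have iA' := ig_dens (hh e) beta cf A'.
have fid x : beta * (w x - f x) ^+ 2 = beta * (u x - f x) ^+ 2 + beta * (D x * (2 * (u x - f x) + D x)).
  by rewrite /w; ring.
split => //.
- rewrite /E -I_scale// -I_add//; last exact: ig_scale.
  apply: I_le => //; first by apply: ig_add => //; exact: ig_scale.
  move=> x _; rewrite /dens fid; have := damped_density (v x) (z x) h0 s01 t01.
  by rewrite -/(z' x) -/(v' x); clear; lra.
- move=> s1; rewrite /E -I_scale// -I_sub//; last exact: ig_sav A.
  rewrite -I_add; [|by apply: ig_sub2 => //; exact: ig_sav A|exact: ig_scale].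
  apply: I_le => //; first by apply: ig_add; [apply: ig_sub2 => //; exact: ig_sav A|exact: ig_scale].
  move=> x _; rewrite /dens fid; have := @damped_density_pos R e t v z x e0 e1 t01.
  by rewrite /z' /v' s1; clear; lra.
- move=> t1; have iS : ig a b (sav e (fun x => - v x) (fun x => - z x)) by exact: ig_sav (arc_opp A).
  rewrite /E -I_scale// -I_sub//.
  rewrite -I_add; [|exact: ig_sub2|exact: ig_scale].
  apply: I_le => //; first by apply: ig_add; [exact: ig_sub2|exact: ig_scale].
  move=> x _; rewrite /dens fid; have := @damped_density_neg R e s v z x e0 e1 s01.
  by rewrite /z' /v' t1; clear; lra.
Qed.

Lemma T_end {R : realType} (y : R) : `|y| <= 1 -> T y = 0 /\ T (- y) = 0.
Proof. by rewrite ler_norml => y1; rewrite !T_le1//; lra. Qed.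

(** Damping factors that remove the same amount t from both excesses, and the smaller one
    completely. *)
Lemma balance {R : realType} (N P t : R) : 0 < t -> t = Num.min N P ->
  [/\ 0 <= t / N <= 1, 0 <= t / P <= 1, t / N * N = t, t / P * P = t &
      t / N = 1 \/ t / P = 1].
Proof.
move=> t0 tE; have tN : t <= N by rewrite tE ge_min lexx.
have tP : t <= P by rewrite tE ge_min lexx orbT.
have N0 : 0 < N by apply: lt_le_trans tN. have P0 : 0 < P by apply: lt_le_trans tP.
have t0' := ltW t0.
split; rewrite ?divfK ?gt_eqF ?divr_ge0 ?(ltW N0) ?(ltW P0)//=.
- by rewrite ler_pdivrMr// mul1r.
- by rewrite ler_pdivrMr// mul1r.
- by move: tE; case: leP => _ ->; [left|right]; rewrite divff// gt_eqF.
Qed.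

(** Removing from a window the same amount of positive and of negative excess moves
    u by at most that amount; hence the two excesses cannot coexist in
    a window much shorter than om. *)
Lemma cancel_window {R : realType} (e beta : R) (f : R -> R) (C a b : R) (u v z : R -> R) :
  0 < e -> 625 * e <= 1 -> 0 < beta -> continuous f -> 1 <= C ->
  minimal (hh e) beta f u v z -> tame beta f e C u v z ->
  0 <= a -> a < b -> b <= 1 -> 36 * beta * C ^+ 2 * (b - a) < om e -> b - a <= om e ->
  `|v a| <= 1 -> `|v b| <= 1 ->
  Num.min (I a b (fun x => T (- v x))) (I a b (T \o v)) < om e ^+ 3.
Proof.
move=> e0 e1 beta0 cf C1 M [tm1 tm2] a0 ab b1 small bao va vb.
have o0 := om_gt0 e0 e1; have A : h2arc a b u v z by apply: (arc_sub M.1).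
have [h1 h2 h3 _] := tm1 a b a0 (ltW ab) b1 bao.
set N := I a b (fun x => T (- v x)) in h3 *; set P := I a b (T \o v) in h2 *.
rewrite ltNge; apply/negP => Jo; set t := Num.min N P in Jo.
have t0 : 0 < t by apply: lt_le_trans Jo; rewrite exprn_gt0.
have [r1 r2 r3 r4 r5] := balance t0 (erefl t).
have [z' [A' _ Ep En]] := @damped_arc R e beta f a b (t / P) (t / N) 0 u v z e0 e1 (ltW beta0) cf (ltW ab) r2 r1 A.
set D := drift _ _ _ _ _ _ in A' Ep En.
have [cu cv mz iz PP] := A.
have cN : continuous (fun x => - v x) by move=> x; apply: cvgN; exact: cv.
have c1 := comp_continuous (@T_continuous R) cv; have c2 := comp_continuous (@T_continuous R) cN.
have T0 (y : R) : 0 <= T y by have /andP[] := T_bounds y.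
have [v1 v2] := T_end va; have [v3 v4] := T_end vb.
have pa g : prim a b g a = 0 by apply: prim0; exact: ltW.
have pb g : prim a b g b = I a b g by rewrite /prim clampE// (ltW ab) lexx.
(* equal amounts of both signs are removed, so the values at both ends are kept *)
have Da : u a + D a = u a by rewrite /D /drift !pa !mulr0 subr0 !addr0.
have Db : u b + D b = u b by rewrite /D /drift !pb -/N -/P r3 r4; ring.
have LM := local_min cf M a0 (ltW ab) b1 A' (or_intror (conj Da _)) (or_intror (conj Db _)).
rewrite v1 v2 v3 v4 !mulr0 !subr0 !addr0 in LM; have {}LM := LM erefl erefl.
have Dt x : a <= x <= b -> `|D x| <= t.
  move=> /andP[ax xb]; have /andP[q1 q2] := prim_bounds c1 (fun y => T0 (v y)) ax xb.
  have /andP[q3 q4] := prim_bounds c2 (fun y => T0 (- v y)) ax xb.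
  rewrite -/P in q2; rewrite -/N in q4; rewrite ler_norml /D /drift.
  have := ler_wpM2l (proj1 (andP r1)) q4; have := ler_wpM2l (proj1 (andP r2)) q2.
  have := mulr_ge0 (proj1 (andP r1)) q3; have := mulr_ge0 (proj1 (andP r2)) q1.
  rewrite r3 r4; set X := t / N * _; set Y := t / P * _.
  by clear; lra.
(* u moves by at most t, so the fidelity changes by at most t * om per unit of length *)
have tC : t <= C * om e by rewrite /t; apply: le_trans h3; rewrite ge_min lexx.
have fidb : I a b (fun x => D x * (2 * (u x - f x) + D x)) <= t * (3 * C * om e) * (b - a).
  apply: I_bound; [|exact: ltW|].
    have cD : continuous D.
      have pc (g : R -> R) : continuous g -> continuous (prim a b g).
        by move=> cg; apply: prim_continuous => //; [exact: ltW|exact: measurable_continuous|exact: ig_sqr_continuous].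
      move=> x; apply: cvgB; last by apply: cvgM; [exact: cvg_cst|exact: pc].
      by apply: cvgD; [exact: cvg_cst|apply: cvgM; [exact: cvg_cst|exact: pc]].
    apply: ig_continuous => x; apply: cvgM; first exact: cD.
    apply: cvgD; last exact: cD.
    by apply: cvgM; [exact: cvg_cst|apply: cvgB; [exact: cu|exact: cf]].
  move=> x xab; have D1 := Dt x xab.
  have x01 : 0 <= x <= 1 by clear - xab a0 b1; lra.
  have f1 := tm2 x x01.
  apply: le_trans (ler_norm _) _; rewrite normrM; apply: ler_pM => //.
  apply: le_trans (ler_normD _ _) _; rewrite normrM ger0_norm//.
  by clear - f1 D1 tC; lra.
have [S [S0 cost SE]] : exists S, [/\ 0 <= S, om e ^+ 5 * t <= 128 * S ^+ 2 & S <= beta * (t * (3 * C * om e) * (b - a))].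
  case: r5 => rr.
    exists (I a b (sav e (fun x => - v x) (fun x => - z x))); split.
    - by apply: I_ge0 => x _; exact: sav_ge0.
    - apply: le_trans (_ : om e ^+ 5 * N <= _).
        by apply: ler_wpM2l; [rewrite exprn_ge0// ltW|rewrite /t ge_min lexx].
      apply: (excess_cost e0 e1 (arc_opp A) (ltW ab)).
        by exists a; [rewrite lexx ltW|move: va; rewrite ler_norml; clear; lra].
      by apply: le_trans Jo _; rewrite /t ge_min lexx.
    - have := En rr; have := ler_wpM2l (ltW beta0) fidb; move: LM; clear; lra.
  exists (I a b (sav e v z)); split.
  - by apply: I_ge0 => x _; exact: sav_ge0.
  - apply: le_trans (_ : om e ^+ 5 * P <= _).
      by apply: ler_wpM2l; [rewrite exprn_ge0// ltW|rewrite /t ge_min lexx orbT].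
    apply: (excess_cost e0 e1 A (ltW ab)).
      by exists a; [rewrite lexx ltW|move: va; rewrite ler_norml; clear; lra].
    by apply: le_trans Jo _; rewrite /t ge_min lexx orbT.
  - have := Ep rr; have := ler_wpM2l (ltW beta0) fidb; move: LM; clear; lra.
have ba : 0 <= b - a by rewrite subr_ge0 ltW.
have C0 : 0 < C by apply: lt_le_trans C1.
pose q := 36 * beta * C ^+ 2 * (b - a).
have q0 : 0 <= q by rewrite /q; apply: mulr_ge0 => //; apply: mulr_ge0; [apply: mulr_ge0; [exact: ler0n|exact: ltW]|exact: sqr_ge0].
have SE' : 12 * C * S <= q * om e * t.
  have -> : q * om e * t = 12 * C * (beta * (t * (3 * C * om e) * (b - a))) by rewrite /q; ring.
  by apply: ler_wpM2l => //; apply: mulr_ge0; [exact: ler0n|exact: ltW].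
have k1 : 144 * C ^+ 2 * (om e ^+ 5 * t) <= 128 * (q * om e * t) ^+ 2.
  apply: (@le_trans _ _ (128 * (12 * C * S) ^+ 2)).
    have -> : 128 * (12 * C * S) ^+ 2 = 144 * C ^+ 2 * (128 * S ^+ 2) by ring.
    by apply: ler_wpM2l => //; apply: mulr_ge0; [exact: ler0n|exact: sqr_ge0].
  apply: ler_wpM2l; first exact: ler0n.
  rewrite ler_sqr// nnegrE; last by apply: le_trans SE'; apply: mulr_ge0 => //; apply: mulr_ge0; [exact: ler0n|exact: ltW].
  by apply: mulr_ge0 => //; apply: mulr_ge0; [exact: ler0n|exact: ltW].
have k2 : 128 * (q * om e * t) ^+ 2 <= 128 * C ^+ 2 * (q ^+ 2 * om e ^+ 3 * t).
  have -> : 128 * (q * om e * t) ^+ 2 = (128 * (q * om e) ^+ 2 * t) * t by ring.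
  have -> : 128 * C ^+ 2 * (q ^+ 2 * om e ^+ 3 * t) = (128 * (q * om e) ^+ 2 * t) * (C * (C * om e)) by ring.
  apply: ler_wpM2l.
    by apply: mulr_ge0; [apply: mulr_ge0; [exact: ler0n|exact: sqr_ge0]|exact: ltW].
  by apply: le_trans tC _; rewrite ler_peMl//; apply: mulr_ge0; exact: ltW.
have k3 : 144 * C ^+ 2 * om e ^+ 3 * t * (om e ^+ 2 - q ^+ 2) <= 0.
  have : 0 <= C ^+ 2 * (q ^+ 2 * om e ^+ 3 * t).
    apply: mulr_ge0; first exact: sqr_ge0.
    by apply: mulr_ge0; [apply: mulr_ge0; [exact: sqr_ge0|exact/exprn_ge0/ltW]|exact: ltW].
  by have := le_trans k1 k2; clear; lra.
rewrite pmulr_rle0 in k3; last first.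
  by apply: mulr_gt0 => //; apply: mulr_gt0; [apply: mulr_gt0; [exact: ltr0n|exact: exprn_gt0]|exact: exprn_gt0].
have : om e <= q by apply: le_of_sqr => //; rewrite -subr_le0.
by rewrite leNgt small.
Qed.

(** Accounting for a competitor on three adjacent intervals: x, y are the old and new energies, and
    s is saved on the first one. *)
Fact gain1 {R : realType} (x1 x2 x3 y1 y2 y3 i1 i2 i3 j1 j2 j3 s b : R) :
  x1 + x2 + x3 <= y1 + y2 + y3 -> y1 <= x1 - s + b * i1 -> y2 <= x2 + b * i2 -> y3 <= x3 + b * i3 ->
  b * i1 <= b * j1 -> b * i2 <= b * j2 -> b * i3 <= b * j3 -> s <= b * (j1 + j2 + j3).
Proof. lra. Qed.

(** As gain1, with the saving on the third interval. *)
Fact gain3 {R : realType} (x1 x2 x3 y1 y2 y3 i1 i2 i3 j1 j2 j3 s b : R) :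
  x1 + x2 + x3 <= y1 + y2 + y3 -> y1 <= x1 + b * i1 -> y2 <= x2 + b * i2 -> y3 <= x3 - s + b * i3 ->
  b * i1 <= b * j1 -> b * i2 <= b * j2 -> b * i3 <= b * j3 -> s <= b * (j1 + j2 + j3).
Proof. lra. Qed.

Lemma continuous_pos_part {R : realType} (g : R -> R) : continuous g -> continuous (fun x => Num.max 0 (g x) : R).
Proof.
move=> cg; rewrite (_ : (fun x => _) = (fun x => 2^-1 * (g x + `|g x|))); last first.
  apply/funext => x; case: (leP 0 (g x)) => [g0|g0]; first by rewrite ger0_norm//; field.
  by rewrite ltr0_norm// subrr mulr0.
move=> x; apply: cvgM; first exact: cvg_cst.
by apply: cvgD; [exact: cg|apply: cvg_norm; exact: cg].
Qed.

(** A negative excess in [a, b] followed by a positive one in [c, d]: cancelling them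
    raises u in between. As this saves slope energy, it must move u away from f. *)
Lemma cancel_pair {R : realType} (e beta : R) (f : R -> R) (C a b c d : R) (u v z : R -> R) :
  0 < e -> 625 * e <= 1 -> 0 < beta -> continuous f -> 1 <= C ->
  minimal (hh e) beta f u v z ->
  0 <= a -> a <= b -> b <= c -> c <= d -> d <= 1 ->
  `|v a| <= 1 -> `|v b| <= 1 -> `|v c| <= 1 -> `|v d| <= 1 ->
  let t := Num.min (I a b (fun x => T (- v x))) (I c d (T \o v)) in
  om e ^+ 3 <= t ->
  om e ^+ 5 <= 128 * beta ^+ 2 * t * (I a d (fun x => Num.max 0 (2 * (u x - f x) + t))) ^+ 2.
Proof.
move=> e0 e1 beta0 cf C1 M a0 ab bc cd d1 va vb vc vd t Jo.
have o0 := om_gt0 e0 e1.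
have A1 : h2arc a b u v z by apply: (arc_sub M.1); clear - a0 ab bc cd d1; lra.
have A2 : h2arc b c u v z by apply: (arc_sub M.1); clear - a0 ab bc cd d1; lra.
have A3 : h2arc c d u v z by apply: (arc_sub M.1); clear - a0 ab bc cd d1; lra.
set N := I a b _ in t Jo *; set P := I c d _ in t Jo *.
have t0 : 0 < t by apply: lt_le_trans Jo; rewrite exprn_gt0.
have [r1 r2 r3 r4 r5] := balance t0 (erefl t).
have z01 : 0 <= (0 : R) <= 1 by rewrite lexx ler01.
have be0 := ltW beta0.
(* undo the amount t of the drop on [a, b], keep u raised by t on [b, c], undo t of the rise on [c, d] *)
have [z1 [B1 F1 _ F1n]] := @damped_arc R e beta f a b 0 (t / N) 0 u v z e0 e1 be0 cf ab z01 r1 A1.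
set D1 := drift _ _ _ _ _ _ in B1 F1 F1n.
have [z2 [B2 F2 _ _]] := @damped_arc R e beta f b c 0 0 t u v z e0 e1 be0 cf bc z01 z01 A2.
set D2 := drift _ _ _ _ _ _ in B2 F2.
have [z3 [B3 F3 F3p _]] := @damped_arc R e beta f c d (t / P) 0 t u v z e0 e1 be0 cf cd r2 z01 A3.
set D3 := drift _ _ _ _ _ _ in B3 F3 F3p.
have [cu cv mz iz PP] := A1.
have cN : continuous (fun x => - v x) by move=> x; apply: cvgN; exact: cv.
have c1 := comp_continuous (@T_continuous R) cv; have c2 := comp_continuous (@T_continuous R) cN.
have T0 (y : R) : 0 <= T y by have /andP[] := T_bounds y.
have [va1 va2] := T_end va; have [vb1 vb2] := T_end vb.
have [vc1 vc2] := T_end vc; have [vd1 vd2] := T_end vd.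
have pl x y g : x <= y -> prim x y g x = 0 :> R by move=> xy; apply: prim0.
have pr x y g : x <= y -> prim x y g y = I x y g :> R by move=> xy; rewrite /prim clampE// xy lexx.
have m1 : u b + D1 b = u b + D2 b by rewrite /D1 /D2 /drift (pr a b)// -/N r3; ring.
have m2 : u c + D2 c = u c + D3 c by rewrite /D2 /D3 /drift !(pl c d)//; ring.
have n1 : v b + t / N * T (- v b) - 0 * T (v b) = v b + 0 * T (- v b) - 0 * T (v b) by rewrite vb1 vb2 !mulr0.
have n2 : v c + 0 * T (- v c) - 0 * T (v c) = v c + 0 * T (- v c) - t / P * T (v c) by rewrite vc1 vc2 !mulr0.
have [Q1 H1] := arc_paste (hh e) beta cf ab bc B1 B2 m1 n1.
have [|| Q2 H2] := @arc_paste _ (hh e) beta f cf _ _ _ _ _ _ _ _ _ (le_trans ab bc) cd Q1 B3.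
- by rewrite pasteR'.
- by rewrite pasteR'.
have ad : a <= d by clear - ab bc cd; lra.
have LM := local_min cf M a0 ad d1 Q2 (or_intror (conj _ _)) (or_intror (conj _ _)).
have ac := le_trans ab bc.
rewrite !(pasteL _ _ ac) !(pasteL _ _ ab) in LM.
have {}LM := LM _ _ _ _.
have Da : u a + D1 a = u a by rewrite /D1 /drift !(pl a b)//; ring.
have Dd : u d + D3 d = u d by rewrite /D3 /drift !(pr c d)// -/P r4; ring.
have va3 : v a + t / N * T (- v a) - 0 * T (v a) = v a by rewrite va1 va2; ring.
have vd3 : v d + 0 * T (- v d) - t / P * T (v d) = v d by rewrite vd1 vd2; ring.
have {}LM := LM Da va3.
rewrite pasteR' in LM; [|by rewrite pasteR'|by []].
rewrite pasteR' in LM; [|by rewrite pasteR'|by []].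
have {}LM := LM Dd vd3; rewrite H2 H1 in LM.
pose q (x : R) : R := Num.max 0 (2 * (u x - f x) + t).
have cq : continuous q.
  apply: continuous_pos_part => x; apply: cvgD; last exact: cvg_cst.
  by apply: cvgM; [exact: cvg_cst|apply: cvgB; [exact: cu|exact: cf]].
(* raising u by D <= t changes the squared distance from f by at most t q *)
have Dq (y D : R) : 0 <= D -> D <= t -> D * (2 * (u y - f y) + D) <= t * q y.
  move=> D0 Dt; apply: (@le_trans _ _ (D * q y)).
    by apply: ler_wpM2l => //; rewrite /q le_max; apply/orP; right; clear - Dt; lra.
  by apply: ler_wpM2r => //; rewrite /q le_max lexx.
have pc x y (g : R -> R) : x <= y -> continuous g -> continuous (prim x y g).
  by move=> xy cg; apply: prim_continuous => //; [exact: measurable_continuous|exact: ig_sqr_continuous].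
have igDD (D : R -> R) x y : continuous D -> ig x y (fun x => D x * (2 * (u x - f x) + D x)).
  move=> cD; apply: ig_continuous => r; apply: cvgM; first exact: cD.
  apply: cvgD; last exact: cD.
  by apply: cvgM; [exact: cvg_cst|apply: cvgB; [exact: cu|exact: cf]].
have K1 : I a b (fun x => D1 x * (2 * (u x - f x) + D1 x)) <= I a b (fun x => t * q x).
  apply: I_le; [apply: igDD|by apply: ig_scale; exact: ig_continuous|].
    move=> x; apply: cvgB; last by apply: cvgM; [exact: cvg_cst|exact: pc].
    by apply: cvgD; [exact: cvg_cst|apply: cvgM; [exact: cvg_cst|exact: pc]].
  move=> x /andP[ax xb]; have /andP[q3 q4] := prim_bounds c2 (fun y => T0 (- v y)) ax xb.
  rewrite -/N in q4; have q5 := ler_wpM2l (proj1 (andP r1)) q4; rewrite r3 in q5.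
  have q6 := mulr_ge0 (proj1 (andP r1)) q3.
  by apply: Dq; rewrite /D1 /drift mul0r subr0 add0r.
have K2 : I b c (fun x => D2 x * (2 * (u x - f x) + D2 x)) <= I b c (fun x => t * q x).
  apply: I_le; [apply: igDD|by apply: ig_scale; exact: ig_continuous|].
    move=> x; apply: cvgB; last by apply: cvgM; [exact: cvg_cst|exact: pc].
    by apply: cvgD; [exact: cvg_cst|apply: cvgM; [exact: cvg_cst|exact: pc]].
  by move=> x _; apply: Dq; rewrite /D2 /drift !mul0r subr0 addr0// ltW.
have K3 : I c d (fun x => D3 x * (2 * (u x - f x) + D3 x)) <= I c d (fun x => t * q x).
  apply: I_le; [apply: igDD|by apply: ig_scale; exact: ig_continuous|].
    move=> x; apply: cvgB; last by apply: cvgM; [exact: cvg_cst|exact: pc].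
    by apply: cvgD; [exact: cvg_cst|apply: cvgM; [exact: cvg_cst|exact: pc]].
  move=> x /andP[cx xd]; have /andP[q3 q4] := prim_bounds c1 (fun y => T0 (v y)) cx xd.
  rewrite -/P in q4; have q5 := ler_wpM2l (proj1 (andP r2)) q4; rewrite r4 in q5.
  have q6 := mulr_ge0 (proj1 (andP r2)) q3.
  by apply: Dq; rewrite /D3 /drift mul0r addr0 ?subr_ge0// lerBlDr lerDl.
have igt x y : ig x y (fun x => t * q x) by apply: ig_scale; exact: ig_continuous.
have Ksum : I a b (fun x => t * q x) + I b c (fun x => t * q x) + I c d (fun x => t * q x) = t * I a d q.
  by rewrite -I_split// -I_split// ?I_scale//; exact: ig_continuous.
have Esum : EE e beta f a d u v z = EE e beta f a b u v z + EE e beta f b c u v z + EE e beta f c d u v z.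
  have A := arc_sub M.1 a0 d1.
  by rewrite (E_split (hh e) beta cf A ac cd) (E_split (hh e) beta cf (arc_sub A (lexx a) cd) ab bc).
set Q := I a d q in Ksum *.
have bK1 := ler_wpM2l be0 K1; have bK2 := ler_wpM2l be0 K2; have bK3 := ler_wpM2l be0 K3.
have [S [S0 cost SE]] : exists S, [/\ 0 <= S, om e ^+ 5 * t <= 128 * S ^+ 2 & S <= beta * (t * Q)].
  case: r5 => rr.
    exists (I a b (sav e (fun x => - v x) (fun x => - z x))); split.
    - by apply: I_ge0 => x _; exact: sav_ge0.
    - apply: le_trans (_ : om e ^+ 5 * N <= _).
        by apply: ler_wpM2l; [rewrite exprn_ge0// ltW|rewrite /t ge_min lexx].
      apply: (excess_cost e0 e1 (arc_opp A1) ab).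
        by exists a; [rewrite lexx|move: va; rewrite ler_norml; clear; lra].
      by apply: le_trans Jo _; rewrite /t ge_min lexx.
    - rewrite Esum in LM; rewrite -Ksum; exact: (gain1 LM (F1n rr) F2 F3 bK1 bK2 bK3).
  exists (I c d (sav e v z)); split.
  - by apply: I_ge0 => x _; exact: sav_ge0.
  - apply: le_trans (_ : om e ^+ 5 * P <= _).
      by apply: ler_wpM2l; [rewrite exprn_ge0// ltW|rewrite /t ge_min lexx orbT].
    apply: (excess_cost e0 e1 A3 cd).
      by exists c; [rewrite lexx|move: vc; rewrite ler_norml; clear; lra].
    by apply: le_trans Jo _; rewrite /t ge_min lexx orbT.
  - rewrite Esum in LM; rewrite -Ksum; exact: (gain3 LM F1 F2 (F3p rr) bK1 bK2 bK3).
have S2 : S ^+ 2 <= (beta * (t * Q)) ^+ 2.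
  by rewrite ler_sqr ?nnegrE//; apply: le_trans SE.
rewrite -(ler_pM2r t0); apply: le_trans cost _; move: S2; clear; lra.
Qed.

(** * Exchanging adjacent blocks *)

Lemma I_cells {R : realType} (y d : R) (g : R -> R) (n : nat) : 0 <= d -> ig y (y + n%:R * d) g ->
  I y (y + n%:R * d) g = \sum_(i < n) I (y + i%:R * d) (y + i.+1%:R * d) g.
Proof.
move=> d0; elim: n => [_|n IH ign]; first by rewrite mul0r addr0 I_empty// big_ord0.
have nd : 0 <= n%:R * d by apply: mulr_ge0.
have sn : n.+1%:R * d = n%:R * d + d by rewrite -natr1 mulrDl mul1r.
have l1 : y <= y + n%:R * d by rewrite lerDl.
have l2 : y + n%:R * d <= y + n.+1%:R * d by rewrite sn; clear - d0; lra.
by rewrite big_ord_recr/= -IH ?(I_split ign l1 l2)//; exact: ig_sub ign (lexx _) l2.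
Qed.

Lemma pigeonhole {R : realType} (y d : R) (g : R -> R) (n : nat) : (0 < n)%N -> 0 <= d ->
  ig y (y + n%:R * d) g ->
  exists s, [/\ y <= s, s + d <= y + n%:R * d & n%:R * I s (s + d) g <= I y (y + n%:R * d) g].
Proof.
move=> n0 d0 ign; apply: contrapT => H.
have lt i : (i < n)%N -> I y (y + n%:R * d) g / n%:R < I (y + i%:R * d) (y + i.+1%:R * d) g.
  move=> ilt; rewrite ltNge; apply/negP => le; apply: H; exists (y + i%:R * d).
  have e1 : y + i%:R * d + d = y + i.+1%:R * d by rewrite -natr1; ring.
  rewrite e1; split; first by rewrite lerDl mulr_ge0.
    by rewrite lerD2l ler_wpM2r// ler_nat.
  by rewrite mulrC -ler_pdivlMr// ltr0n.
have : I y (y + n%:R * d) g < I y (y + n%:R * d) g.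
  rewrite {2}(I_cells d0 ign) -[ltLHS](@divfK _ n%:R) ?pnatr_eq0 -?lt0n//.
  rewrite mulr_natr; case: n n0 lt {ign H} => // n _ lt.
  rewrite -[X in _ *+ X]card_ord -sumr_const.
  apply: ltr_sum => [|i _]; last exact: lt.
  by apply/hasP; exists ord0; rewrite ?mem_index_enum.
by rewrite ltxx.
Qed.

Lemma replace_arc {R : realType} (h beta : R) (f : R -> R) (u v z w v' z' : R -> R) (p q : R) :
  continuous f -> h2arc 0 1 u v z -> 0 <= p -> p <= q -> q <= 1 -> h2arc p q w v' z' ->
  w p = u p -> v' p = v p -> w q = u q -> v' q = v q ->
  exists u2 v2 z2, [/\ h2arc 0 1 u2 v2 z2,
    forall x, p <= x <= q -> u2 x = w x /\ v2 x = v' x,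
    forall x, x <= p \/ q <= x -> u2 x = u x /\ v2 x = v x &
    E h beta f 0 1 u2 v2 z2 = E h beta f 0 1 u v z - E h beta f p q u v z + E h beta f p q w v' z'].
Proof.
move=> cf A p0 pq q1 B wp vp wq vq.
have p1 := le_trans pq q1; have q0 := le_trans p0 pq.
have [C1 C2] := arc_paste h beta cf p0 pq (arc_sub A (lexx 0) p1) B (esym wp) (esym vp).
have [||D1 D2] := @arc_paste _ h beta f cf 0 q 1 _ _ _ u v z q0 q1 C1 (arc_sub A q0 (lexx 1)).
- by rewrite pasteR'.
- by rewrite pasteR'.
exists (paste q (paste p u w) u), (paste q (paste p v v') v), (paste q (paste p z z') z).
split => //.
- move=> x /andP[px xq]; rewrite !(pasteL _ _ xq); split; exact: pasteR'.
- move=> x [xp|qx].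
    by rewrite !pasteL// ?(le_trans xp pq).
  by split; apply: pasteR' => //; rewrite pasteR'.
- rewrite D2 C2 (E_split h beta cf A q0 q1) (E_split h beta cf (arc_sub A (lexx 0) q1) p0 pq); ring.
Qed.

Definition gateV {R : realType} (C d : R) : R := 2 + 16 * C / d.
Definition gateC {R : realType} (beta L C d : R) : R :=
  72 * gateV C d ^+ 2 + 8 * beta * (C + 1 + gateV C d + L) ^+ 2.

(** Otherwise G (v x) >= 1/2 on the whole interval. *)
Lemma slope_point {R : realType} (a b : R) (v : R -> R) : continuous v -> a < b ->
  2 * I a b (fun x => G (v x)) < b - a -> exists2 x, a <= x <= b & `|v x| <= 1.
Proof.
move=> cv ab H; apply: contrapT => H2.
have i1 : ig a b (fun x => G (v x)).
  by apply: ig_continuous; exact: (comp_continuous (@G_continuous R) cv).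
have : 2^-1 * (b - a) <= I a b (fun x => G (v x)).
  apply: I_lower => //; first exact: ltW.
  move=> x xab; have [v1|v1] := leP `|v x| 1; first by exfalso; apply: H2; exists x.
  exact: G_large (ltW v1).
by move: H; clear; lra.
Qed.

Lemma arc_diff_le {R : realType} (a b x y : R) (u v z : R -> R) : h2arc a b u v z -> a <= x -> x <= y -> y <= b ->
  `|u y - u x| <= I x y (fun x => `|v x|).
Proof.
move=> [cu cv mz iz P] ax xy yb; have [_ ->] := P x y ax xy yb.
by apply: I_norm; exact: ig_continuous.
Qed.

Lemma arc_near {R : realType} (a b x y : R) (u v z : R -> R) : h2arc a b u v z -> a <= x <= b -> a <= y <= b ->
  `|u y - u x| <= I a b (fun x => `|v x|).
Proof.
move=> A; wlog xy : x y / x <= y.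
  move=> H xab yab; have [xy|/ltW yx] := leP x y; first exact: H.
  by rewrite distrC; exact: H.
move=> /andP[ax xb] /andP[ay yb]; apply: le_trans (arc_diff_le A ax xy yb) _.
have [cu cv mz iz P] := A.
by apply: I_sub_le => //; apply: ig_norm; exact: ig_continuous.
Qed.

Lemma hh_le {R : realType} (e : R) : 0 < e -> 625 * e <= 1 -> hh e <= om e ^+ 10.
Proof.
move=> e0 e1; rewrite -(hh_Lam e0 e1) ler_peMr ?exprn_ege1 ?Lam_ge1//.
exact/ltW/hh_gt0.
Qed.

(** By the pigeonhole principle the window contains an interval of length of order om^4 on
    which the average slope is bounded by a constant. Its arc can be replaced by one whose slope
    vanishes somewhere, and the cost is of the order of the length. *)
Lemma gate {R : realType} (beta L C d e : R) (f u v z : R -> R) (y : R) :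
  0 < e -> 625 * e <= 1 -> 0 < beta -> 0 <= L -> (forall x y, `|f y - f x| <= L * `|y - x|) ->
  1 <= C -> 0 < d -> d <= 1 -> 32 * C * om e <= d ->
  h2arc 0 1 u v z -> 0 <= y -> y + d * om e <= 1 ->
  I y (y + d * om e) (fun x => `|v x|) <= C * om e ->
  I y (y + d * om e) (fun x => G (v x)) <= C * om e ^+ 3 ->
  (forall x, y <= x <= y + d * om e -> `|u x - f x| <= C) ->
  exists u2 v2 z2 a, exists2 cc : R * R, [/\ y <= cc.1, cc.1 <= a, a <= cc.2 & cc.2 <= y + d * om e] &
    [/\ h2arc 0 1 u2 v2 z2, v2 a = 0 /\ EE e beta f 0 1 u2 v2 z2 <= EE e beta f 0 1 u v z + gateC beta L C d * om e ^+ 4,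
     [/\ `|v cc.1| <= 1, `|v cc.2| <= 1, `|u2 a - u cc.1| <= gateC beta L C d * om e ^+ 4 &
         `|u2 a - u cc.2| <= gateC beta L C d * om e ^+ 4],
     (forall x, x <= y \/ y + d * om e <= x -> u2 x = u x /\ v2 x = v x) &
     forall x, `|u2 x - u x| <= gateC beta L C d * om e ^+ 4].
Proof.
move=> e0 e1 be0 L0 fL C1 d0 d1 small A y0 y1 Iv IG Iu; have [cu cv mz iz P] := A.
have cf : continuous f by exact: lipschitz_continuous_fun fL.
have o0 := om_gt0 e0 e1; have o1 := om_le e0 e1.
have hh10 := hh_le e0 e1.
set o := om e in o0 o1 small y1 Iv IG Iu hh10 *; clearbody o.
have C0 : 0 < C by apply: lt_le_trans C1.
set V := gateV C d.
have V2 : 2 <= V by rewrite /V /gateV lerDl divr_ge0// ?mulr_ge0// ltW.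
have lam0 : 0 < d * o by apply: mulr_gt0.
have o40 : 0 < o ^+ 4 by apply: exprn_gt0.
(* subdivide into pieces of length 4 r with r between om^4 and 2 om^4 *)
pose n := Num.trunc (d * o / (4 * o ^+ 4)).
have q1 : 1 <= d * o / (4 * o ^+ 4).
  rewrite ler_pdivlMr ?mul1r; last by apply: mulr_gt0.
  have -> : 4 * o ^+ 4 = 4 * o * o ^+ 2 * o by ring.
  apply: ler_wpM2r; first exact: ltW.
  have o2 : o ^+ 2 <= 1 by rewrite expr_le1//; [clear - o1 o0; lra|exact: ltW].
  apply: (@le_trans _ _ (4 * o)).
    by rewrite ler_piMr// mulr_ge0// ltW.
  apply: le_trans small; apply: ler_wpM2r; [exact: ltW|clear - C1; lra].
have /andP[n1 n2] : n%:R <= d * o / (4 * o ^+ 4) < n.+1%:R by apply: truncn_itv; apply: le_trans q1.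
have n0 : (0 < n)%N.
  by rewrite lt0n; apply/eqP => n00; move: n2; rewrite n00 ltNge q1.
have nR : 0 < (n%:R : R) by rewrite ltr0n.
pose r := d * o / (4 * n%:R).
have r0 : 0 < r by apply: divr_gt0 => //; apply: mulr_gt0.
have nr : n%:R * (4 * r) = d * o by rewrite /r; field; rewrite gt_eqF.
have r1 : o ^+ 4 <= r.
  rewrite /r ler_pdivlMr ?mulr_gt0//; move: n1; rewrite ler_pdivlMr ?mulr_gt0//.
  by clear; lra.
have r2 : r <= 2 * o ^+ 4.
  rewrite /r ler_pdivrMr ?mulr_gt0//; move: n2; rewrite ltr_pdivrMr ?mulr_gt0// -natr1 => n2.
  have : 1 <= (n%:R : R) by rewrite ler1n.
  rewrite -(ler_pM2r o40) mul1r; move: n2; clear; lra.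
(* the weight makes both integrals of order C om *)
pose g x := `|v x| + (o ^+ 2)^-1 * G (v x).
have iG a b : ig a b (fun x => G (v x)).
  by apply: ig_continuous; exact: (comp_continuous (@G_continuous R) cv).
have iN a b : ig a b (fun x => `|v x|) by apply: ig_norm; exact: ig_continuous.
have igg a b : ig a b g by apply: ig_add => //; exact: ig_scale.
have gE a b : I a b g = I a b (fun x => `|v x|) + (o ^+ 2)^-1 * I a b (fun x => G (v x)).
  by rewrite I_add// ?I_scale//; exact: ig_scale.
have o20 : 0 < o ^+ 2 by apply: exprn_gt0.
have [s []] := @pigeonhole R y (4 * r) g n n0 (ltac:(by rewrite mulr_ge0// ltW)) (igg _ _).
rewrite nr => ys sy Hs.
have Ig : I y (y + d * o) g <= 2 * C * o.
  rewrite gE; have : (o ^+ 2)^-1 * I y (y + d * o) (fun x => G (v x)) <= C * o.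
    rewrite mulrC ler_pdivrMr//; apply: le_trans IG _.
    by rewrite le_eqVlt; apply/orP; left; apply/eqP; ring.
  by move: Iv; clear; lra.
have Is : I s (s + 4 * r) g <= 8 * C / d * r.
  have := le_trans Hs Ig; rewrite -ler_pdivlMl//; move=> H; apply: le_trans H _.
  by rewrite le_eqVlt; apply/orP; left; apply/eqP; rewrite /r; field; rewrite !gt_eqF.
rewrite gE in Is.
have IG0 a b : 0 <= I a b (fun x => G (v x)) by apply: I_ge0 => x _; exact: G_ge0.
have IN0 a b : 0 <= I a b (fun x => `|v x|) by apply: I_ge0.
have o2i : 0 <= (o ^+ 2)^-1 by rewrite invr_ge0 ltW.
have Ivs : I s (s + 4 * r) (fun x => `|v x|) <= 8 * C / d * r.
  by have := mulr_ge0 o2i (IG0 s (s + 4 * r)); move: Is; clear; lra.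
have IGs : 2 * I s (s + 4 * r) (fun x => G (v x)) < r.
  have H1 : (o ^+ 2)^-1 * I s (s + 4 * r) (fun x => G (v x)) <= 8 * C / d * r.
    by have := IN0 s (s + 4 * r); move: Is; clear; lra.
  rewrite mulrC ler_pdivrMr// in H1.
  have H2 : 8 * C / d * r * o ^+ 2 <= r / 4 * o.
    have -> : 8 * C / d * r * o ^+ 2 = (32 * C * o / d) * (r / 4 * o) by field; rewrite gt_eqF.
    rewrite ler_piMl//; first by rewrite mulr_ge0 ?ltW// divr_gt0.
    by rewrite ler_pdivrMr// mul1r.
  have H3 : r * o <= r / 25 by rewrite ler_pdivlMr// -mulrA ler_piMr ?(ltW r0)// mulrC.
  by move: H1 H2 H3 r0; clear; lra.
have [||c /andP[sc cs] vc] := @slope_point R s (s + r) v cv.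
- by rewrite ltrDl.
- apply: le_lt_trans (_ : _ <= 2 * I s (s + 4 * r) (fun x => G (v x))) _.
    apply: ler_wpM2l => //; apply: I_sub_le => //; [by move=> x _; exact: G_ge0|by rewrite lerDl ltW|].
    by rewrite lerD2l; move: r0; clear; lra.
  by rewrite addrAC subrr add0r.
have [||c' /andP[sc' cs'] vc'] := @slope_point R (s + 3 * r) (s + 4 * r) v cv.
- by rewrite ltrD2l; move: r0; clear; lra.
- apply: le_lt_trans (_ : _ <= 2 * I s (s + 4 * r) (fun x => G (v x))) _.
    apply: ler_wpM2l => //; apply: I_sub_le => //; [by move=> x _; exact: G_ge0|move: r0; clear; lra|].
    by rewrite lerD2l; move: r0; clear; lra.
  by apply: lt_le_trans IGs _; rewrite le_eqVlt; apply/orP; left; apply/eqP; ring.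
pose rho := (c' - c) / 2.
have rho1 : r <= rho by rewrite /rho; move: cs sc' r0; clear; lra.
have rho2 : rho <= 2 * r by rewrite /rho; move: cs' sc r0; clear; lra.
have rho0 : 0 < rho by apply: lt_le_trans rho1.
have As : h2arc s (s + 4 * r) u v z.
  by apply: (arc_sub A); [apply: le_trans ys|apply: le_trans sy _].
have near x x' : s <= x <= s + 4 * r -> s <= x' <= s + 4 * r -> `|u x' - u x| <= 8 * C / d * r.
  by move=> h1 h2; apply: le_trans (arc_near As h1 h2) Ivs.
have cin : s <= c <= s + 4 * r by move: sc cs r0; clear; lra.
have c'in : s <= c' <= s + 4 * r by move: sc' cs' r0; clear; lra.
have k0 : 0 <= 8 * C / d by apply: divr_ge0; [apply: mulr_ge0 => //|]; exact: ltW.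
have VE : V = 2 + 2 * (8 * C / d) by rewrite /V /gateV; field; rewrite gt_eqF.
have [|w1 [v1 [z1 [B1 [w1l v1l] [w1r v1r] b1]]]] := @connector R c rho (u c) (v c) (u c) 0 V rho0.
  by rewrite subrr !normr0 mul0r !addr0 VE; move: vc k0; clear; lra.
have [|w2 [v2 [z2 [B2 [w2l v2l] [w2r v2r] b2]]]] := @connector R (c + rho) rho (u c) 0 (u c') (v c') V rho0.
  have : `|u c' - u c| / rho <= 8 * C / d.
    rewrite ler_pdivrMr//; apply: le_trans (near _ _ cin c'in) _.
    by apply: ler_wpM2l.
  by rewrite normr0 add0r VE; move: vc' k0; clear; lra.
have ec : c + rho + rho = c' by rewrite /rho; field.
rewrite ec in B2 w2r v2r b2.
have cr : c <= c + rho by rewrite lerDl ltW.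
have rc : c + rho <= c' by rewrite -ec lerDl ltW.
have cc' := le_trans cr rc.
have [B Be] := arc_paste (hh e) beta cf cr rc B1 B2 (etrans w1r (esym w2l)) (etrans v1r (esym v2l)).
have m1 : w1 (c + rho) = w2 (c + rho) by rewrite w1r w2l.
have m2 : v1 (c + rho) = v2 (c + rho) by rewrite v1r v2l.
have yc : y <= c by apply: le_trans ys _; case/andP: cin.
have c'y : c' <= y + d * o by apply: le_trans sy; case/andP: c'in.
have [||||u2 [v3 [z3 [A3 in3 out3 E3]]]] := replace_arc (hh e) beta cf A (le_trans y0 yc) cc' (le_trans c'y y1) B.
- by rewrite pasteL.
- by rewrite pasteL.
- by rewrite pasteR'.
- by rewrite pasteR'.
have Dc : gateC beta L C d = 72 * V ^+ 2 + 8 * beta * (C + 1 + V + L) ^+ 2 by [].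
set D := gateC beta L C d in Dc *.
have D72 : 72 * V ^+ 2 <= D.
  rewrite Dc lerDl; apply: mulr_ge0; last exact: sqr_ge0.
  by apply: mulr_ge0 => //; exact: ltW.
have VV : 2 * V <= V ^+ 2 by rewrite expr2 ler_pM2r//; apply: lt_le_trans V2.
have Vr : 8 * C / d * r + 2 * V * r <= D * o ^+ 4.
  apply: (@le_trans _ _ (3 * V * (2 * o ^+ 4))).
    apply: (@le_trans _ _ (3 * V * r)).
      by rewrite -mulrDl; apply: ler_wpM2r; [exact: ltW|move: VE V2 k0; clear; lra].
    by apply: ler_wpM2l => //; move: V2; clear; lra.
  rewrite [3 * V * _]mulrA; apply: ler_wpM2r; [exact: ltW|move: D72 VV V2; clear; lra].
have k0r : 0 <= 8 * C / d * r by apply: mulr_ge0 => //; exact: ltW.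
have V0 : 0 <= V by apply: le_trans V2.
have V0r : 0 <= 2 * V * r by apply: mulr_ge0; [apply: mulr_ge0|exact: ltW].
have bnd x : c <= x <= c' -> [/\ `|paste (c + rho) z1 z2 x| <= 4 * V / r,
    `|paste (c + rho) v1 v2 x| <= V & `|paste (c + rho) w1 w2 x - u c| <= 2 * V * r].
  have ir : 4 * V / rho <= 4 * V / r.
    by apply: ler_wpM2l; [apply: mulr_ge0|rewrite lef_pV2 ?posrE].
  have ir2 : V * rho <= 2 * V * r by have := ler_wpM2l V0 rho2; clear; lra.
  move=> /andP[cx xc]; rewrite /paste; case: (leP x (c + rho)) => xr.
    by have [] := b1 x (ltac:(by rewrite cx)) => h1 h2 h3; split=> //; [exact: le_trans ir|exact: le_trans ir2].
  by have [] := b2 x (ltac:(by rewrite xc ltW)) => h1 h2 h3; split=> //; [exact: le_trans ir|exact: le_trans ir2].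
exists u2, v3, z3, (c + rho); exists (c, c') => //=.
have um : u2 (c + rho) = u c.
  by have [-> _] := in3 (c + rho) (ltac:(by rewrite cr rc)); rewrite pasteL ?w1r.
split => //.
- split; first by have [_ ->] := in3 (c + rho) (ltac:(by rewrite cr rc)); rewrite pasteL ?v1r.
  rewrite E3 -addrA lerD2l.
  have E0 := @E_ge0 R (hh e) beta f (ltW (hh_gt0 e0 e1)) (ltW be0) c c' u v z.
  apply: (@le_trans _ _ (E (hh e) beta f c c' (paste (c + rho) w1 w2) (paste (c + rho) v1 v2) (paste (c + rho) z1 z2))).
    by rewrite gerDr oppr_le0.
  apply: (le_trans (@E_bound R (hh e) beta f (ltW (hh_gt0 e0 e1)) (ltW be0) cf c c' _ _ _ (4 * V / r) V (C + 1 + V + L) cc' B _)).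
    move=> x xc; have [b3 b4 b5] := bnd x xc; split => //.
    have -> : paste (c + rho) w1 w2 x - f x = (paste (c + rho) w1 w2 x - u c) + (u c - f c) + (f c - f x) by ring.
    apply: le_trans (ler_normD _ _) _.
    apply: le_trans (lerD (ler_normD _ _) (lexx _)) _.
    have g1 : `|u c - f c| <= C by apply: Iu; rewrite yc (le_trans cc').
    have x1 : `|c - x| <= 1.
      rewrite ler_norml; move: xc y0 y1 yc c'y; clear; lra.
    have g2 := le_trans (fL x c) (ler_wpM2l L0 x1).
    have r25 : 2 * r <= 1.
      have : o ^+ 4 <= 1 / 25.
        have -> : o ^+ 4 = o ^+ 3 * o by ring.
        apply: (@le_trans _ _ (1 * o)).
          by apply: ler_wpM2r; [exact: ltW|rewrite exprn_ile1//; [exact: ltW|move: o1 o0; clear; lra]].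
        by move: o1; clear; lra.
      by move: r2; clear; lra.
    have g3 : 2 * V * r <= V by rewrite mulrAC ler_piMl.
    by move: b5 g1 g2 g3; clear; lra.
  apply: (@le_trans _ _ ((hh e * (4 * V / r) ^+ 2 + V ^+ 2 + beta * (C + 1 + V + L) ^+ 2) * (4 * r))).
    apply: ler_pM; last by move: cs' sc; clear; lra.
    - apply: addr_ge0; [apply: addr_ge0; [|exact: G_ge0]|].
        by apply: mulr_ge0; [exact/ltW/hh_gt0|exact: sqr_ge0].
      by apply: mulr_ge0; [exact: ltW|exact: sqr_ge0].
    - by rewrite subr_ge0.
    - by rewrite lerD2r lerD2l; exact: G_le_sqr.
  have k1 : hh e * (4 * V / r) ^+ 2 * (4 * r) <= 64 * V ^+ 2 * o ^+ 4.
    have -> : hh e * (4 * V / r) ^+ 2 * (4 * r) = (64 * V ^+ 2) * (hh e / r) by field; rewrite gt_eqF.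
    apply: ler_wpM2l; first by apply: mulr_ge0 => //; exact: sqr_ge0.
    rewrite ler_pdivrMr//; apply: le_trans hh10 _.
    apply: (@le_trans _ _ (o ^+ 4 * o ^+ 4)); last by apply: ler_wpM2l => //; exact: ltW.
    have -> : o ^+ 10 = o ^+ 2 * (o ^+ 4 * o ^+ 4) by ring.
    rewrite ler_piMl//; first by apply: mulr_ge0; exact: ltW.
    by rewrite expr_le1//; [move: o1 o0; clear; lra|exact: ltW].
  have k2 : V ^+ 2 * (4 * r) <= 8 * V ^+ 2 * o ^+ 4.
    have -> : 8 * V ^+ 2 * o ^+ 4 = V ^+ 2 * (8 * o ^+ 4) by ring.
    by apply: ler_wpM2l; [exact: sqr_ge0|move: r2; clear; lra].
  have k3 : beta * (C + 1 + V + L) ^+ 2 * (4 * r) <= 8 * beta * (C + 1 + V + L) ^+ 2 * o ^+ 4.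
    have -> : 8 * beta * (C + 1 + V + L) ^+ 2 * o ^+ 4 = beta * (C + 1 + V + L) ^+ 2 * (8 * o ^+ 4) by ring.
    apply: ler_wpM2l; [by apply: mulr_ge0; [exact: ltW|exact: sqr_ge0]|move: r2; clear; lra].
  by rewrite Dc; move: k1 k2 k3; clear; lra.
- rewrite um subrr normr0; split => //.
    by apply: le_trans Vr; apply: addr_ge0.
  by apply: le_trans (near _ _ c'in cin) _; apply: le_trans Vr; rewrite lerDl.
- move=> x [xy|yx]; apply: out3; [left; exact: le_trans yc|right; exact: le_trans yx].
- move=> x; have [xc|cx] := leP x c.
    have [-> _] := out3 x (or_introl xc); rewrite subrr normr0.
    by apply: le_trans Vr; apply: addr_ge0.
  have [xc'|c'x] := leP x c'; last first.
    have [-> _] := out3 x (or_intror (ltW c'x)); rewrite subrr normr0.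
    by apply: le_trans Vr; apply: addr_ge0.
  have xin : c <= x <= c' by rewrite ltW.
  have [-> _] := in3 x xin; have [_ _ b5] := bnd x xin.
  have xs : s <= x <= s + 4 * r by move: xin cin c'in; clear; lra.
  have := near _ _ xs cin => nx.
  have -> : paste (c + rho) w1 w2 x - u x = (paste (c + rho) w1 w2 x - u c) + (u c - u x) by ring.
  apply: le_trans (ler_normD _ _) _; apply: le_trans Vr.
  by rewrite addrC; apply: lerD.
Qed.

Lemma E_shift {R : realType} (h beta : R) (f u v z : R -> R) (a b d k : R) : 0 <= h -> 0 <= beta -> continuous f ->
  h2arc a b u v z ->
  E h beta f (a + d) (b + d) (fun x => u (x - d) + k) (fun x => v (x - d)) (fun x => z (x - d)) =
  E h beta f a b u v z + beta * I a b (fun x => (u x + k - f (x + d)) ^+ 2 - (u x - f x) ^+ 2).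
Proof.
move=> h0 be0 cf A; have [cu cv mz iz P] := A.
have cu' : continuous (fun x => u x + k) by move=> x; apply: cvgD; [exact: cu|exact: cvg_cst].
have cf' : continuous (fun x => f (x + d)).
  move=> x; apply: (continuous_comp (f := fun x => x + d) (g := f)); last exact: cf.
  by apply: cvgD; [exact: cvg_id|exact: cvg_cst].
have id1 := ig_dens h beta cf A.
have iq1 : ig a b (fun x => (u x + k - f (x + d)) ^+ 2).
  by apply: ig_sqr_continuous => x; apply: cvgB; [exact: cu'|exact: cf'].
have iq2 : ig a b (fun x => (u x - f x) ^+ 2).
  by apply: ig_sqr_continuous => x; apply: cvgB; [exact: cu|exact: cf].
have A1 : h2arc a b (fun x => u x + k) v z.
  by have := @arc_shift R a b 0 u v z k A; rewrite !addr0; under eq_fun do rewrite subr0;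
     under [X in h2arc _ _ _ X]eq_fun do rewrite subr0; under [X in h2arc _ _ _ _ X]eq_fun do rewrite subr0.
have id2 := ig_dens h beta cf' A1.
pose g x := h * z x ^+ 2 + G (v x) + beta * (u x + k - f (x + d)) ^+ 2.
have mg : measurable_fun [set: R] g.
  apply: measurable_funD.
    apply: measurable_funD.
      by apply: measurable_funM => //; exact: measurable_funX.
    by apply: measurable_continuous; exact: (comp_continuous (@G_continuous R) cv).
  apply: measurable_funM => //; apply: measurable_continuous; apply: sqr_continuous => x.
  by apply: cvgB; [exact: cu'|exact: cf'].
have [_ S] := shift_integral d mg id2.
have -> : E h beta f (a + d) (b + d) (fun x => u (x - d) + k) (fun x => v (x - d)) (fun x => z (x - d)) = I a b g.
  by rewrite -S; apply: I_eq => x _; rewrite /dens /g subrK.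
rewrite /E -I_scale ?ig_sub2// -I_add//; last by apply: ig_scale; exact: ig_sub2.
by apply: I_eq => x _; rewrite /dens /g; ring.
Qed.

(** Two adjacent blocks between points of slope 0 can be exchanged; after vertical shifts the
    values match again, and only the fidelity term notices. *)
Lemma swap {R : realType} (h beta : R) (f : R -> R) (u v z : R -> R) (m a b c : R) :
  0 <= h -> 0 <= beta -> continuous f -> h2arc 0 1 u v z ->
  (forall w v' z', h2arc 0 1 w v' z' -> m <= E h beta f 0 1 w v' z') ->
  0 <= a -> a <= b -> b <= c -> c <= 1 -> v a = 0 -> v b = 0 -> v c = 0 ->
  m <= E h beta f 0 1 u v z
    + beta * (I b c (fun x => (u x + (u a - u b) - f (x - (b - a))) ^+ 2 - (u x - f x) ^+ 2)
            + I a b (fun x => (u x + (u c - u b) - f (x + (c - b))) ^+ 2 - (u x - f x) ^+ 2)).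
Proof.
move=> h0 be0 cf A M a0 ab bc c1 va vb vc.
have ac := le_trans ab bc.
have A1 : h2arc b c u v z by apply: (arc_sub A) => //; apply: le_trans ab.
have A2 : h2arc a b u v z by apply: (arc_sub A) => //; apply: le_trans c1.
have A3 : h2arc a c u v z by apply: (arc_sub A).
have B1 := arc_shift (- (b - a)) (u a - u b) A1; have B2 := arc_shift (c - b) (u c - u b) A2.
have F1 := E_shift (- (b - a)) (u a - u b) h0 be0 cf A1.
have F2 := E_shift (c - b) (u c - u b) h0 be0 cf A2.
set w1 := fun x => _ in B1 F1; set v1 := fun x => v _ in B1 F1; set z1 := fun x => z _ in B1 F1.
set w2 := fun x => _ in B2 F2; set v2 := fun x => v _ in B2 F2; set z2 := fun x => z _ in B2 F2.
have e1 : b - (b - a) = a by ring. have e2 : b + (c - b) = c by ring.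
rewrite e1 in B1 F1; rewrite e2 in B2 F2.
pose d := c - (b - a).
have ed : a + (c - b) = d by rewrite /d; ring.
rewrite -/d in B1 F1; rewrite ed in B2 F2.
have ad : a <= d by rewrite -ed lerDl subr_ge0.
have dc : d <= c by rewrite /d lerBlDr lerDl subr_ge0.
have w1a : w1 a = u a by rewrite /w1 (_ : a - - (b - a) = b); [ring|ring].
have v1a : v1 a = v a by rewrite /v1 (_ : a - - (b - a) = b) ?vb ?va//; ring.
have w1d : w1 d = u c + (u a - u b) by rewrite /w1 (_ : d - - (b - a) = c)// /d; ring.
have w2d : w2 d = u a + (u c - u b) by rewrite /w2 (_ : d - (c - b) = a)// /d; ring.
have v1d : v1 d = 0 by rewrite /v1 (_ : d - - (b - a) = c)// /d; ring.
have v2d : v2 d = 0 by rewrite /v2 (_ : d - (c - b) = a)// /d; ring.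
have w2c : w2 c = u c by rewrite /w2 (_ : c - (c - b) = b); [ring|ring].
have v2c : v2 c = v c by rewrite /v2 (_ : c - (c - b) = b) ?vb ?vc//; ring.
have m1 : w1 d = w2 d by rewrite w1d w2d; ring.
have m2 : v1 d = v2 d by rewrite v1d v2d.
have [B Be] := arc_paste h beta cf ad dc B1 B2 m1 m2.
have [||||u2 [v3 [z3 [A4 _ _ E4]]]] := replace_arc h beta cf A a0 ac c1 B.
- by rewrite pasteL.
- by rewrite pasteL.
- by rewrite pasteR'.
- by rewrite pasteR'.
have := M _ _ _ A4; rewrite E4 Be F1 F2 (E_split h beta cf A3 ab bc); clear; lra.
Qed.

Section exchange.
Context {R : realType}.
Variables (h beta L D o g m : R) (f u v z : R -> R).
Hypotheses (h0 : 0 <= h) (be0 : 0 < beta) (L0 : 0 <= L) (D0 : 0 <= D) (o0 : 0 <= o).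
Hypothesis fL : forall x y, `|f y - f x| <= L * `|y - x|.
Hypothesis A : h2arc 0 1 u v z.
Hypothesis M : forall w v' z', h2arc 0 1 w v' z' -> m <= E h beta f 0 1 w v' z'.
Hypothesis Em : E h beta f 0 1 u v z <= m + g.
Hypothesis uf : forall x, 0 <= x <= 1 -> `|u x - f x| <= D * o.

Let cf : continuous f. Proof. exact: lipschitz_continuous_fun fL. Qed.
Let cu : continuous u. Proof. by case: A. Qed.

Let jump x y : 0 <= x -> x <= y -> y <= 1 -> y - x <= o -> `|u y - u x| <= (2 * D + L) * o.
Proof.
move=> x0 xy y1 yx.
have -> : u y - u x = (u y - f y) + (f y - f x) - (u x - f x) by ring.
apply: le_trans (ler_normB _ _) _; apply: le_trans (lerD (ler_normD _ _) (lexx _)) _.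
have h1 := uf (ltac:(by rewrite (le_trans x0 xy)) : 0 <= y <= 1).
have h2 := uf (ltac:(by rewrite x0 (le_trans xy)) : 0 <= x <= 1).
have h3 := fL x y; rewrite (ger0_norm (_ : 0 <= y - x)) ?subr_ge0// in h3.
have h4 := ler_wpM2l L0 yx.
by move: h1 h2 h3 h4; lra.
Qed.

Let long_block p q k d : 0 <= p -> p <= q -> q <= 1 -> q - p <= o -> `|d| <= o -> `|k| <= (2 * D + L) * o ->
  I p q (fun x => (u x + k - f (x + d)) ^+ 2 - (u x - f x) ^+ 2) <=
  k * (2 * I p q (fun x => u x - f x) + (q - p) * k) + `|d| * o ^+ 2 * (L * (6 * D + 3 * L)).
Proof.
move=> p0 pq q1 qp dl kl.
have cw : continuous (fun x => u x - f x) by move=> x; apply: cvgB; [exact: cu|exact: cf].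
have cf' : continuous (fun x => f (x + d)).
  move=> x; apply: (continuous_comp (f := fun x => x + d) (g := f)); last exact: cf.
  by apply: cvgD; [exact: cvg_id|exact: cvg_cst].
have cu' : continuous (fun x => u x + k) by move=> x; apply: cvgD; [exact: cu|exact: cvg_cst].
pose B := L * `|d| * ((6 * D + 3 * L) * o).
apply: (@le_trans _ _ (I p q (fun x => (k * (2 * (u x - f x))) + (k * k + B)))).
  have i1 : ig p q (fun x => (u x + k - f (x + d)) ^+ 2).
    by apply: ig_sqr_continuous => x; apply: cvgB; [exact: cu'|exact: cf'].
  have i2 : ig p q (fun x => (u x - f x) ^+ 2) by exact: ig_sqr_continuous.
  apply: I_le; [exact: ig_sub2| |].
    apply: ig_add; last exact: ig_cst.
    by apply: ig_scale; apply: ig_scale; exact: ig_continuous.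
  move=> x xpq; set w := u x - f x; set Y := f x - f (x + d).
  have -> : u x + k - f (x + d) = w + k + Y by rewrite /w /Y; ring.
  have -> : (w + k + Y) ^+ 2 - w ^+ 2 = k * (2 * w) + k * k + Y * (2 * w + 2 * k + Y) by ring.
  rewrite [leRHS]addrA lerD2l.
  have Yd : `|Y| <= L * `|d|.
    by rewrite /Y distrC; apply: le_trans (fL _ _) _; rewrite addrAC subrr add0r.
  have wl : `|w| <= D * o by apply: uf; move: xpq p0 q1; lra.
  apply: le_trans (ler_norm _) _; rewrite normrM; apply: ler_pM => //.
  apply: le_trans (ler_normD _ _) _; apply: le_trans (lerD (ler_normD _ _) (lexx _)) _.
  have n2 t : `|2 * t| = 2 * `|t| :> R by rewrite normrM ger0_norm.
  by rewrite !n2; have := ler_wpM2l L0 dl; move: Yd wl kl; lra.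
have iw : ig p q (fun x => u x - f x) by exact: ig_continuous.
have i2w : ig p q (fun x => 2 * (u x - f x)) by exact: ig_scale.
rewrite (I_add (ig_scale k i2w) (ig_cst p q (k * k + B))) (I_scale k i2w) (I_scale 2 iw) I_cst//.
have : B * (q - p) <= B * o.
  apply: ler_wpM2l => //; apply: mulr_ge0; first exact: mulr_ge0.
  by apply: mulr_ge0 => //; apply: addr_ge0; exact: mulr_ge0.
rewrite /B; lra.
Qed.

Let short_block p q k d : 0 <= p -> p <= q -> q <= 1 -> `|d| <= o -> `|k| <= (2 * D + L) * o ->
  I p q (fun x => (u x + k - f (x + d)) ^+ 2 - (u x - f x) ^+ 2) <=
  (q - p) * o ^+ 2 * (3 * D + 2 * L) ^+ 2.
Proof.
move=> p0 pq q1 dl kl.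
have cw : continuous (fun x => u x - f x) by move=> x; apply: cvgB; [exact: cu|exact: cf].
have cf' : continuous (fun x => f (x + d)).
  move=> x; apply: (continuous_comp (f := fun x => x + d) (g := f)); last exact: cf.
  by apply: cvgD; [exact: cvg_id|exact: cvg_cst].
have cu' : continuous (fun x => u x + k) by move=> x; apply: cvgD; [exact: cu|exact: cvg_cst].
have -> : (q - p) * o ^+ 2 * (3 * D + 2 * L) ^+ 2 = (((3 * D + 2 * L) * o) ^+ 2) * (q - p) by ring.
apply: I_bound => //.
  have i1 : ig p q (fun x => (u x + k - f (x + d)) ^+ 2).
    by apply: ig_sqr_continuous => x; apply: cvgB; [exact: cu'|exact: cf'].
  have i2 : ig p q (fun x => (u x - f x) ^+ 2) by exact: ig_sqr_continuous.
  exact: ig_sub2.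
move=> x xpq; apply: (@le_trans _ _ ((u x + k - f (x + d)) ^+ 2)).
  by rewrite gerBl sqr_ge0.
rewrite -(real_normK (num_real (u x + k - f (x + d)))) ler_sqr ?nnegrE//; last first.
  by apply: mulr_ge0 => //; apply: addr_ge0; exact: mulr_ge0.
have -> : u x + k - f (x + d) = (u x - f x) + k + (f x - f (x + d)) by ring.
apply: le_trans (ler_normD _ _) _; apply: le_trans (lerD (ler_normD _ _) (lexx _)) _.
have wl : `|u x - f x| <= D * o by apply: uf; move: xpq p0 q1; lra.
have Yd : `|f x - f (x + d)| <= L * `|d|.
  by rewrite distrC; apply: le_trans (fL _ _) _; rewrite addrAC subrr add0r.
by have := ler_wpM2l L0 dl; move: Yd wl kl; lra.
Qed.

Let small_sum (l X : R) : 0 <= l ->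
  l * o ^+ 2 * (L * (6 * D + 3 * L)) + l * o ^+ 2 * (3 * D + 2 * L) ^+ 2 <= l * o ^+ 2 * (3 * D + 3 * L) ^+ 2.
Proof.
move=> l0; rewrite -mulrDr; apply: ler_wpM2l; first by apply: mulr_ge0 => //; exact: sqr_ge0.
have := sqr_ge0 L; lra.
Qed.

(** The exchange lifts the block [b, c] by the drop u a - u b; that both blocks are also
    moved sideways matters little because [a, b] is short and f is Lipschitz. *)
Lemma exchange_right a b c : 0 <= a -> a <= b -> b <= c -> c <= 1 -> b - a <= o -> c - b <= o ->
  v a = 0 -> v b = 0 -> v c = 0 ->
  - ((b - a) * o ^+ 2 * (3 * D + 3 * L) ^+ 2 + g / beta) <=
  (u a - u b) * (2 * I b c (fun x => u x - f x) + (c - b) * (u a - u b)).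
Proof.
move=> a0 ab bc c1 bao cbo va vb vc.
have b1 := le_trans bc c1; have b0 := le_trans a0 ab.
have S := swap h0 (ltW be0) cf A M a0 ab bc c1 va vb vc.
have ba : 0 <= b - a by rewrite subr_ge0. have cb : 0 <= c - b by rewrite subr_ge0.
have j1 : `|u a - u b| <= (2 * D + L) * o by rewrite distrC; exact: jump.
have j2 : `|u c - u b| <= (2 * D + L) * o by exact: jump.
have := @long_block b c (u a - u b) (- (b - a)) b0 bc c1 cbo; rewrite normrN ger0_norm// => /(_ bao j1) B1.
have := @short_block a b (u c - u b) (c - b) a0 ab b1; rewrite ger0_norm// => /(_ cbo j2) B2.
have B3 := small_sum 0 ba.
have : - (g / beta) <= I b c (fun x => (u x + (u a - u b) - f (x - (b - a))) ^+ 2 - (u x - f x) ^+ 2)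
            + I a b (fun x => (u x + (u c - u b) - f (x + (c - b))) ^+ 2 - (u x - f x) ^+ 2).
  rewrite -mulNr ler_pdivrMr// mulrC; move: S Em; lra.
move: B1 B2 B3; lra.
Qed.

(** Mirror image of exchange_right: the block [a, b] is lowered by u b - u c, and [b, c] is
    short. *)
Lemma exchange_left a b c : 0 <= a -> a <= b -> b <= c -> c <= 1 -> b - a <= o -> c - b <= o ->
  v a = 0 -> v b = 0 -> v c = 0 ->
  - ((c - b) * o ^+ 2 * (3 * D + 3 * L) ^+ 2 + g / beta) <=
  (u b - u c) * (- 2 * I a b (fun x => u x - f x) + (b - a) * (u b - u c)).
Proof.
move=> a0 ab bc c1 bao cbo va vb vc.
have b1 := le_trans bc c1; have b0 := le_trans a0 ab.
have S := swap h0 (ltW be0) cf A M a0 ab bc c1 va vb vc.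
have ba : 0 <= b - a by rewrite subr_ge0. have cb : 0 <= c - b by rewrite subr_ge0.
have j1 : `|u a - u b| <= (2 * D + L) * o by rewrite distrC; exact: jump.
have j2 : `|u c - u b| <= (2 * D + L) * o by exact: jump.
have := @long_block a b (u c - u b) (c - b) a0 ab b1 bao; rewrite ger0_norm// => /(_ cbo j2) B1.
have := @short_block b c (u a - u b) (- (b - a)) b0 bc c1; rewrite normrN ger0_norm// => /(_ bao j1) B2.
have B3 := small_sum 0 cb.
have : - (g / beta) <= I b c (fun x => (u x + (u a - u b) - f (x - (b - a))) ^+ 2 - (u x - f x) ^+ 2)
            + I a b (fun x => (u x + (u c - u b) - f (x + (c - b))) ^+ 2 - (u x - f x) ^+ 2).
  rewrite -mulNr ler_pdivrMr// mulrC; move: S Em; lra.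
move: B1 B2 B3; lra.
Qed.

End exchange.

(** * The position of a drop *)

Lemma minimal_opp {R : realType} (h beta : R) (f u v z : R -> R) : minimal h beta f u v z ->
  minimal h beta (fun x => - f x) (fun x => - u x) (fun x => - v x) (fun x => - z x).
Proof.
move=> [A M].
have Eo (w v' z' : R -> R) : E h beta (fun x => - f x) 0 1 (fun x => - w x) (fun x => - v' x) (fun x => - z' x) =
    E h beta f 0 1 w v' z'.
  by apply: I_eq => x _; rewrite /dens /G !sqrrN -opprD sqrrN.
split; first exact: arc_opp.
move=> w v' z' B; rewrite Eo; have := M _ _ _ (arc_opp B); rewrite -Eo.
suff -> : E h beta f 0 1 (fun x => - w x) (fun x => - v' x) (fun x => - z' x) = E h beta (fun x => - f x) 0 1 w v' z'.
  by rewrite Eo.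
apply: I_eq => x _; rewrite /dens /G !sqrrN.
by have -> : (- w x - f x) ^+ 2 = (w x - - f x) ^+ 2 by ring.
Qed.

Lemma tame_opp {R : realType} (beta e C : R) (f u v z : R -> R) : tame beta f e C u v z ->
  tame beta (fun x => - f x) e C (fun x => - u x) (fun x => - v x) (fun x => - z x).
Proof.
move=> [t1 t2]; split; last by move=> x x01; rewrite -opprD normrN; exact: t2.
move=> p q p0 pq q1 qp; have [h1 h2 h3 h4] := t1 p q p0 pq q1 qp; split => //.
- apply: le_trans h1; rewrite le_eqVlt; apply/orP; left; apply/eqP.
  by apply: I_eq => x _; rewrite /dens /G !sqrrN -opprD sqrrN.
- apply: le_trans h2; rewrite le_eqVlt; apply/orP; left; apply/eqP.
  by apply: I_eq => x _; rewrite /= opprK.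
- apply: le_trans h4; rewrite le_eqVlt; apply/orP; left; apply/eqP.
  by apply: I_eq => x _; rewrite normrN.
Qed.

Lemma tame_long {R : realType} (beta e C : R) (f u v z : R -> R) (n : nat) (p q : R) :
  0 < e -> 625 * e <= 1 -> continuous f -> h2arc 0 1 u v z -> tame beta f e C u v z ->
  0 <= p -> p <= q -> q <= 1 -> q - p <= n.+1%:R * om e ->
  EE e beta f p q u v z <= n.+1%:R * (C * om e ^+ 3) /\ I p q (fun x => `|v x|) <= n.+1%:R * (C * om e).
Proof.
move=> e0 e1 cf A [t1 t2]; have o0 := ltW (om_gt0 e0 e1); have [cu cv mz iz P] := A.
elim: n p => [|n IH] p p0 pq q1 qp.
  by rewrite !mul1r; rewrite mul1r in qp; have [] := t1 p q p0 pq q1 qp.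
have C0 : 0 <= C * om e ^+ 3.
  by have [h _ _ _] := t1 0 0 (lexx 0) (lexx 0) ler01 (ltac:(by rewrite subrr)); apply: le_trans h; rewrite /E I_empty.
have C0' : 0 <= C * om e.
  by have [_ _ _ h] := t1 0 0 (lexx 0) (lexx 0) ler01 (ltac:(by rewrite subrr)); apply: le_trans h; rewrite I_empty.
have [qpo|qpo] := leP (q - p) (om e).
  have [h1 _ _ h4] := t1 p q p0 pq q1 qpo; have n1 : 1 <= (n.+2%:R : R) by rewrite ler1n.
  by split; [apply: le_trans h1 _; rewrite ler_peMl|apply: le_trans h4 _; rewrite ler_peMl].
have pp : p <= p + om e by rewrite lerDl.
have pq' : p + om e <= q by move: qpo; clear; lra.
have [h1 _ _ h4] := t1 p (p + om e) p0 pp (le_trans pq' q1) (ltac:(by rewrite addrAC subrr add0r)).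
have [h5 h6] : EE e beta f (p + om e) q u v z <= n.+1%:R * (C * om e ^+ 3) /\ I (p + om e) q (fun x => `|v x|) <= n.+1%:R * (C * om e).
  apply: IH => //; first exact: le_trans pp.
  by move: qp; rewrite -[n.+2%:R]natr1; clear; lra.
have iv : ig p q (fun x => `|v x|) by apply: ig_norm; exact: ig_continuous.
rewrite (E_split (hh e) beta cf (arc_sub A p0 q1) pp pq') (I_split iv pp pq') -[n.+2%:R]natr1 !mulrDl !mul1r.
by split; rewrite addrC; exact: lerD.
Qed.

(** Up to the flat part, u can only rise where v has positive excess. *)
Lemma slope_le {R : realType} (k t : R) : 0 < k -> t <= T t + (k + 5 * G t / k) / 2.
Proof.
move=> k0; have [t0|t0] := leP 0 t; last first.
  apply: le_trans (ltW t0) _; have /andP[T0 _] := T_bounds t.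
  apply: addr_ge0 => //; apply: divr_ge0 => //; apply: addr_ge0; first exact: ltW.
  by apply: divr_ge0; [apply: mulr_ge0 => //; exact: G_ge0|exact: ltW].
have := flat_part t k0; rewrite (@T_le1 _ (- t)); last by move: t0; clear; lra.
by rewrite ger0_norm// addr0.
Qed.

Lemma I_cst_scale {R : realType} (a b k r : R) (g : R -> R) : a <= b -> ig a b g ->
  I a b (fun x => k + r * g x) = k * (b - a) + r * I a b g.
Proof.
move=> ab ig1; have i2 : ig a b (fun x => r * g x) by exact: ig_scale.
by rewrite (I_add (ig_cst a b k) i2) I_scale// I_cst.
Qed.

Lemma rise_le {R : realType} (h beta k : R) (f u v z : R -> R) (a b x y : R) :
  0 <= h -> 0 <= beta -> continuous f -> 0 < k -> h2arc a b u v z -> a <= x -> x <= y -> y <= b ->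
  u y - u x <= I x y (T \o v) + (k * (y - x) + 5 * E h beta f a b u v z / k) / 2.
Proof.
move=> h0 be0 cf k0 A ax xy yb; have [cu cv mz iz P] := A; have [_ ->] := P x y ax xy yb.
have iT : ig x y (T \o v) by apply: ig_continuous; exact: (comp_continuous (@T_continuous R) cv).
have iG : ig x y (fun x => G (v x)) by apply: ig_continuous; exact: (comp_continuous (@G_continuous R) cv).
have A' := arc_sub A ax yb.
have g1 := le_trans (I_G_le_E h0 be0 cf A') (E_mono h0 be0 cf A ax xy yb).
apply: (@le_trans _ _ (I x y (fun x => (T \o v) x + (k / 2 + 5 / k / 2 * G (v x))))).
  apply: I_le; [exact: ig_continuous| |].
    by apply: ig_add => //; apply: ig_add; [exact: ig_cst|exact: ig_scale].
  move=> r _; apply: le_trans (slope_le (v r) k0) _; rewrite le_eqVlt; apply/orP; left; apply/eqP.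
  by rewrite /=; field; rewrite gt_eqF.
rewrite I_add//; last by apply: ig_add; [exact: ig_cst|exact: ig_scale].
rewrite lerD2l (I_cst_scale _ _ xy iG).
have k5 : 0 <= 5 / k / 2 by rewrite !divr_ge0// ltW.
have := ler_wpM2l k5 g1.
have -> : 5 / k / 2 * E h beta f a b u v z = 5 * E h beta f a b u v z / k / 2 by field; rewrite gt_eqF.
clear; lra.
Qed.

Lemma drop_ge {R : realType} (h beta k : R) (f u v z : R -> R) (a b x y : R) :
  0 <= h -> 0 <= beta -> continuous f -> 0 < k -> h2arc a b u v z -> a <= x -> x <= y -> y <= b ->
  I x y (fun x => T (- v x)) - I x y (T \o v) - (k * (y - x) + 5 * E h beta f a b u v z / k) / 2 <= u x - u y.
Proof.
move=> h0 be0 cf k0 A ax xy yb; have [cu cv mz iz P] := A.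
have cN : continuous (fun x => - v x) by move=> r; apply: cvgN; exact: cv.
have iT : ig x y (T \o v) by apply: ig_continuous; exact: (comp_continuous (@T_continuous R) cv).
have iN : ig x y (fun x => T (- v x)) by apply: ig_continuous; exact: (comp_continuous (@T_continuous R) cN).
have iG : ig x y (fun x => G (v x)) by apply: ig_continuous; exact: (comp_continuous (@G_continuous R) cv).
have A' := arc_sub A ax yb.
have g1 := le_trans (I_G_le_E h0 be0 cf A') (E_mono h0 be0 cf A ax xy yb).
have -> : u x - u y = I x y (fun x => - v x).
  have [_ e] := P x y ax xy yb; rewrite I_opp; last exact: ig_continuous.
  by rewrite -e; ring.
have iR : ig x y (fun x => k / 2 + 5 / k / 2 * G (v x)) by apply: ig_add; [exact: ig_cst|exact: ig_scale].
apply: (@le_trans _ _ (I x y (fun x => T (- v x) - (T \o v) x - (k / 2 + 5 / k / 2 * G (v x))))).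
  rewrite I_sub//; last exact: ig_sub2.
  rewrite I_sub// lerD2l lerN2 (I_cst_scale _ _ xy iG).
  have k5 : 0 <= 5 / k / 2 by rewrite !divr_ge0// ltW.
  have := ler_wpM2l k5 g1.
  have -> : 5 / k / 2 * E h beta f a b u v z = 5 * E h beta f a b u v z / k / 2 by field; rewrite gt_eqF.
  clear; lra.
apply: I_le; [by apply: ig_sub2 => //; exact: ig_sub2|exact: ig_continuous|].
move=> r _ /=; have /andP[T0 T1] := T_bounds (- v r).
have -> : k / 2 + 5 / k / 2 * G (v r) = (k + 5 * G (v r) / k) / 2 by field; rewrite gt_eqF.
have [v0|v0] := leP 0 (v r).
  have := slope_le (v r) k0; rewrite (@T_le1 _ (- v r)); [clear; lra|move: v0; clear; lra].
have /andP[T2 _] := T_bounds (v r).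
have F : 0 <= (k + 5 * G (v r) / k) / 2.
  apply: divr_ge0 => //; apply: addr_ge0; first exact: ltW.
  by apply: divr_ge0; [apply: mulr_ge0 => //; exact: G_ge0|exact: ltW].
rewrite normrN ltr0_norm// in T1; move: T1 T2 F; clear; lra.
Qed.

Lemma variation_le {R : realType} (h beta k : R) (f u v z : R -> R) (a b : R) :
  0 <= h -> 0 <= beta -> continuous f -> 0 < k -> h2arc a b u v z -> a <= b ->
  I a b (fun x => `|v x|) <= u b - u a + 2 * I a b (fun x => T (- v x)) + (k * (b - a) + 5 * E h beta f a b u v z / k).
Proof.
move=> h0 be0 cf k0 A ab; have [cu cv mz iz P] := A.
have cN : continuous (fun x => - v x) by move=> r; apply: cvgN; exact: cv.
have iN : ig a b (fun x => T (- v x)) by apply: ig_continuous; exact: (comp_continuous (@T_continuous R) cN).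
have iG : ig a b (fun x => G (v x)) by apply: ig_continuous; exact: (comp_continuous (@G_continuous R) cv).
have iv : ig a b v by exact: ig_continuous.
have g1 := I_G_le_E h0 be0 cf A.
have [_ ->] := P a b (lexx a) ab (lexx b).
have iR : ig a b (fun x => k + 5 / k * G (v x)) by apply: ig_add; [exact: ig_cst|exact: ig_scale].
apply: (@le_trans _ _ (I a b (fun x => v x + 2 * T (- v x) + (k + 5 / k * G (v x))))).
  apply: I_le; [exact: ig_norm| |].
    by apply: ig_add => //; apply: ig_add => //; exact: ig_scale.
  move=> r _; have -> : k + 5 / k * G (v r) = (k + 5 * G (v r) / k) by field; rewrite gt_eqF.
  have [v0|v0] := leP 0 (v r).
    have /andP[T0 _] := T_bounds (- v r).
    have F : 0 <= (k + 5 * G (v r) / k).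
      apply: addr_ge0; first exact: ltW.
      by apply: divr_ge0; [apply: mulr_ge0 => //; exact: G_ge0|exact: ltW].
    by rewrite ger0_norm//; move: T0 F; clear; lra.
  have := slope_le (- v r) k0; rewrite /G sqrrN ltr0_norm//; clear; lra.
rewrite I_add//; last by apply: ig_add => //; exact: ig_scale.
rewrite I_add//; last exact: ig_scale.
rewrite I_scale// lerD2l (I_cst_scale _ _ ab iG).
have k5 : 0 <= 5 / k by rewrite divr_ge0// ltW.
have := ler_wpM2l k5 g1.
have -> : 5 / k * E h beta f a b u v z = 5 * E h beta f a b u v z / k by field; rewrite gt_eqF.
clear; lra.
Qed.

(** By excess_cost the energy spent on J is of order J^(1/2) om^(5/2), so small portions are
    expensive: J = J^(1/2) J^(1/2) is at most eta1 / om^2 times the energy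
    if om^3 <= J <= eta1^2 om / 128. *)
Lemma small_excess {R : realType} (e : R) (u v z : R -> R) (p d eta1 : R) (n : nat) :
  0 < e -> 625 * e <= 1 -> 0 <= eta1 -> 0 <= d -> h2arc p (p + n%:R * d) u v z ->
  (forall i : nat, (i < n)%N -> exists2 c, p + i%:R * d <= c <= p + i.+1%:R * d & v c <= 1) ->
  (forall i : nat, (i < n)%N -> I (p + i%:R * d) (p + i.+1%:R * d) (T \o v) <= eta1 ^+ 2 / 128 * om e) ->
  I p (p + n%:R * d) (T \o v) <= n%:R * om e ^+ 3 + eta1 * (I p (p + n%:R * d) (sav e v z) / om e ^+ 2).
Proof.
move=> e0 e1 n0 d0 A good small; have [cu cv mz iz P] := A; have o0 := om_gt0 e0 e1.
have cT := comp_continuous (@T_continuous R) cv.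
rewrite (I_cells d0 (ig_continuous _ _ cT)) (I_cells d0 (@ig_sav R e _ _ u v z A)).
rewrite mulr_suml mulr_sumr -[n in n%:R * om e ^+ 3]card_ord mulr_natl -sumr_const -big_split/=.
apply: ler_sum => i _; have il := ltn_ord i.
have l1 : p + i%:R * d <= p + i.+1%:R * d by rewrite lerD2l ler_wpM2r// ler_nat.
have Ai : h2arc (p + i%:R * d) (p + i.+1%:R * d) u v z.
  apply: (arc_sub A); first by rewrite lerDl mulr_ge0.
  by rewrite lerD2l ler_wpM2r// ler_nat.
have sm := small i il; set P0 := I _ _ (T \o v) in sm *; set S := I _ _ (sav e v z).
have S0 : 0 <= S by apply: I_ge0 => x _; exact: sav_ge0.
have P00 : 0 <= P0 by apply: I_ge0 => x _; have /andP[] := T_bounds (v x).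
have o20 : 0 < om e ^+ 2 by rewrite exprn_gt0.
have ES : 0 <= eta1 * (S / om e ^+ 2) by apply: mulr_ge0 => //; apply: divr_ge0 => //; exact: ltW.
have [Po|Po] := leP P0 (om e ^+ 3); first by apply: le_trans Po _; rewrite lerDl.
apply: (@le_trans _ _ (eta1 * (S / om e ^+ 2))); last by rewrite lerDr exprn_ge0// ltW.
rewrite mulrA ler_pdivlMr//; apply: le_of_sqr; first exact: mulr_ge0.
have cost := excess_cost e0 e1 Ai l1 (good i il) (ltW Po); rewrite -/P0 -/S in cost.
have -> : (P0 * om e ^+ 2) ^+ 2 = (om e ^+ 4 * P0) * P0 by ring.
have s1 := ler_wpM2l (mulr_ge0 (exprn_ge0 4 (ltW o0)) P00) sm.
apply: le_trans s1 _.
have -> : om e ^+ 4 * P0 * (eta1 ^+ 2 / 128 * om e) = eta1 ^+ 2 / 128 * (om e ^+ 5 * P0) by ring.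
have -> : (eta1 * S) ^+ 2 = eta1 ^+ 2 / 128 * (128 * S ^+ 2) by field.
by apply: ler_wpM2l => //; apply: divr_ge0 => //; exact: sqr_ge0.
Qed.

Lemma I_affine {R : realType} (a b c k : R) : a <= b -> I a b (fun x => c + k * (x - a)) = c * (b - a) + k * (b - a) ^+ 2 / 2.
Proof.
move=> ab; pose F (x : R) := c * x + (k / 2) * (x - a) ^+ 2.
have <- : F b - F a = I a b (fun x => c + k * (x - a)).
  apply: ftc => //.
    move=> x; apply: cvgD; first exact: cvg_cst.
    by apply: cvgM; [exact: cvg_cst|apply: cvgB; [exact: cvg_id|exact: cvg_cst]].
  by move=> x; rewrite /F; apply: is_derive_eq; rewrite /= /GRing.scale/=; field.
by rewrite /F; field.
Qed.

(** Gates can be opened one after the other, since an arc that was changed elsewhere is as good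
    as the tame one. *)
Lemma gate_on {R : realType} (beta L C d e : R) (f u v z u1 v1 z1 : R -> R) (y : R) :
  0 < e -> 625 * e <= 1 -> 0 < beta -> 0 <= L -> (forall x y, `|f y - f x| <= L * `|y - x|) ->
  1 <= C -> 0 < d -> d <= 1 -> 32 * C * om e <= d ->
  h2arc 0 1 u v z -> tame beta f e C u v z -> h2arc 0 1 u1 v1 z1 -> 0 <= y -> y + d * om e <= 1 ->
  (forall x, y <= x <= y + d * om e -> u1 x = u x /\ v1 x = v x) ->
  exists u2 v2 z2 a, exists2 cc : R * R, [/\ y <= cc.1, cc.1 <= a, a <= cc.2 & cc.2 <= y + d * om e] &
    [/\ h2arc 0 1 u2 v2 z2, v2 a = 0 /\ EE e beta f 0 1 u2 v2 z2 <= EE e beta f 0 1 u1 v1 z1 + gateC beta L C d * om e ^+ 4,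
     [/\ `|v cc.1| <= 1, `|v cc.2| <= 1, `|u2 a - u cc.1| <= gateC beta L C d * om e ^+ 4 &
         `|u2 a - u cc.2| <= gateC beta L C d * om e ^+ 4],
     (forall x, x <= y \/ y + d * om e <= x -> u2 x = u1 x /\ v2 x = v1 x) &
     forall x, `|u2 x - u1 x| <= gateC beta L C d * om e ^+ 4].
Proof.
move=> e0 e1 be0 L0 fL C1 d0 d1 dC A tm A1 y0 y1 eq1; have [t1 t2] := tm.
have cf : continuous f by exact: lipschitz_continuous_fun fL.
have o0 := om_gt0 e0 e1; have o1 := om_le e0 e1.
have yy : y <= y + d * om e by rewrite lerDl; apply: mulr_ge0; exact: ltW.
have [h1 _ _ h4] := t1 y (y + d * om e) y0 yy y1 (ltac:(by rewrite addrAC subrr add0r ler_piMl// ltW)).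
have g1 := le_trans (I_G_le_E (ltW (hh_gt0 e0 e1)) (ltW be0) cf (arc_sub A y0 y1)) h1.
have [|||u2 [v2 [z2 [a [[c c'] /= cin H]]]]] := @gate R beta L C d e f u1 v1 z1 y e0 e1 be0 L0 fL C1 d0 d1 dC A1 y0 y1.
- by rewrite (@I_eq _ _ _ _ (fun x => `|v x|))// => x /eq1[_ ->].
- by rewrite (@I_eq _ _ _ _ (fun x => G (v x)))// => x /eq1[_ ->].
- move=> x xin; have [-> _] := eq1 x xin; apply: le_trans (t2 x _) _.
    by move: xin y0 y1; clear; lra.
  have C0 : 0 <= C by apply: le_trans C1.
  by rewrite ger_pMr ?(lt_le_trans ltr01 C1)//; move: o1 o0; clear; lra.
case: cin => i1 i2 i3 i4.
have [e2 e3] : u1 c = u c /\ v1 c = v c by apply: eq1; rewrite i1 (le_trans i2)// (le_trans i3).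
have [e4 e5] : u1 c' = u c' /\ v1 c' = v c' by apply: eq1; rewrite i4 (le_trans i1)// (le_trans i2).
rewrite e2 e3 e4 e5 in H.
by exists u2, v2, z2, a; exists (c, c').
Qed.

(** In units of om, a length far below the one at which cancel_window ceases to apply. *)
Definition zeta {R : realType} (beta C : R) : R := ((1 + beta) * C ^+ 2)^-1 / 200.

Lemma zeta_bounds {R : realType} (beta C : R) : 0 < beta -> 1 <= C ->
  [/\ 0 < zeta beta C, 200 * zeta beta C <= 1 & 200 * (beta * C ^+ 2 * zeta beta C) <= 1].
Proof.
move=> be0 C1; have C2 : 1 <= C ^+ 2 by rewrite exprn_ege1.
have b1 : 1 <= 1 + beta by rewrite lerDl ltW.
have D1 : 1 <= (1 + beta) * C ^+ 2 by rewrite -[leLHS]mulr1 ler_pM.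
have D0 : 0 < (1 + beta) * C ^+ 2 by apply: lt_le_trans D1.
have X0 : 0 < ((1 + beta) * C ^+ 2)^-1 by rewrite invr_gt0.
have X1 : ((1 + beta) * C ^+ 2)^-1 <= 1 by rewrite invf_le1.
have XD : beta * C ^+ 2 * ((1 + beta) * C ^+ 2)^-1 <= 1.
  rewrite ler_pdivrMr// mul1r; apply: ler_wpM2r; first by apply: le_trans C2.
  by rewrite lerDr.
by rewrite /zeta; move: X0 X1 XD; set X := _^-1; clear; split; lra.
Qed.

(** The real-number core of drop_position. *)
Lemma drop_algebra {R : realType} (J Jt ux ux' fa fb fx' sig m s s0 A0 R' zo lo o L : R) :
  0 <= A0 -> 0 < m -> 0 < zo -> 0 < o -> 8 * zo <= o -> 0 <= L ->
  J = ux - ux' -> Jt <= J + A0 ->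
  - R' <= 2 * (ux' + 2 * A0 - fb) - (sig - m) * s + Jt ->
  - R' <= 2 * (fa - ux + 2 * A0) - (sig - m) * s0 + Jt ->
  zo / 2 <= s -> zo / 2 <= s0 -> s0 <= 2 * zo -> fa - fb <= L * lo -> fa - fx' <= L * lo ->
  40 * A0 <= m * zo -> 8 * (L * lo) <= m * zo -> 8 * R' <= m * zo ->
  sig <= 2 * m /\ (- 2 * m <= sig -> ux' - fx' <= - (J / 2) + m * o).
Proof.
move=> A00 m0 zo0 o0 zoo L0 JE JtJ H1 H2 s1 s2 s3 fab fax k1 k2 k3; split.
  rewrite leNgt; apply/negP => sm.
  have : m * zo < (sig - m) * (s + s0).
    apply: (@lt_le_trans _ _ ((sig - m) * zo)).
      by rewrite ltr_pM2r//; move: sm; clear; lra.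
    by apply: ler_wpM2l; [move: sm m0; clear; lra|move: s1 s2; clear; lra].
  by move: H1 H2 JtJ fab k1 k2 k3; rewrite JE; clear - A00; lra.
move=> sm.
have h : - (sig - m) * s0 <= 3 * m * (2 * zo).
  apply: (@le_trans _ _ (3 * m * s0)).
    by apply: ler_wpM2r; [move: s2 zo0; clear; lra|move: sm; clear; lra].
  by apply: ler_wpM2l => //; move: m0; clear; lra.
have := ler_wpM2l (ltW m0) zoo.
by move: H2 JtJ fax k1 k2 k3 h; rewrite JE; clear - A00; lra.
Qed.

(** If the exchange of the drop with the block to its left does not pay, then on average u is at
    most half the drop above f before it, hence at least half the drop below f after it. If that with
    the block to its right does not pay, then on average u is at most half the drop below f after it.
    As u can hardly rise near the drop, both together bound the slope sig of f from above. *)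
Lemma drop_position {R : realType} (beta L C eta m d sig e : R) (f u v z : R -> R) (y : R) :
  0 < e -> 625 * e <= 1 -> 0 < beta -> 0 <= L -> (forall x y, `|f y - f x| <= L * `|y - x|) ->
  1 <= C -> minimal (hh e) beta f u v z -> tame beta f e C u v z ->
  0 < eta -> 0 < m -> 0 < d -> 8 * d <= zeta beta C -> 24 * (L * d) <= m * zeta beta C ->
  192 * ((6 * C + 3 * L) ^+ 2 * d) <= m * (eta * zeta beta C ^+ 2) ->
  32 * C * om e <= d -> 4 * gateC beta L C d * om e <= C -> 16 * C * om e <= eta ->
  160 * C * om e <= m * zeta beta C ->
  256 * (gateC beta L C d * om e) <= m * (eta * zeta beta C ^+ 2 * beta) ->
  om e <= y -> y + d * om e <= 1 - om e ->
  (forall s t, y - om e <= s -> s <= t -> t <= y + d * om e + om e -> `|f t - f s - sig * (t - s)| <= m * (t - s)) ->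
  eta * om e <= I y (y + d * om e) (fun x => T (- v x)) ->
  exists x x', [/\ y - d * om e <= x <= y /\ y + d * om e <= x' <= y + 2 * d * om e,
    `|v x| <= 1 /\ `|v x'| <= 1,
    I (y - d * om e) (y + 4 * d * om e) (T \o v) < om e ^+ 3,
    sig <= 2 * m &
    - 2 * m <= sig -> u x' - f x' <= - (I x x' (fun x => T (- v x)) / 2) + 2 * m * om e].
Proof.
move=> e0 e1 be0 L0 fL C1 M tm eta0 m0 d0 dz dL dE oC og oe om1 og2 y0 y1 aff HN.
have [z0 z1 z2] := zeta_bounds be0 C1; set ze := zeta beta C in z0 z1 z2 dz dL dE om1 og2 *.
have cf : continuous f by exact: lipschitz_continuous_fun fL.
have o0 := om_gt0 e0 e1; have o1 := om_le e0 e1.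
have hh0 := ltW (hh_gt0 e0 e1).
have A := M.1; have [cu cv mz iz P] := A.
have cN : continuous (fun x => - v x) by move=> r; apply: cvgN; exact: cv.
have iT a b : ig a b (T \o v) by apply: ig_continuous; exact: (comp_continuous (@T_continuous R) cv).
have iN a b : ig a b (fun x => T (- v x)) by apply: ig_continuous; exact: (comp_continuous (@T_continuous R) cN).
have T0 (t : R) : 0 <= T t by have /andP[] := T_bounds t.
have [t1 t2] := tm.
set o := om e in o0 o1 oC og oe om1 og2 y0 y1 aff HN t1 t2 *.
pose lam := d * o; pose zo := ze * o.
have lam0 : 0 < lam by apply: mulr_gt0.
have zo0 : 0 < zo by apply: mulr_gt0.
have lamz : 8 * lam <= zo by rewrite /lam mulrA; apply: ler_wpM2r => //; exact: ltW.
have zoo : 200 * zo <= o by rewrite /zo mulrA ler_piMl// ltW.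
rewrite -/lam in HN y1 aff *.
have e2 : 2 * d * o = 2 * lam by rewrite /lam mulrA. have e4 : 4 * d * o = 4 * lam by rewrite /lam mulrA.
rewrite e2 e4.
have C0 : 0 < C by apply: lt_le_trans C1.
have d1 : d <= 1 by move: dz z1; clear; lra.
(* every interval of length lam contains a point of slope at most 1 *)
have pt a : 0 <= a -> a + lam <= 1 -> exists2 x, a <= x <= a + lam & `|v x| <= 1.
  move=> a0 a1; apply: slope_point => //; first by rewrite ltrDl.
  have al : a <= a + lam by rewrite lerDl ltW.
  have [h1 _ _ _] := t1 a (a + lam) a0 al a1 (ltac:(by rewrite addrAC subrr add0r; move: lamz zoo o0 zo0; clear; lra)).
  have g1 := le_trans (I_G_le_E hh0 (ltW be0) cf (arc_sub A a0 a1)) h1.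
  rewrite addrAC subrr add0r.
  apply: le_lt_trans (ler_wpM2l (ler0n _ 2) g1) _.
  apply: (@lt_le_trans _ _ (32 * C * o * o)).
    have -> : 2 * (C * o ^+ 3) = 2 * o * (C * o * o) by ring.
    have -> : 32 * C * o * o = 32 * (C * o * o) by ring.
    rewrite ltr_pM2r; first by move: o1; clear; lra.
    by apply: mulr_gt0 => //; exact: mulr_gt0.
  by apply: ler_wpM2r => //; exact: ltW.
have [||g0 /andP[g01 g02] vg0] := pt (y - zo - 2 * lam); [move: y0 zoo lamz zo0; clear; lra|move: y1 zoo lamz zo0 lam0; clear; lra|].
have [||g1 /andP[g11 g12] vg1] := pt (y + zo + 2 * lam); [move: y0 zoo lamz zo0 lam0 o0; clear; lra|move: y1 zoo lamz zo0; clear; lra|].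
have g0g1 : g0 < g1 by move: g02 g11 zo0 lam0; clear; lra.
have g00 : 0 <= g0 by move: g01 y0 zoo lamz zo0; clear; lra.
have g1l : g1 <= 1 by move: g12 y1 zoo lamz zo0 lam0; clear; lra.
have glen : g1 - g0 <= 3 * zo by move: g01 g12 lamz lam0; clear; lra.
(* hence there is hardly any positive excess near the drop *)
have CW := @cancel_window R e beta f C g0 g1 u v z e0 e1 be0 cf C1 M tm g00 g0g1 g1l.
rewrite -/o in CW.
have {}CW : Num.min (I g0 g1 (fun x => T (- v x))) (I g0 g1 (T \o v)) < o ^+ 3.
  apply: CW => //.
    apply: (@le_lt_trans _ _ (36 * beta * C ^+ 2 * (3 * zo))).
      apply: ler_wpM2l => //; apply: mulr_ge0; last exact: sqr_ge0.
      by apply: mulr_ge0 => //; exact: ltW.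
    have -> : 36 * beta * C ^+ 2 * (3 * zo) = 108 * (beta * C ^+ 2 * ze) * o by rewrite /zo; ring.
    by rewrite gtr_pMl//; move: z2; set X := beta * _ * _; clear; lra.
  by move: glen zoo o0; clear; lra.
have No : o ^+ 3 <= I g0 g1 (fun x => T (- v x)).
  apply: (@le_trans _ _ (I y (y + lam) (fun x => T (- v x)))).
    apply: le_trans HN.
    have -> : o ^+ 3 = o ^+ 2 * o by ring.
    apply: ler_wpM2r; first exact: ltW.
    apply: le_trans oe; rewrite expr2; apply: ler_wpM2r; first exact: ltW.
    by move: o1 C1; clear; lra.
  apply: I_sub_le => //; [by move: g02 zo0 lam0; clear; lra|by rewrite lerDl ltW|move: g11 zo0 lam0; clear; lra].
have {CW}PW : I g0 g1 (T \o v) < o ^+ 3.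
  by move: CW; rewrite gt_min => /orP[|//]; rewrite ltNge No.
have [EW _ _ _] := t1 g0 g1 g00 (ltW g0g1) g1l (ltac:(by move: glen zoo o0; clear; lra)).
have Ag := arc_sub A g00 g1l.
pose A0 := 4 * (C * o ^+ 2).
have o20 : 0 < o ^+ 2 by apply: exprn_gt0.
have A00 : 0 < A0 by apply: mulr_gt0 => //; exact: mulr_gt0.
have o3 : 25 * o ^+ 3 <= o ^+ 2.
  by have := ler_wpM2r (ltW o20) o1; rewrite mul1r -mulrA -exprS.
have o2C : o ^+ 2 <= C * o ^+ 2 by rewrite ler_peMl// ltW.
have flat x x' : x <= x' -> g0 <= x -> x' <= g1 -> (o * (x' - x) + 5 * EE e beta f g0 g1 u v z / o) / 2 <= (o ^+ 2 + 5 * (C * o ^+ 2)) / 2.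
  move=> xx gx xg; have h1 : 5 * EE e beta f g0 g1 u v z / o <= 5 * (C * o ^+ 2).
    rewrite ler_pdivrMr//; have := ler_wpM2l (ler0n R 5) EW.
    by have -> : 5 * (C * o ^+ 2) * o = 5 * (C * o ^+ 3) by ring.
  have h2 : o * (x' - x) <= o ^+ 2.
    rewrite expr2; apply: ler_wpM2l; [exact: ltW|move: gx xg glen zoo zo0 o0; clear; lra].
  by move: h1 h2; clear; lra.
have rise x x' : g0 <= x -> x <= x' -> x' <= g1 -> u x' - u x <= A0.
  move=> gx xx xg; have h1 := rise_le hh0 (ltW be0) cf o0 Ag gx xx xg.
  have h2 := flat x x' xx gx xg.
  have h3 : I x x' (T \o v) <= o ^+ 3.
    by apply: le_trans (ltW PW); apply: I_sub_le => // r _; exact: T0.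
  by move: h1 h2 h3 o3 o2C o20; rewrite /A0; clear; lra.
have drop x x' : g0 <= x -> x <= x' -> x' <= g1 -> I x x' (fun x => T (- v x)) - A0 <= u x - u x'.
  move=> gx xx xg; have h1 := drop_ge hh0 (ltW be0) cf o0 Ag gx xx xg.
  have h2 := flat x x' xx gx xg.
  have h3 : I x x' (T \o v) <= o ^+ 3.
    by apply: le_trans (ltW PW); apply: I_sub_le => // r _; exact: T0.
  by move: h1 h2 h3 o3 o2C o20; rewrite /A0; clear; lra.
(* gates at c0, a, b and c make both exchanges possible *)
pose Dg := gateC beta L C d * o ^+ 4.
have Dg0 : 0 <= Dg.
  apply: mulr_ge0; last by apply: exprn_ge0; exact: ltW.
  by apply: addr_ge0; apply: mulr_ge0 => //; try exact: sqr_ge0; apply: mulr_ge0 => //; exact: ltW.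
have DgA : 4 * Dg <= A0.
  have -> : 4 * Dg = (4 * gateC beta L C d * o) * o ^+ 3 by rewrite /Dg; ring.
  apply: le_trans (ler_wpM2r _ og) _; first by apply: exprn_ge0; exact: ltW.
  rewrite /A0; have := ler_wpM2l (ltW C0) o3; have := mulr_gt0 C0 o20.
  by have := mulr_ge0 (ltW C0) (exprn_ge0 3 (ltW o0)); clear; lra.
have GG (u' v' z' : R -> R) yy : h2arc 0 1 u' v' z' -> 0 <= yy -> yy + lam <= 1 ->
  (forall x, yy <= x <= yy + lam -> u' x = u x /\ v' x = v x) ->
  exists u2 v2 z2 a, exists2 cc : R * R, [/\ yy <= cc.1, cc.1 <= a, a <= cc.2 & cc.2 <= yy + lam] &
    [/\ h2arc 0 1 u2 v2 z2, v2 a = 0 /\ EE e beta f 0 1 u2 v2 z2 <= EE e beta f 0 1 u' v' z' + Dg,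
     [/\ `|v cc.1| <= 1, `|v cc.2| <= 1, `|u2 a - u cc.1| <= Dg & `|u2 a - u cc.2| <= Dg],
     (forall x, x <= yy \/ yy + lam <= x -> u2 x = u' x /\ v2 x = v' x) &
     forall x, `|u2 x - u' x| <= Dg].
  by move=> A' yy0 yy1 H; exact: (gate_on e0 e1 be0 L0 fL C1 d0 d1 oC A tm A' yy0 yy1 H).
have [||//|u1 [v1 [z1' [c0 [[p1 p2] /= [q1 q2 q3 q4] [A1 [s1 E1] _ out1 dif1]]]]]] := GG u v z (y - lam - zo) A.
- by move: y0 zoo lamz zo0; clear; lra.
- by move: y1 zoo lamz zo0 lam0 o0; clear; lra.
have [|||u2 [v2 [z2' [a [[p3 x] /= [q5 q6 q7 q8] [A2 [s2 E2] [_ vx _ uax] out2 dif2]]]]]] := GG u1 v1 z1' (y - lam) A1.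
- by move: y0 zoo lamz zo0; clear; lra.
- by move: y1 zoo lamz zo0 lam0 o0; clear; lra.
- by move=> r rin; apply: out1; right; move: rin lamz zo0; clear; lra.
have [|||u3 [v3 [z3' [b [[x' p4] /= [q9 q10 q11 q12] [A3 [s3 E3] [vx' _ ubx _] out3 dif3]]]]]] := GG u2 v2 z2' (y + lam) A2.
- by move: y0 o0 lam0; clear; lra.
- by move: y1 zoo lamz zo0 lam0 o0; clear; lra.
- move=> r rin; have [|-> ->] := out2 r; first by right; move: rin lam0; clear; lra.
  by apply: out1; right; move: rin lamz zo0; clear; lra.
have [|||u4 [v4 [z4' [c [[p5 p6] /= [q13 q14 q15 q16] [A4 [s4 E4] _ out4 dif4]]]]]] := GG u3 v3 z3' (y + lam + zo) A3.
- by move: y0 o0 lam0 zo0; clear; lra.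
- by move: y1 zoo lamz zo0 lam0 o0; clear; lra.
- move=> r rin; have [|-> ->] := out3 r; first by right; move: rin lamz zo0; clear; lra.
  have [|-> ->] := out2 r; first by right; move: rin lam0 zo0; clear; lra.
  by apply: out1; right; move: rin lamz zo0; clear; lra.
rewrite subrK in q8.
have vc0 : v4 c0 = 0.
  have [|_ ->] := out4 c0; first by left; move: q3 q4 lamz zo0 lam0; clear; lra.
  have [|_ ->] := out3 c0; first by left; move: q3 q4 lamz zo0 lam0; clear; lra.
  by have [|_ ->] := out2 c0; first by left; move: q3 q4 lamz zo0 lam0; clear; lra.
have [va ua] : v4 a = 0 /\ u4 a = u2 a.
  have [|-> ->] := out4 a; first by left; move: q7 q8 lam0 zo0; clear; lra.
  by have [|-> ->] := out3 a; first by left; move: q7 q8 lam0 zo0; clear; lra.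
have [vb ub] : v4 b = 0 /\ u4 b = u3 b.
  by have [|-> ->] := out4 b; first by left; move: q11 q12 lamz lam0 zo0; clear; lra.
have dif r : `|u4 r - u r| <= A0.
  have -> : u4 r - u r = (u4 r - u3 r) + (u3 r - u2 r) + (u2 r - u1 r) + (u1 r - u r) by ring.
  apply: le_trans (ler_normD _ _) _; apply: le_trans (lerD (ler_normD _ _) (lexx _)) _.
  apply: le_trans (lerD (lerD (ler_normD _ _) (lexx _)) (lexx _)) _.
  by move: (dif1 r) (dif2 r) (dif3 r) (dif4 r) DgA; clear; lra.
have E5 : EE e beta f 0 1 u4 v4 z4' <= EE e beta f 0 1 u v z + 4 * Dg.
  by move: E1 E2 E3 E4; clear; lra.
have A0o : A0 <= C * o.
  have -> : A0 = 4 * o * (C * o) by rewrite /A0; ring.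
  by rewrite ler_piMl//; [apply: mulr_ge0; exact: ltW|move: o1 o0; clear; lra].
have uf4 r : 0 <= r <= 1 -> `|u4 r - f r| <= (2 * C) * o.
  move=> r01; have -> : u4 r - f r = (u4 r - u r) + (u r - f r) by ring.
  by apply: le_trans (ler_normD _ _) _; move: (dif r) (t2 r r01) A0o; clear; lra.
have c0a : c0 <= a by move: q3 q4 q5 q6 lamz zo0 lam0; clear; lra.
have ab : a <= b by move: q7 q8 q9 q10 lam0; clear; lra.
have bc : b <= c by move: q11 q12 q13 q14 lamz lam0 zo0; clear; lra.
have c00 : 0 <= c0 by move: q1 q2 y0 zoo lamz zo0; clear; lra.
have c1 : c <= 1 by move: q15 q16 y1 zoo lamz zo0 lam0; clear; lra.
have bal : b - a <= 3 * lam by move: q5 q6 q11 q12; clear; lra.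
have cb1 : zo / 2 <= c - b by move: q11 q12 q13 q14 lamz lam0; clear; lra.
have cb2 : c - b <= 2 * zo by move: q9 q10 q15 q16 lamz zo0; clear; lra.
have ac1 : zo / 2 <= a - c0 by move: q3 q4 q5 q6 lamz lam0; clear; lra.
have ac2 : a - c0 <= 2 * zo by move: q1 q2 q7 q8 lamz zo0; clear; lra.
have C20 : 0 <= 2 * C by apply: mulr_ge0 => //; exact: ltW.
have bao : b - a <= o by move: bal lamz zoo zo0; clear; lra.
have cbo : c - b <= o by move: cb2 zoo zo0; clear; lra.
have aco : a - c0 <= o by move: ac2 zoo zo0; clear; lra.
have X1 := exchange_right hh0 be0 L0 C20 (ltW o0) fL A4 M.2 E5 uf4 (le_trans c00 c0a) ab bc c1 bao cbo va vb s4.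
have X2 := exchange_left hh0 be0 L0 C20 (ltW o0) fL A4 M.2 E5 uf4 c00 c0a ab (le_trans bc c1) aco bao vc0 va vb.
pose S := (6 * C + 3 * L) ^+ 2.
have S0 : 0 <= S by exact: sqr_ge0.
have S32 : (3 * (2 * C) + 3 * L) ^+ 2 = S by rewrite /S; congr (_ ^+ 2); ring.
rewrite S32 in X1 X2.
pose R0 := 3 * lam * (o ^+ 2 * S) + 4 * Dg / beta.
have baS : (b - a) * o ^+ 2 * S + 4 * Dg / beta <= R0.
  rewrite /R0 lerD2r -mulrA; apply: ler_wpM2r => //; apply: mulr_ge0 => //; exact: ltW.
have R00 : 0 <= R0.
  rewrite /R0; apply: addr_ge0.
    by apply: mulr_ge0; [apply: mulr_ge0 => //|apply: mulr_ge0 => //]; exact: ltW.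
  by apply: divr_ge0; [apply: mulr_ge0|exact: ltW].
pose Jt := u4 a - u4 b; rewrite -/Jt in X1 X2.
pose J := u x - u x'.
have JtJ : `|Jt - J| <= 2 * Dg.
  have -> : Jt - J = (u2 a - u x) - (u3 b - u x') by rewrite /Jt /J ua ub; ring.
  by apply: le_trans (ler_normB _ _) _; move: uax ubx; clear; lra.
rewrite ler_norml in JtJ.
have JN : I x x' (fun x => T (- v x)) - A0 <= J.
  apply: drop; [move: q6 q7 q5 g02 zo0 lam0|move: q8 q9 lam0|move: q10 q11 q12 g11 zo0 lam0]; clear; lra.
have NN : eta * o <= I x x' (fun x => T (- v x)).
  by apply: le_trans HN _; apply: I_sub_le => //; rewrite lerDl ltW.
have A0e : A0 <= eta * o / 4.
  have := ler_wpM2r (ltW o0) oe; rewrite /A0 expr2 mulrA; clear; lra.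
have eo0 : 0 < eta * o by apply: mulr_gt0.
have Jt0 : eta * o / 2 <= Jt by move: JtJ JN NN A0e DgA Dg0; clear; lra.
pose Rr := 2 * R0 / (eta * o).
have quot Q : - R0 <= Jt * Q -> - Rr <= Q.
  move=> H; have [Q0|Q0] := leP 0 Q.
    by apply: le_trans Q0; rewrite oppr_le0 divr_ge0// ?mulr_ge0// ltW.
  have H2 : Jt * Q <= eta * o / 2 * Q by rewrite ler_nM2r.
  rewrite /Rr -mulNr ler_pdivrMr//; move: (le_trans H H2); clear; lra.
have Y1 : - Rr <= 2 * I b c (fun x => u4 x - f x) + (c - b) * Jt.
  by apply: quot; move: X1 baS; clear; lra.
have Y2 : - Rr <= - 2 * I c0 a (fun x => u4 x - f x) + (a - c0) * Jt.
  by apply: quot; move: X2 baS; clear; lra.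
have iuf p q : ig p q (fun x => u4 x - f x).
  by apply: ig_continuous => r; apply: cvgB; [have [h _ _ _ _] := A4; exact: h|exact: cf].
have iaf p q k l : ig p q (fun r => k + l * (r - p)).
  apply: ig_continuous => r; apply: cvgD; first exact: cvg_cst.
  by apply: cvgM; [exact: cvg_cst|apply: cvgB; [exact: cvg_id|exact: cvg_cst]].
have Z1 : I b c (fun x => u4 x - f x) <= (u x' + 2 * A0 - f b) * (c - b) + - (sig - m) * (c - b) ^+ 2 / 2.
  rewrite -I_affine//; apply: I_le => // r /andP[br rc].
  have := aff b r (ltac:(move: q9 q10 q11 y0 o0 lam0 zo0; clear; lra)) br (ltac:(move: rc q15 q16 lamz zoo zo0; clear; lra)).
  rewrite ler_norml => h1.
  have h2 := rise x' r (ltac:(move: q9 g02 zo0 lam0; clear; lra)) (le_trans q10 br) (ltac:(move: rc q15 q16 g11; clear; lra)).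
  by move: (dif r); rewrite ler_norml; move: h1 h2; clear; lra.
have Z2 : (u x - 2 * A0 - f a + (sig - m) * (a - c0)) * (a - c0) + - (sig - m) * (a - c0) ^+ 2 / 2 <= I c0 a (fun x => u4 x - f x).
  rewrite -I_affine//; apply: I_le => // r /andP[cr ra].
  have := aff r a (ltac:(move: cr q1 q2 lamz zoo zo0; clear; lra)) ra (ltac:(move: q7 q8 o0 lam0; clear; lra)).
  rewrite ler_norml => h1.
  have h2 := rise r x (ltac:(move: cr q1 q2 g02; clear; lra)) (le_trans ra q7) (ltac:(move: q8 g11 zo0 lam0; clear; lra)).
  by move: (dif r); rewrite ler_norml; move: h1 h2; clear; lra.
pose R' := 2 * Rr / zo.
have Rr0 : 0 <= Rr by apply: divr_ge0; [apply: mulr_ge0|exact: ltW].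
have dv s K : zo / 2 <= s -> - Rr <= K * s -> - R' <= K.
  move=> s1' H; have s0 : 0 < s by apply: lt_le_trans s1'; apply: divr_gt0.
  have [K0|K0] := leP 0 K.
    by apply: le_trans K0; rewrite oppr_le0; apply: divr_ge0; [apply: mulr_ge0|exact: ltW].
  have H2 : K * s <= K * (zo / 2) by rewrite ler_nM2l.
  rewrite /R' -mulNr ler_pdivrMr//; move: (le_trans H H2); clear; lra.
have W1 : - R' <= 2 * (u x' + 2 * A0 - f b) - (sig - m) * (c - b) + Jt.
  by apply: (dv (c - b)) => //; move: Y1 Z1; clear; lra.
have W2 : - R' <= 2 * (f a - u x + 2 * A0) - (sig - m) * (a - c0) + Jt.
  by apply: (dv (a - c0)) => //; move: Y2 Z2; clear; lra.
have lip r r' : `|r - r'| <= 3 * lam -> f r - f r' <= L * (3 * lam).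
  by move=> H; apply: le_trans (ler_norm _) _; apply: le_trans (fL _ _) _; apply: ler_wpM2l.
have R'm : 8 * R' <= m * zo.
  have -> : 8 * R' = 32 * R0 / (eta * o * zo) by rewrite /R' /Rr; field; rewrite !gt_eqF.
  rewrite ler_pdivrMr; last by apply: mulr_gt0.
  have o30 : 0 <= o ^+ 3 by apply: exprn_ge0; exact: ltW.
  have h1 := ler_wpM2r o30 dE.
  have h2 := ler_wpM2r o30 og2.
  have h3 : 256 * Dg / beta <= m * (eta * ze ^+ 2) * o ^+ 3.
    rewrite ler_pdivrMr//; apply: le_trans (_ : _ <= 256 * (gateC beta L C d * o) * o ^+ 3) _.
      by rewrite /Dg le_eqVlt; apply/orP; left; apply/eqP; ring.
    by apply: le_trans h2 _; rewrite le_eqVlt; apply/orP; left; apply/eqP; ring.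
  have -> : 32 * R0 = 96 * (lam * (o ^+ 2 * S)) + 128 * Dg / beta by rewrite /R0; field; rewrite gt_eqF.
  have -> : m * zo * (eta * o * zo) = m * (eta * ze ^+ 2) * o ^+ 3 by rewrite /zo; ring.
  have h4 : 192 * (lam * (o ^+ 2 * S)) <= m * (eta * ze ^+ 2) * o ^+ 3.
    by apply: le_trans h1; rewrite /lam /S le_eqVlt; apply/orP; left; apply/eqP; ring.
  have -> : 128 * Dg / beta = (256 * Dg / beta) / 2 by field; rewrite gt_eqF.
  by move: h3 h4; clear; lra.
have k1 : 40 * A0 <= m * zo.
  by have := ler_wpM2r (ltW o0) om1; rewrite /A0 /zo expr2; clear; lra.
have k2 : 8 * (L * (3 * lam)) <= m * zo.
  by have := ler_wpM2r (ltW o0) dL; rewrite /lam /zo; clear; lra.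
have Jle : Jt <= J + A0 by move: JtJ DgA Dg0; clear; lra.
have fab : f a - f b <= L * (3 * lam).
  by apply: lip; rewrite ler_norml; move: ab bal lam0; clear; lra.
have fax : f a - f x' <= L * (3 * lam).
  by apply: lip; rewrite ler_norml; move: q5 q6 q7 q8 q9 q10 q11 q12 lam0; clear; lra.
have zo8 : 8 * zo <= o by move: zoo zo0; clear; lra.
have [D1 D2] := drop_algebra (ltW A00) m0 zo0 o0 zo8 L0 (erefl J) Jle W1 W2 cb1 ac1 ac2 fab fax k1 k2 R'm.
exists x, x'; split => //.
- by split; apply/andP; split; move: q5 q6 q7 q8 q9 q10 q11 q12; clear; lra.
- apply: le_lt_trans PW; apply: I_sub_le => //; [by move=> r _; exact: T0| | |]; move: g02 g11 lamz zo0 lam0; clear; lra.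
- move=> sm; apply: le_trans (D2 sm) _.
  have : m * zo <= m * o by apply: ler_wpM2l; [exact: ltW|move: zo8 zo0; clear; lra].
  by move: JN k1 A00; clear; lra.
Qed.

(** * Monotonicity on windows of length of order om *)

Definition CK {R : realType} (C : R) (K : nat) : R := K.+1%:R * C.

(** The parameters are chosen one after the other, each small in terms of the previous ones:
    eta1 measures which excess is significant, m how far f deviates from an affine function, d is
    the length of a slot in units of om, and finally om. *)
Record fine_scales {R : realType} (beta L C eta1 m d o : R) (K n : nat) : Prop := FineScales {
  fs_eta : 0 < eta1;
  fs_m : 0 < m;
  fs_d : 0 < d;
  fs_nd : n%:R * d = K%:R;
  fs_dz : 8 * d <= zeta beta C;
  fs_dL : 24 * (L * d) <= m * zeta beta C;
  fs_dE : 192 * ((6 * C + 3 * L) ^+ 2 * d) <= m * (eta1 ^+ 2 / 128 * zeta beta C ^+ 2);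
  fs_oC : 32 * C * o <= d;
  fs_og : 4 * gateC beta L C d * o <= C;
  fs_oe : 16 * C * o <= eta1 ^+ 2 / 128;
  fs_om : 160 * C * o <= m * zeta beta C;
  fs_og2 : 256 * (gateC beta L C d * o) <= m * (eta1 ^+ 2 / 128 * zeta beta C ^+ 2 * beta);
  fs_n : n%:R * o <= eta1;
  fs_CK : 3 * CK C K * o <= eta1;
  fs_gain : 12 * (beta * C * (18 * C * d + K%:R * (4 * m + 6 * CK C K * eta1 + 6 * m * K%:R))) <= 1;
  fs_var : 6 * CK C K * eta1 <= 1 }.

Section cells.
Context {R : realType}.
Variables (beta L C eta1 m d sig e p : R) (K n : nat).
Hypotheses (e0 : 0 < e) (e1 : 625 * e <= 1) (beta0 : 0 < beta) (L0 : 0 <= L) (C1 : 1 <= C).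
Local Notation o := (om e).
Hypothesis FS : fine_scales beta L C eta1 m d o K n.
Hypotheses (p0 : o <= p) (p1 : p + K%:R * o <= 1 - o).
Let lam := d * o.
Local Notation pt k := (p + k%:R * lam).

Let o0 : 0 < o := om_gt0 e0 e1.
Let o1 : 25 * o <= 1 := om_le e0 e1.
Let C0 : 0 < C. Proof. exact: lt_le_trans C1. Qed.
Let hh0 : 0 <= hh e := ltW (hh_gt0 e0 e1).
Let lam0 : 0 < lam. Proof. by rewrite mulr_gt0//; case: FS. Qed.
Let nlam : n%:R * lam = K%:R * o. Proof. by rewrite /lam mulrA; case: FS => _ _ _ ->. Qed.
Let K0 : 0 <= K%:R * o. Proof. by rewrite mulr_ge0// ltW. Qed.
Let CK1 : C + K%:R <= CK C K. Proof. by rewrite /CK -natr1 mulrDl mul1r addrC lerD2r ler_peMr. Qed.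
Let CK0 : 1 <= CK C K. Proof. by apply: le_trans CK1; have := ler0n R K; move: C1; lra. Qed.

Let pt_le (i j : nat) : (i <= j)%N -> pt i <= pt j.
Proof. by move=> ij; rewrite lerD2l; apply: ler_wpM2r; [exact: ltW|rewrite ler_nat]. Qed.

Let ptS (k : nat) : pt k.+1 = pt k + lam.
Proof. by rewrite -[k.+1%:R]natr1 mulrDl mul1r addrA. Qed.

Let pt_n : pt n = p + K%:R * o. Proof. by rewrite nlam. Qed.

Let pt_in (k : nat) : (k <= n)%N -> 0 <= pt k <= 1 - o.
Proof.
move=> kn; have := pt_le kn; rewrite pt_n => h.
have h2 := pt_le (leq0n k); rewrite mul0r addr0 in h2.
by rewrite (le_trans h p1) andbT; apply: le_trans h2; apply: le_trans p0; exact: ltW.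
Qed.

Definition affine_near (f : R -> R) := forall s t, p - o <= s -> s <= t -> t <= p + K%:R * o + o ->
  `|f t - f s - sig * (t - s)| <= m * (t - s).

(** The threshold is that of small_excess. *)
Definition significant (v : R -> R) (k : nat) := eta1 ^+ 2 / 128 * o <= I (pt k) (pt k.+1) (T \o v).

Section one_arc.
Variables (f u v z : R -> R).
Hypothesis fL : forall x y, `|f y - f x| <= L * `|y - x|.
Hypotheses (M : minimal (hh e) beta f u v z) (tm : tame beta f e C u v z).

Let cf : continuous f. Proof. exact: lipschitz_continuous_fun fL. Qed.
Let cv : continuous v. Proof. by case: M => [[]]. Qed.
Let be0 : 0 <= beta := ltW beta0.

Let energy x y : p <= x -> x <= y -> y <= p + K%:R * o -> EE e beta f x y u v z <= CK C K * o ^+ 3.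
Proof.
move=> px xy yp.
have [h _] := @tame_long R beta e C f u v z K x y e0 e1 cf M.1 tm (ltac:(move: p0 o0; lra)) xy (ltac:(move: p1 o0; lra)) (ltac:(rewrite -natr1 mulrDl mul1r; move: o0; lra)).
by move: h; rewrite mulrA.
Qed.

Let good_slot (k : nat) : (k < n)%N -> exists2 x, pt k <= x <= pt k.+1 & `|v x| <= 1.
Proof.
move=> kn; have [t1 _] := tm; have [h1 h2 h3 h4 h5 h6 h7 h8 h9 h10 _ _ _ _ _ _] := FS.
have k1 : 0 <= pt k by have /andP[] := pt_in (ltnW kn).
have k2 : pt k.+1 <= 1 by have /andP[_ h] := pt_in kn; apply: le_trans h _; move: o0; lra.
have [_ z1 _] := zeta_bounds beta0 C1.
have dle : d <= 1 by move: h5 z1 h3; lra.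
have kk : pt k < pt k.+1 by rewrite ptS ltrDl.
have len : pt k.+1 - pt k = lam by rewrite ptS addrAC subrr add0r.
apply: slope_point => //.
have [g1 _ _ _] := t1 (pt k) (pt k.+1) k1 (ltW kk) k2 (ltac:(by rewrite len ler_piMl// ltW)).
have g2 := le_trans (I_G_le_E hh0 be0 cf (arc_sub M.1 k1 k2)) g1.
rewrite len; apply: le_lt_trans (ler_wpM2l (ler0n _ 2) g2) _.
apply: (@lt_le_trans _ _ (32 * C * o * o)); last by apply: ler_wpM2r => //; exact: ltW.
have -> : 2 * (C * o ^+ 3) = 2 * o * (C * o * o) by ring.
have -> : 32 * C * o * o = 32 * (C * o * o) by ring.
rewrite ltr_pM2r; first by move: o1 o0; lra.
by apply: mulr_gt0 => //; exact: mulr_gt0.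
Qed.

(** Sum small_excess over the slots; the energy of the window pays for it. *)
Lemma insignificant_excess (i j : nat) : (i <= j)%N -> (j <= n)%N ->
  (forall k, (i <= k)%N -> (k < j)%N -> ~ significant v k) ->
  I (pt i) (pt j) (T \o v) <= 2 * CK C K * eta1 * o.
Proof.
move=> ij jn H; have [h1 _ _ _ _ _ _ _ _ _ _ _ h2 _ _ _] := FS.
have A : h2arc (pt i) (pt j) u v z.
  apply: (arc_sub M.1); first by have /andP[] := pt_in (leq_trans ij jn).
  by have /andP[_ h] := pt_in jn; apply: le_trans h _; move: o0; lra.
have shift k : pt i + k%:R * lam = pt (i + k)%N by rewrite natrD; ring.
have jE : pt j = pt i + (j - i)%:R * lam by rewrite shift subnKC.
have H3 : I (pt i) (pt i + (j - i)%:R * lam) (T \o v) <=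
   (j - i)%:R * o ^+ 3 + eta1 * (I (pt i) (pt i + (j - i)%:R * lam) (sav e v z) / o ^+ 2).
  apply: (@small_excess R e u v z (pt i) lam eta1 (j - i) e0 e1 (ltW h1) (ltW lam0)); rewrite -?jE//.
    move=> k kl; rewrite !shift addnS.
    have [|c cin vc] := @good_slot (i + k); first by rewrite (leq_trans _ jn)// -ltn_subRL.
    by exists c => //; apply: le_trans vc; exact: ler_norm.
  move=> k kl; rewrite !shift addnS leNgt; apply/negP => /ltW; apply: H; first exact: leq_addr.
  by rewrite -ltn_subRL.
rewrite -jE in H3; apply: le_trans H3 _.
have px : p <= pt i by have := pt_le (leq0n i); rewrite mul0r addr0.
have py : pt j <= p + K%:R * o by rewrite -pt_n; exact: pt_le.
have S1 := le_trans (@sav_le_E R e e0 e1 beta f be0 cf _ _ u v z A) (energy px (pt_le ij) py).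
have S2 : I (pt i) (pt j) (sav e v z) / o ^+ 2 <= CK C K * o.
  by rewrite ler_pdivrMr ?exprn_gt0// -mulrA -exprS.
have S3 := ler_wpM2l (ltW h1) S2.
have S4 : (j - i)%:R * o ^+ 3 <= eta1 * o.
  apply: (@le_trans _ _ (n%:R * o * (o * o))).
    have -> : n%:R * o * (o * o) = n%:R * o ^+ 3 by ring.
    apply: ler_wpM2r; first by rewrite exprn_ge0// ltW.
    by rewrite ler_nat (leq_trans (leq_subr _ _)).
  apply: ler_pM => //; [by rewrite mulr_ge0// ltW|by rewrite mulr_ge0// ltW|].
  by rewrite ler_piMl// ?(ltW o0)//; move: o1 o0; lra.
have S5 : 1 * (eta1 * o) <= CK C K * (eta1 * o) by apply: ler_wpM2r => //; rewrite mulr_ge0// ltW.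
move: S3 S4 S5; lra.
Qed.

Lemma drop_slot (k : nat) : (k < n)%N -> affine_near f -> significant (fun x => - v x) k ->
  exists x x', [/\ pt k - lam <= x <= pt k /\ pt k.+1 <= x' <= pt k.+1 + lam,
    `|v x| <= 1 /\ `|v x'| <= 1,
    forall j, (k <= j)%N -> significant v j -> (k.+3 < j)%N,
    sig <= 2 * m &
    - 2 * m <= sig -> u x' - f x' <= - (I x x' (fun x => T (- v x)) / 2) + 2 * m * o].
Proof.
move=> kn aff sk; have [h1 h2 h3 h4 h5 h6 h7 h8 h9 h10 h11 h12 h13 h14 h15 h16] := FS.
have eta0 : 0 < eta1 ^+ 2 / 128 by rewrite divr_gt0// exprn_gt0.
have a1 : p <= pt k by rewrite lerDl mulr_ge0// ltW.
have a2 : pt k + lam <= p + K%:R * o by rewrite -ptS -pt_n; exact: pt_le.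
have [||x [x' [x1 x2 x3 x4 x5]]] := @drop_position R beta L C (eta1 ^+ 2 / 128) m d sig e f u v z (pt k) e0 e1 beta0 L0 fL C1 M tm eta0 h2 h3 h5 h6 h7 h8 h9 h10 h11 h12 (le_trans p0 a1) (le_trans a2 p1).
- move=> s t s1 st t1; apply: aff => //; first by apply: le_trans s1; rewrite lerD2r.
  by apply: le_trans t1 _; rewrite lerD2r.
- by rewrite -/lam -ptS.
exists x, x'; split => //.
  have -> : pt k.+1 + lam = pt k + 2 * d * o by rewrite ptS /lam; ring.
  by rewrite ptS.
move=> j kj sj; rewrite ltnNge; apply/negP => jk.
have : eta1 ^+ 2 / 128 * o < o ^+ 3.
  apply: le_lt_trans x3; apply: le_trans sj _; apply: I_sub_le.
  - by apply: ig_continuous; exact: (comp_continuous (@T_continuous R) cv).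
  - by move=> r _; have /andP[] := T_bounds (v r).
  - by apply: (@le_trans _ _ (pt k)); [rewrite gerBl ltW|exact/pt_le].
  - exact: pt_le.
  - rewrite -/lam; apply: (@le_trans _ _ (pt k.+4)); first exact: pt_le.
    by rewrite !ptS -mulrA -/lam le_eqVlt; apply/orP; left; apply/eqP; ring.
have : o ^+ 3 <= eta1 ^+ 2 / 128 * o.
  have -> : o ^+ 3 = o ^+ 2 * o by ring.
  apply: ler_wpM2r; first exact: ltW.
  apply: le_trans h10; rewrite expr2; apply: ler_wpM2r; first exact: ltW.
  by move: o1 C1; lra.
by move=> h h'; move: (le_lt_trans h h'); rewrite ltxx.
Qed.
End one_arc.

Lemma affine_opp f : affine_near f ->
  forall s t, p - o <= s -> s <= t -> t <= p + K%:R * o + o ->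
  `|- f t - - f s - - sig * (t - s)| <= m * (t - s).
Proof.
move=> H s t s1 st t1; have := H s t s1 st t1; rewrite -normrN.
by congr (`|_| <= _); ring.
Qed.
End cells.

(** drop_slot for the reflected functions. *)
Lemma rise_slot {R : realType} (beta L C eta1 m d sig e p : R) (K n : nat) (f u v z : R -> R) :
  0 < e -> 625 * e <= 1 -> 0 < beta -> 0 <= L -> 1 <= C ->
  fine_scales beta L C eta1 m d (om e) K n -> om e <= p -> p + K%:R * om e <= 1 - om e ->
  (forall x y, `|f y - f x| <= L * `|y - x|) ->
  minimal (hh e) beta f u v z -> tame beta f e C u v z -> affine_near m sig e p K f ->
  forall k : nat, (k < n)%N -> significant eta1 d e p v k ->
  exists x x', [/\ p + k%:R * (d * om e) - d * om e <= x <= p + k%:R * (d * om e) /\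
      p + k.+1%:R * (d * om e) <= x' <= p + k.+1%:R * (d * om e) + d * om e,
    `|v x| <= 1 /\ `|v x'| <= 1 & - 2 * m <= sig].
Proof.
move=> e0 e1 be0 L0 C1 FS p0 p1 fL M tm aff k kn sk.
have fL' x y : `|- f y - - f x| <= L * `|y - x| by rewrite -opprD normrN.
have [|x [x' [h1 h2 _ h4 _]]] := drop_slot e0 e1 be0 L0 C1 FS p0 p1 fL' (minimal_opp M) (tame_opp tm) kn (affine_opp aff).
  by rewrite /significant (_ : _ \o _ = T \o v)//; apply/funext => r /=; rewrite opprK.
exists x, x'; split=> //; first by rewrite -[`|v x|]normrN -[`|v x'|]normrN.
by move: h4; clear; lra.
Qed.

(** After a drop, u stays below f by half of the drop, because f does not decrease fast;
    then a drop and the next rise could be cancelled at a profit. *)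
Lemma no_rise_after_drop {R : realType} (beta L C eta1 m d sig e p : R) (K n : nat) (f u v z : R -> R) :
  0 < e -> 625 * e <= 1 -> 0 < beta -> 0 <= L -> 1 <= C ->
  fine_scales beta L C eta1 m d (om e) K n -> om e <= p -> p + K%:R * om e <= 1 - om e ->
  (forall x y, `|f y - f x| <= L * `|y - x|) ->
  minimal (hh e) beta f u v z -> tame beta f e C u v z -> affine_near m sig e p K f ->
  forall i j : nat, (i <= j)%N -> (j < n)%N -> significant eta1 d e p (fun x => - v x) i ->
  significant eta1 d e p v j -> False.
Proof.
move=> e0 e1 be0 L0 C1 FS p0 p1 fL M tm aff i j' ij'' j'n si sj'.
have [x [x' [[/andP[x1 x2] /andP[x3 x4]] [vx vx'] far _ below]]] := drop_slot e0 e1 be0 L0 C1 FS p0 p1 fL M tm (leq_ltn_trans ij'' j'n) aff si.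
have ij' : (i < j')%N by apply: leq_trans (far j' ij'' sj'); rewrite 2?ltnW.
have cf : continuous f by exact: lipschitz_continuous_fun fL.
have [[cu cv mz iz P] _] := M.
have cN : continuous (fun x => - v x) by move=> r; apply: cvgN; exact: cv.
have iT a b : ig a b (T \o v) by apply: ig_continuous; exact: (comp_continuous (@T_continuous R) cv).
have iN a b : ig a b (fun x => T (- v x)) by apply: ig_continuous; exact: (comp_continuous (@T_continuous R) cN).
have T0 (t : R) : 0 <= T t by have /andP[] := T_bounds t.
(* the first rise after the drop *)
have [j [[ij jn sj] jmin]] : exists j, [/\ (i < j)%N, (j < n)%N & significant eta1 d e p v j] /\
   forall k, (i < k)%N -> (k < j)%N -> ~ significant eta1 d e p v k.
  have ex : exists j, (i < j)%N && `[< significant eta1 d e p v j >] by exists j'; rewrite ij'; apply/asboolP.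
  case: (ex_minnP ex) => j /andP[ij /asboolP sj] mn; exists j; split; first split => //.
    by apply: leq_ltn_trans j'n; apply: mn; rewrite ij'; apply/asboolP.
  move=> k ik kj sk; have := mn k; rewrite ik/= => /(_ (asboolT sk)).
  by rewrite leqNgt kj.
have [w [w' [[/andP[w1 w2] /andP[w3 w4]] [vw vw'] sm]]] := rise_slot e0 e1 be0 L0 C1 FS p0 p1 fL M tm aff jn sj.
have {}below := below sm; have {}far := far j (ltnW ij) sj.
have Mlow := insignificant_excess e0 e1 be0 C1 FS p0 p1 fL M tm ij (ltnW jn) (fun k ik kj => jmin k ik kj).
have [h1 h2 h3 h4 h5 _ _ h8 _ h10 _ _ _ h14 h15 _] := FS.
have [_ z1 _] := zeta_bounds be0 C1.
have dle : 8 * d <= 1 by move: h5 z1 h3; clear; lra.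
have o0 := om_gt0 e0 e1; have o1 := om_le e0 e1.
have C0 : 0 < C by apply: lt_le_trans C1.
set o := om e in p0 p1 si sj x1 x2 x3 x4 w1 w2 w3 w4 Mlow h8 h10 h14 o0 o1 below far jmin sj' *.
pose lam := d * o; rewrite -/lam in x1 x2 x3 x4 w1 w2 w3 w4 Mlow.
have lam0 : 0 < lam by apply: mulr_gt0.
have lamo : 8 * lam <= o by rewrite /lam mulrA ler_piMl// ltW.
pose pt (k : nat) := p + k%:R * lam.
have pt_le (a b : nat) : (a <= b)%N -> pt a <= pt b.
  by move=> ab; rewrite lerD2l; apply: ler_wpM2r; [exact: ltW|rewrite ler_nat].
have ptS (k : nat) : pt k.+1 = pt k + lam by rewrite /pt -[k.+1%:R]natr1 mulrDl mul1r addrA.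
have ptn : pt n = p + K%:R * o by rewrite /pt /lam mulrA h4.
have pt0 : pt 0%N = p by rewrite /pt mul0r addr0.
rewrite -/(pt i) -/(pt j) -/(pt i.+1) -/(pt j.+1) in x1 x2 x3 x4 w1 w2 w3 w4 Mlow.
have b1 : p <= pt i by rewrite -pt0; exact: pt_le.
have b2 : pt j.+1 <= p + K%:R * o by rewrite -ptn; exact: pt_le.
have b3 : pt i + 4 * lam <= pt j by have := pt_le _ _ far; rewrite !ptS; clear; lra.
rewrite ptS in x3 x4; rewrite ptS in w3 w4 b2.
have xw : x' <= w by move: x4 w1 b3 lam0; clear; lra.
have xx : x <= x' by move: x2 x3 lam0; clear; lra.
have ww : w <= w' by move: w2 w3 lam0; clear; lra.
have x00 : 0 <= x by move: x1 b1 p0 lamo o0; clear; lra.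
have w10 : w' <= 1 by move: w4 b2 p1 lamo o0; clear; lra.
have [t1 t2] := tm; rewrite -/o in t1 t2.
have [_ _ NC _] := t1 x x' x00 xx (le_trans xw (le_trans ww w10)) (ltac:(move: x1 x4 lamo lam0; clear; lra)).
have CP := @cancel_pair R e beta f C x x' w w' u v z e0 e1 be0 cf C1 M x00 xx xw ww w10 vx vx' vw vw'.
cbv zeta in CP; rewrite -/o in CP.
set N := I x x' _ in CP below NC; set t := Num.min N _ in CP.
have eo3 : o ^+ 3 <= eta1 ^+ 2 / 128 * o.
  have -> : o ^+ 3 = o ^+ 2 * o by ring.
  apply: ler_wpM2r; first exact: ltW.
  apply: le_trans h10; rewrite expr2; apply: ler_wpM2r; first exact: ltW.
  by move: o1 C1; clear; lra.
have to : o ^+ 3 <= t.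
  rewrite le_min; apply/andP; split; apply: (le_trans eo3).
    rewrite /significant -/o -/lam -/(pt i) -/(pt i.+1) in si; apply: le_trans si _.
    apply: (I_sub_le (iN x x') (fun r _ => T0 (- v r)) x2 (pt_le _ _ (leqnSn i))).
    by rewrite ptS.
  rewrite /significant -/o -/lam -/(pt j) -/(pt j.+1) in sj; apply: le_trans sj _.
  apply: (I_sub_le (iT w w') (fun r _ => T0 (v r)) w2 (pt_le _ _ (leqnSn j))).
  by rewrite ptS.
have {}CP := CP to.
have tN : t <= N by rewrite /t ge_min lexx.
have t0 : 0 < t by apply: lt_le_trans to; rewrite exprn_gt0.
pose s1 := 4 * m + 6 * CK C K * eta1 + 6 * m * K%:R.
have CK1 : C + K%:R <= CK C K by rewrite /CK -natr1 mulrDl mul1r addrC lerD2r ler_peMr.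
have CK0 : 1 <= CK C K by apply: le_trans CK1; have := ler0n R K; move: C1; clear; lra.
pose q r := Num.max 0 (2 * (u r - f r) + t).
have cq : continuous q.
  apply: continuous_pos_part => r; apply: cvgD; last exact: cvg_cst.
  by apply: cvgM; [exact: cvg_cst|apply: cvgB; [exact: cu|exact: cf]].
(* near the two jumps only the bound of order om is available, but these pieces are short *)
have q_far r : 0 <= r <= 1 -> q r <= 3 * C * o.
  move=> r01; rewrite /q ge_max; apply/andP; split; first by rewrite mulr_ge0 ?mulr_ge0// ltW.
  by have := ler_norm (u r - f r); have := t2 r r01; move: tN NC; clear; lra.
have s10 : 0 <= s1.
  have := mulr_ge0 (ltW h2) (ler0n R K); have := mulr_ge0 (le_trans ler01 CK0) (ltW h1).
  by rewrite /s1; move: h2; clear; lra.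
(* in between, u rises little above its value after the drop, and f falls at a rate of at most 3 m *)
have q_mid r : x' <= r <= w -> q r <= s1 * o.
  move=> /andP[xr rw]; rewrite /q ge_max; apply/andP; split; first by rewrite mulr_ge0// ltW.
  have Axw : h2arc x' w u v z.
    by apply: (arc_sub M.1); [exact: le_trans xx|exact: le_trans w10].
  have R1 := rise_le (ltW (hh_gt0 e0 e1)) (ltW be0) cf o0 Axw (lexx _) xr rw.
  have R2 : I x' r (T \o v) <= 2 * CK C K * eta1 * o.
    apply: le_trans Mlow; apply: (I_sub_le (iT (pt i.+1) (pt j)) (fun s _ => T0 (v s)) _ xr (le_trans rw w2)).
    by rewrite ptS.
  have len : w - x' <= K%:R * o by move: w2 b2 x3 b1 lam0; clear; lra.
  have R3 : EE e beta f x' w u v z <= CK C K * o ^+ 3.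
    have [h _] := @tame_long R beta e C f u v z K x' w e0 e1 cf M.1 tm (le_trans x00 xx) xw (le_trans ww w10) (ltac:(rewrite -natr1 mulrDl mul1r -/o; move: len o0; clear; lra)).
    by move: h; rewrite -/o mulrA.
  have R4 : 5 * EE e beta f x' w u v z / o <= 5 * (CK C K * o ^+ 2).
    rewrite ler_pdivrMr//; have := ler_wpM2l (ler0n R 5) R3.
    by have -> : 5 * (CK C K * o ^+ 2) * o = 5 * (CK C K * o ^+ 3) by ring.
  have R5 : o * (r - x') <= CK C K * o ^+ 2.
    apply: (@le_trans _ _ (o * (K%:R * o))).
      by apply: ler_wpM2l; [exact: ltW|move: len rw; clear; lra].
    have -> : o * (K%:R * o) = K%:R * o ^+ 2 by ring.
    by apply: ler_wpM2r; [exact: sqr_ge0|move: CK1 C0; clear; lra].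
  have R6 : 3 * CK C K * o ^+ 2 <= eta1 * o by have := ler_wpM2r (ltW o0) h14; rewrite expr2 mulrA.
  have R7 : 1 * (eta1 * o) <= CK C K * (eta1 * o) by apply: ler_wpM2r => //; rewrite mulr_ge0// ltW.
  have F1 := aff x' r; rewrite -/o in F1.
  have {F1} := F1 (ltac:(move: x3 b1 lam0 o0; clear; lra)) xr (ltac:(move: rw w2 b2 lam0 o0; clear; lra)).
  rewrite ler_norml => F1.
  have F2 : - (3 * m) * (r - x') >= - (3 * m) * (K%:R * o).
    apply: ler_wnM2l; first by move: h2; clear; lra.
    by move: len rw; clear; lra.
  have F3 : (- 2 * m) * (r - x') <= sig * (r - x') by apply: ler_wpM2r => //; rewrite subr_ge0.
  rewrite /s1; move: below tN R1 R2 R4 R5 R6 R7 F1 F2 F3; clear; lra.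
have Iq : I x w' q <= (18 * C * d + K%:R * s1) * o ^+ 2.
  have iq a b : ig a b q by exact: ig_continuous.
  rewrite (@I_split _ x x' w')//; last exact: le_trans ww.
  rewrite (@I_split _ x' w w')//.
  have Q1 : I x x' q <= 3 * C * o * (x' - x).
    by apply: I_bound => // r rin; apply: q_far; move: rin x00 xw ww w10; clear; lra.
  have Q3 : I w w' q <= 3 * C * o * (w' - w).
    by apply: I_bound => // r rin; apply: q_far; move: rin x00 xx xw w10; clear; lra.
  have Q2 : I x' w q <= s1 * o * (w - x') by apply: I_bound.
  have Co : 0 <= 3 * C * o by rewrite mulr_ge0 ?mulr_ge0// ltW.
  have Q4 : 3 * C * o * (x' - x) <= 3 * C * o * (3 * lam).
    by apply: ler_wpM2l => //; move: x1 x4; clear; lra.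
  have Q5 : 3 * C * o * (w' - w) <= 3 * C * o * (3 * lam).
    by apply: ler_wpM2l => //; move: w1 w4; clear; lra.
  have Q6 : s1 * o * (w - x') <= s1 * o * (K%:R * o).
    apply: ler_wpM2l; first by rewrite mulr_ge0// ltW.
    by move: w2 b2 x3 b1 lam0; clear; lra.
  have -> : (18 * C * d + K%:R * s1) * o ^+ 2 = 3 * C * o * (3 * lam) + s1 * o * (K%:R * o) + 3 * C * o * (3 * lam).
    by rewrite /lam; ring.
  by move: Q1 Q2 Q3 Q4 Q5 Q6; clear; lra.
rewrite -/q in CP.
set g := 18 * C * d + K%:R * s1 in Iq h15.
have g0 : 0 <= g by rewrite /g addr_ge0 ?mulr_ge0// ltW.
have I0 : 0 <= I x w' q by apply: I_ge0 => r _; rewrite /q le_max lexx.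
have B1 : I x w' q ^+ 2 <= (g * o ^+ 2) ^+ 2 by rewrite ler_sqr ?nnegrE// mulr_ge0 ?sqr_ge0.
have G0 : 0 <= 12 * (beta * C * g) by rewrite mulr_ge0// mulr_ge0// mulr_ge0// ltW.
have B2 : (12 * (beta * C * g)) ^+ 2 <= 1 by rewrite expr_le1.
have : o ^+ 5 <= 128 / 144 * o ^+ 5.
  apply: (le_trans CP); apply: (@le_trans _ _ (128 * beta ^+ 2 * (C * o) * (g * o ^+ 2) ^+ 2)).
    apply: ler_pM => //.
    - by rewrite mulr_ge0 ?(ltW t0)// mulr_ge0// sqr_ge0.
    - exact: sqr_ge0.
    - by apply: ler_wpM2l; [rewrite mulr_ge0// sqr_ge0|exact: le_trans NC].
  have -> : 128 * beta ^+ 2 * (C * o) * (g * o ^+ 2) ^+ 2 = 128 * (beta ^+ 2 * g ^+ 2 * o ^+ 5) * C by ring.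
  apply: (@le_trans _ _ (128 * (beta ^+ 2 * g ^+ 2 * o ^+ 5) * C ^+ 2)).
    apply: ler_wpM2l; last by rewrite expr2 ler_peMl// ltW.
    apply: mulr_ge0 => //; apply: mulr_ge0; last by rewrite exprn_ge0// ltW.
    by apply: mulr_ge0; exact: sqr_ge0.
  have -> : 128 * (beta ^+ 2 * g ^+ 2 * o ^+ 5) * C ^+ 2 = (12 * (beta * C * g)) ^+ 2 * (128 / 144 * o ^+ 5) by field.
  by apply: ler_piMl B2; apply: mulr_ge0; [exact: divr_ge0|exact/exprn_ge0/ltW].
have : 0 < o ^+ 5 by rewrite exprn_gt0.
by clear; lra.
Qed.

(** Without significant drops u increases up to a small excess and the flat part. *)
Lemma variation_without_drops {R : realType} (beta L C eta1 m d e p : R) (K n : nat) (f u v z : R -> R) :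
  0 < e -> 625 * e <= 1 -> 0 < beta -> 1 <= C ->
  fine_scales beta L C eta1 m d (om e) K n -> om e <= p -> p + K%:R * om e <= 1 - om e ->
  (forall x y, `|f y - f x| <= L * `|y - x|) ->
  minimal (hh e) beta f u v z -> tame beta f e C u v z ->
  (forall k : nat, (k < n)%N -> ~ significant eta1 d e p (fun x => - v x) k) ->
  I p (p + K%:R * om e) (fun x => `|v x|) <= `|u (p + K%:R * om e) - u p| + om e.
Proof.
move=> e0 e1 be0 C1 FS p0 p1 fL M tm none.
have cf : continuous f by exact: lipschitz_continuous_fun fL.
have fL' x y : `|- f y - - f x| <= L * `|y - x| by rewrite -opprD normrN.
have H := insignificant_excess e0 e1 be0 C1 FS p0 p1 fL' (minimal_opp M) (tame_opp tm) (leq0n n) (leqnn n) (fun k _ kn => none k kn).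
have [h1 h2 h3 h4 _ _ _ _ _ _ _ _ _ h14 _ h16] := FS.
have o0 := om_gt0 e0 e1; have C0 : 0 < C by apply: lt_le_trans C1.
set o := om e in p0 p1 H h14 o0 *.
rewrite mul0r addr0 mulrA h4 in H.
set q := p + K%:R * o in p1 H *.
have K0 : 0 <= K%:R * o by rewrite mulr_ge0// ltW.
have pq : p <= q by rewrite /q lerDl.
have pp : 0 <= p by apply: le_trans p0; exact: ltW.
have q1 : q <= 1 by move: p1 o0; clear; lra.
have V := variation_le (ltW (hh_gt0 e0 e1)) (ltW be0) cf o0 (arc_sub M.1 pp q1) pq.
have [R3 _] := @tame_long R beta e C f u v z K p q e0 e1 cf M.1 tm pp pq q1 (ltac:(rewrite -natr1 mulrDl mul1r -/o /q; move: o0; clear; lra)).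
rewrite -/o mulrA -/(CK C K) in R3.
have CK1 : C + K%:R <= CK C K by rewrite /CK -natr1 mulrDl mul1r addrC lerD2r ler_peMr.
have CK0 : 1 <= CK C K by apply: le_trans CK1; have := ler0n R K; move: C1; clear; lra.
have R4 : 5 * EE e beta f p q u v z / o <= 5 * (CK C K * o ^+ 2).
  rewrite ler_pdivrMr//; have := ler_wpM2l (ler0n R 5) R3.
  by have -> : 5 * (CK C K * o ^+ 2) * o = 5 * (CK C K * o ^+ 3) by ring.
have R5 : o * (q - p) <= CK C K * o ^+ 2.
  have -> : o * (q - p) = K%:R * o ^+ 2 by rewrite /q; ring.
  by apply: ler_wpM2r; [exact: sqr_ge0|move: CK1 C0; clear; lra].
have R6 : 3 * CK C K * o ^+ 2 <= eta1 * o by have := ler_wpM2r (ltW o0) h14; rewrite expr2 mulrA.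
have R7 : 1 * (eta1 * o) <= CK C K * (eta1 * o) by apply: ler_wpM2r => //; rewrite mulr_ge0// ltW.
have R8 : 6 * CK C K * eta1 * o <= o by rewrite ler_piMl// ltW.
have R9 := ler_norm (u q - u p).
have H' : I p q (fun x => T (- v x)) <= 2 * CK C K * eta1 * o by exact: H.
move: V H' R4 R5 R6 R7 R8 R9; clear; lra.
Qed.

(** By no_rise_after_drop, applied to u and to - u, significant drops and significant rises do
    not both occur. *)
Lemma variation_of_cell {R : realType} (beta L C eta1 m d sig e p : R) (K n : nat) (f u v z : R -> R) :
  0 < e -> 625 * e <= 1 -> 0 < beta -> 0 <= L -> 1 <= C ->
  fine_scales beta L C eta1 m d (om e) K n -> om e <= p -> p + K%:R * om e <= 1 - om e ->
  (forall x y, `|f y - f x| <= L * `|y - x|) ->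
  minimal (hh e) beta f u v z -> tame beta f e C u v z -> affine_near m sig e p K f ->
  I p (p + K%:R * om e) (fun x => `|v x|) <= `|u (p + K%:R * om e) - u p| + om e.
Proof.
move=> e0 e1 be0 L0 C1 FS p0 p1 fL M tm aff.
have fL' x y : `|- f y - - f x| <= L * `|y - x| by rewrite -opprD normrN.
have vNN : (fun x => - - v x) = v by apply/funext => x; rewrite opprK.
have [[i ni si]|no] := pselect (exists2 i, (i < n)%N & significant eta1 d e p (fun x => - v x) i); last first.
  apply: (variation_without_drops e0 e1 be0 C1 FS p0 p1 fL M tm) => k kn sk.
  by apply: no; exists k.
have [[j nj sj]|no] := pselect (exists2 j, (j < n)%N & significant eta1 d e p v j); last first.
  have := variation_without_drops e0 e1 be0 C1 FS p0 p1 fL' (minimal_opp M) (tame_opp tm).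
  rewrite vNN -opprD normrN (@I_eq _ _ _ (fun x => `|- v x|) (fun x => `|v x|)); last by move=> x _; rewrite normrN.
  by apply => k kn sk; apply: no; exists k.
exfalso; have [ij|/ltnW ji] := leqP i j.
  exact: (no_rise_after_drop e0 e1 be0 L0 C1 FS p0 p1 fL M tm aff ij nj si sj).
apply: (no_rise_after_drop e0 e1 be0 L0 C1 FS p0 p1 fL' (minimal_opp M) (tame_opp tm) (affine_opp aff) ji ni _ si).
by rewrite vNN.
Qed.

Lemma linear_small {R : realType} (c b : R) : 0 < b -> exists2 r, 0 < r & forall x, 0 <= x -> x <= r -> c * x <= b.
Proof.
move=> b0; have c1 : 0 < `|c| + 1 by rewrite ltr_wpDl.
exists (b / (`|c| + 1)); first exact: divr_gt0.
move=> x x0; rewrite ler_pdivlMr// => h; apply: le_trans h.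
by rewrite mulrC ler_wpM2l//; apply: le_trans (ler_norm c) _; rewrite lerDl.
Qed.

Lemma fine_scales_exist {R : realType} (beta L C : R) (K : nat) : 0 < beta -> 0 <= L -> 1 <= C -> (0 < K)%N ->
  exists eta1 m d n (r : R), 0 < m /\ 0 < r /\
    forall o, 0 <= o -> o <= r -> fine_scales beta L C eta1 m d o K n.
Proof.
move=> be0 L0 C1 K0; have [z0 z1 z2] := zeta_bounds be0 C1.
have C0 : 0 < C by apply: lt_le_trans C1.
have KR : 0 < (K%:R : R) by rewrite ltr0n.
have CKR : 0 < CK C K by rewrite /CK mulr_gt0.
pose B := 12 * (beta * C).
have B0 : 0 < B by rewrite mulr_gt0 ?mulr_gt0.
have [m m0 hm] := linear_small (B * (K%:R * (4 + 6 * K%:R))) (ltac:(by rewrite divr_gt0) : 0 < (1 / 3 : R)).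
have [t1 t10 ht1] := linear_small (B * (K%:R * (6 * CK C K))) (ltac:(by rewrite divr_gt0) : 0 < (1 / 3 : R)).
have [t2 t20 ht2] := linear_small (6 * CK C K) (@ltr01 R).
pose eta1 := Num.min t1 t2.
have eta0 : 0 < eta1 by rewrite lt_min t10.
have eta20 : 0 < eta1 ^+ 2 / 128 by rewrite divr_gt0// exprn_gt0.
have [d1 d10 hd1] := linear_small (B * (18 * C)) (ltac:(by rewrite divr_gt0) : 0 < (1 / 3 : R)).
have [d2 d20 hd2] := linear_small 8 z0.
have [d3 d30 hd3] := linear_small (24 * L) (mulr_gt0 m0 z0).
have [d4 d40 hd4] := linear_small (192 * (6 * C + 3 * L) ^+ 2) (mulr_gt0 m0 (mulr_gt0 eta20 (exprn_gt0 2 z0))).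
pose d0 := Num.min (Num.min d1 d2) (Num.min d3 d4).
have d00 : 0 < d0 by rewrite !lt_min d10 d20 d30.
pose n := (Num.trunc (K%:R / d0)).+1.
have nd0 : K%:R / d0 < n%:R.
  by have /andP[] := truncn_itv (ltW (divr_gt0 KR d00)).
have nR : 0 < (n%:R : R) by rewrite ltr0n.
pose d : R := K%:R / n%:R.
have dp : 0 < d by rewrite divr_gt0.
have dd0 : d <= d0 by rewrite /d ler_pdivrMr// mulrC -ler_pdivrMr// ltW.
have [dd1 dd2] : d <= d1 /\ d <= d2 by move: dd0; rewrite /d0 !le_min => /andP[/andP[]].
have [dd3 dd4] : d <= d3 /\ d <= d4 by move: dd0; rewrite /d0 !le_min => /andP[_ /andP[]].
have {}hd1 := hd1 d (ltW dp) dd1; have {}hd2 := hd2 d (ltW dp) dd2.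
have {}hd3 := hd3 d (ltW dp) dd3; have {}hd4 := hd4 d (ltW dp) dd4.
have {}hm := hm m (ltW m0) (lexx _).
have {}ht1 := ht1 eta1 (ltW eta0) (ltac:(by rewrite ge_min lexx)).
have {}ht2 := ht2 eta1 (ltW eta0) (ltac:(by rewrite ge_min lexx orbT)).
have [r1 r10 hr1] := linear_small (32 * C) dp.
have [r2 r20 hr2] := linear_small (4 * gateC beta L C d) C0.
have [r3 r30 hr3] := linear_small (16 * C) eta20.
have [r4 r40 hr4] := linear_small (160 * C) (mulr_gt0 m0 z0).
have [r5 r50 hr5] := linear_small (256 * gateC beta L C d) (mulr_gt0 m0 (mulr_gt0 (mulr_gt0 eta20 (exprn_gt0 2 z0)) be0)).
have [r6 r60 hr6] := linear_small n%:R eta0.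
have [r7 r70 hr7] := linear_small (3 * CK C K) eta0.
exists eta1, m, d, n, (Num.min (Num.min (Num.min r1 r2) (Num.min r3 r4)) (Num.min (Num.min r5 r6) r7)).
split=> //; split; first by rewrite !lt_min r10 r20 r30 r40 r50 r60.
move=> o o0; rewrite !le_min => /andP[/andP[/andP[s1 s2] /andP[s3 s4]] /andP[/andP[s5 s6] s7]].
split=> //.
- by rewrite /d mulrC divfK// gt_eqF.
- by rewrite mulrA.
- by rewrite mulrA.
- exact: hr1.
- exact: hr2.
- exact: hr3.
- exact: hr4.
- by rewrite mulrA; exact: hr5.
- exact: hr6.
- exact: hr7.
- move: hd1 hm ht1; rewrite /B; move: (CK C K) => X; clear; lra.
Qed.

Lemma om_le_of_sqr {R : realType} (e r : R) : 0 < e -> 625 * e <= 1 -> 0 <= r -> e <= r ^+ 2 -> om e <= r.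
Proof. by move=> e0 e1 r0 er; apply: le_of_sqr => //; exact: le_trans (om_sqr_le e0 e1) er. Qed.

(** The window length K is arbitrary, but the error term does not depend on it. *)
Lemma cell_variation {R : realType} (beta L C : R) (K : nat) : 0 < beta -> 0 <= L -> 1 <= C -> (0 < K)%N ->
  exists m r : R, [/\ 0 < m, 0 < r & forall (f : R -> R) (e : R) (u v z : R -> R) (p sig : R),
    (forall x y, `|f y - f x| <= L * `|y - x|) -> 0 < e -> 625 * e <= 1 -> om e <= r ->
    minimal (hh e) beta f u v z -> tame beta f e C u v z ->
    om e <= p -> p + K%:R * om e <= 1 - om e ->
    (forall s t, p - om e <= s -> s <= t -> t <= p + K%:R * om e + om e -> `|f t - f s - sig * (t - s)| <= m * (t - s)) ->
    I p (p + K%:R * om e) (fun x => `|v x|) <= `|u (p + K%:R * om e) - u p| + om e].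
Proof.
move=> be0 L0 C1 K0; have [eta1 [m [d [n [r [m0 [r0 FS]]]]]]] := fine_scales_exist be0 L0 C1 K0.
exists m, r; split=> // f e u v z p sig fL e0 e1 er M tm p0 p1 aff.
have {}FS := FS (om e) (ltW (om_gt0 e0 e1)) er.
exact: (variation_of_cell e0 e1 be0 L0 C1 FS p0 p1 fL M tm aff).
Qed.

(** * The total variation in the limit *)

Lemma uniformly_continuous_compact {R : realType} (S : pseudoMetricType R) (K : set S) (g : S -> R) (m : R) :
  compact K -> continuous g -> 0 < m ->
  exists2 r, 0 < r & forall x y, K x -> ball x r y -> `|g y - g x| <= m.
Proof.
move=> /compact_near_coveringP cK cg m0.
have H : \forall r \near (0 : R)^'+, K `<=` [set x | forall y, ball x r y -> `|g y - g x| <= m].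
  apply: (cK _ (0 : R)^'+ (fun r x => forall y, ball x r y -> `|g y - g x| <= m)) => x _.
  have := cg x => /cvgrPdist_le /(_ (m / 2)) /=.
  have m2 : 0 < m / 2 by rewrite divr_gt0.
  move=> /(_ m2) /nbhs_ballP[d /= d0 H].
  have d2 : 0 < d / 2 by rewrite divr_gt0.
  exists (ball x (d / 2), [set r | 0 < r < d / 2]) => /=.
    split; first exact: nbhsx_ballx.
    near=> r; apply/andP; split; first by near: r; exact: nbhs_right_gt.
    by near: r; exact: nbhs_right_lt.
  move=> [x' r] /= [x'x /andP[r0 rd]] y yx.
  have h1 : `|g x - g x'| <= m / 2 by apply: H; apply: le_ball x'x; move: d0; lra.
  have h2 : `|g x - g y| <= m / 2.
    apply: H; have -> : d = d / 2 + d / 2 by move: d0; lra.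
    by apply: ball_triangle x'x _; apply: le_ball yx; exact: ltW.
  have -> : g y - g x' = (g x - g x') - (g x - g y) by ring.
  by apply: le_trans (ler_normB _ _) _; lra.
near (0 : R)^'+ => r; exists r; first by near: r; exact: nbhs_right_gt.
have Hr : K `<=` [set x | forall y, ball x r y -> `|g y - g x| <= m] by near: r.
by move=> x y Kx; exact: Hr.
Unshelve. all: by end_near. Qed.

Lemma uniformly_continuous_itv {R : realType} (a b m : R) (g : R -> R) : continuous g -> 0 < m ->
  exists2 r, 0 < r & forall x y, a <= x <= b -> `|y - x| <= r -> `|g y - g x| <= m.
Proof.
move=> cg m0; have [r r0 H] := uniformly_continuous_compact (@segment_compact R a b) cg m0.
exists (r / 2); first by rewrite divr_gt0.
move=> x y xab xy; apply: H; first by rewrite /= in_itv.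
by rewrite /ball/= distrC; apply: le_lt_trans xy _; rewrite ltr_pdivrMr// ltr_pMr// ltr1n.
Qed.

Lemma sum_adjacent_le {R : realType} (p d c : R) (f g : R -> R) (n : nat) : 0 <= d -> continuous g ->
  (forall a b, p <= a -> a <= b -> b <= p + n%:R * d -> f b - f a = I a b g) ->
  \sum_(i < n) `|f (p + i.+1%:R * d) - f (p + i%:R * d)| <= I p (p + n%:R * d) (fun x => `|g x|).
Proof.
move=> d0 cg H.
have ig1 a b : ig a b (fun x => `|g x|) by apply: ig_norm; exact: ig_continuous.
rewrite (I_cells d0)//; apply: ler_sum => i _.
rewrite H; first by apply: I_norm; exact: ig_continuous.
- by rewrite lerDl mulr_ge0.
- by rewrite lerD2l ler_wpM2r// ler_nat.
- by rewrite lerD2l ler_wpM2r// ler_nat ltn_ord.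
Qed.

(** Divide [0, 1] into windows of length K om. The error of each is of order om, so their
    sum is of order 1 / K. *)
Theorem variation_limit {R : realType} (beta L : R) (f g : R -> R) : 0 < beta -> 0 <= L ->
  (forall x y, `|f y - f x| <= L * `|y - x|) -> continuous g ->
  (forall a b, 0 <= a -> a <= b -> b <= 1 -> f b - f a = I a b g) ->
  forall eta, 0 < eta -> exists2 r, 0 < r & forall e u v z, 0 < e -> e <= r ->
    minimal (hh e) beta f u v z -> I 0 1 (fun x => `|v x|) <= I 0 1 (fun x => `|g x|) + eta.
Proof.
move=> be0 L0 fL cg fg eta eta0.
have [C [r1 [C1 [r10 TM]]]] := minimizers_tame be0 L0.
have C0 : 0 < C by apply: lt_le_trans C1.
have [rk rk0 hk] := linear_small (2 * C + 1) (ltac:(by rewrite divr_gt0) : 0 < eta / 2).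
pose K := (Num.trunc rk^-1).+1.
have KR : 0 < (K%:R : R) by rewrite ltr0n.
have Kk : K%:R^-1 <= rk.
  rewrite -[leRHS]invrK lef_pV2 ?posrE ?invr_gt0//.
  by have /andP[_ /ltW] := truncn_itv (ltac:(by rewrite invr_ge0 ltW) : 0 <= rk^-1).
have {}hk := hk _ (ltac:(by rewrite invr_ge0) : 0 <= K%:R^-1) Kk.
have [m [r2 [m0 r20 cell]]] := cell_variation be0 L0 C1 (ltac:(by []) : (0 < K)%N).
have [rho rho0 UC] := uniformly_continuous_itv 0 1 cg m0.
have [r3 r30 h3] := linear_small (K%:R + 2) rho0.
have [r4 r40 h4] := linear_small ((K%:R + 2) * C) (ltac:(by rewrite divr_gt0) : 0 < eta / 2).
have [r5 r50 h5] := linear_small (K%:R + 2) (@ltr01 R).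
pose r0 := Num.min (Num.min r2 r3) (Num.min r4 r5).
have r00 : 0 < r0 by rewrite !lt_min r20 r30 r40.
exists (Num.min r1 (r0 ^+ 2)); first by rewrite lt_min r10 exprn_gt0.
move=> e u v z e0; rewrite le_min => /andP[er1 er0] M.
have [e1 tm] := TM f e u v z fL e0 er1 M.
have o0 := om_gt0 e0 e1; have orr := om_le_of_sqr e0 e1 (ltW r00) er0.
move: (orr); rewrite !le_min => /andP[/andP[or2 or3] /andP[or4 or5]].
have {}h3 := h3 _ (ltW o0) or3; have {}h4 := h4 _ (ltW o0) or4; have {}h5 := h5 _ (ltW o0) or5.
have cf : continuous f by exact: lipschitz_continuous_fun fL.
have [[cu cv mz iz P] _] := M.
have {}cell := fun p sig => cell f e u v z p sig fL e0 e1 or2 M tm.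
have tl := fun p q => @tame_long R beta e C f u v z K p q e0 e1 cf M.1 tm.
have [_ t2] := tm.
have iv a b : ig a b (fun x => `|v x|) by apply: ig_norm; exact: ig_continuous.
have igg a b : ig a b (fun x => `|g x|) by apply: ig_norm; exact: ig_continuous.
set o := om e in o0 h3 h4 h5 cell tl t2 or2.
(* the windows have length d and cover [o, q]; the two ends are short *)
pose d := K%:R * o.
have d0 : 0 < d by rewrite mulr_gt0.
have dO : d + 2 * o <= 1 by move: h5; rewrite mulrDl.
pose n := Num.trunc ((1 - 2 * o) / d).
have X0 : 0 <= (1 - 2 * o) / d by rewrite divr_ge0 ?(ltW d0)//; move: dO d0; clear; lra.
have /andP[n1 n2] := truncn_itv X0; rewrite -/n in n1 n2.
rewrite ler_pdivlMr// in n1; rewrite ltr_pdivrMr// -[n.+1%:R]natr1 mulrDl mul1r in n2.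
have nd0 : 0 <= n%:R * d by rewrite mulr_ge0// ltW.
pose q := o + n%:R * d.
have oq : o <= q by rewrite lerDl.
have q1 : q <= 1 - o by rewrite /q; move: n1; clear; lra.
have q1' : q <= 1 by move: q1 o0; clear; lra.
have o01 := ltW o0.
have V1 : I 0 o (fun x => `|v x|) <= C * o.
  have [_ _ _] := tm.1 0 o (lexx 0) o01 (le_trans oq q1') (ltac:(by rewrite subr0)); exact.
have V3 : I q 1 (fun x => `|v x|) <= K.+1%:R * (C * o).
  have [_ ] := tl q 1 (le_trans o01 oq) q1' (lexx 1) (ltac:(rewrite -natr1 mulrDl mul1r -/d /q; move: n2 o0; clear; lra)); exact.
have V2 : I o q (fun x => `|v x|) <= \sum_(i < n) (`|f (o + i.+1%:R * d) - f (o + i%:R * d)| + (2 * C + 1) * o).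
  rewrite /q (I_cells (ltW d0))//; apply: ler_sum => i _.
  have il := ltn_ord i.
  pose p := o + i%:R * d.
  have id0 : 0 <= i%:R * d by rewrite mulr_ge0// ltW.
  have pE : o + i.+1%:R * d = p + d by rewrite /p -natr1; ring.
  have op : o <= p by rewrite /p lerDl.
  have pn : p + d <= q by rewrite -pE lerD2l ler_wpM2r ?(ltW d0)// ler_nat.
  rewrite pE -/p.
  have := cell p (g p) op (le_trans pn q1); rewrite -/d => H.
  apply: le_trans (H _) _.
    move=> s t s1 st t1.
    have s0 : 0 <= s by move: s1 op; clear; lra.
    have t1' : t <= 1 by move: t1 pn q1; clear; lra.
    rewrite fg// -(I_cst (g p) st) -I_sub; [|exact: ig_continuous|exact: ig_cst].
    apply: I_norm_bound => //; first by apply: ig_sub2; [exact: ig_continuous|exact: ig_cst].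
    move=> x xst; apply: UC.
      by move: op pn q1' d0 o0; clear; lra.
    by rewrite ler_norml; move: xst s1 t1 h3; rewrite /d mulrDl; move: d0 o0; rewrite /d; clear; lra.
  have p01 : 0 <= p <= 1 by move: op pn q1' d0 o0; clear; lra.
  have p02 : 0 <= p + d <= 1 by move: op pn q1' d0 o0; clear; lra.
  have -> : u (p + d) - u p = (u (p + d) - f (p + d)) + (f (p + d) - f p) - (u p - f p) by ring.
  have := t2 p p01; have := t2 (p + d) p02.
  have := ler_normB ((u (p + d) - f (p + d)) + (f (p + d) - f p)) (u p - f p).
  have := ler_normD (u (p + d) - f (p + d)) (f (p + d) - f p).
  clear; lra.
rewrite big_split/= sumr_const card_ord -[_ *+ n]mulr_natl in V2.
have V4 : \sum_(i < n) `|f (o + i.+1%:R * d) - f (o + i%:R * d)| <= I o q (fun x => `|g x|).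
  apply: sum_adjacent_le => //; first exact: ltW.
  by move=> a b oa ab bq; apply: fg => //; [exact: le_trans oa|exact: le_trans q1'].
have V5 : I o q (fun x => `|g x|) <= I 0 1 (fun x => `|g x|) by exact: I_sub_le.
have V6 : n%:R * ((2 * C + 1) * o) <= eta / 2.
  apply: le_trans hk; rewrite mulrCA; apply: ler_wpM2l; first by move: C0; clear; lra.
  have -> : n%:R * o = n%:R * d / K%:R by rewrite /d; field; rewrite gt_eqF.
  rewrite ler_pdivrMr// mulVf ?gt_eqF//.
  by move: n1 o0; clear; lra.
rewrite (@I_split _ 0 o 1)// ?(le_trans oq q1')// (@I_split _ o q 1)//.
move: V1 V2 V3 V4 V5 V6 h4; rewrite -[K.+1%:R]natr1; clear; lra.
Qed.

(** * Test functions on an interval *)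

Section weak_derivatives.
Context {R : realType}.
Implicit Types (a b c d x y : R) (u v h H phi psi : R -> R).
Local Notation mu := (@lebesgue_measure R).
Local Notation Om := (`]0%R, 1%R[%classic : set R).

Lemma is_derive_of_taylor (F g : R -> R) (C : R) : (forall x y, `|F y - F x - g x * (y - x)| <= C * (y - x) ^+ 2) ->
  forall x, is_derive x (1 : R) F (g x).
Proof.
move=> H x.
have cv : h^-1 *: (F (h *: (1 : R) + x) - F x) @[h --> (0 : R)^'] --> g x.
  apply/cvgrPdist_le => e e0.
  have C1 : 0 < `|C| + 1 by rewrite ltr_wpDl.
  near=> h.
  have h0 : h != 0 by near: h; exact: nbhs_dnbhs_neq.
  have := H x (h *: (1 : R) + x); rewrite /GRing.scale /= mulr1 addrK => K.
  have -> : g x - h^-1 * (F (h + x) - F x) = - (h^-1 * (F (h + x) - F x - g x * h)) by field.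
  rewrite normrN normrM normfV ler_pdivrMl ?normr_gt0//.
  apply: le_trans K _; rewrite -(real_normK (num_real h)) expr2 mulrA mulrC.
  apply: ler_wpM2l => //.
  apply: (@le_trans _ _ ((`|C| + 1) * `|h|)).
    by apply: ler_wpM2r => //; apply: le_trans (ler_norm C) _; rewrite lerDl.
  rewrite mulrC -ler_pdivlMr//.
  near: h; apply/nbhs_dnbhs.
  have := @nbhsx_ballx R _ (0 : R) (e / (`|C| + 1)) (divr_gt0 e0 C1).
  by apply: filterS => r; rewrite /ball/= sub0r normrN => /ltW.
have dF : derivable F x 1 by apply/cvg_ex; exists (g x).
by apply: DeriveDef => //; apply/cvg_lim.
Unshelve. all: by end_near. Qed.

Lemma is_derive1_eq phi psi : (forall x, is_derive x (1 : R) phi (psi x)) -> derive1 phi = psi.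
Proof. by move=> H; apply/funext => x; rewrite derive1E; have [_ ->] := H x. Qed.

(** The blocks of a test function: step is a C^1 step of height del^2, and its derivative hat is a
    hat of half-width del. *)
Definition quad x := x * Num.max 0 x / 2.
Definition step del x := quad (x + del) - 2 * quad x + quad (x - del).
Definition hat del x : R := Num.max 0 (x + del) - 2 * Num.max 0 x + Num.max 0 (x - del).

Lemma quad_taylor x y : `|quad y - quad x - Num.max 0 x * (y - x)| <= 1 * (y - x) ^+ 2.
Proof.
have sq := sqr_ge0 (y - x); have sx := sqr_ge0 x; have sy := sqr_ge0 y.
rewrite /quad mul1r; case: (leP 0 x) => x0; case: (leP 0 y) => y0; rewrite ler_norml.
- by apply/andP; split; lra.
- have xy : x * y <= 0 by rewrite mulr_ge0_le0// ltW.
  by apply/andP; split; lra.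
- have xy : x * y <= 0 by rewrite mulr_le0_ge0// ltW.
  by apply/andP; split; lra.
- by apply/andP; split; lra.
Qed.

Lemma step_derive del x : is_derive x (1 : R) (step del) (hat del x).
Proof.
apply: (@is_derive_of_taylor _ _ 4) => {}x y.
have h1 := quad_taylor (x + del) (y + del); have h2 := quad_taylor x y; have h3 := quad_taylor (x - del) (y - del).
have e1 : y + del - (x + del) = y - x by ring. have e2 : y - del - (x - del) = y - x by ring.
rewrite e1 in h1; rewrite e2 in h3.
have -> : step del y - step del x - hat del x * (y - x) =
  (quad (y + del) - quad (x + del) - Num.max 0 (x + del) * (y - x))
  - 2 * (quad y - quad x - Num.max 0 x * (y - x))
  + (quad (y - del) - quad (x - del) - Num.max 0 (x - del) * (y - x)) by rewrite /step /hat; ring.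
move: h1 h2 h3; rewrite !ler_norml !mul1r => /andP[a1 a2] /andP[a3 a4] /andP[a5 a6].
by apply/andP; split; move: a1 a2 a3 a4 a5 a6; clear; lra.
Qed.

Lemma max_continuous0 : continuous (fun x => Num.max 0 x : R).
Proof. by apply: continuous_pos_part => x; exact: cvg_id. Qed.

Lemma hat_continuous del : continuous (hat del).
Proof.
have sh k : continuous (fun x : R => Num.max 0 (x + k) : R).
  by apply: continuous_pos_part => x; apply: cvgD; [exact: cvg_id|exact: cvg_cst].
move=> x; apply: cvgD; last exact: (sh (- del)).
apply: cvgB; first exact: sh.
by apply: cvgM; [exact: cvg_cst|exact: max_continuous0].
Qed.

Lemma hat_ge0 del x : 0 <= del -> 0 <= hat del x.
Proof.
by move=> d0; rewrite /hat; case: (leP 0 (x + del)) => h1; case: (leP 0 x) => h2; case: (leP 0 (x - del)) => h3; lra.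
Qed.

Lemma hat_out del x : 0 <= del -> del <= `|x| -> hat del x = 0.
Proof.
move=> d0; rewrite ler_normr => /orP[h|h]; rewrite /hat.
  by rewrite !max_r; lra.
by rewrite !max_l; lra.
Qed.

Lemma step_left del x : 0 <= del -> x <= - del -> step del x = 0.
Proof. by move=> d0 xd; rewrite /step /quad !max_l; lra. Qed.

Lemma step_right del x : 0 <= del -> del <= x -> step del x = del ^+ 2.
Proof. by move=> d0 xd; rewrite /step /quad !max_r; [field|lra|lra|lra]. Qed.

Lemma step_mono del x y : 0 <= del -> x <= y -> step del x <= step del y.
Proof.
move=> d0 xy; rewrite -subr_ge0 (ftc xy (@hat_continuous del) (step_derive del)).
by apply: I_ge0 => r _; exact: hat_ge0.
Qed.

Definition bump del c d x := step del (x - c) - step del (x - d).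

Lemma is_derive_shift (F g : R -> R) c : (forall x, is_derive x (1 : R) F (g x)) ->
  forall x, is_derive x (1 : R) (fun x => F (x - c)) (g (x - c)).
Proof.
move=> H x.
have h1 : is_derive x (1 : R) (fun x : R => x - c) (1 - 0) by apply: is_deriveB.
have := @is_derive1_comp R F (fun x => x - c) x (g (x - c)) (1 - 0) (H _) h1.
by rewrite subr0 mulr1.
Qed.

Lemma bump_derive del c d x : is_derive x (1 : R) (bump del c d) (hat del (x - c) - hat del (x - d)).
Proof. by apply: is_deriveB; apply: is_derive_shift => r; exact: step_derive. Qed.

Lemma bump_test del a b c d : 0 <= del -> a < c - del -> c <= d -> d + del < b ->
  C1c `]a, b[ (bump del c d).
Proof.
move=> d0 ac cd db; split.
- by move=> x; have [] := bump_derive del c d x.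
- rewrite (is_derive1_eq (bump_derive del c d)) => x; apply: cvgB.
    by apply: (@continuous_comp _ _ _ (fun x => x - c) (hat del)); [apply: cvgB; [exact: cvg_id|exact: cvg_cst]|exact: hat_continuous].
  by apply: (@continuous_comp _ _ _ (fun x => x - d) (hat del)); [apply: cvgB; [exact: cvg_id|exact: cvg_cst]|exact: hat_continuous].
- exists (`[c - del, d + del]%classic); split; first exact: segment_compact.
    by move=> x /=; rewrite !in_itv/=; lra.
  move=> x; rewrite /= in_itv/= => /negP; rewrite negb_and -!ltNge => /orP[h|h]; rewrite /bump.
    by rewrite !step_left ?subrr//; lra.
  by rewrite !step_right ?subrr//; lra.
Qed.

Lemma C1c_sub (A B : set R) phi : A `<=` B -> C1c A phi -> C1c B phi.
Proof.
move=> AB [h1 h2 [K [k1 k2 k3]]]; split => //; exists K; split => //.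
by apply: subset_trans AB.
Qed.

Lemma I_hat del a b c : 0 <= del -> a < c - del -> c + del < b -> I a b (fun x => hat del (x - c)) = del ^+ 2.
Proof.
move=> d0 ac cb; have ab : a <= b by lra.
have cs : continuous (fun x => hat del (x - c)).
  by move=> x; apply: (@continuous_comp _ _ _ (fun x => x - c) (hat del)); [apply: cvgB; [exact: cvg_id|exact: cvg_cst]|exact: hat_continuous].
rewrite -(ftc ab cs (is_derive_shift c (step_derive del))) step_right//; last lra.
by rewrite step_left ?subr0//; lra.
Qed.

(** If H c < H d, then the integral of H against the difference of two narrow hats, at c
    and at d, is negative; but that difference is the derivative of bump. *)
Lemma continuous_weakly_constant_le a b c d H : continuous H ->
  (forall phi, C1c `]a, b[ phi -> I a b (fun x => derive1 phi x * H x) = 0) ->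
  a < c -> c <= d -> d < b -> H d <= H c.
Proof.
move=> cH T ac; rewrite le_eqVlt => /orP[/eqP -> _|cd db]; first by [].
rewrite leNgt; apply/negP => Hlt.
pose e := (H d - H c) / 3.
have e0 : 0 < e by rewrite divr_gt0// subr_gt0.
have [/= r1 r10 h1] : exists2 r, 0 < r & forall x, `|x - c| <= r -> `|H x - H c| <= e.
  have := cH c => /cvgrPdist_le /(_ e e0) /nbhs_ballP[r /= r0 Hr].
  exists (r / 2); first by rewrite divr_gt0.
  move=> x xc; rewrite distrC; apply: Hr; rewrite /ball/= distrC; lra.
have [/= r2 r20 h2] : exists2 r, 0 < r & forall x, `|x - d| <= r -> `|H x - H d| <= e.
  have := cH d => /cvgrPdist_le /(_ e e0) /nbhs_ballP[r /= r0 Hr].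
  exists (r / 2); first by rewrite divr_gt0.
  move=> x xc; rewrite distrC; apply: Hr; rewrite /ball/= distrC; lra.
pose del := Num.min (Num.min r1 r2) (Num.min ((c - a) / 2) (Num.min ((b - d) / 2) ((d - c) / 2))).
have [d1 [d2 [d3 [d4 d5]]]] : del <= r1 /\ del <= r2 /\ del <= (c - a) / 2 /\ del <= (b - d) / 2 /\ del <= (d - c) / 2.
  by rewrite !ge_min !lexx !orbT.
have d0 : 0 < del by rewrite !lt_min r10 r20 !divr_gt0// subr_gt0//.
have ab : a <= b by lra.
have := T _ (@bump_test del a b c d (ltW d0) (ltac:(lra)) (ltW cd) (ltac:(lra))).
rewrite (is_derive1_eq (bump_derive del c d)).
have chat k : continuous (fun x => hat del (x - k)).
  by move=> x; apply: (@continuous_comp _ _ _ (fun x => x - k) (hat del)); [apply: cvgB; [exact: cvg_id|exact: cvg_cst]|exact: hat_continuous].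
have ihat k : ig a b (fun x => hat del (x - k)) by exact: ig_continuous.
have iH k : ig a b (fun x => hat del (x - k) * H x).
  by apply: ig_continuous => x; apply: cvgM; [exact: chat|exact: cH].
have -> : I a b (fun x => (hat del (x - c) - hat del (x - d)) * H x) =
  I a b (fun x => hat del (x - c) * H x) - I a b (fun x => hat del (x - d) * H x).
  by rewrite -I_sub//; apply: I_eq => x _; ring.
have k1 : I a b (fun x => hat del (x - c) * H x) <= (H c + e) * del ^+ 2.
  rewrite -(@I_hat del a b c (ltW d0)); [|by move: d3 ac; clear; lra|by move: d4 cd db; clear; lra].
  rewrite -I_scale//; apply: I_le => //; first exact: ig_scale.
  move=> x _; have [xc|xc] := leP del `|x - c|; first by rewrite hat_out ?(ltW d0)// mul0r mulr0.
  rewrite mulrC; apply: ler_wpM2r; first exact/hat_ge0/ltW.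
  by have := h1 x (le_trans (ltW xc) d1); rewrite ler_norml; clear; lra.
have k2 : (H d - e) * del ^+ 2 <= I a b (fun x => hat del (x - d) * H x).
  rewrite -(@I_hat del a b d (ltW d0)); [|by move: d3 ac cd; clear; lra|by move: d4 db; clear; lra].
  rewrite -I_scale//; apply: I_le => //; first exact: ig_scale.
  move=> x _; have [xc|xc] := leP del `|x - d|; first by rewrite hat_out ?(ltW d0)// mul0r mulr0.
  rewrite [leRHS]mulrC; apply: ler_wpM2r; first exact/hat_ge0/ltW.
  by have := h2 x (le_trans (ltW xc) d2); rewrite ler_norml; clear; lra.
have k3 : (H c + e) * del ^+ 2 < (H d - e) * del ^+ 2.
  by rewrite ltr_pM2r ?exprn_gt0//; rewrite /e; lra.
lra.
Qed.

Lemma continuous_weakly_constant a b c d H : continuous H ->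
  (forall phi, C1c `]a, b[ phi -> I a b (fun x => derive1 phi x * H x) = 0) ->
  a < c -> c <= d -> d < b -> H d = H c.
Proof.
move=> cH T ac cd db; apply/eqP; rewrite eq_le.
rewrite (continuous_weakly_constant_le cH T ac cd db)/= -lerN2.
apply: (@continuous_weakly_constant_le a b c d (fun x => - H x)) => //.
  by move=> x; apply: cvgN; exact: cH.
move=> phi tp; have := T phi tp => T0.
rewrite -[RHS]oppr0 -T0 -I_opp; first by apply: I_eq => x _; ring.
have [_ cp _] := tp.
by apply: ig_continuous => x; apply: cvgM; [exact: cp|exact: cH].
Qed.

End weak_derivatives.

(** * Weak derivatives on an interval *)

Section weak_derivatives.
Context {R : realType}.
Implicit Types (a b c d x y : R) (u v h H phi psi : R -> R).
Local Notation mu := (@lebesgue_measure R).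
Local Notation Om := (`]0%R, 1%R[%classic : set R).

Lemma clamp_within (T : topologicalType) a b (g : R -> T) : a <= b -> {within `[a, b], continuous g} -> continuous (g \o clamp a b).
Proof.
move=> ab /subspace_continuousP cg x.
have cx : `[a, b]%classic (clamp a b x) by rewrite /= in_itv /= clamp_itv.
apply: cvg_comp (cg _ cx); move=> A /= wA.
have K : nbhs x (clamp a b @^-1` (fun t => `[a, b]%classic t -> A t)) := @clamp_continuous R a b x _ wA.
suff : nbhs x (clamp a b @^-1` A) by [].
apply: filterS K => y; apply.
by rewrite /= in_itv /= clamp_itv.
Qed.

Lemma prim_continuous_integrable a b g : a <= b -> ig a b g -> continuous (prim a b g).
Proof. by move=> ab ig1; exact: (clamp_within ab (parameterized_integral_continuous ab ig1)). Qed.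

Lemma Rint_support (A B : set R) (g : R -> R) : A `<=` B -> (forall x, B x -> ~ A x -> g x = 0) ->
  \int[mu]_(x in B) g x = \int[mu]_(x in A) g x.
Proof.
move=> AB g0; rewrite Rintegral_mkcond [RHS]Rintegral_mkcond; congr (Rintegral _ _ _).
apply/funext => x; rewrite !patchE; case: ifPn => xB; case: ifPn => xA //.
  rewrite inE in xB; apply: g0 => //; move: xA; rewrite notin_setE; exact.
by move: xA xB; rewrite inE => /AB xB; rewrite notin_setE.
Qed.

Lemma locally_ig h a b : locally_integrable Om h -> 0 < a -> b < 1 -> ig a b h.
Proof.
move=> [mh _ fh] a0 b1.
have sub : `[a, b]%classic `<=` Om by move=> x /=; rewrite !in_itv/=; lra.
apply/integrableP; split.
  by apply/measurable_EFinP; apply: measurable_funS mh.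
by apply: fh => //; exact: segment_compact.
Qed.

Lemma C1c_itv phi : C1c Om phi -> exists2 a, 0 < a < 1 / 2 & forall x, ~~ (a <= x <= 1 - a) -> phi x = 0.
Proof.
move=> [_ _ [K [cK KO phi0]]].
have H : \forall r \near (0 : R)^'+, K `<=` [set x | r <= x <= 1 - r].
  have /compact_near_coveringP N := cK.
  apply: (N _ (0 : R)^'+ (fun r x => r <= x <= 1 - r)) => x /KO; rewrite /= in_itv/= => /andP[x0 x1].
  pose d := Num.min x (1 - x) / 2.
  have [d1 d2] : d <= x / 2 /\ d <= (1 - x) / 2.
    by rewrite /d !ler_pM2r// !ge_min !lexx orbT.
  have d0 : 0 < d by rewrite /d divr_gt0// lt_min x0 subr_gt0.
  exists (ball x d, [set r | 0 < r < d]) => /=.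
    split; first exact: nbhsx_ballx.
    near=> r; apply/andP; split; first by near: r; exact: nbhs_right_gt.
    by near: r; exact: nbhs_right_lt.
  move=> [x' r] /= [+ /andP[r0 rd]]; rewrite /ball/= ltr_norml; lra.
near (0 : R)^'+ => r.
have Hr : K `<=` [set x | r <= x <= 1 - r] by near: r.
exists r.
  by apply/andP; split; near: r; [exact: nbhs_right_gt|apply: nbhs_right_lt; rewrite divr_gt0].
by move=> x xr; apply: phi0 => /Hr /=; apply/negP.
Unshelve. all: by end_near. Qed.

Lemma C1c_ftc (A : set R) phi a b : C1c A phi -> a <= b -> phi b - phi a = I a b (derive1 phi).
Proof.
move=> [dphi cphi _] ab; apply: ftc => // x.
by apply: DeriveDef; [exact: dphi|rewrite derive1E].
Qed.

Lemma C1c_continuous (A : set R) phi : C1c A phi -> continuous phi.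
Proof.
move=> [dphi _ _] x; apply: differentiable_continuous; apply/derivable1_diffP; exact: dphi.
Qed.

Lemma C1c_derive_out phi a x : (forall x, ~~ (a <= x <= 1 - a) -> phi x = 0) -> ~~ (a <= x <= 1 - a) -> derive1 phi x = 0.
Proof.
move=> phi0; rewrite negb_and -!ltNge => xa; rewrite derive1E.
rewrite (@near_eq_derive _ _ _ phi (fun=> 0)); first by rewrite derive_cst.
case/orP: xa => xa; near=> y; apply: phi0; rewrite negb_and -!ltNge; apply/orP.
  by left; near: y; exact: lt_nbhsl.
by right; near: y; exact: lt_nbhsr.
Unshelve. all: by end_near. Qed.

(** A primitive of h is weakly constant, hence constant. *)
Lemma weakly_zero_integral h : locally_integrable Om h ->
  (forall phi, C1c Om phi -> \int[mu]_(x in Om) (h x * phi x) = 0) ->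
  forall c d, 0 < c -> c <= d -> d < 1 -> I c d h = 0.
Proof.
move=> lh T c d c0 cd d1.
pose a := c / 2; pose b := (1 + d) / 2.
have [a0 ac db b1] : [/\ 0 < a, a < c, d < b & b < 1] by rewrite /a /b; split; lra.
have ab : a <= b by lra.
have ih : ig a b h by exact: locally_ig.
pose H := prim a b h.
have cH : continuous H by exact: prim_continuous_integrable.
suff : H d = H c by move=> e; rewrite -(primB ih (ltW ac) cd (ltW db)) -/H e subrr.
apply: (continuous_weakly_constant cH _ ac cd db) => phi tphi.
have sub : `]a, b[%classic `<=` Om by move=> x /=; rewrite !in_itv/=; lra.
have tphi' := C1c_sub sub tphi.
have [_ cphi [K [cK KO phi0]]] := tphi.
have out x : ~~ (a < x < b) -> phi x = 0.
  by move=> xab; apply: phi0 => /KO/=; rewrite in_itv/=; exact/negP.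
have [M M0 hM] := continuous_itv_bounded a b cphi.
have := by_parts ab cH (C1c_continuous tphi) cphi ih (fun x y ax xy yb => esym (esym (primB ih ax xy yb)))
  (fun x y _ xy _ => C1c_ftc tphi xy) hM.
rewrite (out a) ?ltxx// (out b) ?ltxx ?andbF// !mul0r subrr.
have <- : \int[mu]_(x in Om) (h x * phi x) = I a b (fun x => phi x * h x).
  rewrite (@Rint_support `[a, b]%classic).
  - by apply: eq_Rintegral => x _; rewrite mulrC.
  - by move=> x /=; rewrite !in_itv/=; lra.
  - move=> x _ /=; rewrite in_itv/= => /negP xab; rewrite out ?mulr0//.
    by apply: contra xab; lra.
by rewrite T// add0r => <-.
Qed.

(** The primitive of an integrable function is differentiable a.e. with derivative h. *)
Lemma zero_integrals_ae h : (forall a b, 0 < a -> b < 1 -> ig a b h) ->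
  (forall c d, 0 < c -> c <= d -> d < 1 -> I c d h = 0) -> {ae mu, forall x, Om x -> h x = 0}.
Proof.
move=> ih I0.
have loc a b : 0 < a -> a < b -> b < 1 -> {ae mu, forall x, a < x < b -> h x = 0}.
  move=> a0 ab b1; pose g := h \_ `[a, b].
  have ig1 : mu.-integrable setT (EFin \o g).
    by have := (@integrable_mkcond _ _ _ mu `[a, b]%classic (EFin \o h) (measurable_itv _)).1 (ih a b a0 b1); rewrite restrict_EFin.
  have igy y : mu.-integrable `]-oo, y] (EFin \o g) by apply: integrableS ig1.
  have := FTC1Ny igy (open_integrable_locally openT ig1).
  apply: filterS; first exact: (ae_filter_ringOfSetsType mu).
  move=> x /= [dF F'] /andP[ax xb].
  have gx : g x = h x by rewrite /g patchE mem_set//= in_itv/= !ltW.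
  rewrite -gx -F' derive1E.
  rewrite (@near_eq_derive _ _ _ _ (fun=> 0)); first by rewrite derive_cst.
  near=> y.
  have ay : a < y by near: y; exact: lt_nbhsr.
  have yb : y < b by near: y; exact: lt_nbhsl.
  rewrite (@Rint_support `[a, y]%classic).
  - rewrite -(I0 a y a0 (ltW ay) (lt_trans yb b1)); apply: eq_Rintegral => t.
    rewrite inE/= in_itv/= => /andP[t1 t2]; rewrite /g patchE mem_set//= in_itv/= t1.
    by apply: le_trans t2 _; exact: ltW.
  - by move=> t /=; rewrite !in_itv/= => /andP[].
  - move=> t /=; rewrite !in_itv/= => ty /negP; rewrite ty andbT -ltNge => ta.
    by rewrite /g patchE memNset//= in_itv/= leNgt ta.
have : {ae mu, forall x, forall n : nat, n.+3%:R^-1 < x < 1 - n.+3%:R^-1 -> h x = 0}.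
  apply: ae_foralln => n; apply: loc.
  - by rewrite invr_gt0.
  - have : n.+3%:R^-1 <= (3^-1 : R) by rewrite lef_pV2 ?posrE// ler_nat.
    by move: (n.+3%:R^-1) => k; lra.
  - by rewrite ltrBlDr ltrDl invr_gt0.
apply: filterS; first exact: (ae_filter_ringOfSetsType mu).
move=> x H; rewrite /= in_itv/= => /andP[x0 x1].
pose m := Num.min x (1 - x).
have m0 : 0 < m by rewrite lt_min x0 subr_gt0.
have [mx mx'] : m <= x /\ m <= 1 - x by rewrite !ge_min !lexx orbT.
apply: (H (Num.trunc m^-1)).
have : (Num.trunc m^-1).+3%:R^-1 < m.
  rewrite -[ltRHS]invrK ltf_pV2 ?posrE ?invr_gt0//.
  have /andP[_ h1] := truncn_itv (ltac:(by rewrite invr_ge0 ltW) : 0 <= m^-1).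
  by apply: lt_trans h1 _; rewrite ltr_nat.
by move: (_.+3%:R^-1) => k h1; apply/andP; split; lra.
Unshelve. all: by end_near. Qed.

Lemma weakly_zero h : locally_integrable Om h ->
  (forall phi, C1c Om phi -> \int[mu]_(x in Om) (h x * phi x) = 0) ->
  {ae mu, forall x, Om x -> h x = 0}.
Proof.
move=> lh T; apply: zero_integrals_ae; last exact: weakly_zero_integral.
by move=> a b a0 b1; exact: locally_ig.
Qed.

Lemma locally_test h psi a : locally_integrable Om h -> continuous psi -> 0 < a ->
  (forall x, ~~ (a <= x <= 1 - a) -> psi x = 0) ->
  ig a (1 - a) (fun x => h x * psi x) /\ \int[mu]_(x in Om) (h x * psi x) = I a (1 - a) (fun x => h x * psi x).
Proof.
move=> lh cpsi a0 psi0; split.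
  apply: (@ig_eq _ _ _ (fun x => psi x * h x)); first by move=> x _; rewrite mulrC.
  by apply: ig_mul_continuous => //; apply: locally_ig => //; lra.
apply: Rint_support.
  by move=> x /=; rewrite !in_itv/=; lra.
by move=> x _ /=; rewrite in_itv/= => /negP xa; rewrite psi0 ?mulr0.
Qed.

Lemma locally_sub h k : locally_integrable Om h -> locally_integrable Om k -> locally_integrable Om (fun x => h x - k x).
Proof.
move=> lh lk; have [mh oO fh] := lh; have [mk _ fk] := lk.
have mhk : measurable_fun Om (fun x => h x - k x) by exact: measurable_funB.
split => // K KO cK.
have mK : measurable K by exact: compact_measurable.
have mf (g : R -> R) : measurable_fun Om g -> measurable_fun K (fun x => `|g x|%:E).
  by move=> mg; apply/measurable_EFinP; apply: measurableT_comp => //; exact: measurable_funS mg.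
apply: (@le_lt_trans _ _ (\int[mu]_(x in K) (`|h x|%:E + `|k x|%:E))%E).
  apply: ge0_le_integral => //.
  - exact: mf.
  - by apply: emeasurable_funD; exact: mf.
  - by move=> x _; rewrite -EFinD lee_fin ler_normB.
rewrite ge0_integralD//; [|exact: mf|exact: mf].
by rewrite lte_add_pinfty ?fh ?fk.
Qed.

Lemma weak_derive_unique u v1 v2 : is_weak_derive Om u v1 -> is_weak_derive Om u v2 -> {ae mu, forall x, Om x -> v1 x = v2 x}.
Proof.
move=> [lu l1 T1] [_ l2 T2].
have : {ae mu, forall x, Om x -> v1 x - v2 x = 0}.
  apply: weakly_zero; first exact: locally_sub.
  move=> phi tphi; have [a /andP[a0 a1] phi0] := C1c_itv tphi.
  have cphi := C1c_continuous tphi.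
  have [i1 e1] := locally_test l1 cphi a0 phi0; have [i2 e2] := locally_test l2 cphi a0 phi0.
  have [i3 ->] := locally_test (locally_sub l1 l2) cphi a0 phi0.
  have -> : I a (1 - a) (fun x => (v1 x - v2 x) * phi x) = I a (1 - a) (fun x => v1 x * phi x - v2 x * phi x).
    by apply: I_eq => x _; ring.
  rewrite I_sub// -e1 -e2; apply/eqP; rewrite subr_eq0; apply/eqP.
  by apply: oppr_inj; rewrite -T1// -T2.
apply: filterS; first exact: (ae_filter_ringOfSetsType mu).
by move=> x H /H /eqP; rewrite subr_eq0 => /eqP.
Qed.

Lemma antiderivative (s : R -> R) : continuous s -> (forall x, x < 0 -> s x = 0) ->
  forall x, is_derive x (1 : R) (fun y => I (-1) y s) (s x).
Proof.
move=> cs s0 x; have is_ p q : ig p q s by exact: ig_continuous.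
have base b y : b <= -1 -> I (-1) y s = I b y s.
  move=> b1; have [y1|y1] := leP (-1) y.
    rewrite (@I_split _ b (-1) y)// (@I_eq _ b (-1) s (fun=> 0)) ?I_cst// ?mul0r ?add0r//.
    by move=> t t1; apply: s0; lra.
  rewrite I_empty ?(ltW y1)//; have [b_y|b_y] := leP b y; last by rewrite I_empty// ltW.
  by rewrite (@I_eq _ b y s (fun=> 0)) ?I_cst ?mul0r// => t t1; apply: s0; lra.
pose b := Num.min (-1) (x - 1).
have [b1 bx] : b <= -1 /\ b <= x - 1 by rewrite !ge_min !lexx orbT.
have -> : (fun y => I (-1) y s) = (fun y => I b y s) by apply/funext => y; exact: base.
have [] := @continuous_FTC1_closed R s b x (x + 1) (ltac:(lra)) (is_ b (x + 1)) (ltac:(lra)) (cs x).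
move=> d1 d2; have d3 : derivable (fun y => I b y s) x 1 := d1.
have d4 : derive1 (fun y => I b y s) x = s x := d2.
by apply: (DeriveDef d3); rewrite -derive1E.
Qed.

(** Subtracting a suitable multiple of one fixed test function makes every test
    function the derivative of a test function. *)
Lemma weakly_constant h : locally_integrable Om h ->
  (forall phi, C1c Om phi -> \int[mu]_(x in Om) (h x * derive1 phi x) = 0) ->
  exists k, {ae mu, forall x, Om x -> h x = k}.
Proof.
move=> lh T.
have e8 : 0 <= (8^-1 : R) by rewrite invr_ge0.
have tr : C1c Om (@bump R 8^-1 4^-1 (3 / 4)) by apply: bump_test; lra.
set rho := @bump R 8^-1 4^-1 (3 / 4) in tr.
have crho := C1c_continuous tr.
have rho_out x : ~~ (8^-1 <= x <= 1 - 8^-1) -> rho x = 0.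
  rewrite negb_and -!ltNge => /orP[x1|x1]; rewrite /rho /bump.
    by rewrite !step_left ?subrr//; lra.
  by rewrite !step_right ?subrr//; lra.
have irho p q : ig p q rho by exact: ig_continuous.
have rho0 x : 0 <= rho x by rewrite /rho /bump subr_ge0; apply: step_mono => //; lra.
pose m0 := I 0 1 rho.
have m00 : 0 < m0.
  apply: (@lt_le_trans _ _ (I (3 / 8) (5 / 8) rho)); last by apply: I_sub_le => //; lra.
  apply: (@lt_le_trans _ _ ((8^-1) ^+ 2 * (5 / 8 - 3 / 8))).
    by apply: mulr_gt0; [rewrite exprn_gt0// invr_gt0|lra].
  apply: I_lower => //; first by lra.
  by move=> x x1; rewrite /rho /bump step_right ?step_left ?subr0//; lra.
pose kap := \int[mu]_(x in Om) (h x * rho x) / m0.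
exists kap.
have lk : locally_integrable Om (fun=> kap).
  have [_ oO _] := lh; apply: open_integrable_locally => //.
  apply: (@integrableS _ _ _ mu `[0, 1]%classic) => //; last exact: ig_cst.
  by move=> x /=; rewrite !in_itv/=; lra.
suff : {ae mu, forall x, Om x -> h x - kap = 0}.
  apply: filterS; first exact: (ae_filter_ringOfSetsType mu).
by move=> x H /H /eqP; rewrite subr_eq0 => /eqP.
apply: weakly_zero; first exact: locally_sub.
move=> psi tpsi; have [a' /andP[a0' a1'] psi0'] := C1c_itv tpsi.
pose a := Num.min a' 8^-1.
have [aa' a8] : a <= a' /\ a <= 8^-1 by rewrite !ge_min !lexx orbT.
have a0 : 0 < a by rewrite lt_min a0'/= invr_gt0.
have psi0 x : ~~ (a <= x <= 1 - a) -> psi x = 0.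
  by move=> xa; apply: psi0'; apply: contra xa; lra.
have rho_out' x : ~~ (a <= x <= 1 - a) -> rho x = 0.
  by move=> xa; apply: rho_out; apply: contra xa; lra.
have cpsi := C1c_continuous tpsi.
have ipsi p q : ig p q psi by exact: ig_continuous.
pose c := I 0 1 psi / m0.
pose Psi x := psi x - c * rho x.
have cPsi : continuous Psi.
  by move=> x; apply: cvgB; [exact: cpsi|apply: cvgM; [exact: cvg_cst|exact: crho]].
have iPsi p q : ig p q Psi by exact: ig_continuous.
have Psi0 x : ~~ (a <= x <= 1 - a) -> Psi x = 0.
  by move=> xa; rewrite /Psi psi0// rho_out'// mulr0 subrr.
pose Phi x := I (-1) x Psi.
have dPhi x : is_derive x (1 : R) Phi (Psi x).
  by apply: antiderivative => // t t0; apply: Psi0; lra.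
have Psi_eq0 p q : p <= q -> (forall t, p <= t <= q -> ~~ (a <= t <= 1 - a)) -> I p q Psi = 0.
  by move=> pq out; rewrite (@I_eq _ _ _ Psi (fun=> 0)) ?I_cst ?mul0r// => t tpq; apply: Psi0; exact: out.
have I01 : I 0 1 Psi = 0.
  rewrite I_sub// ?I_scale// -/m0; last exact: ig_scale.
  by rewrite /c divfK ?gt_eqF// subrr.
have Phi0 x : ~~ (a <= x <= 1 - a) -> Phi x = 0.
  rewrite negb_and -!ltNge => /orP[xa|xa].
    have [x1|x1] := leP (-1) x; last by rewrite /Phi I_empty// ltW.
    by apply: Psi_eq0 => // t; move: xa; clear; lra.
  have x0 : 0 <= x by lra.
  have n10 : -1 <= 0 :> R by lra.
  have z0 : I (-1) 0 Psi = 0 by apply: Psi_eq0 => // t; move: a0; clear; lra.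
  rewrite /Phi (I_split (iPsi (-1) x) n10 x0) z0 add0r; have [x1|x1] := leP x 1.
    by have := I01; rewrite (@I_split _ 0 x 1)// (Psi_eq0 x 1)// ?addr0// => t; move: xa; clear; lra.
  rewrite (@I_split _ 0 1 x)// ?(ltW x1)// I01 add0r Psi_eq0 ?(ltW x1)// => t; move: a0; clear; lra.
have tPhi : C1c Om Phi.
  split.
  - by move=> x; have [] := dPhi x.
  - by rewrite (is_derive1_eq dPhi).
  - exists `[a, 1 - a]%classic; split; first exact: segment_compact.
      by move=> x /=; rewrite !in_itv/=; lra.
    by move=> x; rewrite /= in_itv/= => /negP; exact: Phi0.
have := T _ tPhi; rewrite (is_derive1_eq dPhi).
have [i1 ->] := locally_test lh cPsi a0 Psi0.
have [i2 _] := locally_test lh cpsi a0 psi0.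
have [i3 e3] := locally_test lh crho a0 rho_out'.
have [i4 ->] := locally_test (locally_sub lh lk) cpsi a0 psi0.
have -> : I a (1 - a) (fun x => h x * Psi x) = I a (1 - a) (fun x => h x * psi x - c * (h x * rho x)).
  by apply: I_eq => x _; rewrite /Psi; ring.
have -> : I a (1 - a) (fun x => (h x - kap) * psi x) = I a (1 - a) (fun x => h x * psi x - kap * psi x).
  by apply: I_eq => x _; ring.
rewrite I_sub// ?I_scale//; last exact: ig_scale.
rewrite I_sub// ?I_scale//; last exact: ig_scale.
have -> : I a (1 - a) psi = I 0 1 psi.
  apply/esym/Rint_support; first by move=> x /=; rewrite !in_itv/=; lra.
  by move=> x _ /=; rewrite in_itv/= => /negP; exact: psi0.
rewrite -e3 -/(kap * m0) /c.
have <- : kap * m0 = \int[mu]_(x in Om) (h x * rho x) by rewrite /kap divfK// gt_eqF.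
move=> /eqP; rewrite subr_eq0 => /eqP ->.
by field; rewrite gt_eqF.
Qed.

Lemma I_support (g h : R -> R) a : 0 < a -> (forall x, ~~ (a <= x <= 1 - a) -> g x = 0) ->
  I 0 1 (fun x => g x * h x) = I a (1 - a) (fun x => h x * g x).
Proof.
move=> a0 g0; transitivity (I a (1 - a) (fun x => g x * h x)); last by apply: I_eq => x _; rewrite mulrC.
apply: Rint_support; first by move=> x /=; rewrite !in_itv/=; lra.
by move=> x _ /=; rewrite in_itv/= => /negP xa; rewrite g0 ?mul0r.
Qed.

(** The difference of u and the primitive has weak derivative zero, so it is a.e.
    constant. *)
Lemma weak_derive_primitive u v : is_weak_derive Om u v -> ig 0 1 v ->
  exists k, {ae mu, forall x, Om x -> u x = k + prim 0 1 v x}.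
Proof.
move=> [lu lv T] iv; have cV := prim_continuous_integrable (@ler01 R) iv.
have [_ oO _] := lu.
have ioo g : ig 0 1 g -> mu.-integrable Om (EFin \o g).
  by move=> ig1; apply: integrableS ig1 => // x /=; rewrite !in_itv/=; lra.
have lV : locally_integrable Om (prim 0 1 v).
  by apply: open_integrable_locally => //; apply: ioo; exact: ig_continuous.
have [phi tphi|k H] := @weakly_constant (fun x => u x - prim 0 1 v x) (locally_sub lu lV).
  have [a /andP[a0 a1] phi0] := C1c_itv tphi.
  have cphi := C1c_continuous tphi; have [_ cphi' _] := tphi.
  have phi0' x := C1c_derive_out phi0 (x := x).
  have [i1 e1] := locally_test lu cphi' a0 phi0'; have [i2 e2] := locally_test lV cphi' a0 phi0'.
  have [i3 e3] := locally_test lv cphi a0 phi0.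
  have [_ ->] := locally_test (locally_sub lu lV) cphi' a0 phi0'.
  have -> : I a (1 - a) (fun x => (u x - prim 0 1 v x) * derive1 phi x) =
     I a (1 - a) (fun x => u x * derive1 phi x - prim 0 1 v x * derive1 phi x).
    by apply: I_eq => x _; ring.
  rewrite I_sub// -e1 -e2 T//.
  have [M M0 hM] := continuous_itv_bounded 0 1 cphi'.
  have := by_parts ler01 cV cphi cphi' iv (fun x y ax xy yb => primB iv ax xy yb) (fun x y _ xy _ => C1c_ftc tphi xy) hM.
  rewrite (phi0 0) ?(phi0 1) ?mul0r ?subrr; [|by rewrite negb_and -!ltNge; lra|by rewrite negb_and -!ltNge; lra].
  rewrite !(I_support _ a0 phi0) !(I_support _ a0 phi0') -e3 -e2 => h0; lra.
exists k; apply: filterS H; first exact: (ae_filter_ringOfSetsType mu).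
by move=> x H /H <-; rewrite subrK.
Qed.

(** Integration by parts against a test function. *)
Lemma primitive_weak_derive u v : continuous u -> ig 0 1 v ->
  (forall x y, 0 <= x -> x <= y -> y <= 1 -> u y - u x = I x y v) -> is_weak_derive Om u v.
Proof.
move=> cu iv P.
have oO : open Om by exact: interval_open.
have ioo g : ig 0 1 g -> mu.-integrable Om (EFin \o g).
  by move=> ig1; apply: integrableS ig1 => // x /=; rewrite !in_itv/=; lra.
have lu : locally_integrable Om u by apply: open_integrable_locally => //; apply: ioo; exact: ig_continuous.
have lv : locally_integrable Om v by apply: open_integrable_locally => //; exact: ioo.
split=> // phi tphi.
have [a /andP[a0 a1] phi0] := C1c_itv tphi.
have cphi := C1c_continuous tphi; have [_ cphi' _] := tphi.
have phi0' x := C1c_derive_out phi0 (x := x).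
have [i1 ->] := locally_test lu cphi' a0 phi0'; have [i3 ->] := locally_test lv cphi a0 phi0.
have [M M0 hM] := continuous_itv_bounded 0 1 cphi'.
have := by_parts ler01 cu cphi cphi' iv P (fun x y _ xy _ => C1c_ftc tphi xy) hM.
rewrite (phi0 0) ?(phi0 1) ?mul0r ?subrr; [|by rewrite negb_and -!ltNge; lra|by rewrite negb_and -!ltNge; lra].
rewrite !(I_support _ a0 phi0) !(I_support _ a0 phi0') => h0; lra.
Qed.

End weak_derivatives.

(** * The functional on H2 *)

Section sobolev.
Context {R : realType}.
Implicit Types (a b c d x y : R) (u v w z h g phi : R -> R).
Local Notation mu := (@lebesgue_measure R).
Local Notation Om := (`]0%R, 1%R[%classic : set R).

Let mOm : measurable (Om : set (measurableTypeR R)). Proof. exact: measurable_itv. Qed.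

Lemma integral_open g : ig 0 1 g -> (\int[mu]_(x in Om) (g x)%:E)%E = (I 0 1 g)%:E.
Proof.
move=> ig1.
have i2 : mu.-integrable Om (EFin \o g).
  by apply: integrableS ig1 => // x /=; rewrite !in_itv/=; lra.
have i3 : mu.-integrable `[0%R, 1%R[ (EFin \o g).
  by apply: integrableS ig1 => // x /=; rewrite !in_itv/=; lra.
have := integrable_fin_num mOm i2 => /fineK <-.
congr (_%:E); rewrite -/(Rintegral mu Om g).
by rewrite Rintegral_itv_obnd_cbnd// Rintegral_itv_bndo_bndc.
Qed.

Lemma ae_Rintegral g h : measurable_fun Om g -> measurable_fun Om h -> {ae mu, forall x, Om x -> g x = h x} ->
  \int[mu]_(x in Om) g x = \int[mu]_(x in Om) h x.
Proof.
move=> mg mh gh; rewrite /Rintegral; congr fine; apply: ae_eq_integral => //.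
- exact/measurable_EFinP.
- exact/measurable_EFinP.
- apply: filterS gh; first exact: (ae_filter_ringOfSetsType mu).
  by move=> x H /H ->.
Qed.

Lemma C1c_measurable phi : C1c Om phi -> measurable_fun Om phi /\ measurable_fun Om (derive1 phi).
Proof.
move=> tphi; have [_ cphi' _] := tphi.
by split; apply: measurable_funTS; apply: measurable_continuous => //; exact: C1c_continuous tphi.
Qed.

Lemma is_weak_derive_ae u1 u2 v1 v2 : is_weak_derive Om u1 v1 -> locally_integrable Om u2 -> locally_integrable Om v2 ->
  {ae mu, forall x, Om x -> u1 x = u2 x} -> {ae mu, forall x, Om x -> v1 x = v2 x} -> is_weak_derive Om u2 v2.
Proof.
move=> [l1 k1 T] l2 k2 u12 v12; split => // phi tphi.
have [m1 m2] := C1c_measurable tphi.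
have [ml1 _ _] := l1; have [ml2 _ _] := l2; have [mk1 _ _] := k1; have [mk2 _ _] := k2.
rewrite -(@ae_Rintegral (fun x => u1 x * derive1 phi x)); [|exact: measurable_funM|exact: measurable_funM|].
  rewrite T//; congr (- _); apply: ae_Rintegral; [exact: measurable_funM|exact: measurable_funM|].
  apply: filterS v12; first exact: (ae_filter_ringOfSetsType mu).
  by move=> x H /H ->.
apply: filterS u12; first exact: (ae_filter_ringOfSetsType mu).
by move=> x H /H ->.
Qed.

Lemma weak_deriveP u v : is_weak_derive Om u v -> is_weak_derive Om u (weak_derive Om u).
Proof. by move=> H; apply: (@xgetPex _ _ [set v | is_weak_derive Om u v]); exists v. Qed.

Definition cut g x := if (0 < x < 1) then g x else 0.

Lemma cutE g : cut g = g \_ Om.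
Proof.
apply/funext => x; rewrite /cut patchE; case: ifPn => x01.
  by rewrite mem_set//= in_itv.
by rewrite memNset//= in_itv/=; exact/negP.
Qed.

Lemma cut_in g x : Om x -> cut g x = g x.
Proof. by rewrite /= in_itv/= /cut => ->. Qed.

Lemma L2_cut g : L2 Om g -> measurable_fun [set: R] (cut g) /\ forall a b, ig a b (fun x => cut g x ^+ 2).
Proof.
move=> [mg ig1]; split; first by rewrite cutE; exact: (measurable_restrictT _ mOm).1 mg.
move=> a b; have := (@integrable_mkcond _ _ _ mu Om (EFin \o (fun x => g x ^+ 2)) mOm).1 ig1.
rewrite restrict_EFin => ig2.
have -> : (fun x => cut g x ^+ 2) = (fun x => g x ^+ 2) \_ Om.
  by apply/funext => x; rewrite cutE !patchE; case: ifP => // _; rewrite expr0n.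
by apply: integrableS ig2.
Qed.

Lemma ig_oo g : ig 0 1 g -> mu.-integrable Om (EFin \o g).
Proof. by move=> ig1; apply: integrableS ig1 => // x /=; rewrite !in_itv/=; lra. Qed.

Lemma Om_open : open Om. Proof. exact: interval_open. Qed.

Lemma ig_local g : ig 0 1 g -> locally_integrable Om g.
Proof. by move=> ig1; apply: open_integrable_locally; [exact: Om_open|exact: ig_oo]. Qed.

Lemma locally_eq g h : (forall x, Om x -> g x = h x) -> locally_integrable Om g -> locally_integrable Om h.
Proof.
move=> gh [mg oO fg]; split => //.
  by apply: eq_measurable_fun mg => x; rewrite inE => /gh.
move=> K KO cK; have -> : (\int[mu]_(x in K) `|h x|%:E = \int[mu]_(x in K) `|g x|%:E)%E.
  by apply: eq_integral => x; rewrite inE => /KO /gh ->.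
exact: fg.
Qed.

Lemma ae_sym (g h : R -> R) : {ae mu, forall x, Om x -> g x = h x} -> {ae mu, forall x, Om x -> h x = g x}.
Proof.
apply: filterS; first exact: (ae_filter_ringOfSetsType mu).
by move=> x h1 ox; rewrite h1.
Qed.

Lemma ae_of (g h : R -> R) : (forall x, Om x -> g x = h x) -> {ae mu, forall x, Om x -> g x = h x}.
Proof. by move=> gh; apply: aeW => x; exact: gh. Qed.

Definition represents u w v z := [/\ {ae mu, forall x, Om x -> u x = w x},
  {ae mu, forall x, Om x -> weak_derive Om u x = v x} &
  {ae mu, forall x, Om x -> weak_derive Om (weak_derive Om u) x = z x}].

(** Integrate twice: u' is a.e. a primitive of u'', and u is one of u'. *)
Lemma H2_arc u : H2 Om u -> exists w v z, h2arc 0 1 w v z /\ represents u w v z.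
Proof.
move=> [[_ [v1 _ d1]] [_ [z1 z1L d2]]].
have e1 := weak_deriveP d1; have e2 := weak_deriveP d2.
set u' := weak_derive Om u in d2 e1 e2.
have [mz iz] := L2_cut z1L.
pose z := cut z1.
have iz1 : ig 0 1 z by exact: ig_sqr.
have [lu lu' _] := e1.
have d3 : is_weak_derive Om u' z.
  apply: (is_weak_derive_ae d2 lu' (ig_local iz1) (ae_of (fun x _ => erefl))).
  by apply: ae_of => x ox; rewrite /z cut_in.
have [k1 H1] := weak_derive_primitive d3 iz1.
pose v x := k1 + prim 0 1 z x.
have cv : continuous v.
  by move=> x; apply: cvgD; [exact: cvg_cst|exact: prim_continuous_integrable].
have iv : ig 0 1 v by exact: ig_continuous.
have d4 : is_weak_derive Om u v by exact: (is_weak_derive_ae e1 lu (ig_local iv) (ae_of (fun x _ => erefl)) H1).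
have [k2 H2] := weak_derive_primitive d4 iv.
pose w x := k2 + prim 0 1 v x.
exists w, v, z; split; last first.
  split => //; apply: weak_derive_unique e2 d3.
split => //.
- by move=> x; apply: cvgD; [exact: cvg_cst|exact: prim_continuous_integrable].
- move=> x y x0 xy y1; split.
    by rewrite -(primB iz1 x0 xy y1) /v; ring.
  by rewrite -(primB iv x0 xy y1) /w; ring.
Qed.

Lemma L2_of_ig g : measurable_fun Om g -> ig 0 1 (fun x => g x ^+ 2) -> L2 Om g.
Proof. by move=> mg ig1; split => //; exact: (@ig_oo (fun x => g x ^+ 2)). Qed.

Lemma L2_ae g h : measurable_fun Om h -> L2 Om g -> {ae mu, forall x, Om x -> g x = h x} -> L2 Om h.
Proof.
move=> mh [mg ig1] gh; split => //.
have mh2 : measurable_fun Om (EFin \o (fun x => h x ^+ 2)) by apply/measurable_EFinP; exact: measurable_funX.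
apply/integrableP; split => //.
have [mg2 fg] := integrableP _ _ _ ig1.
rewrite (@ae_eq_integral _ _ _ mu Om (fun x => `|(EFin \o (fun x => (g x ^+ 2)%R)) x|)%E) => //.
- exact: measurableT_comp.
- exact: measurableT_comp.
- apply: filterS gh; first exact: (ae_filter_ringOfSetsType mu).
  by move=> x H /H /= ->.
Qed.

Lemma arc_H2 w v z : h2arc 0 1 w v z -> H2 Om w /\ represents w w v z.
Proof.
move=> A; have [cw cv mz iz P] := A; have iz1 := arc_igz A.
have iv : ig 0 1 v by exact: ig_continuous.
have mOm' g : measurable_fun setT g -> measurable_fun Om g by exact: measurable_funTS.
have d1 : is_weak_derive Om w v.
  by apply: primitive_weak_derive => // x y x0 xy y1; have [] := P x y x0 xy y1.
have d2 : is_weak_derive Om v z.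
  by apply: primitive_weak_derive => // x y x0 xy y1; have [] := P x y x0 xy y1.
have e1 := weak_deriveP d1; have q1 := weak_derive_unique e1 d1.
have [_ l1 _] := e1; have [_ lz _] := d2.
have d3 : is_weak_derive Om (weak_derive Om w) z.
  exact: (is_weak_derive_ae d2 l1 lz (ae_sym q1) (ae_of (fun x _ => erefl))).
have e3 := weak_deriveP d3; have q3 := weak_derive_unique e3 d3.
have mv := measurable_continuous cv; have mw := measurable_continuous cw.
have Lv : L2 Om v by apply: L2_of_ig; [exact: mOm'|exact: ig_sqr_continuous].
have Lz : L2 Om z by apply: L2_of_ig; [exact: mOm'|].
have Lw : L2 Om w by apply: L2_of_ig; [exact: mOm'|exact: ig_sqr_continuous].
split; last by split => //; exact: ae_of.
split; first by split => //; exists v.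
split; last by exists z.
by apply: L2_ae Lv (ae_sym q1); have [] := l1.
Qed.

Lemma H2_measurable u : H2 Om u -> [/\ measurable_fun Om u, measurable_fun Om (weak_derive Om u) &
  measurable_fun Om (weak_derive Om (weak_derive Om u))].
Proof.
move=> [[[mu1 _] [v1 _ d1]] [[mu2 _] [z1 z1L d2]]]; split => //.
by have [_ [] ] := weak_deriveP d2.
Qed.

Lemma PMF_arc (e beta : R) (f0 f u w v z : R -> R) : continuous f -> (forall x, Om x -> f x = f0 x) ->
  H2 Om u -> h2arc 0 1 w v z -> represents u w v z ->
  PMF e beta f0 Om u = (E (hh e) beta f 0 1 w v z)%:E.
Proof.
move=> cf ff H A [q1 q2 q3]; have [m1 m2 m3] := H2_measurable H.
have iD := ig_dens (hh e) beta cf A.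
rewrite /E -integral_open// /PMF; apply: ae_eq_integral => //.
- apply/measurable_EFinP; apply: measurable_funD.
    apply: measurable_funD.
      by apply: measurable_funM => //; exact: measurable_funX.
    apply: (@measurableT_comp _ _ _ _ _ _ (@G R) _ (weak_derive Om u)) => //.
    exact: measurable_continuous (@G_continuous R).
  apply: measurable_funM => //; apply: measurable_funX; apply: measurable_funB => //.
  apply: (@eq_measurable_fun _ _ _ _ Om f) => [x|]; first by rewrite inE => /ff.
  by apply: measurable_funTS; exact: measurable_continuous.
- by have /integrableP[] := ig_oo iD.
- near=> x => ox /=.
  have -> : u x = w x by apply: (near q1 x).
  have -> : weak_derive Om u x = v x by apply: (near q2 x).
  have -> : weak_derive Om (weak_derive Om u) x = z x by apply: (near q3 x).
  by rewrite -ff// /dens.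
Unshelve. all: by end_near. Qed.

(** Every arc is in H2, so minimality over H2 is minimality over arcs. *)
Lemma minimizer_arc (e beta : R) (f0 f u : R -> R) : continuous f -> (forall x, Om x -> f x = f0 x) ->
  minimizer (H2 Om) (PMF e beta f0 Om) u ->
  exists w v z, minimal (hh e) beta f w v z /\ represents u w v z.
Proof.
move=> cf ff [H M]; have [w [v [z [A r]]]] := H2_arc H.
exists w, v, z; split => //; split => // w' v' z' A'.
have [H' r'] := arc_H2 A'.
by have := M _ H'; rewrite (PMF_arc e beta cf ff H A r) (PMF_arc e beta cf ff H' A' r') lee_fin.
Qed.

End sobolev.

(** * Functions of class C1 on a compact interval *)

Section c1_functions.
Context {R : realType}.
Variable (f0 : R -> R).
Hypothesis hf : C1_on `[0, 1] f0.
Local Notation A := (`[0%R, 1%R]%classic : set R).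
Local Notation f0' := (derive_in A f0).

Definition ext (h : R -> R) : R -> R := h \o clamp 0 1.

Lemma extE h (x : R) : 0 <= x <= 1 -> ext h x = h x.
Proof. by move=> x01; rewrite /ext /= clampE. Qed.

Let quotient_bound (x : R) : A x -> forall e : R, 0 < e -> exists2 d : R, 0 < d &
  forall y : R, A y -> `|y - x| < d -> `|f0 y - f0 x - f0' x * (y - x)| <= e * `|y - x|.
Proof.
move=> Ax e e0; have /cvgrPdist_le /(_ e e0) := (hf.1 x Ax).
rewrite -/(f0' x) => /nbhs_ballP[d /= d0 H]; exists d => // y Ay yx.
have [->|yxn] := eqVneq y x; first by rewrite !subrr mulr0 subrr normr0 mulr0.
have := H y; rewrite /ball/= distrC => /(_ yx yxn Ay).
have yx0 : y - x != 0 by rewrite subr_eq0.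
have -> : f0 y - f0 x - f0' x * (y - x) = - ((f0' x - (f0 y - f0 x) / (y - x)) * (y - x)) by field.
by rewrite normrN normrM; apply: ler_wpM2r.
Qed.

Lemma C1_derivative_continuous : continuous (ext f0').
Proof. by apply: clamp_within; [exact: ler01|exact: hf.2]. Qed.

Lemma C1_continuous : continuous (ext f0).
Proof.
apply: clamp_within; first exact: ler01.
apply/subspace_continuousP => x Ax; apply/cvgrPdist_le => e e0.
have [d d0 H] := quotient_bound Ax (@ltr01 R).
pose r := Num.min d (e / (1 + `|f0' x|)).
have c0 : 0 < 1 + `|f0' x| by rewrite ltr_pwDl.
have r0 : 0 < r by rewrite lt_min d0 divr_gt0.
apply/nbhs_ballP; exists r => // y; rewrite /ball/= distrC lt_min => /andP[yd ye] Ay.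
rewrite distrC; have := H y Ay yd; rewrite mul1r => h1.
have -> : f0 y - f0 x = (f0 y - f0 x - f0' x * (y - x)) + f0' x * (y - x) by ring.
apply: le_trans (ler_normD _ _) _; rewrite normrM.
apply: (@le_trans _ _ ((1 + `|f0' x|) * `|y - x|)); first by rewrite mulrDl mul1r lerD2r.
by rewrite mulrC -ler_pdivlMr// ltW.
Qed.

Lemma C1_derivative (x : R) : 0 < x < 1 -> is_derive x (1 : R) (ext f0) (ext f0' x).
Proof.
move=> /andP[x0 x1]; have Ax : A x by rewrite /= in_itv/= !ltW.
have xx : 0 <= x <= 1 by rewrite !ltW.
have cv : h^-1 *: (ext f0 (h *: (1 : R) + x) - ext f0 x) @[h --> (0 : R)^'] --> ext f0' x.
  apply/cvgrPdist_le => e e0; rewrite !extE//.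
  have [d d0 H] := quotient_bound Ax e0.
  near=> h.
  have h0 : h != 0 by near: h; exact: nbhs_dnbhs_neq.
  have hd : `|h| < Num.min d (Num.min x (1 - x)).
    near: h; apply: nbhs_dnbhs.
    have m0 : 0 < Num.min d (Num.min x (1 - x)) by rewrite !lt_min d0 x0 subr_gt0.
    have := nbhsx_ballx (0 : R) _ m0; apply: filterS => r; by rewrite /ball/= sub0r normrN.
  move: hd; rewrite !lt_min => /andP[hd /andP[hx hx']].
  have y01 : 0 <= h + x <= 1 by move: hx hx'; rewrite !ltr_norml; lra.
  have Ay : A (h + x) by rewrite /= in_itv/=.
  rewrite /GRing.scale /= mulr1 extE//.
  have := H (h + x) Ay; rewrite addrK => /(_ hd) K.
  have -> : f0' x - h^-1 * (f0 (h + x) - f0 x) = - (h^-1 * (f0 (h + x) - f0 x - f0' x * h)) by field.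
  by rewrite normrN normrM normfV ler_pdivrMl ?normr_gt0// [leRHS]mulrC.
have dF : derivable (ext f0) x 1 by apply/cvg_ex; exists (ext f0' x).
by apply: DeriveDef; [exact: dF|exact: cvg_lim cv].
Unshelve. all: by end_near. Qed.

Lemma C1_ftc (a b : R) : 0 <= a -> a <= b -> b <= 1 -> ext f0 b - ext f0 a = I a b (ext f0').
Proof.
move=> a0; rewrite le_eqVlt => /orP[/eqP -> _|ab b1]; first by rewrite subrr I_empty.
have int x : x \in `]a, b[ -> 0 < x < 1 by rewrite in_itv/=; move: a0 b1; lra.
rewrite /I /Rintegral (@continuous_FTC2 _ (ext f0') (ext f0))//.
- exact/continuous_subspaceT/C1_derivative_continuous.
- split=> [x /int x01||]; first by case: (C1_derivative x01).
    by apply: cvg_at_right_filter; exact: C1_continuous.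
  by apply: cvg_at_left_filter; exact: C1_continuous.
- by move=> x /int x01; rewrite derive1E; case: (C1_derivative x01).
Qed.

Lemma C1_lipschitz : exists2 L : R, 0 <= L & forall x y, `|ext f0 y - ext f0 x| <= L * `|y - x|.
Proof.
have [L L0 gL] := continuous_itv_bounded 0 1 C1_derivative_continuous.
exists L => // x y; wlog xy : x y / x <= y.
  move=> H; have [|/ltW yx] := leP x y; first exact: H.
  by rewrite distrC [X in _ <= _ * X]distrC; exact: H.
have cl t : clamp 0 1 (clamp 0 1 t) = clamp 0 1 t :> R.
  by apply: clampE; apply: clamp_itv; exact: ler01.
have e t : ext f0 t = ext f0 (clamp 0 1 t) by rewrite /ext /= cl.
have /andP[x0 x1] := clamp_itv x (@ler01 R); have /andP[y0 y1] := clamp_itv y (@ler01 R).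
have xy' := clamp_le 0 1 xy.
rewrite e [ext f0 x]e C1_ftc//.
apply: le_trans (_ : _ <= L * (clamp 0 1 y - clamp 0 1 x)) _.
  apply: I_norm_bound => //; first exact/ig_continuous/C1_derivative_continuous.
  by move=> t txy; apply: gL; move: txy; lra.
apply: ler_wpM2l => //; have := clamp_dist 0 1 x y; rewrite [X in X <= _]ger0_norm// subr_ge0//.
Qed.

End c1_functions.

(** * Total variations *)

Section total_variation.
Context {R : realType}.
Implicit Types (a b c d x y : R) (u v w z h g phi : R -> R).
Local Notation mu := (@lebesgue_measure R).
Local Notation Om := (`]0%R, 1%R[%classic : set R).

Lemma weak_pairing u v phi : is_weak_derive Om u v -> continuous v -> C1c Om phi ->
  \int[mu]_(x in Om) (u x * derive1 phi x) = - I 0 1 (fun x => phi x * v x).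
Proof.
move=> [_ lv T] cv tphi; rewrite T//; congr (- _).
have [a /andP[a0 a1] phi0] := C1c_itv tphi.
have [_ ->] := locally_test lv (C1c_continuous tphi) a0 phi0.
by rewrite (I_support _ a0 phi0).
Qed.

Lemma BV_variation_le u v : is_weak_derive Om u v -> continuous v ->
  (BV_variation Om u <= (I 0 1 (fun x => `|v x|))%:E)%E.
Proof.
move=> uv cv; apply: ub_ereal_sup => _ [phi [tphi phi1] <-].
have cphi := C1c_continuous tphi.
rewrite lee_fin (weak_pairing uv cv tphi); apply: le_trans (ler_norm _) _; rewrite normrN.
have ipv : ig 0 1 (fun x => phi x * v x).
  by apply: ig_continuous => x; apply: cvgM; [exact: cphi|exact: cv].
apply: le_trans (I_norm ipv) _; apply: I_le; [exact: ig_norm|by apply: ig_norm; exact: ig_continuous|].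
by move=> x _; rewrite normrM ler_piMl.
Qed.

(** Averaging over [x, x + d] for small d gives a differentiable function. *)
Lemma mollify s (t k : R) : 0 < t -> t <= 12^-1 -> 0 < k -> continuous s -> (forall x, `|s x| <= 1) ->
  (forall x, ~~ (2 * t <= x <= 1 - 2 * t) -> s x = 0) ->
  exists phi, [/\ C1c Om phi, forall x, `|phi x| <= 1 & forall x, 0 <= x <= 1 -> `|phi x - s x| <= k].
Proof.
move=> tp t12 k0 cs s1 s0.
have [r r0 UC] := uniformly_continuous_itv 0 1 cs k0.
pose d : R := Num.min t r.
have dt : d <= t by rewrite ge_min lexx.
have dr : d <= r by rewrite ge_min lexx orbT.
have d0 : 0 < d by rewrite lt_min tp.
pose S y := I (-1) y s.
have dS : forall x, is_derive x (1 : R) S (s x).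
  by apply: antiderivative => // x x0; apply: s0; lra.
pose phi x := d^-1 * (S (x + d) - S x).
have dphi x : is_derive x (1 : R) phi (d^-1 * (s (x + d) - s x)).
  have h1 : is_derive x (1 : R) (fun x => S (x + d)) (s (x + d)).
    have := @is_derive_shift R S s (- d) dS x.
    by rewrite opprK.
  have h2 := is_deriveB h1 (dS x).
  exact: (is_deriveZ d^-1 h2).
have iS a b : ig a b s by exact: ig_continuous.
have phiE x : phi x = d^-1 * I x (x + d) s.
  by rewrite /phi (ftc _ cs dS)//; lra.
have phi1 x : `|phi x| <= 1.
  rewrite phiE normrM normfV (gtr0_norm d0) ler_pdivrMl// mulr1.
  have := @I_norm_bound R x (x + d) s 1 (iS _ _) (ltac:(lra)) (fun y _ => s1 y).
  by rewrite mul1r addrAC subrr add0r.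
have phi_s x : 0 <= x <= 1 -> `|phi x - s x| <= k.
  move=> x01; rewrite phiE.
  have -> : d^-1 * I x (x + d) s - s x = d^-1 * (I x (x + d) s - s x * (x + d - x)).
    by field; rewrite gt_eqF.
  rewrite normrM normfV (gtr0_norm d0) ler_pdivrMl//.
  have xd : x <= x + d by lra.
  rewrite -(I_cst (s x) xd) -I_sub; [|exact: iS|exact: ig_cst].
  have := @I_norm_bound R x (x + d) (fun y => s y - s x) k.
  rewrite [x + d - x]addrAC subrr add0r mulrC; apply=> //.
    by apply: ig_sub2 => //; exact: ig_cst.
  by move=> y xy; apply: UC => //; rewrite ler_norml; lra.
have cphi : continuous phi.
  by move=> x; apply: differentiable_continuous; apply/derivable1_diffP; case: (dphi x).
exists phi; split=> //.
- split.
  + by move=> x; case: (dphi x).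
  + rewrite (is_derive1_eq dphi) => x; apply: cvgM; first exact: cvg_cst.
    apply: cvgB; last exact: cs.
    apply: (@continuous_comp _ _ _ (fun x => x + d) s); last exact: cs.
    by apply: cvgD; [exact: cvg_id|exact: cvg_cst].
  + exists `[t, 1 - t]%classic; split; first exact: segment_compact.
      by move=> x /=; rewrite !in_itv/=; lra.
    move=> x; rewrite /= in_itv/= => /negP; rewrite negb_and -!ltNge => xt.
    have xd : x <= x + d by lra.
    rewrite phiE (@I_eq _ _ _ s (fun=> 0)) ?I_cst ?mul0r ?mulr0// => y xy.
    by apply: s0; rewrite negb_and -!ltNge; case/orP: xt => xt; apply/orP; [left|right]; lra.
Qed.

(** The sign of g, smoothed near the zeros of g and cut off near the end points, is nearly
    optimal; mollify turns it into a test function. *)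
Lemma almost_optimal_test g : continuous g -> forall eta, 0 < eta -> exists phi, [/\ C1c Om phi,
  forall x, `|phi x| <= 1 & I 0 1 (fun x => `|g x|) - eta <= - I 0 1 (fun x => phi x * g x)].
Proof.
move=> cg eta eta0; have [M M0 gM] := continuous_itv_bounded 0 1 cg.
have q0 : 0 < eta / 3 by rewrite divr_gt0.
have [t0 t00 ht0] := linear_small (6 * M) q0.
pose t : R := Num.min t0 12^-1.
have tt : t <= t0 by rewrite ge_min lexx.
have t12 : t <= 12^-1 by rewrite ge_min lexx orbT.
have tp : 0 < t by rewrite lt_min t00/=; lra.
have {}ht0 := ht0 t (ltW tp) tt.
have [k k0 hk] := linear_small M q0.
have {}hk := hk k (ltW k0) (lexx k).
pose q : R := eta / 3.
have {}q0 : 0 < q := q0.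
pose chi x := clamp 0 1 ((x - 2 * t) / t) * clamp 0 1 ((1 - 2 * t - x) / t).
have cl01 y : 0 <= clamp 0 1 y <= (1 : R) by apply: clamp_itv; exact: ler01.
have chi01 x : 0 <= chi x <= 1.
  have /andP[p0 p1] := cl01 ((x - 2 * t) / t); have /andP[q1 q2] := cl01 ((1 - 2 * t - x) / t).
  by rewrite /chi mulr_ge0//= mulr_ile1.
have cchi : continuous chi.
  have cl1 : continuous (fun x => (x - 2 * t) / t).
    by move=> x; apply: cvgM; [apply: cvgB; [exact: cvg_id|exact: cvg_cst]|exact: cvg_cst].
  have cl2 : continuous (fun x => (1 - 2 * t - x) / t).
    by move=> x; apply: cvgM; [apply: cvgB; [exact: cvg_cst|exact: cvg_id]|exact: cvg_cst].
  move=> x; apply: cvgM; first exact: (comp_continuous (@clamp_continuous R 0 1) cl1).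
  exact: (comp_continuous (@clamp_continuous R 0 1) cl2).
have chi0 x : ~~ (2 * t <= x <= 1 - 2 * t) -> chi x = 0.
  have cl0 y : y <= 0 -> clamp 0 1 y = 0 :> R by move=> y0; rewrite /clamp max_l// ge_min y0 orbT.
  rewrite negb_and -!ltNge => /orP[h|h]; rewrite /chi.
    by rewrite (cl0 ((x - 2 * t) / t)) ?mul0r// pmulr_lle0 ?invr_gt0//; lra.
  by rewrite (cl0 ((1 - 2 * t - x) / t)) ?mulr0// pmulr_lle0 ?invr_gt0//; lra.
have chi1 x : 3 * t <= x <= 1 - 3 * t -> chi x = 1.
  have cl1 y : 1 <= y -> clamp 0 1 y = 1 :> R by move=> y1; rewrite /clamp min_l ?max_r ?ler01.
  move=> xt; rewrite /chi !cl1 ?mulr1// ler_pdivlMr// mul1r; lra.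
have den x : 0 < `|g x| + q by rewrite ltr_wpDl.
pose s x := - (chi x * (g x / (`|g x| + q))).
have cs : continuous s.
  move=> x; apply: cvgN; apply: cvgM; first exact: cchi.
  apply: cvgM; first exact: cg.
  apply: cvgV; first by rewrite gt_eqF.
  by apply: cvgD; [apply: cvg_norm; exact: cg|exact: cvg_cst].
have gq x : `|g x / (`|g x| + q)| <= 1.
  by rewrite normrM normfV (gtr0_norm (den x)) ler_pdivrMr// mul1r lerDl ltW.
have s1 x : `|s x| <= 1.
  have /andP[c0 c1] := chi01 x.
  by rewrite /s normrN normrM (ger0_norm c0) mulr_ile1.
have s0 x : ~~ (2 * t <= x <= 1 - 2 * t) -> s x = 0 by move=> /chi0 e; rewrite /s e mul0r oppr0.
have gs0 x : 0 <= - (s x * g x).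
  have /andP[c0 c1] := chi01 x.
  have -> : - (s x * g x) = chi x * (g x ^+ 2 / (`|g x| + q)) by rewrite /s; ring.
  by apply: mulr_ge0 => //; apply: divr_ge0; [exact: sqr_ge0|exact: ltW].
have ic h : continuous h -> ig 0 1 h by exact: ig_continuous.
have csg : continuous (fun x => s x * g x) by move=> x; apply: cvgM; [exact: cs|exact: cg].
have isg a b : ig a b (fun x => - (s x * g x)) by apply: ig_continuous => x; apply: cvgN; exact: csg.
have ign a b : ig a b (fun x => `|g x|) by apply: ig_norm; exact: ig_continuous.
have step1 : I 0 1 (fun x => `|g x|) - eta / 3 - q <= I 0 1 (fun x => - (s x * g x)).
  apply: (@le_trans _ _ (I (3 * t) (1 - 3 * t) (fun x => - (s x * g x)))); last first.
    by apply: I_sub_le => //; move: tp t12; clear; lra.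
  apply: (@le_trans _ _ (I (3 * t) (1 - 3 * t) (fun x => `|g x| - q))).
    rewrite I_sub ?I_cst//; [|lra|exact: ig_cst].
    have b1 : I 0 (3 * t) (fun x => `|g x|) <= M * (3 * t - 0).
      by apply: I_bound => //; [by move: tp t12; clear; lra|move=> x x1; apply: gM; move: x1 tp t12; clear; lra].
    have b2 : I (1 - 3 * t) 1 (fun x => `|g x|) <= M * (1 - (1 - 3 * t)).
      by apply: I_bound => //; [by move: tp t12; clear; lra|move=> x x1; apply: gM; move: x1 tp t12; clear; lra].
    rewrite (@I_split _ 0 (3 * t) 1)//; [|by move: tp t12; clear; lra|by move: tp t12; clear; lra].
    rewrite (@I_split _ (3 * t) (1 - 3 * t) 1)//; [|by move: tp t12; clear; lra|by move: tp t12; clear; lra].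
    have qq : q * (1 - 3 * t - 3 * t) <= q by rewrite ler_piMr ?(ltW q0)//; lra.
    lra.
  apply: I_le => //; first by apply: ig_sub2 => //; exact: ig_cst.
  move=> x x3; rewrite /s (chi1 x x3) mul1r mulNr opprK mulrAC -expr2 -(real_normK (num_real (g x))).
  rewrite ler_pdivlMr//; have := sqr_ge0 q; lra.
have [phi [tphi phi1 phi_s]] := mollify tp t12 k0 cs s1 s0.
have cphi := C1c_continuous tphi.
exists phi; split=> //.
have i1 : ig 0 1 (fun x => phi x * g x) by apply: ic => x; apply: cvgM; [exact: cphi|exact: cg].
rewrite -I_opp//.
apply: (@le_trans _ _ (I 0 1 (fun x => - (s x * g x) - M * k))).
  rewrite I_sub//; last exact: ig_cst.
  by rewrite I_cst// subr0 mulr1; move: step1; rewrite /q; lra.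
apply: I_le; [by apply: ig_sub2 => //; exact: ig_cst|by apply: ic => x; apply: cvgN; apply: cvgM; [exact: cphi|exact: cg]|].
move=> x x01; have h1 : `|(phi x - s x) * g x| <= k * M by rewrite normrM ler_pM// ?phi_s// gM.
by move: h1; rewrite ler_norml mulrBl; clear; lra.
Qed.

Lemma BV_variation_C1 f g : is_weak_derive Om f g -> continuous g ->
  BV_variation Om f = (I 0 1 (fun x => `|g x|))%:E.
Proof.
move=> fg cg; apply/eqP; rewrite eq_le BV_variation_le//=.
apply/lee_addgt0Pr => eta eta0.
have [phi [tphi phi1 H]] := almost_optimal_test cg eta0.
have : ((- I 0 1 (fun x => phi x * g x))%:E <= BV_variation Om f)%E.
  by apply: ereal_sup_ubound; exists phi; rewrite ?(weak_pairing fg cg tphi).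
move=> h; apply: (@le_trans _ _ ((- I 0 1 (fun x => phi x * g x))%:E + eta%:E)%E).
  by rewrite -EFinD lee_fin; lra.
by rewrite leeD2r.
Qed.

(** Test with one almost optimal function: its pairing with w is close to that with f if w is
    uniformly close to f. *)
Lemma BV_variation_lower f g : continuous f -> is_weak_derive Om f g -> continuous g -> forall eta, 0 < eta ->
  exists2 d, 0 < d & forall u w, measurable_fun Om u -> continuous w -> {ae mu, forall x, Om x -> u x = w x} ->
    (forall x, 0 <= x <= 1 -> `|w x - f x| <= d) ->
    ((I 0 1 (fun x => `|g x|) - eta)%:E <= BV_variation Om u)%E.
Proof.
move=> cf fg cg eta eta0.
have [phi [tphi phi1 H]] := almost_optimal_test cg (ltac:(by rewrite divr_gt0) : 0 < eta / 2).
have [_ cphi' _] := tphi.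
have [M M0 hM] := continuous_itv_bounded 0 1 cphi'.
have [d d0 hd] := linear_small M (ltac:(by rewrite divr_gt0) : 0 < eta / 2).
have {}hd := hd d (ltW d0) (lexx d).
exists d => // u w mu' cw uw wf.
apply: (@le_trans _ _ (\int[mu]_(x in Om) (u x * derive1 phi x))%:E); last first.
  by apply: ereal_sup_ubound; exists phi.
have [m1 m2] := C1c_measurable tphi.
have mw : measurable_fun Om w by apply: measurable_funTS; exact: measurable_continuous.
rewrite lee_fin (@ae_Rintegral _ _ (fun x => w x * derive1 phi x)); [|exact: measurable_funM|exact: measurable_funM|]; last first.
  apply: filterS uw; first exact: (ae_filter_ringOfSetsType mu).
  by move=> x h /h ->.
have mf : measurable_fun Om f by apply: measurable_funTS; exact: measurable_continuous.
have P := weak_pairing fg cg tphi.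
have [a /andP[a0 a1] phi0] := C1c_itv tphi.
have phi0' x := C1c_derive_out phi0 (x := x).
have lc h : continuous h -> locally_integrable Om h by move=> ch; apply: ig_local; exact: ig_continuous.
have [i1 e1] := locally_test (lc _ cf) cphi' a0 phi0'; have [i2 e2] := locally_test (lc _ cw) cphi' a0 phi0'.
rewrite e1 in P; rewrite e2.
have D : `|I a (1 - a) (fun x => w x * derive1 phi x) - I a (1 - a) (fun x => f x * derive1 phi x)| <= eta / 2.
  rewrite -I_sub//; apply: le_trans (_ : _ <= (M * d) * (1 - a - a)) _.
    apply: I_norm_bound; [exact: ig_sub2|lra|].
    move=> x xa; rewrite -mulrBl normrM mulrC; apply: ler_pM => //; [apply: hM|apply: wf]; move: xa a0 a1; clear; lra.
  have Md : 0 <= M * d by rewrite mulr_ge0// ltW.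
  by apply: le_trans hd; rewrite ler_piMr//; move: a0 a1; clear; lra.
by move: D H; rewrite ler_norml P; clear; lra.
Qed.

End total_variation.

(** * Continuous functions of position, value and direction *)

Section test_functions.
Context {R : realType}.
Implicit Types (x y t v m r M : R) (F : R -> R -> R -> R).
Local Notation A := (((`[0%R, 1%R]%classic `*` setT) `*` `[- (pi / 2), pi / 2]%classic) : set (R * R * R)).

Lemma pihalf_ge0 : 0 <= pi / 2 :> R.
Proof. by rewrite divr_ge0// pi_ge0. Qed.

(** Clamp position and direction. *)
Lemma test_extension (phi : R * R * R -> R) : {within A, continuous phi} ->
  exists2 F0 : R * R * R -> R, continuous F0 & forall p, A p -> F0 p = phi p.
Proof.
move=> /subspace_continuousP cphi.
pose K (p : R * R * R) : R * R * R := (clamp 0 1 p.1.1, p.1.2, clamp (- (pi / 2)) (pi / 2) p.2).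
have pp := pihalf_ge0.
have AK p : A (K p).
  by split; first split => //=; rewrite /= in_itv/= clamp_itv//; lra.
have cK : continuous K.
  move=> p.
  have k1 : clamp 0 1 q.1.1 @[q --> p] --> clamp 0 1 p.1.1.
    apply: (@continuous_comp _ _ _ (fun q : R * R * R => q.1.1) (clamp 0 1)); last exact: clamp_continuous.
    by apply: (@continuous_comp _ _ _ fst fst); exact: cvg_fst.
  have k2 : q.1.2 @[q --> p] --> p.1.2.
    by apply: (@continuous_comp _ _ _ fst snd); [exact: cvg_fst|exact: cvg_snd].
  have k3 : clamp (- (pi / 2)) (pi / 2) q.2 @[q --> p] --> clamp (- (pi / 2)) (pi / 2) p.2.
    by apply: (@continuous_comp _ _ _ snd (clamp (- (pi / 2)) (pi / 2))); [exact: cvg_snd|exact: clamp_continuous].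
  exact: (cvg_pair (cvg_pair k1 k2) k3).
exists (phi \o K).
  move=> p; apply: cvg_comp (cphi _ (AK p)) => /= W wW.
  have := cK p _ wW; rewrite /= /nbhs /=; apply: filterS => q; apply; exact: AK.
move=> [[x y] t] [[/= + _] +]; rewrite !in_itv/= => x01 t01.
by rewrite /= /K /= !clampE.
Qed.

Definition uniform3 F := forall m, 0 < m -> exists2 r, 0 < r & forall x y t x' y' t',
  `|x' - x| <= r -> `|y' - y| <= r -> `|t' - t| <= r -> `|F x' y' t' - F x y t| <= m.

Lemma test_box (F0 : R * R * R -> R) M : continuous F0 -> 0 <= M ->
  exists F, [/\ forall x y t, 0 <= x <= 1 -> `|y| <= M -> `|t| <= pi / 2 -> F x y t = F0 (x, y, t),
    uniform3 F & exists2 B, 0 <= B & forall x y t, `|F x y t| <= B].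
Proof.
move=> cF M0; have pp := pihalf_ge0.
pose K := ((`[0%R, 1%R]%classic `*` `[- M, M]%classic) `*` `[- (pi / 2), pi / 2]%classic) : set (R * R * R).
have cK : compact K by apply: compact_setX; [apply: compact_setX|]; exact: segment_compact.
pose F x y t := F0 (clamp 0 1 x, clamp (- M) M y, clamp (- (pi / 2)) (pi / 2) t).
have KF x y t : K (clamp 0 1 x, clamp (- M) M y, clamp (- (pi / 2)) (pi / 2) t).
  by split; first split => //=; rewrite /= in_itv/= clamp_itv//; lra.
exists F; split.
- by move=> x y t x01 yM tp; rewrite /F !clampE -?ler_norml.
- move=> m m0; have [r r0 H] := uniformly_continuous_compact cK cF m0.
  exists (r / 2); first by rewrite divr_gt0.
  have cl a b s s' : `|s' - s| <= r / 2 -> ball (clamp a b s) r (clamp a b s').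
    move=> ss; rewrite /ball /= distrC; apply: le_lt_trans (clamp_dist a b s s') _.
    by apply: le_lt_trans ss _; rewrite ltr_pdivrMr// ltr_pMr// ltr1n.
  by move=> x y t x' y' t' hx hy ht; apply: H => //; split; first split; exact: cl.
- have /compact_bounded[N [_ HN]] := continuous_compact (continuous_subspaceT cF) cK.
  exists (`|N| + 1); first by rewrite addr_ge0.
  move=> x y t; apply: (HN (`|N| + 1)); first by apply: le_lt_trans (ler_norm _) _; rewrite ltrDl.
  by exists (clamp 0 1 x, clamp (- M) M y, clamp (- (pi / 2)) (pi / 2) t).
Qed.

(** F is measurable in one variable and continuous in the other; discretise the latter
    and pass to the limit. *)
Lemma measurable_diagonal (D : set R) (F : R -> R -> R) (a : R -> R) : measurable (D : set (measurableTypeR R)) ->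
  (forall x, continuous (F ^~ x)) -> (forall s, measurable_fun D (F s)) -> measurable_fun D a ->
  measurable_fun D (fun x => F (a x) x).
Proof.
move=> mD cF mF ma.
pose q (n : nat) t : R := (Num.floor (n.+1%:R * t))%:~R / n.+1%:R.
have qt t : q ^~ t @ \oo --> t.
  apply/cvgrPdist_le => e e0; near=> n.
  have n0 : 0 < n.+1%:R :> R by rewrite ltr0n.
  have /andP[h1 h2] := floor_itv (n.+1%:R * t).
  have -> : t - q n t = (n.+1%:R * t - (Num.floor (n.+1%:R * t))%:~R) / n.+1%:R.
    by rewrite /q; field; rewrite gt_eqF.
  rewrite normrM normfV (gtr0_norm n0) ler_pdivrMr// ger0_norm ?subr_ge0//.
  apply: (@le_trans _ _ 1).
    by move: h2; rewrite intrD1; lra.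
  rewrite -ler_pdivrMr// mul1r ltW//; near: n; exact: near_infty_natSinv_lt (PosNum e0).
apply: (@measurable_fun_cvg _ _ _ _ (fun n x => F (q n (a x)) x)); last first.
  by move=> x Dx; apply: cvg_comp (qt (a x)) (cF x (a x)).
move=> n _ Y mY.
have n0 : 0 < n.+1%:R :> R by rewrite ltr0n.
pose c (i : int) : R := i%:~R / n.+1%:R.
pose cell (i : int) : set R := (D `&` a @^-1` `[c i, c (i + 1)[%classic) `&` (D `&` F (c i) @^-1` Y).
have mcell i : measurable (cell i : set (measurableTypeR R)).
  by apply: measurableI; [apply: ma => //; exact: measurable_itv|exact: mF].
have -> : D `&` (fun x => F (q n (a x)) x) @^-1` Y =
    \bigcup_k (if unpickle k is Some i then cell i else set0).
  have key t i : (c i <= t < c (i + 1)) = (Num.floor (n.+1%:R * t) == i).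
    rewrite floor_eq /c ler_pdivrMr// ltr_pdivlMr// ![t * _]mulrC; reflexivity.
  apply/seteqP; split.
    move=> x [Dx Yx]; set i := Num.floor (n.+1%:R * a x); exists (pickle i); first exact: Logic.I.
    by rewrite pickleK; split; split => //=; rewrite in_itv/= key.
  move=> x [k _]; case: unpickle => // i [[Dx]] /=; rewrite in_itv/= key => /eqP ai [_ Yx].
  by split => //=; rewrite /q ai.
by apply: bigcup_measurable => k _; case: unpickle.
Unshelve. all: by end_near. Qed.

Lemma test_measurable (F0 : R * R * R -> R) (D : set R) (a b : R -> R) : measurable (D : set (measurableTypeR R)) -> continuous F0 ->
  measurable_fun D a -> measurable_fun D b -> measurable_fun D (fun x => F0 (x, a x, b x)).
Proof.
move=> mD cF ma mb.
have c1 y t : continuous (fun s => F0 (s, y, t)).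
  move=> s; apply: (@continuous_comp _ _ _ (fun s => (s, y, t)) F0); last exact: cF.
  have c (z : R) : (fun=> z) @ s --> z by exact: cvg_cst.
  have i : (fun s => s) @ s --> s by exact: cvg_id.
  exact: (cvg_pair (cvg_pair i (c y)) (c t)).
have c2 x t : continuous (fun s => F0 (x, s, t)).
  move=> s; apply: (@continuous_comp _ _ _ (fun s => (x, s, t)) F0); last exact: cF.
  have c (z : R) : (fun=> z) @ s --> z by exact: cvg_cst.
  have i : (fun s => s) @ s --> s by exact: cvg_id.
  exact: (cvg_pair (cvg_pair (c x) i) (c t)).
have c3 x y : continuous (fun s => F0 (x, y, s)).
  move=> s; apply: (@continuous_comp _ _ _ (fun s => (x, y, s)) F0); last exact: cF.
  have c (z : R) : (fun=> z) @ s --> z by exact: cvg_cst.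
  have i : (fun s => s) @ s --> s by exact: cvg_id.
  exact: (cvg_pair (cvg_pair (c x) (c y)) i).
have m1 s r : measurable_fun D (fun x => F0 (s, r, b x)).
  by apply: (@measurableT_comp _ _ _ _ _ _ (fun t => F0 (s, r, t))) => //; exact: measurable_continuous.
have m2 s : measurable_fun D (fun x => F0 (s, a x, b x)).
  exact: (measurable_diagonal mD (fun x => c2 s (b x)) (m1 s) ma).
have mi : measurable_fun D (fun x : R => x) by exact: measurable_id.
exact: (measurable_diagonal (F := fun s x => F0 (s, a x, b x)) mD (fun x => c1 (a x) (b x)) m2 mi).
Qed.

Lemma atan_near_pihalf r : 0 < r -> exists2 V, 1 <= V & forall v, V <= v -> `|atan v - pi / 2| <= r.
Proof.
move=> r0; have p0 := @pi_gt0 R.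
pose s := Num.min (r / 2) (pi / 4).
have s1 : s <= r / 2 by rewrite ge_min lexx.
have s2 : s <= pi / 4 by rewrite ge_min lexx orbT.
have s0 : 0 < s by rewrite lt_min !divr_gt0.
exists (Num.max 1 (tan (pi / 2 - s))); first by rewrite le_max lexx.
move=> v; rewrite ge_max => /andP[_ tv].
have h1 := @atan_ltpi2 R v; have h2 := @atan_gtNpi2 R v.
have h : pi / 2 - s <= atan v.
  rewrite leNgt; apply/negP => lt; move: tv; rewrite leNgt -[X in X < _]atanK ltr_tan ?lt//.
    by rewrite in_itv/= h1 h2.
  by rewrite in_itv/=; apply/andP; split; move: s0 s2 p0; lra.
by rewrite ler_norml; apply/andP; split; lra.
Qed.

Lemma atan_near0 r : 0 < r -> exists2 d, 0 < d & forall v, `|v| <= d -> `|atan v| <= r.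
Proof.
move=> r0; have [d d0 H] := uniformly_continuous_itv 0 0 (@continuous_atan R) r0.
exists d => // v vd; have := H 0 v; rewrite atan0 !subr0 lexx; exact.
Qed.

(** The graph is nearly horizontal where the slope is small, nearly vertical where it is large,
    and in between its length is controlled by the logarithm. *)
Lemma direction_pos F B : 0 <= B -> (forall x y t, `|F x y t| <= B) -> uniform3 F -> forall eta, 0 < eta ->
  exists2 C, 0 <= C & forall x y v, 0 <= v ->
    `|F x y (atan v) * Num.sqrt (1 + v ^+ 2) - F x y 0 - F x y (pi / 2) * v| <= eta * (1 + v) + C * G v.
Proof.
move=> B0 FB UC eta eta0.
have e2 : 0 < eta / 2 by rewrite divr_gt0.
have [r r0 H] := UC _ e2.
have [d1 d10 h1] := atan_near0 r0; have [V V1 h2] := atan_near_pihalf r0.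
have [d2 d20 h3] := linear_small (2 * B) e2.
pose d : R := Num.min d1 d2.
have dd1 : d <= d1 by rewrite ge_min lexx.
have dd2 : d <= d2 by rewrite ge_min lexx orbT.
have d0 : 0 < d by rewrite lt_min d10.
have {}h3 := h3 d (ltW d0) dd2.
have Gd : 0 < G d.
  apply: lt_le_trans (G_lower d); rewrite divr_gt0 ?exprn_gt0//.
  by have := sqr_ge0 d; lra.
have V0 : 0 <= V by apply: le_trans V1.
have Q0 : 0 <= 2 * B * (1 + V) / G d by rewrite divr_ge0 ?(ltW Gd)// !mulr_ge0// addr_ge0.
exists (4 * B + 2 * B * (1 + V) / G d); first by rewrite addr_ge0// mulr_ge0.
move=> x y v v0; set s := Num.sqrt _.
have sE : s ^+ 2 = 1 + v ^+ 2 by rewrite sqr_sqrtr// addr_ge0// sqr_ge0.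
have s0 : 0 <= s by exact: sqrtr_ge0.
have sv : v <= s by apply: le_of_sqr => //; rewrite sE lerDr.
have s1 : 1 <= s by apply: le_of_sqr => //; rewrite sE expr1n lerDl sqr_ge0.
have s2 : s <= 1 + v by apply: le_of_sqr; [exact: addr_ge0|rewrite sE sqrrD expr1n mul1r; move: v0; lra].
have b0 := FB x y 0; have bp := FB x y (pi / 2); have ba := FB x y (atan v).
have Gv := G_ge0 v.
have prod (a c p k : R) : 0 <= k -> `|a| <= c -> `|p| <= k -> `|a * p| <= c * k.
  by move=> k0 ac pk; rewrite normrM ler_pM.
have abs3 (a b c k1 k2 k3 : R) : `|a| <= k1 -> `|b| <= k2 -> `|c| <= k3 -> `|a + b + c| <= k1 + k2 + k3.
  by move=> ha hb hc; apply: le_trans (ler_normD _ _) _; apply: lerD => //; apply: le_trans (ler_normD _ _) _; exact: lerD.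
have n1 : `|s - 1| <= v by rewrite ger0_norm ?subr_ge0//; move: s2; clear; lra.
have n2 : `|s - v| <= 1 by rewrite ger0_norm ?subr_ge0//; move: s2; clear; lra.
have n3 : `|s| <= 1 + v by rewrite ger0_norm.
have n4 : `|v| <= v by rewrite ger0_norm.
have v1 : 0 <= 1 + v by rewrite addr_ge0.
have [vd|dv] := leP v d.
  have k : `|F x y (atan v) - F x y 0| <= eta / 2.
    by apply: H; rewrite ?subrr ?normr0 ?(ltW r0)// subr0; apply: h1; rewrite ger0_norm//; exact: le_trans dd1.
  have -> : F x y (atan v) * s - F x y 0 - F x y (pi / 2) * v =
      (F x y (atan v) - F x y 0) * s + F x y 0 * (s - 1) + - (F x y (pi / 2) * v) by ring.
  apply: le_trans (abs3 _ _ _ _ _ _ (prod _ _ _ _ v1 k n3) (prod _ _ _ _ v0 b0 n1) _) _.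
    by rewrite normrN; exact: (prod _ _ _ _ v0 bp n4).
  have q1 : B * v <= B * d by exact: ler_wpM2l.
  have q2 : 0 <= (4 * B + 2 * B * (1 + V) / G d) * G v by rewrite mulr_ge0// addr_ge0// mulr_ge0.
  have q3 : 0 <= eta * v by rewrite mulr_ge0// ltW.
  move: q1 q2 q3 h3 eta0; clear; lra.
have Gdv : G d <= G v by apply: G_le; rewrite !ger0_norm// ltW.
have [Vv|vV] := leP V v.
  have k : `|F x y (atan v) - F x y (pi / 2)| <= eta / 2.
    by apply: H; rewrite ?subrr ?normr0 ?(ltW r0)//; exact: h2.
  have -> : F x y (atan v) * s - F x y 0 - F x y (pi / 2) * v =
      (F x y (atan v) - F x y (pi / 2)) * s + F x y (pi / 2) * (s - v) + - F x y 0 by ring.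
  apply: le_trans (abs3 _ _ _ _ _ _ (prod _ _ _ _ v1 k n3) (prod _ _ _ _ ler01 bp n2) _) _.
    by rewrite normrN; exact: b0.
  have q1 : 2^-1 <= G v by apply: G_large; rewrite ger0_norm//; exact: le_trans Vv.
  have q2 : 0 <= 2 * B * (1 + V) / G d * G v by exact: mulr_ge0.
  have q3 : B * 2^-1 <= B * G v by exact: ler_wpM2l.
  have q4 : 0 <= eta * (1 + v) by rewrite mulr_ge0// ltW.
  rewrite [(4 * B + _) * _]mulrDl; move: q1 q2 q3 q4; clear; lra.
have q0 : 0 <= 1 + v by [].
apply: le_trans (abs3 _ _ _ (B * (1 + v)) B (B * v) (prod _ _ _ _ v1 ba n3) _ _) _.
- by rewrite normrN.
- by rewrite normrN; exact: (prod _ _ _ _ v0 bp n4).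
have q1 : 2 * B * (1 + V) <= 2 * B * (1 + V) / G d * G v.
  rewrite -[leRHS]mulrA ler_peMr//; first by rewrite !mulr_ge0// addr_ge0.
  by rewrite mulrC ler_pdivlMr// mul1r.
have q2 : B * v <= B * V by apply: ler_wpM2l => //; exact: ltW.
have q3 : 0 <= 4 * B * G v by rewrite !mulr_ge0.
have q4 : 0 <= eta * (1 + v) by rewrite mulr_ge0// ltW.
rewrite [(4 * B + _) * _]mulrDl; move: q1 q2 q3 q4; clear; lra.
Qed.

Lemma direction F B : 0 <= B -> (forall x y t, `|F x y t| <= B) -> uniform3 F -> forall eta, 0 < eta ->
  exists2 C, 0 <= C & forall x y v,
    `|F x y (atan v) * Num.sqrt (1 + v ^+ 2) - F x y 0 - F x y (pi / 2) * Num.max 0 v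
      - F x y (- (pi / 2)) * Num.max 0 (- v)| <= eta * (1 + `|v|) + C * G v.
Proof.
move=> B0 FB UC eta eta0.
have [C1 C10 H1] := direction_pos B0 FB UC eta0.
pose F' x y t := F x y (- t).
have UC' : uniform3 F'.
  move=> m m0; have [r r0 H] := UC m m0; exists r => // x y t x' y' t' hx hy ht.
  by apply: H => //; rewrite -opprD normrN.
have [C2 C20 H2] := direction_pos B0 (fun x y t => FB x y (- t)) UC' eta0.
exists (C1 + C2); first exact: addr_ge0.
move=> x y v; have Gv := G_ge0 v; rewrite [(C1 + C2) * _]mulrDl.
have [v0|/ltW v0] := leP 0 v.
  have -> : Num.max 0 (- v) = 0 by apply: max_l; rewrite oppr_le0.
  rewrite mulr0 subr0 (ger0_norm v0).
  by apply: le_trans (H1 x y v v0) _; rewrite lerD2l lerDl mulr_ge0.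
have nv0 : 0 <= - v by rewrite oppr_ge0.
have -> : Num.max 0 (- v) = - v by exact: max_r.
rewrite mulr0 subr0 (ler0_norm v0).
have := H2 x y (- v) nv0; rewrite /F' atanN opprK oppr0 sqrrN => h; apply: le_trans h _.
by rewrite /G sqrrN -/(G v) lerD2l lerDr mulr_ge0.
Qed.

End test_functions.

(** * Passing to the limit in the rises, the drops and the direction *)

Section limits.
Context {R : realType}.
Implicit Types (a b c d x y : R) (f g w v psi : R -> R) (F : R -> R -> R -> R).
Local Notation pos g := (fun x => Num.max 0 (g x)).

Lemma pos_partE (t : R) : Num.max 0 t = 2^-1 * (t + `|t|).
Proof. by case: (leP 0 t) => t0; [rewrite ger0_norm//; field|rewrite ltr0_norm// subrr mulr0]. Qed.

Lemma pos_part_bounds (t : R) : 0 <= Num.max 0 t <= `|t|.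
Proof. by case: (leP 0 t) => t0; rewrite ?normr_ge0 ?lexx ?t0 ?ler_norm. Qed.

Lemma neg_part (t : R) : Num.max 0 t + Num.max 0 (- t) = `|t|.
Proof. by rewrite !pos_partE normrN; field. Qed.

(** If g and psi are nearly constant on [p, q], then the variation of g is close to
    |f q - f p|, which is close to |w q - w p| and hence not much larger than the variation of v.
    So the two variations differ by little more than their signed difference. *)
Lemma cell_positive_part (p q m B d : R) f g psi w v : p <= q -> 0 <= m ->
  continuous v -> continuous g -> continuous psi ->
  (forall x, p <= x <= q -> `|g x - g p| <= m) -> (forall x, p <= x <= q -> `|psi x - psi p| <= m) ->
  `|psi p| <= B -> w q - w p = I p q v -> f q - f p = I p q g -> `|w p - f p| <= d -> `|w q - f q| <= d ->
  `|I p q (fun x => psi x * pos v x) - I p q (fun x => psi x * pos g x)| <=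
    m * (I p q (fun x => `|v x|) + I p q (fun x => `|g x|)) +
    B * (2^-1 * (I p q (fun x => `|v x|) - I p q (fun x => `|g x|)) + 2 * m * (q - p) + 3 * d).
Proof.
move=> pq m0 cv cg cpsi gm pm pB wv fg dp dq.
have B0 : 0 <= B by apply: le_trans pB.
have ic (h : R -> R) : continuous h -> ig p q h by exact: ig_continuous.
have inorm (h : R -> R) : continuous h -> ig p q (fun x => `|h x|) by move=> ch; apply: ig_norm; exact: ic.
have cp (h : R -> R) : continuous h -> continuous (pos h) by exact: continuous_pos_part.
have cm (h k : R -> R) : continuous h -> continuous k -> continuous (fun x => h x * k x).
  by move=> ch ck x; apply: cvgM; [exact: ch|exact: ck].
have ipos (h : R -> R) : continuous h -> I p q (pos h) = 2^-1 * (I p q h + I p q (fun x => `|h x|)).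
  move=> ch; rewrite -I_add; [|exact: ic|exact: inorm]; rewrite -I_scale; last by apply: ig_add; [exact: ic|exact: inorm].
  by apply: I_eq => x _; rewrite pos_partE.
have frozen (h : R -> R) : continuous h -> `|I p q (fun x => psi x * pos h x) - psi p * I p q (pos h)| <= m * I p q (fun x => `|h x|).
  move=> ch; rewrite -I_scale; last by apply: ic; exact: cp.
  have i1 : ig p q (fun x => psi x * pos h x) by apply: ic; apply: cm => //; exact: cp.
  have i2 : ig p q (fun x => psi p * pos h x) by apply: ig_scale; apply: ic; exact: cp.
  rewrite -I_sub//; apply: le_trans (I_norm (ig_sub2 i1 i2)) _.
  rewrite -I_scale; last exact: inorm.
  apply: I_le; [by apply: ig_norm; exact: ig_sub2|by apply: ig_scale; exact: inorm|] => x xpq.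
  have /andP[h1 h2] := pos_part_bounds (h x).
  by rewrite -mulrBl normrM (ger0_norm h1) ler_pM// pm.
have lower : I p q (fun x => `|g x|) <= `|I p q g| + 2 * m * (q - p).
  have h1 : I p q (fun x => `|g x|) <= (`|g p| + m) * (q - p).
    apply: I_bound => //; [exact: inorm|move=> x /gm].
    have -> : g x = g p + (g x - g p) by ring.
    rewrite [g p + (g x - g p) - g p]addrAC subrr add0r => h; apply: le_trans (ler_normD _ _) _.
    by rewrite lerD2l.
  have h2 : `|I p q g - g p * (q - p)| <= m * (q - p).
    rewrite -(I_cst (g p) pq) -I_sub; [|exact: ic|exact: ig_cst].
    by apply: I_norm_bound => //; apply: ig_sub2; [exact: ic|exact: ig_cst].
  have h3 : `|g p| * (q - p) = `|g p * (q - p)| by rewrite normrM [X in _ = _ * X]ger0_norm// subr_ge0.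
  have h4 := ler_normB (I p q g) (I p q g - g p * (q - p)).
  have e1 : I p q g - (I p q g - g p * (q - p)) = g p * (q - p) by ring.
  by rewrite e1 in h4; move: h1 h2 h3 h4; lra.
have fv := frozen v cv; have fg' := frozen g cg.
have D : `|I p q (pos v) - I p q (pos g)| <=
    2^-1 * (I p q (fun x => `|v x|) - I p q (fun x => `|g x|)) + 2 * m * (q - p) + 3 * d.
  rewrite !ipos//.
  have k1 : `|I p q v| <= I p q (fun x => `|v x|) by apply: I_norm; exact: ic.
  have k2 : `|I p q v - I p q g| <= 2 * d.
    by rewrite -wv -fg; move: dp dq; rewrite !ler_norml; lra.
  have k3 := ler_normB (I p q v) (I p q v - I p q g).
  have e1 : I p q v - (I p q v - I p q g) = I p q g by ring.
  rewrite e1 in k3.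
  have mq : 0 <= m * (q - p) by rewrite mulr_ge0// subr_ge0.
  have d0 : 0 <= d by apply: le_trans dp.
  have /andP[k4 k5] : - (2 * d) <= I p q v - I p q g <= 2 * d by rewrite -ler_norml.
  by rewrite ler_norml; apply/andP; split; move: lower k1 k2 k3 k4 k5 mq d0; clear; lra.
have M : `|psi p * I p q (pos v) - psi p * I p q (pos g)| <=
    B * (2^-1 * (I p q (fun x => `|v x|) - I p q (fun x => `|g x|)) + 2 * m * (q - p) + 3 * d).
  by rewrite -mulrBr normrM ler_pM.
rewrite mulrDr; move: fv fg' M; rewrite !ler_norml; clear; lra.
Qed.

(** Uniform convergence makes the variation on any interval lower semicontinuous. Since the
    total variation is nearly at most that of the limit, it cannot be larger on any interval
    either; so rises and drops converge separately. *)
Lemma positive_part_limit f g psi : continuous g -> continuous psi ->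
  (forall a b, 0 <= a -> a <= b -> b <= 1 -> f b - f a = I a b g) ->
  forall eta, 0 < eta -> exists2 d, 0 < d & forall w v, continuous v ->
    (forall a b, 0 <= a -> a <= b -> b <= 1 -> w b - w a = I a b v) ->
    (forall x, 0 <= x <= 1 -> `|w x - f x| <= d) ->
    I 0 1 (fun x => `|v x|) <= I 0 1 (fun x => `|g x|) + d ->
    `|I 0 1 (fun x => psi x * pos v x) - I 0 1 (fun x => psi x * pos g x)| <= eta.
Proof.
move=> cg cpsi fg eta eta0.
have [B B0 pB] := continuous_itv_bounded 0 1 cpsi.
pose Q := I 0 1 (fun x => `|g x|).
have Q0 : 0 <= Q by apply: I_ge0.
have e2 : 0 < eta / 2 by rewrite divr_gt0.
have [m m0 hm] := linear_small (2 * Q + 1 + 2 * B) e2.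
have {}hm := hm m (ltW m0) (lexx m).
have [r1 r10 UC1] := uniformly_continuous_itv 0 1 cg m0.
have [r2 r20 UC2] := uniformly_continuous_itv 0 1 cpsi m0.
pose r : R := Num.min r1 r2.
have rr1 : r <= r1 by rewrite ge_min lexx.
have rr2 : r <= r2 by rewrite ge_min lexx orbT.
have r0 : 0 < r by rewrite lt_min r10.
have [N NR Nr] : exists2 N : nat, 0 < N%:R :> R & N%:R^-1 <= r.
  exists (Num.trunc r^-1).+1; first by rewrite ltr0n.
  rewrite -[leRHS]invrK lef_pV2 ?posrE ?invr_gt0//.
  have ri : 0 <= r^-1 by rewrite invr_ge0 ltW.
  by have /andP[_ /ltW] := truncn_itv ri.
have NV : 0 < N%:R^-1 :> R by rewrite invr_gt0.
have [d1 d10 hd] := linear_small (B * (2^-1 + 3 * N%:R)) e2.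
pose d : R := Num.min d1 1.
have d1' : d <= d1 by rewrite ge_min lexx.
have dl1 : d <= 1 by rewrite ge_min lexx orbT.
have d0 : 0 < d by rewrite lt_min d10 ltr01.
have {}hd := hd d (ltW d0) d1'.
exists d => // w v cv wv wf Vd.
have cpos (h : R -> R) : continuous h -> continuous (fun x => psi x * pos h x).
  by move=> ch x; apply: cvgM; [exact: cpsi|exact: (continuous_pos_part ch)].
have inorm (h : R -> R) a b : continuous h -> ig a b (fun x => `|h x|) by move=> ch; apply: ig_norm; exact: ig_continuous.
have E1 : 0 + N%:R * N%:R^-1 = 1 :> R by rewrite add0r mulfV// gt_eqF.
have cells (h : R -> R) : (forall a b, ig a b h) ->
    I 0 1 h = \sum_(i < N) I (0 + i%:R * N%:R^-1) (0 + i.+1%:R * N%:R^-1) h.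
  by move=> ih; rewrite -(@I_cells R 0 _ h N (ltW NV)) E1.
have ipos (h : R -> R) a b : continuous h -> ig a b (fun x => psi x * pos h x) by move=> ch; apply: ig_continuous; exact: cpos.
rewrite (cells (fun x => psi x * pos v x) (fun a b => ipos v a b cv)).
rewrite (cells (fun x => psi x * pos g x) (fun a b => ipos g a b cg)).
rewrite -sumrB; apply: le_trans (ler_norm_sum _ _ _) _.
pose pt i : R := 0 + i%:R * N%:R^-1.
apply: (@le_trans _ _ (\sum_(i < N) (m * (I (pt i) (pt i.+1) (fun x => `|v x|) + I (pt i) (pt i.+1) (fun x => `|g x|)) +
    B * (2^-1 * (I (pt i) (pt i.+1) (fun x => `|v x|) - I (pt i) (pt i.+1) (fun x => `|g x|)) + 2 * m * N%:R^-1 + 3 * d)))).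
  apply: ler_sum => i _; rewrite -/(pt i) -/(pt i.+1).
  have ptS : pt i.+1 = pt i + N%:R^-1 by rewrite /pt -[i.+1%:R]natr1 mulrDl mul1r addrA.
  have p0 : 0 <= pt i by rewrite /pt add0r mulr_ge0// ltW.
  have pp : pt i <= pt i.+1 by rewrite ptS lerDl ltW.
  have p1 : pt i.+1 <= 1 by rewrite -E1 /pt lerD2l ler_wpM2r ?(ltW NV)// ler_nat.
  have -> : N%:R^-1 = pt i.+1 - pt i by rewrite ptS addrAC subrr add0r.
  have pi1 : 0 <= pt i <= 1 by rewrite p0 (le_trans pp).
  have dist x : pt i <= x <= pt i.+1 -> `|x - pt i| <= r.
    by move=> /andP[x1 x2]; rewrite ger0_norm ?subr_ge0//; move: x2 Nr; rewrite ptS; clear; lra.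
  apply: (cell_positive_part (f := f) (w := w) pp (ltW m0) cv cg cpsi).
  - by move=> x /dist xr; apply: UC1 => //; exact: le_trans rr1.
  - by move=> x /dist xr; apply: UC2 => //; exact: le_trans rr2.
  - exact: pB.
  - exact: wv.
  - exact: fg.
  - exact: wf.
  - by apply: wf; rewrite p1 (le_trans p0).
have sv := cells _ (fun a b => inorm v a b cv); have sg := cells _ (fun a b => inorm g a b cg).
rewrite big_split/= -!mulr_sumr !big_split/= -mulr_sumr !big_split/= sumrN !sumr_const card_ord -sv -sg -/Q.
have -> : 2 * m / N%:R *+ N = 2 * m by rewrite -[LHS]mulr_natr mulfVK// gt_eqF.
have -> : 3 * d *+ N = 3 * d * N%:R by rewrite mulr_natr.
have V0 : I 0 1 (fun x => `|v x|) <= Q + 1 by move: Vd dl1; rewrite -/Q; clear; lra.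
have q1 : m * (I 0 1 (fun x => `|v x|) + Q) <= m * (2 * Q + 1).
  by apply: ler_wpM2l; [exact: ltW|move: V0; clear; lra].
have q2 : B * (2^-1 * (I 0 1 (fun x => `|v x|) - Q) + 2 * m + 3 * d * N%:R) <= B * (2^-1 * d + 2 * m + 3 * d * N%:R).
  by apply: ler_wpM2l => //; move: Vd; rewrite -/Q; clear; lra.
move: q1 q2 hm hd; clear; lra.
Qed.

Lemma uniform3_continuous F (a b c : R -> R) : uniform3 F -> continuous a -> continuous b -> continuous c ->
  continuous (fun x => F (a x) (b x) (c x)).
Proof.
move=> UC ca cb cc x; apply/cvgrPdist_le => m m0; have [r r0 H] := UC m m0.
have /cvgrPdist_le /(_ r r0) h1 := ca x; have /cvgrPdist_le /(_ r r0) h2 := cb x.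
have /cvgrPdist_le /(_ r r0) h3 := cc x.
near=> y; rewrite distrC; apply: H; rewrite distrC.
- by near: y.
- by near: y.
- by near: y.
Unshelve. all: by end_near. Qed.

(** By direction the integrand can be replaced by its horizontal and vertical parts, and
    positive_part_limit applies to the latter. *)
Lemma direction_limit F B f g : 0 <= B -> (forall x y t, `|F x y t| <= B) -> uniform3 F ->
  continuous f -> continuous g -> (forall a b, 0 <= a -> a <= b -> b <= 1 -> f b - f a = I a b g) ->
  forall eta, 0 < eta -> exists2 d, 0 < d & forall w v, continuous w -> continuous v ->
    (forall a b, 0 <= a -> a <= b -> b <= 1 -> w b - w a = I a b v) ->
    (forall x, 0 <= x <= 1 -> `|w x - f x| <= d) ->
    I 0 1 (fun x => `|v x|) <= I 0 1 (fun x => `|g x|) + d -> I 0 1 (fun x => G (v x)) <= d ->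
    `|I 0 1 (fun x => F x (w x) (atan (v x)) * Num.sqrt (1 + v x ^+ 2)) -
      (I 0 1 (fun x => F x (f x) 0) + I 0 1 (fun x => F x (f x) (- (pi / 2)) * Num.max 0 (- g x))
       + I 0 1 (fun x => F x (f x) (pi / 2) * Num.max 0 (g x)))| <= eta.
Proof.
move=> B0 FB UC cf cg fg eta eta0.
have e4 : 0 < eta / 4 by rewrite divr_gt0.
have id_c : continuous (fun x : R => x) by move=> x; exact: cvg_id.
have cst_c (t : R) : continuous (fun _ : R => t) by move=> x; exact: cvg_cst.
have cF (h : R -> R) (t : R) : continuous h -> continuous (fun x => F x (h x) t).
  by move=> ch; exact: (uniform3_continuous UC id_c ch (cst_c t)).
pose Q := I 0 1 (fun x => `|g x|).
have Q0 : 0 <= Q by apply: I_ge0.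
have [m m0 hm] := linear_small (2 * (2 + Q)) e4.
have {}hm := hm m (ltW m0) (lexx m).
have [C C0 dir] := direction B0 FB UC m0.
have [r r0 UCr] := UC m m0.
have [d1 d10 hC] := linear_small C e4.
have cmg : continuous (fun x => - g x) by move=> x; apply: cvgN; exact: cg.
have mfg a b : 0 <= a -> a <= b -> b <= 1 -> - f b - - f a = I a b (fun x => - g x).
  by move=> a0 ab b1; rewrite I_opp -?fg//; [ring|exact: ig_continuous].
have [d2 d20 P2] := positive_part_limit cg (cF f (pi / 2) cf) fg e4.
have [d3 d30 P3] := positive_part_limit cmg (cF f (- (pi / 2)) cf) mfg e4.
pose d : R := Num.min (Num.min d1 d2) (Num.min d3 (Num.min r 1)).
have : d <= d by []; rewrite {2}/d !le_min => /andP[/andP[dd1 dd2] /andP[dd3 /andP[dr dl1]]].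
have d0 : 0 < d by rewrite /d !lt_min d10 d20 d30 r0 ltr01.
exists d => // w v cw cv wv wf Vd Gd.
have cmv : continuous (fun x => - v x) by move=> x; apply: cvgN; exact: cv.
have ic (h : R -> R) : continuous h -> ig 0 1 h by exact: ig_continuous.
have cmul (h k : R -> R) : continuous h -> continuous k -> continuous (fun x => h x * k x).
  by move=> ch ck x; apply: cvgM; [exact: ch|exact: ck].
have hw2 x : 0 <= x <= 1 -> `|w x - f x| <= d2 by move=> /wf; move/le_trans; apply.
have hv2 : I 0 1 (fun x => `|v x|) <= I 0 1 (fun x => `|g x|) + d2.
  by apply: le_trans Vd _; rewrite lerD2l.
have {}P2 := P2 w v cv wv hw2 hv2.
have mwv a b : 0 <= a -> a <= b -> b <= 1 -> - w b - - w a = I a b (fun x => - v x).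
  by move=> a0 ab b1; rewrite I_opp -?wv//; [ring|exact: ig_continuous].
have {}P3 := P3 (fun x => - w x) (fun x => - v x) cmv mwv.
have hw3 x : 0 <= x <= 1 -> `|- w x - - f x| <= d3.
  by move=> x1; rewrite -opprD normrN; apply: le_trans dd3; exact: wf.
have hv3 : I 0 1 (fun x => `|- v x|) <= I 0 1 (fun x => `|- g x|) + d3.
  rewrite (@I_eq _ 0 1 _ (fun x => `|v x|)) => [|x _]; last by rewrite normrN.
  rewrite [in leRHS](@I_eq _ 0 1 _ (fun x => `|g x|)) => [|x _]; last by rewrite normrN.
  by apply: le_trans Vd _; rewrite lerD2l.
have {}P3 := P3 hw3 hv3.
pose s x := F x (w x) (atan (v x)) * Num.sqrt (1 + v x ^+ 2).
have cs : continuous s.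
  apply: cmul; first exact: (uniform3_continuous UC id_c cw (comp_continuous (@continuous_atan R) cv)).
  apply: (@comp_continuous R Num.sqrt (fun x => 1 + v x ^+ 2)); first exact: sqrt_continuous.
  by move=> x; apply: cvgD; [exact: cvg_cst|exact: (sqr_continuous cv)].
have c0 := cF f 0 cf; have cb := cmul _ _ (cF f (pi / 2) cf) (continuous_pos_part cv).
have cc := cmul _ _ (cF f (- (pi / 2)) cf) (continuous_pos_part cmv).
have cabs : continuous (fun x => `|v x|) by move=> x; apply: cvg_norm; exact: cv.
have cG : continuous (fun x => G (v x)) := comp_continuous (@G_continuous R) cv.
have key : `|I 0 1 s - I 0 1 (fun x => F x (f x) 0) - I 0 1 (fun x => F x (f x) (pi / 2) * pos v x)
    - I 0 1 (fun x => F x (f x) (- (pi / 2)) * Num.max 0 (- v x))| <= eta / 2.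
  have i1 := ic _ cs; have i2 := ic _ c0; have i3 := ic _ cb; have i4 := ic _ cc.
  rewrite -I_sub// -I_sub//; last exact: ig_sub2.
  rewrite -I_sub//; last by do 2 apply: ig_sub2 => //.
  have i5 := ig_sub2 (ig_sub2 (ig_sub2 i1 i2) i3) i4.
  apply: le_trans (I_norm i5) _.
  have i6 : ig 0 1 (fun x => 1 + `|v x|) by apply: ig_add; [exact: ig_cst|exact: ic].
  apply: (@le_trans _ _ (I 0 1 (fun x => 2 * m * (1 + `|v x|) + C * G (v x)))).
    apply: I_le; [exact: ig_norm|by apply: ig_add; [exact: ig_scale|apply: ig_scale; exact: ic]|].
    move=> x x1; have D := dir x (w x) (v x).
    have near t : `|F x (w x) t - F x (f x) t| <= m.
      apply: UCr; rewrite ?subrr ?normr0 ?(ltW r0)//; apply: le_trans dr; exact: wf.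
    have /andP[p0 _] := pos_part_bounds (v x); have /andP[n0 _] := pos_part_bounds (- v x).
    have np := neg_part (v x).
    have k1 := near 0.
    have k2 : `|(F x (w x) (pi / 2) - F x (f x) (pi / 2)) * pos v x| <= m * pos v x.
      by rewrite normrM (ger0_norm p0) ler_wpM2r.
    have k3 : `|(F x (w x) (- (pi / 2)) - F x (f x) (- (pi / 2))) * Num.max 0 (- v x)| <= m * Num.max 0 (- v x).
      by rewrite normrM (ger0_norm n0) ler_wpM2r.
    rewrite -np in D *; rewrite /s.
    move: D k1 k2 k3; rewrite !mulrBl !ler_norml; clear; lra.
  rewrite I_add; [|exact: ig_scale|by apply: ig_scale; exact: ic].
  rewrite !I_scale//; last exact: ic.
  rewrite I_add; [|exact: ig_cst|exact: ic]; rewrite I_cst// subr0 mulr1.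
  have q1 : C * I 0 1 (fun x => G (v x)) <= eta / 4 by apply: hC; [apply: I_ge0 => x _; exact: G_ge0|exact: le_trans dd1].
  have q2 : m * (1 + I 0 1 (fun x => `|v x|)) <= m * (2 + Q).
    by apply: ler_wpM2l; [exact: ltW|move: Vd dl1; rewrite -/Q; clear; lra].
  move: q1 q2 hm; clear; lra.
move: key P2 P3; rewrite !ler_norml; clear; lra.
Qed.

End limits.

(** * Convergence of the minimizers *)

Section convergence.
Context {R : realType}.
Implicit Types (f g u w v z h k : R -> R).
Local Notation mu := (@lebesgue_measure R).
Local Notation Om := (`]0%R, 1%R[%classic : set R).

Lemma symmetric_itv (p : R) : 0 <= p -> [/\ - p <= 0 <= p, - p <= - p <= p & - p <= p <= p].
Proof. by move=> p0; split; lra. Qed.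

Lemma cvg_near_EFin (a : nat -> \bar R) (l : R) :
  (forall eta : R, 0 < eta -> \forall n \near \oo, exists2 c : R, a n = c%:E & `|c - l| <= eta) -> a @ \oo --> l%:E.
Proof.
move=> H A /= nA.
have {nA} [d /= d0 Ad] : nbhs_ball l (EFin @^-1` A) by apply/nbhs_ballP; exact: nA.
have d2 : 0 < d / 2 by rewrite divr_gt0.
have := H _ d2; rewrite /= !near_simpl => K.
apply: filterS K => n [c ac cl]; rewrite /= ac; apply: Ad; rewrite /ball/= distrC.
by apply: le_lt_trans cl _; rewrite ltr_pdivrMr// ltr_pMr// ltr1n.
Qed.

Lemma integral_itv k : ig 0 1 k -> (\int[mu]_(x in `[0%R, 1%R]%classic) (k x)%:E)%E = (I 0 1 k)%:E.
Proof.
move=> ik.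
have mI : measurable (`[0%R, 1%R]%classic : set (measurableTypeR R)) by exact: measurable_itv.
by have /fineK <- := integrable_fin_num mI ik.
Qed.

Lemma integral_support (V : set R) h k : V `<=` `[0%R, 1%R]%classic -> (forall x, V x -> h x = k x) ->
  (forall x, 0 <= x <= 1 -> ~ V x -> k x = 0) -> ig 0 1 k ->
  (\int[mu]_(x in V) (h x)%:E)%E = (I 0 1 k)%:E.
Proof.
move=> V01 hk k0 /integral_itv <-; rewrite integral_mkcond [RHS]integral_mkcond.
congr (integral _ _ _); apply/funext => x; rewrite !patchE.
case: ifPn => xV; case: ifPn => x01 //.
- by rewrite hk//; rewrite inE in xV.
- by exfalso; move: x01; rewrite notin_setE; apply; apply: V01; rewrite inE in xV.
- rewrite k0//; first by move: x01; rewrite inE/= in_itv.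
  by move: xV; rewrite notin_setE.
Qed.

Lemma ae_integral g h : measurable_fun Om g -> continuous h -> {ae mu, forall x, Om x -> g x = h x} ->
  (\int[mu]_(x in Om) (g x)%:E)%E = (I 0 1 h)%:E.
Proof.
move=> mg ch gh; have mOm : measurable (Om : set (measurableTypeR R)) by exact: measurable_itv.
rewrite -integral_open; last exact: ig_continuous.
apply: ae_eq_integral => //; first exact/measurable_EFinP.
  by apply/measurable_EFinP; apply: measurable_funTS; exact: measurable_continuous.
apply: filterS gh; first exact: (ae_filter_ringOfSetsType mu).
by move=> x H /H ->.
Qed.

Lemma minimizer_estimates (beta L : R) f g : 0 < beta -> 0 <= L ->
  (forall x y, `|f y - f x| <= L * `|y - x|) -> continuous g ->
  (forall a b, 0 <= a -> a <= b -> b <= 1 -> f b - f a = I a b g) ->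
  forall d, 0 < d -> exists2 r, 0 < r & forall e w v z, 0 < e -> e <= r -> minimal (hh e) beta f w v z ->
    [/\ forall x, 0 <= x <= 1 -> `|w x - f x| <= d, I 0 1 (fun x => `|v x|) <= I 0 1 (fun x => `|g x|) + d &
      I 0 1 (fun x => G (v x)) <= d].
Proof.
move=> be0 L0 fL cg fg d d0.
have [C [r1 [C1 r10 TM]]] := minimizers_tame be0 L0.
have [r2 r20 VL] := variation_limit be0 L0 fL cg fg d0.
have [r3 r30 h3] := linear_small (6 + 2 * L) (@ltr01 R).
have [r4 r40 h4] := linear_small C d0.
have [r5 r50 h5] := linear_small (9 * C2 beta L) d0.
pose s : R := Num.min r4 r5.
have s4 : s <= r4 by rewrite ge_min lexx.
have s5 : s <= r5 by rewrite ge_min lexx orbT.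
have s0 : 0 < s by rewrite lt_min r40.
pose r : R := Num.min (Num.min r1 r2) (Num.min r3 (s ^+ 2)).
have r0 : 0 < r by rewrite !lt_min r10 r20 r30 exprn_gt0.
exists r => // e w v z e0; rewrite !le_min => /andP[/andP[er1 er2] /andP[er3 ers]] M.
have [e1 [_ t2]] := TM f e w v z fL e0 er1 M.
have os := om_le_of_sqr e0 e1 (ltW s0) ers.
have o0 := om_gt0 e0 e1; have o1 := om_le e0 e1.
have eL := h3 e (ltW e0) er3.
split; last 1 first.
- have h0 := ltW (hh_gt0 e0 e1).
  have cf : continuous f by exact: lipschitz_continuous_fun fL.
  apply: le_trans (I_G_le_E h0 (ltW be0) cf M.1) _.
  apply: le_trans (total_energy be0 L0 fL e0 e1 eL M) _.
  apply: le_trans (h5 (om e) (ltW o0) (le_trans os s5)).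
  have c2 : 1400 <= C2 beta L by exact: C2_ge.
  rewrite expr2 mulrA; apply: ler_piMr; last by move: o1 o0; clear; lra.
  by apply: mulr_ge0; [move: c2; clear; lra|exact: ltW].
- by move=> x x1; apply: le_trans (t2 x x1) _; apply: h4; [exact: ltW|exact: le_trans s4].
- exact: VL M.
Qed.

End convergence.

Theorem theorem2p14 (R : realType) (beta : R) (f : R -> R) (u : R -> R -> R)
    (hbeta : 0 < beta) (hf : C1_on `[0, 1] f)
    (hu : forall e : R, 0 < e < 1 ->
       minimizer (H2 `]0, 1[) (PMF e beta f `]0, 1[) (u e)) :
  forall e_ : nat -> R,
    (forall n, 0 < e_ n < 1) -> e_ n @[n --> \oo] --> (0 : R) ->
    [/\ strict_BV_cvg `]0, 1[ (fun n => u (e_ n)) f,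
        repr_uniform_cvg 0 1 (fun n => u (e_ n)) f &
        forall phi : R * R * R -> R,
          {within (`[0, 1] `*` setT) `*` `[- (pi / 2), pi / 2],
             continuous phi} ->
          let f' := derive_in `[0, 1] f in
          let V0p := [set x : R | x \in `[0, 1] /\ 0 < f' x] in
          let V0m := [set x : R | x \in `[0, 1] /\ f' x < 0] in
          let mu := @lebesgue_measure R in
          (\int[mu]_(x in `]0%R, 1%R[)
             (let u' := weak_derive `]0%R, 1%R[ (u (e_ n)) x in
              phi (x, u (e_ n) x, atan u') * Num.sqrt (1 + u' ^+ 2))%:E)%E
            @[n --> \oo] -->
          (\int[mu]_(x in `]0%R, 1%R[) (phi (x, f x, 0))%:E
           + \int[mu]_(x in V0m) (phi (x, f x, - (pi / 2)) * `|f' x|)%:E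
           + \int[mu]_(x in V0p) (phi (x, f x, pi / 2) * `|f' x|)%:E)%E].
Proof.
move=> e_ e01 e_0.
pose Om : set R := `]0%R, 1%R[%classic.
pose mu := @lebesgue_measure R.
have mOm : measurable (Om : set (measurableTypeR R)) by exact: measurable_itv.
pose f' := derive_in `[0, 1] f.
pose g := ext f'; pose fx := ext f.
have cg : continuous g := C1_derivative_continuous hf.
have cf : continuous fx := C1_continuous hf.
have fg (a b : R) : 0 <= a -> a <= b -> b <= 1 -> fx b - fx a = I a b g := @C1_ftc _ _ hf a b.
have [L L0 fL] := C1_lipschitz hf.
have inOm (x : R) : Om x -> 0 <= x <= 1 by rewrite /Om /= in_itv/= => /andP[? ?]; rewrite !ltW.
have ff (x : R) : Om x -> fx x = f x by move=> /inOm x1; exact: extE.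
have arcs n : exists s : (R -> R) * (R -> R) * (R -> R),
    minimal (hh (e_ n)) beta fx s.1.1 s.1.2 s.2 /\ represents (u (e_ n)) s.1.1 s.1.2 s.2.
  by have [w [v [z Hn]]] := minimizer_arc cf ff (hu _ (e01 n)); exists (w, v, z).
have [t Ht] := boolp.choice arcs.
pose w n := (t n).1.1; pose v n := (t n).1.2.
have Hu n : H2 Om (u (e_ n)) := (hu _ (e01 n)).1.
have cw n : continuous (w n) by have [[[]]] := Ht n.
have cv n : continuous (v n) by have [[[]]] := Ht n.
have uw n : {ae mu, forall x, Om x -> u (e_ n) x = w n x} by have [_ []] := Ht n.
have uv n : {ae mu, forall x, Om x -> weak_derive Om (u (e_ n)) x = v n x} by have [_ []] := Ht n.
have wv n a b : 0 <= a -> a <= b -> b <= 1 -> w n b - w n a = I a b (v n).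
  by move=> a0 ab b1; have [[[_ _ _ _ P] _] _] := Ht n; have [] := P a b a0 ab b1.
have small d : 0 < d -> \forall n \near \oo,
    [/\ forall x, 0 <= x <= 1 -> `|w n x - fx x| <= d,
     I 0 1 (fun x => `|v n x|) <= I 0 1 (fun x => `|g x|) + d & I 0 1 (fun x => G (v n x)) <= d].
  move=> d0; have [r r0 Hr] := minimizer_estimates hbeta L0 fL cg fg d0.
  have /cvgrPdist_le /(_ r r0) := e_0; apply: filterS => n.
  have /andP[en0 _] := e01 n; rewrite sub0r normrN gtr0_norm// => er.
  exact: (Hr _ _ _ _ en0 er (Ht n).1).
have ic (h : R -> R) : continuous h -> ig 0 1 h by exact: ig_continuous.
have m_cont (h : R -> R) : continuous h -> measurable_fun Om h.
  by move=> ch; apply: measurable_funTS; exact: measurable_continuous.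
have mu_ n : measurable_fun Om (u (e_ n)) by have [] := H2_measurable (Hu n).
have mu'_ n : measurable_fun Om (weak_derive Om (u (e_ n))) by have [] := H2_measurable (Hu n).
have du n : is_weak_derive Om (u (e_ n)) (v n).
  have [[_ [v1 _ d1]] _] := Hu n.
  have e1 := weak_deriveP d1; have [l1 _ _] := e1.
  apply: (is_weak_derive_ae e1 l1) (uv n); last exact: ae_of.
  by apply: ig_local; exact: ic.
have df : is_weak_derive Om f g.
  have e1 : is_weak_derive Om fx g by apply: primitive_weak_derive => //; exact: ic.
  have [l1 l2 _] := e1.
  by apply: (is_weak_derive_ae e1 _ l2); [exact: locally_eq ff l1|exact: ae_of|exact: ae_of].
have dfx : is_weak_derive Om fx g by apply: primitive_weak_derive => //; exact: ic.
have mf : measurable_fun Om f.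
  by apply: (eq_measurable_fun fx) (m_cont _ cf) => x; rewrite inE => /ff.
have Vf : BV_variation Om f = (I 0 1 (fun x => `|g x|))%:E by exact: BV_variation_C1.
split.
- split.
  + move=> n; split; last by apply: le_lt_trans (BV_variation_le (du n) (cv n)) _; rewrite ltry.
    apply/integrableP; split; first by apply/measurable_EFinP; exact: mu_.
    have cabs : continuous (fun x => `|w n x|) by move=> x; apply: cvg_norm; exact: cw.
    have mabs : measurable_fun Om (fun x => `|u (e_ n) x|) by apply: measurableT_comp => //; exact: mu_.
    have abs_eq : {ae mu, forall x, Om x -> `|u (e_ n) x| = `|w n x|}.
      apply: filterS (uw n); first exact: (ae_filter_ringOfSetsType mu).
      by move=> x H /H ->.
    by have := ae_integral mabs cabs abs_eq; rewrite /= => ->; rewrite ltry.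
  + split; last by rewrite Vf ltry.
    have := ig_oo (ic _ cf); apply: eq_integrable => //.
    by move=> x; rewrite inE => /ff /= ->.
  + apply: cvg_near_EFin => eta eta0.
    have := small eta eta0; apply: filterS => n [wf _ _].
    pose k x := `|w n x - fx x|.
    have ck : continuous k.
      by move=> x; apply: cvg_norm; apply: cvgB; [exact: cw|exact: cf].
    exists (I 0 1 k).
      apply: ae_integral => //; first by apply: measurableT_comp => //; apply: measurable_funB => //; exact: mu_.
      apply: filterS (uw n); first exact: (ae_filter_ringOfSetsType mu).
      by move=> x H ox; rewrite H// -ff.
    rewrite subr0 ger0_norm; last by apply: I_ge0 => x _; exact: normr_ge0.
    by have := I_bound (ic _ ck) (@ler01 R) wf; rewrite subr0 mulr1.
  + rewrite Vf; apply: cvg_near_EFin => eta eta0.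
    have [d d0 low] := BV_variation_lower cf dfx cg eta0.
    pose r : R := Num.min d eta.
    have rd : r <= d by rewrite ge_min lexx.
    have re : r <= eta by rewrite ge_min lexx orbT.
    have r0 : 0 < r by rewrite lt_min d0.
    have := small r r0; apply: filterS => n [wf Vn _].
    have up := BV_variation_le (du n) (cv n).
    have lo := low _ _ (mu_ n) (cw n) (uw n) (fun x x1 => le_trans (wf x x1) rd).
    have fin : BV_variation Om (u (e_ n)) \is a fin_num.
      by rewrite fin_numE; apply/andP; split; apply/eqP => h; move: up lo; rewrite h.
    exists (fine (BV_variation Om (u (e_ n)))); first by rewrite fineK.
    move: up lo; rewrite -(fineK fin) !lee_fin ler_norml; move: Vn re; clear; lra.
- exists w; split.
    move=> n; split; first exact: continuous_subspaceT.
    exact: ae_sym (uw n).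
  move=> P /uniform_nbhs[E [entE EP]].
  have [r r0 rE] : exists2 r : R, 0 < r & forall x y : R, ball x r y -> E (x, y).
    by have [r /= r0 rE] := entE; exists r => // x y xy; exact: (rE (x, y)).
  have r2 : 0 < r / 2 by rewrite divr_gt0.
  have := small _ r2; apply: filterS => n [wf _ _]; apply: EP => x /=; rewrite in_itv/= => x1.
  apply: rE; rewrite /ball/= distrC -(extE f x1).
  by apply: le_lt_trans (wf x x1) _; rewrite ltr_pdivrMr// ltr_pMr// ltr1n.
move=> phi cphi f'0 V0p V0m mu0.
have [F0 cF0 F0E] := test_extension cphi.
have [M M0 fM] := continuous_itv_bounded 0 1 cf.
have [F [FF0 UC [B B0 FB]]] := test_box cF0 (ltac:(by rewrite addr_ge0) : 0 <= M + 1).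
have pp := @pihalf_ge0 R.
have phiE x y s : 0 <= x <= 1 -> - (pi / 2) <= s <= pi / 2 -> phi (x, y, s) = F0 (x, y, s).
  by move=> x1 s1; rewrite F0E//; split => //=; rewrite ?in_itv//; split => //=; rewrite in_itv.
have FE x y s : 0 <= x <= 1 -> `|y| <= M + 1 -> - (pi / 2) <= s <= pi / 2 -> phi (x, y, s) = F x y s.
  by move=> x1 y1 s1; rewrite FF0 ?phiE// ler_norml.
have id_c : continuous (fun x : R => x) by move=> x; exact: cvg_id.
have cst_c (s : R) : continuous (fun _ : R => s) by move=> x; exact: cvg_cst.
have cF s : continuous (fun x => F x (fx x) s) := uniform3_continuous UC id_c cf (cst_c s).
have fM1 x : 0 <= x <= 1 -> `|f x| <= M + 1.
  by move=> x1; rewrite -(extE f x1); apply: le_trans (fM x x1) _; rewrite lerDl.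
have [s0 sm sp] := symmetric_itv pp.
have cmul (h k : R -> R) : continuous h -> continuous k -> continuous (fun x => h x * k x).
  by move=> ch ck x; apply: cvgM; [exact: ch|exact: ck].
have cng : continuous (fun x => - g x) by move=> x; apply: cvgN; exact: cg.
rewrite (_ : (\int[mu0]_(x in _) (phi (x, f x, 0))%:E)%E = (I 0 1 (fun x => F x (fx x) 0))%:E); last first.
  rewrite -integral_open; last exact: ic.
  apply: eq_integral => x; rewrite inE => ox; have x1 := inOm x ox.
  by rewrite FE ?fM1// ff.
rewrite (@integral_support R V0m _ (fun x => F x (fx x) (- (pi / 2)) * Num.max 0 (- g x))); last 4 first.
- by move=> x [].
- move=> x [+ f'x]; rewrite in_itv/= => x1.
  by rewrite FE ?fM1// /fx /g !extE// ltr0_norm// max_r// oppr_ge0 ltW.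
- move=> x x1 nV; rewrite max_l ?mulr0// oppr_le0 leNgt; apply/negP => gx; apply: nV.
  by move: gx; rewrite /g (extE f' x1) => gx; split => //; rewrite in_itv.
- by apply: ic; apply: cmul => //; exact: continuous_pos_part.
rewrite (@integral_support R V0p _ (fun x => F x (fx x) (pi / 2) * Num.max 0 (g x))); last 4 first.
- by move=> x [].
- move=> x [+ f'x]; rewrite in_itv/= => x1.
  by rewrite FE ?fM1// /fx /g !extE// gtr0_norm// max_r// ltW.
- move=> x x1 nV; rewrite max_l ?mulr0// leNgt; apply/negP => gx; apply: nV.
  by move: gx; rewrite /g (extE f' x1) => gx; split => //; rewrite in_itv.
- by apply: ic; apply: cmul => //; exact: continuous_pos_part.
rewrite -!EFinD; apply: cvg_near_EFin => eta eta0.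
have [d d0 lim] := direction_limit B0 FB UC cf cg fg eta0.
pose r : R := Num.min d 1.
have rd : r <= d by rewrite ge_min lexx.
have r1 : r <= 1 by rewrite ge_min lexx orbT.
have r0 : 0 < r by rewrite lt_min d0 ltr01.
have := small r r0; apply: filterS => n [wf Vn Gn].
have wM x : 0 <= x <= 1 -> `|w n x| <= M + 1.
  move=> x1; have -> : w n x = fx x + (w n x - fx x) by ring.
  apply: le_trans (ler_normD _ _) _; apply: lerD; first exact: fM.
  by apply: le_trans r1; exact: wf.
exists (I 0 1 (fun x => F x (w n x) (atan (v n x)) * Num.sqrt (1 + v n x ^+ 2))); last first.
  have wfd x : 0 <= x <= 1 -> `|w n x - fx x| <= d by move=> x1; apply: le_trans rd; exact: wf.
  have Vnd : I 0 1 (fun x => `|v n x|) <= I 0 1 (fun x => `|g x|) + d by apply: le_trans Vn _; rewrite lerD2l.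
  exact: (lim _ _ (cw n) (cv n) (wv n) wfd Vnd (le_trans Gn rd)).
have csqrt : continuous (fun x : R => Num.sqrt (1 + x ^+ 2)).
  apply: (@comp_continuous R Num.sqrt (fun x => 1 + x ^+ 2)); first exact: sqrt_continuous.
  by move=> x; apply: cvgD; [exact: cvg_cst|exact: (sqr_continuous id_c)].
have cs : continuous (fun x => F x (w n x) (atan (v n x)) * Num.sqrt (1 + v n x ^+ 2)).
  apply: cmul; first exact: (uniform3_continuous UC id_c (cw n) (comp_continuous (@continuous_atan R) (cv n))).
  exact: (comp_continuous csqrt (cv n)).
have atan_itv (s : R) : - (pi / 2) <= atan s <= pi / 2 by rewrite !ltW ?atan_gtNpi2 ?atan_ltpi2.
apply: ae_integral => //.
- apply: measurable_funM.
    apply: (@eq_measurable_fun _ _ _ _ Om (fun x => F0 (x, u (e_ n) x, atan (weak_derive Om (u (e_ n)) x)))).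
      by move=> x; rewrite inE => /inOm x1; rewrite phiE.
    apply: test_measurable => //.
    apply: (@measurableT_comp _ _ _ _ _ _ (@atan R)) => //.
    by apply: measurable_continuous; exact: continuous_atan.
  apply: (@measurableT_comp _ _ _ _ _ _ (fun x : R => Num.sqrt (1 + x ^+ 2))) => //.
  exact: measurable_continuous.
- apply: filterS2 (uw n) (uv n); first exact: (ae_filter_ringOfSetsType mu).
  move=> x H1 H2 ox; have x1 := inOm x ox.
  by rewrite /= -/Om H1// H2// FE// wM.
Qed.
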